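(* Let $0<\beta<1$ and let $\Omega\subset\mathbb{C}$ be a bounded doubly-connected domain whose outermost boundary component $\mathcal{C}$ is $C^{3,\alpha}$. If $\Omega$ is biholomorphic to $B_1-\overline{B}_\beta=\{z:\beta<|z|<1\}$, then $$\lambda(\Omega,v)\ge\frac{2\pi^2}{3}\Bigl[\Bigl(\frac{\pi}{\ln\beta}\Bigr)^2+1\Bigr].$$
   Context: For a bounded domain $\Omega\subset\mathbb{C}$, let $u$ be the solution of $\Delta u=e^{2u}$ in $\Omega$ with $u\to+\infty$ at $\partial\Omega$ (the conformal factor of the complete hyperbolic metric $e^{2u}g_E$), and set $v=e^{-u}$, so $v\Delta v=|\nabla v|^2-1$ in $\Omega$ and $v=0$ on $\partial\Omega$. Near the $C^{3,\alpha}$ boundary component $\mathcal{C}$, $v(z)=d(z)-\tfrac12\kappa(y)d(z)^2+c_3(y)d(z)^3+O(d(z)^{3+\alpha})$, where $d(z)$ is the Euclidean distance to $\partial\Omega$, $y\in\partial\Omega$ is the point with $d(z)=|z-y|$ and $\kappa(y)$ is the curvature of the boundary at $y$; this defines $c_3$ on $\mathcal{C}$. Then $\lambda(\Omega,v)=-\int_{\mathcal{C}}dl\cdot\int_{\mathcal{C}}c_3\,dl$, with Euclidean arc length. *)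

(* Defs.v *)
From Stdlib Require Import Reals.
From Coquelicot Require Import Coquelicot.
Open Scope R_scope.

Definition planar_open (O : C -> Prop) : Prop :=
  forall z, O z -> exists r, 0 < r /\ forall w, Cmod (Cminus w z) < r -> O w.

Definition bounded_set (O : C -> Prop) : Prop :=
  exists M, forall z, O z -> Cmod z <= M.

Definition boundary (O : C -> Prop) (w : C) : Prop :=
  ~ O w /\ forall r, 0 < r -> exists z, O z /\ Cmod (Cminus z w) < r.

Definition annulus (beta : R) (w : C) : Prop := beta < Cmod w < 1.

Definition C_differentiable_at (f : C -> C) (z : C) : Prop :=
  exists f' : C, forall eps, 0 < eps -> exists delta, 0 < delta /\
    forall h : C, 0 < Cmod h < delta ->
      Cmod (Cminus (Cdiv (Cminus (f (Cplus z h)) (f z)) h) f') < eps.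

Definition holomorphic_on (O : C -> Prop) (f : C -> C) : Prop :=
  forall z, O z -> C_differentiable_at f z.

Definition biholomorphic (O O' : C -> Prop) : Prop :=
  exists (f g : C -> C),
    holomorphic_on O f /\ holomorphic_on O' g /\
    (forall z, O z -> O' (f z)) /\ (forall w, O' w -> O (g w)) /\
    (forall z, O z -> g (f z) = z) /\ (forall w, O' w -> f (g w) = w).

Definition is_C3alpha (f : R -> R) (alpha : R) : Prop :=
  (forall s, ex_derive f s) /\
  (forall s, ex_derive (Derive_n f 1) s) /\
  (forall s, ex_derive (Derive_n f 2) s) /\
  exists H, forall s t, s <> t ->
    Rabs (Derive_n f 3 s - Derive_n f 3 t) <= H * Rpower (Rabs (s - t)) alpha.

Definition gx (g : R -> C) : R -> R := fun s => fst (g s).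
Definition gy (g : R -> C) : R -> R := fun s => snd (g s).

Definition C3alpha_jordan_arclength (g : R -> C) (L alpha : R) : Prop :=
  0 < L /\
  is_C3alpha (gx g) alpha /\ is_C3alpha (gy g) alpha /\
  (forall s, (Derive (gx g) s) ^ 2 + (Derive (gy g) s) ^ 2 = 1) /\
  (forall s, g (s + L) = g s) /\
  (forall s t, 0 <= s -> s < t -> t < L -> g s <> g t).

Definition left_normal (g : R -> C) (s : R) : C :=
  (- Derive (gy g) s, Derive (gx g) s)%R.

(* signed curvature of the arc-length parametrized curve g at parameter s;
   with the orientation in which the left normal points into Omega this is
   the curvature convention of the paper (kappa = 1/R for the outer circle
   of radius R) *)
Definition curvature (g : R -> C) (s : R) : R :=
  Derive (gx g) s * Derive_n (gy g) 2 s - Derive (gy g) s * Derive_n (gx g) 2 s.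

(* points in the unbounded component of C minus the image of g: those that
   can be joined, avoiding the curve, to a point farther from 0 than every
   point of the curve *)
Definition outside_curve (g : R -> C) (w : C) : Prop :=
  exists p : R -> C,
    (forall t, 0 <= t <= 1 -> continuous p t) /\
    p 0 = w /\
    (forall t s, 0 <= t <= 1 -> p t <> g s) /\
    (forall s, Cmod (g s) < Cmod (p 1)).

Definition outer_boundary_component (Omega : C -> Prop) (g : R -> C) : Prop :=
  (forall s, boundary Omega (g s)) /\
  (* the image of g is relatively open (hence, being connected, a connected
     component) in the boundary of Omega *)
  (exists eps, 0 < eps /\ forall w, boundary Omega w ->
      (exists s, Cmod (Cminus w (g s)) < eps) -> exists s, w = g s) /\
  (* Omega lies inside the curve: the component is the outermost one *)
  (forall z, Omega z -> ~ outside_curve g z) /\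
  (forall s, exists t0, 0 < t0 /\ forall t, 0 < t < t0 ->
      Omega (Cplus (g s) (Cmult (RtoC t) (left_normal g s)))).

Definition d1 (f : C -> R) (z : C) : R := Derive (fun x => f (x, snd z)) (fst z).
Definition d2 (f : C -> R) (z : C) : R := Derive (fun y => f (fst z, y)) (snd z).

Definition C2_on (O : C -> Prop) (f : C -> R) : Prop :=
  forall z, O z ->
    ex_derive (fun x => f (x, snd z)) (fst z) /\
    ex_derive (fun y => f (fst z, y)) (snd z) /\
    ex_derive (fun x => d1 f (x, snd z)) (fst z) /\
    ex_derive (fun y => d1 f (fst z, y)) (snd z) /\
    ex_derive (fun x => d2 f (x, snd z)) (fst z) /\
    ex_derive (fun y => d2 f (fst z, y)) (snd z) /\
    continuous f z /\ continuous (d1 f) z /\ continuous (d2 f) z /\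
    continuous (d1 (d1 f)) z /\ continuous (d2 (d1 f)) z /\
    continuous (d1 (d2 f)) z /\ continuous (d2 (d2 f)) z.

Definition laplacian (f : C -> R) (z : C) : R := d1 (d1 f) z + d2 (d2 f) z.

Definition liouville_blowup_solution (Omega : C -> Prop) (u : C -> R) : Prop :=
  C2_on Omega u /\
  (forall z, Omega z -> laplacian u z = exp (2 * u z)) /\
  (forall w, boundary Omega w -> forall M, exists delta, 0 < delta /\
      forall z, Omega z -> Cmod (Cminus z w) < delta -> M < u z).

(* c3 (a function on the curve) is the third coefficient in the boundary
   expansion of v = e^{-u} near the component parametrized by g:
   v(z) = d - kappa(y) d^2 / 2 + c3(y) d^3 + O(d^{3+alpha}),
   where y = g s is a nearest point of the boundary to z and d = |z - y|. *)
Definition third_coefficient (Omega : C -> Prop) (u : C -> R) (g : R -> C)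
    (alpha : R) (c3 : C -> R) : Prop :=
  exists delta K, 0 < delta /\
    forall z s, Omega z ->
      (forall w, boundary Omega w -> Cmod (Cminus z (g s)) <= Cmod (Cminus z w)) ->
      Cmod (Cminus z (g s)) < delta ->
      let d := Cmod (Cminus z (g s)) in
      Rabs (exp (- u z) - (d - / 2 * curvature g s * d ^ 2 + c3 (g s) * d ^ 3))
        <= K * Rpower d (3 + alpha).

(* lambda(Omega, v) = - (int_C dl) * (int_C c3 dl); with the arc-length
   parametrization g of period L, int_C dl = L *)
Definition lambda_inv (g : R -> C) (L : R) (c3 : C -> R) : R :=
  - L * RInt (fun s => c3 (g s)) 0 L.

(* Main.v *)
Require Import Defs.
From Stdlib Require Import Reals Lra Lia Psatz ZArith Classical ClassicalEpsilon FunctionalExtensionality.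
From Coquelicot Require Import Coquelicot.
Open Scope R_scope.

(** If [f] maps the domain onto the annulus, the metric [e^u |dz|] is the pull-back of the complete
    hyperbolic metric of the annulus: it is at most this metric by Ahlfors' lemma, and at least it because
    both complementary components contain two points, which forces [u >= - ln d - C] and lets a small power
    of the density absorb the boundary.  Hence [v = sin (a X) / (a |p|)] with [X = - ln |f|], [p = f' / f]
    and [a = PI / - ln beta].

    Along the normals of the outer curve this formula and the expansion of [v] give a system of ordinary
    differential equations whose regular solution has
    [ln |p| = ln P + kappa t + (kappa^2 / 4 - (chi^2 + a^2 P^2) / 4 - 3 c3 / 2) t^2 + o(t^2)],
    where [P] is the boundary value of [|p|] and [chi = (ln P)'].  The normal flux of [ln |p|] through a
    parallel curve is an integral multiple of [2 PI], hence constant, and comparing the two expansions of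
    the mean of [ln |p|] yields [- 6 int c3 = int kappa^2 + int chi^2 + a^2 int P^2].

    By Hopf's theorem on the total curvature, [h = sqrt P e^(i theta / 2)] with [theta' = kappa] is
    antiperiodic, so the Wirtinger inequality with weight [P] bounds
    [int kappa^2 + int chi^2 = 4 int |h'|^2 / P] below by [4 (PI / int P)^2 int P^2].  The bound follows
    from [(int P)^2 <= L int P^2] and [int P >= 2 PI], a winding number of [f]. *)

(** The map [f] is not known to extend smoothly to the curve and nothing is assumed about the other
    boundary component, so no boundary regularity of conformal maps is invoked: the expansion of [v]
    is the only information at the curve. It is sharpened to gradients by comparing [u] with the
    exact metric of the osculating circle, which differs from [u] by [O(t^2)] with bounded
    Laplacian. The resulting system along a normal has coefficients singular like [1 / t]; its
    non-regular solutions are excluded because [|f|] tends to [1] uniformly at the curve. Two points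
    in a complementary component matter because a square root of [(z - p) / (z - q)] is then single
    valued on the domain. It acts as a barrier at [p] for an arbitrary boundary; at a puncture the
    bound [u >= - ln d - C] fails. Multiplying the integral identity by [L] turns the two lower
    bounds into [4 PI^2] and [4 PI^2 a^2]; division by 6 gives the factor [2 PI^2 / 3]. *)

(** * Automation for bounds, signs, derivatives and continuity *)

Lemma Rabs_bounds (x : R) : - Rabs x <= x <= Rabs x.
Proof. apply Rabs_le_between. lra. Qed.

Ltac saturate := repeat match goal with
  | |- context [Cmod ?x] => lazymatch goal with _ : 0 <= Cmod x |- _ => fail | _ => pose proof (Cmod_ge_0 x) end
  | _ : context [Cmod ?x] |- _ => lazymatch goal with _ : 0 <= Cmod x |- _ => fail | _ => pose proof (Cmod_ge_0 x) end
  | |- context [exp ?x] => lazymatch goal with _ : 0 < exp x |- _ => fail | _ => pose proof (exp_pos x) end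
  | _ : context [exp ?x] |- _ => lazymatch goal with _ : 0 < exp x |- _ => fail | _ => pose proof (exp_pos x) end
  | _ : context [Rabs ?x] |- _ => lazymatch goal with _ : - Rabs x <= x <= Rabs x |- _ => fail | _ => pose proof (Rabs_bounds x) end
  | |- context [Rabs ?x] => lazymatch goal with _ : - Rabs x <= x <= Rabs x |- _ => fail | _ => pose proof (Rabs_bounds x) end
  | _ : context [Rmin ?x ?y] |- _ => lazymatch goal with _ : Rmin x y <= x /\ _ |- _ => fail | _ => pose proof (conj (Rmin_l x y) (Rmin_r x y)) end
  | |- context [Rmin ?x ?y] => lazymatch goal with _ : Rmin x y <= x /\ _ |- _ => fail | _ => pose proof (conj (Rmin_l x y) (Rmin_r x y)) end
  | _ : context [Rmax ?x ?y] |- _ => lazymatch goal with _ : x <= Rmax x y /\ _ |- _ => fail | _ => pose proof (conj (Rmax_l x y) (Rmax_r x y)) end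
  | |- context [Rmax ?x ?y] => lazymatch goal with _ : x <= Rmax x y /\ _ |- _ => fail | _ => pose proof (conj (Rmax_l x y) (Rmax_r x y)) end
  | |- context [PI] => lazymatch goal with _ : 0 < PI |- _ => fail | _ => pose proof (PI_RGT_0 : 0 < PI) end
  | _ : context [PI] |- _ => lazymatch goal with _ : 0 < PI |- _ => fail | _ => pose proof (PI_RGT_0 : 0 < PI) end
  end.

Ltac abs_goal := repeat match goal with
  | |- Rabs _ <= _ => apply Rabs_le
  | |- Rabs _ < _ => apply Rabs_def1
  | |- _ /\ _ => split end.

(* These shadow the standard tactics, which are retried after adding elementary bounds for the
   occurrences of [Cmod], [exp], [Rabs], [Rmin], [Rmax] and [PI]. *)
Ltac lra := first [Lra.lra | saturate; solve [Lra.lra | abs_goal; Lra.lra]].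

Ltac nra := first [Lra.nra | saturate; solve [Lra.nra | abs_goal; Lra.nra]].

(** Recursion on the shape of a sign or monotonicity goal, with [lra] at the leaves. Since it first
    tries [assumption] and ends with [easy], it also serves as a closing tactic for goals that do
    not concern signs. *)
Ltac pos :=
  try assumption;
  match goal with
  | |- _ /\ _ => split; pos
  | |- _ <> 0 => solve [lra | apply Rgt_not_eq; red; pos | apply Rlt_not_eq; pos]
  | |- _ > _ => red; pos
  | |- _ >= _ => apply Rle_ge; pos
  | |- 0 < exp _ => apply exp_pos
  | |- 0 <= exp _ => apply Rlt_le, exp_pos
  | |- 0 <= Rabs _ => apply Rabs_pos
  | |- 0 <= Cmod _ => apply Cmod_ge_0
  | |- 0 < PI => apply PI_RGT_0
  | |- 0 <= PI => apply Rlt_le, PI_RGT_0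
  | |- 0 < Rmin _ _ => apply Rmin_pos; pos
  | |- 0 < / _ => apply Rinv_0_lt_compat; pos
  | |- 0 <= / _ => first [apply Rlt_le, Rinv_0_lt_compat; pos]
  | |- 0 < _ * _ => solve [lra | apply Rmult_lt_0_compat; pos]
  | |- 0 <= ?a * ?a => apply Rle_0_sqr
  | |- 0 <= _ * _ => solve [lra | apply Rmult_le_pos; pos]
  | |- 0 < _ / _ => apply Rdiv_lt_0_compat; pos
  | |- 0 <= _ / _ => first [apply Rdiv_le_0_compat; pos | apply Rlt_le, Rdiv_lt_0_compat; pos]
  | |- 0 < _ + _ => solve [lra | apply Rplus_lt_le_0_compat; pos | apply Rplus_le_lt_0_compat; pos]
  | |- 0 <= _ + _ => solve [lra | apply Rplus_le_le_0_compat; pos]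
  | |- 0 < _ ^ _ => apply pow_lt; pos
  | |- 0 <= _ ^ _ => first [apply pow_le; pos]
  | |- 0 < sqrt _ => apply sqrt_lt_R0; pos
  | |- 0 <= sqrt _ => apply sqrt_pos
  | |- ?a * _ <= ?a * _ => first [apply Rmult_le_compat_l; pos | solve [lra]]
  | |- _ * ?a <= _ * ?a => first [apply Rmult_le_compat_r; pos | solve [lra]]
  | |- _ * _ <= _ * _ => solve [lra | apply Rmult_le_compat; pos]
  | |- ?a * _ < ?a * _ => first [apply Rmult_lt_compat_l; pos | solve [lra]]
  | |- _ * ?a < _ * ?a => first [apply Rmult_lt_compat_r; pos | solve [lra]]
  | _ => solve [lra | easy]
  end.

Ltac ceq := apply injective_projections; simpl; solve [ring | field; pos].

Tactic Notation "le_via" uconstr(H) := eapply Rle_trans; [apply H|].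
Tactic Notation "lt_via" uconstr(H) := eapply Rle_lt_trans; [apply H|].

Lemma Rlt_min_l {x a b : R} : x < Rmin a b -> x < a.
Proof. intros H. exact (Rlt_le_trans _ _ _ H (Rmin_l _ _)). Qed.

Lemma Rlt_min_r {x a b : R} : x < Rmin a b -> x < b.
Proof. intros H. exact (Rlt_le_trans _ _ _ H (Rmin_r _ _)). Qed.

Lemma der_mult (f g : R -> R) (x a b : R) : is_derive f x a -> is_derive g x b -> is_derive (fun t => f t * g t) x (a * g x + f x * b).
Proof. apply Derive.is_derive_mult. Qed.

Lemma der_plus (f g : R -> R) (x a b : R) : is_derive f x a -> is_derive g x b -> is_derive (fun t => f t + g t) x (a + b).
Proof. apply (is_derive_plus f g). Qed.

Lemma der_minus (f g : R -> R) (x a b : R) : is_derive f x a -> is_derive g x b -> is_derive (fun t => f t - g t) x (a - b).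
Proof. apply (is_derive_minus f g). Qed.

Lemma der_opp (f : R -> R) (x a : R) : is_derive f x a -> is_derive (fun t => - f t) x (- a).
Proof. apply (is_derive_opp f). Qed.

Lemma der_div (f g : R -> R) (x a b : R) : is_derive f x a -> is_derive g x b -> g x <> 0 -> is_derive (fun t => f t / g t) x ((a * g x - f x * b) / g x ^ 2).
Proof. apply (is_derive_div f g). Qed.

Lemma der_comp (f g : R -> R) (x a b : R) : is_derive f (g x) a -> is_derive g x b -> is_derive (fun t => f (g t)) x (a * b).
Proof. intros Hf Hg. rewrite Rmult_comm. apply (is_derive_comp f g x a b Hf Hg). Qed.

Lemma der_const (k x : R) : is_derive (fun _ => k) x 0.
Proof. apply (is_derive_const k). Qed.

Lemma der_id (x : R) : is_derive (fun t => t) x 1.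
Proof. apply (is_derive_id x). Qed.

(** Builds the derivative from the syntax of the function and takes derivatives of opaque heads from
    the hypotheses. Side conditions of quotients and logarithms remain as goals; [der] leaves in
    addition the equation between the computed and the stated derivative. *)
Ltac der_core := cbv beta; first
  [ lazymatch goal with
    | |- is_derive (fun _ => ?k) _ _ => apply (der_const k)
    | |- is_derive (fun t => t) _ _ => apply der_id
    | |- is_derive (fun t => @?f t + @?g t) _ _ => eapply (der_plus f g); der_core
    | |- is_derive (fun t => @?f t - @?g t) _ _ => eapply (der_minus f g); der_core
    | |- is_derive (fun t => - @?f t) _ _ => eapply (der_opp f); der_core
    | |- is_derive (fun t => @?f t * @?g t) _ _ => eapply (der_mult f g); der_core
    | |- is_derive (fun t => @?f t / @?g t) _ _ => eapply (der_div f g); [der_core|der_core|]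
    | |- is_derive (fun t => exp (@?f t)) _ _ => eapply (der_comp exp f); [apply is_derive_exp|der_core]
    | |- is_derive (fun t => sin (@?f t)) _ _ => eapply (der_comp sin f); [apply is_derive_sin|der_core]
    | |- is_derive (fun t => cos (@?f t)) _ _ => eapply (der_comp cos f); [apply is_derive_cos|der_core]
    | |- is_derive (fun t => ln (@?f t)) _ _ => eapply (der_comp ln f); [apply is_derive_ln|der_core]
    end
  | lazymatch goal with |- is_derive (fun t => ?f t) ?x ?l => change (is_derive f x l) | _ => idtac end;
    match goal with
    | H : is_derive ?f _ _ |- is_derive ?f _ _ => exact H
    | H : forall _ : _, is_derive ?f _ _ |- is_derive ?f _ _ => apply H
    end
  | idtac ].

Ltac der := evar_last; [der_core|]; cbv beta.

Lemma continuous_inv (f : R -> R) (x : R) : continuous f x -> f x <> 0 -> continuous (fun t => / f t) x.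
Proof. intros H Hn. apply continuity_pt_filterlim, (continuity_pt_inv f); [apply continuity_pt_filterlim, H|exact Hn]. Qed.

Ltac cont := cbv beta; first
  [ lazymatch goal with
    | |- continuous (fun _ => ?k) _ => apply (continuous_const k)
    | |- continuous (fun x => x) _ => apply continuous_id
    | |- continuous (fun x => @?f x * @?g x) _ => apply (continuous_mult (K := R_AbsRing) f g); cont
    | |- continuous (fun x => @?f x + @?g x) _ => apply (continuous_plus (V := R_NormedModule) f g); cont
    | |- continuous (fun x => @?f x - @?g x) _ => apply (continuous_minus (V := R_NormedModule) f g); cont
    | |- continuous (fun x => - @?f x) _ => apply (continuous_opp (V := R_NormedModule) f); cont
    | |- continuous (fun x => @?f x / @?g x) _ => apply (continuous_mult (K := R_AbsRing) f (fun x => / g x)); cont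
    | |- continuous (fun x => / @?f x) _ => apply (continuous_inv f); [cont|cbv beta]
    | |- continuous (fun x => exp (@?f x)) _ => apply (continuous_comp f exp); [cont|apply (ex_derive_continuous exp); eexists; apply is_derive_exp]
    | |- continuous (fun x => sin (@?f x)) _ => apply (continuous_comp f sin); [cont|apply (ex_derive_continuous sin); eexists; apply is_derive_sin]
    | |- continuous (fun x => cos (@?f x)) _ => apply (continuous_comp f cos); [cont|apply (ex_derive_continuous cos); eexists; apply is_derive_cos]
    end
  | lazymatch goal with |- continuous (fun t => ?f t) ?x => change (continuous f x) | _ => idtac end;
    match goal with
    | H : continuous ?f _ |- continuous ?f _ => exact H
    | H : forall _ : _, continuous ?f _ |- continuous ?f _ => apply H
    end
  | idtac ].

(** * Complex differentiation *)

Lemma Re_le_Cmod (z : C) : Rabs (fst z) <= Cmod z.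
Proof. eapply Rle_trans; [apply Rmax_l | apply Rmax_Cmod]. Qed.

Lemma Im_le_Cmod (z : C) : Rabs (snd z) <= Cmod z.
Proof. eapply Rle_trans; [apply Rmax_r | apply Rmax_Cmod]. Qed.

Lemma Cmod_le_sum (z : C) : Cmod z <= Rabs (fst z) + Rabs (snd z).
Proof.
 rewrite <- (sqrt_square (Rabs (fst z) + Rabs (snd z))) by lra.
 apply sqrt_le_1_alt. nra.
Qed.

Lemma Cmod_sqr (z : C) : Cmod z * Cmod z = fst z * fst z + snd z * snd z.
Proof. unfold Cmod. rewrite sqrt_sqrt; nra. Qed.

Lemma Cmod_minus_sym (a b : C) : Cmod (a - b) = Cmod (b - a).
Proof. rewrite <- Cmod_opp. f_equal. ring. Qed.

Lemma Cmod_minus_triangle (a b c : C) :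
  Cmod (a - c) <= Cmod (a - b) + Cmod (b - c).
Proof.
 replace (a - c)%C with (a - b + (b - c))%C by ring. apply Cmod_triangle.
Qed.

Lemma Cmod_triangle_inv (a b : C) : Cmod a - Cmod b <= Cmod (a - b).
Proof.
 pose proof (Cmod_triangle (a - b)%C b) as H.
 replace (a - b + b)%C with a in H by ring. lra.
Qed.

Lemma Cmod_triangle_minus (a b : C) : Cmod (a - b) <= Cmod a + Cmod b.
Proof. rewrite <- (Cmod_opp b). apply Cmod_triangle. Qed.

(** The complex derivative in the form of a linear approximation: without a quotient, [h = 0] needs
    no exclusion. [C_differentiable_hder] and [hder_is_derive] relate it to the two other notions of
    derivative in use. *)
Definition hder (f : C -> C) (z l : C) : Prop :=
  forall eps, 0 < eps -> exists delta, 0 < delta /\ forall h, Cmod h < delta ->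
  Cmod (f (z + h) - f z - l * h)%C <= eps * Cmod h.

Definition ccont (f : C -> C) (z : C) : Prop :=
  forall eps, 0 < eps -> exists delta, 0 < delta /\ forall w, Cmod (w - z) < delta ->
  Cmod (f w - f z) < eps.

Definition rcont (f : C -> R) (z : C) : Prop :=
  forall eps, 0 < eps -> exists delta, 0 < delta /\ forall w, Cmod (w - z) < delta ->
  Rabs (f w - f z) < eps.

Definition cder (c : R -> C) (t : R) (l : C) : Prop :=
  is_derive (fun t => fst (c t)) t (fst l) /\ is_derive (fun t => snd (c t)) t (snd l).

Lemma is_derive_eps (g : R -> R) (t l : R) :
  is_derive g t l <-> forall eps, 0 < eps -> exists delta, 0 < delta /\
  forall h, Rabs h < delta -> Rabs (g (t + h) - g t - l * h) <= eps * Rabs h.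
Proof.
 rewrite is_derive_Reals. split.
 - intros H eps He. destruct (H eps He) as [d Hd]. exists d. split; [apply d|].
  intros h Hh. destruct (Req_dec h 0) as [->|Hn].
  + rewrite Rplus_0_r. nra.
  + specialize (Hd h Hn Hh).
   replace (g (t + h) - g t - l * h) with (((g (t + h) - g t) / h - l) * h) by (field; pos).
   nra.
 - intros H eps He. destruct (H (eps / 2)) as [d [Hd Hb]]; [lra|].
  exists (mkposreal d Hd). intros h Hn Hh. specialize (Hb h Hh).
  replace ((g (t + h) - g t) / h - l) with ((g (t + h) - g t - l * h) * / h) by (field; pos).
  rewrite Rabs_mult, Rabs_inv.
  assert (Hp : 0 < Rabs h) by lra.
  apply Rle_lt_trans with (eps / 2 * Rabs h * / Rabs h).
  + pos.
  + rewrite Rmult_assoc, Rinv_r; lra.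
Qed.

Lemma cder_eps (c : R -> C) (t : R) (l : C) :
  cder c t l <-> forall eps, 0 < eps -> exists delta, 0 < delta /\
  forall h, Rabs h < delta ->
  Cmod (c (t + h)%R - c t - l * h)%C <= eps * Rabs h.
Proof.
 unfold cder. rewrite !is_derive_eps. split.
 - intros [H1 H2] eps He.
  destruct (H1 (eps / 2)) as [d1 [Hd1 Hb1]]; [lra|].
  destruct (H2 (eps / 2)) as [d2 [Hd2 Hb2]]; [lra|].
  exists (Rmin d1 d2). split; [pos|]. intros h Hh.
  specialize (Hb1 h (Rlt_min_l Hh)).
  specialize (Hb2 h (Rlt_min_r Hh)).
  le_via Cmod_le_sum. simpl.
  replace (fst (c (t + h)) + - fst (c t) + - (fst l * h - snd l * 0))
   with (fst (c (t + h)) - fst (c t) - fst l * h) by ring.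
  replace (snd (c (t + h)) + - snd (c t) + - (fst l * 0 + snd l * h))
   with (snd (c (t + h)) - snd (c t) - snd l * h) by ring. lra.
 - split; intros eps He; destruct (H eps He) as [d [Hd Hb]]; exists d; split; trivial;
   intros h Hh; eapply Rle_trans; [| apply (Hb h Hh) | | apply (Hb h Hh)].
  + eapply Rle_trans; [| apply Re_le_Cmod]. simpl. lra.
  + eapply Rle_trans; [| apply Im_le_Cmod]. simpl. lra.
Qed.

Lemma hder_lipschitz (f : C -> C) (z l : C) : hder f z l ->
  exists delta, 0 < delta /\ forall h, Cmod h < delta ->
  Cmod (f (z + h) - f z)%C <= (Cmod l + 1) * Cmod h.
Proof.
 intros H. destruct (H 1 Rlt_0_1) as [d [Hd Hb]]. exists d. split; trivial.
 intros h Hh. specialize (Hb h Hh).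
 pose proof (Cmod_triangle (f (z + h) - f z - l * h)%C (l * h)%C) as Ht.
 rewrite Cmod_mult in Ht.
 replace (f (z + h) - f z - l * h + l * h)%C
  with (f (z + h) - f z)%C in Ht by ring. lra.
Qed.

Lemma hder_ccont (f : C -> C) (z l : C) : hder f z l -> ccont f z.
Proof.
 intros H eps He. destruct (hder_lipschitz f z l H) as [d [Hd Hb]].
 exists (Rmin d (eps / (Cmod l + 1))). split.
 { pos. }
 intros w Hw. specialize (Hb (w - z)%C (Rlt_min_l Hw)).
 replace (z + (w - z))%C with w in Hb by ring.
 pose proof (Rlt_min_r Hw) as H2.
 apply (Rmult_lt_compat_l (Cmod l + 1)) in H2; [|lra].
 replace ((Cmod l + 1) * (eps / (Cmod l + 1))) with eps in H2 by (field; lra). lra.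
Qed.

Lemma hder_comp_curve (f : C -> C) (c : R -> C) (t : R) (l c' : C) :
  hder f (c t) l -> cder c t c' -> cder (fun t => f (c t)) t (l * c')%C.
Proof.
 intros Hf Hc. rewrite cder_eps in *. intros eps He.
 destruct (Hf (eps / 2 / (Cmod c' + 1))) as [d1 [Hd1 Hb1]].
 { pos. }
 destruct (Hc (Rmin 1 (eps / 2 / (Cmod l + 1)))) as [d2 [Hd2 Hb2]].
 { pos. }
 exists (Rmin d2 (d1 / (Cmod c' + 1))). split.
 { pos. }
 intros h Hh.
 specialize (Hb2 h (Rlt_min_l Hh)).
 pose proof (Rlt_min_r Hh) as Hh1.
 set (k := (c (t + h)%R - c t)%C) in *.
 assert (Hk1 : Cmod (k - c' * h) <= Rabs h).
 { nra. }
 assert (Hk2 : (Cmod l + 1) * Cmod (k - c' * h) <= eps / 2 * Rabs h).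
 { apply Rle_trans with ((Cmod l + 1) * (eps / 2 / (Cmod l + 1) * Rabs h)).
  - apply Rmult_le_compat_l; [lra|]. nra.
  - right. field. lra. }
 assert (Hk : Cmod k <= (Cmod c' + 1) * Rabs h).
 { pose proof (Cmod_triangle (k - c' * h)%C (c' * h)%C) as Ht.
  replace (k - c' * h + c' * h)%C with k in Ht by ring.
  rewrite Cmod_mult, Cmod_R in Ht. lra. }
 assert (Hkd : Cmod k < d1).
 { lt_via Hk. apply (Rmult_lt_compat_l (Cmod c' + 1)) in Hh1; [|lra].
  replace ((Cmod c' + 1) * (d1 / (Cmod c' + 1))) with d1 in Hh1 by (field; lra). lra. }
 specialize (Hb1 k Hkd). replace (c t + k)%C with (c (t + h)) in Hb1 by ceq.
 replace (f (c (t + h)%R) - f (c t) - l * c' * h)%C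
  with (f (c (t + h)%R) - f (c t) - l * k + l * (k - c' * h))%C by ring.
 le_via Cmod_triangle. rewrite Cmod_mult.
 assert (eps / 2 / (Cmod c' + 1) * Cmod k <= eps / 2 * Rabs h).
 { apply Rle_trans with (eps / 2 / (Cmod c' + 1) * ((Cmod c' + 1) * Rabs h)).
  - pos.
  - right. field. lra. }
 nra.
Qed.

Lemma Cplus_minus_cancel (a b : C) : (a + (b - a))%C = b.
Proof. ring. Qed.
Lemma hder_is_derive (f : C -> C) (z l : C) : hder f z l <-> is_derive (V := AbsRing_NormedModule C_AbsRing) f z l.
Proof.
 split.
 - split; [apply is_linear_scal_l|]. intros x Hx. apply (is_filter_lim_locally_unique (V := AbsRing_NormedModule C_AbsRing)) in Hx. subst x. intros [eps He].
  destruct (H eps He) as [d [Hd Hb]]. exists (mkposreal d Hd). intros w Hw.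
  specialize (Hb (w - z)%C Hw). replace (z + (w - z))%C with w in Hb by (symmetry; apply Cplus_minus_cancel). rewrite (Cmult_comm _ l). pos.
 - intros [_ H] eps He. destruct (H z (fun P HP => HP) (mkposreal eps He)) as [d Hd]. exists d. split; [apply d|]. intros h Hh.
  assert (Hz : (z + h - z)%C = h) by ring. specialize (Hd (z + h)%C).
  assert (Hb := Hd ltac:(change (Cmod (z + h - z)%C < d); rewrite Hz; exact Hh)).
  change (Cmod (f (z + h) - f z - (z + h - z) * l)%C <= eps * Cmod (z + h - z)%C) in Hb. rewrite Hz, Cmult_comm in Hb. lra.
Qed.

Lemma hder_const (a z : C) : hder (fun _ => a) z 0.
Proof. apply hder_is_derive, (is_derive_const (V := AbsRing_NormedModule C_AbsRing) a). Qed.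

Lemma hder_id (z : C) : hder (fun w => w) z 1.
Proof. apply hder_is_derive, (is_derive_id (K := C_AbsRing) z). Qed.

Lemma hder_plus (f g : C -> C) (z l m : C) :
  hder f z l -> hder g z m -> hder (fun w => (f w + g w)%C) z (l + m).
Proof. rewrite !hder_is_derive. apply (is_derive_plus (V := AbsRing_NormedModule C_AbsRing)). Qed.

Lemma hder_mult (f g : C -> C) (z l m : C) :
  hder f z l -> hder g z m -> hder (fun w => (f w * g w)%C) z (l * g z + f z * m).
Proof. rewrite !hder_is_derive. intros Hf Hg. apply (is_derive_mult f g z l m Hf Hg Cmult_comm). Qed.

Lemma hder_comp (f g : C -> C) (z l m : C) :
  hder f (g z) l -> hder g z m -> hder (fun w => f (g w)) z (l * m).
Proof. rewrite !hder_is_derive, Cmult_comm. apply (is_derive_comp (V := AbsRing_NormedModule C_AbsRing) f g). Qed.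

Lemma hder_inv (z : C) : z <> 0 -> hder Cinv z (- (/ (z * z)))%C.
Proof.
 intros Hz eps He. assert (Hm : 0 < Cmod z) by (apply Cmod_gt_0; exact Hz).
 exists (Rmin (Cmod z / 2) (eps * Cmod z * Cmod z * Cmod z / 2)). split.
 { pos. }
 intros h Hh.
 pose proof (Rlt_min_r Hh) as H2.
 assert (Hzh : Cmod z / 2 <= Cmod (z + h)).
 { pose proof (Cmod_triangle_inv z (- h)%C) as Ht. rewrite Cmod_opp in Ht.
  replace (z - (- h))%C with (z + h)%C in Ht by ring. lra. }
 assert (Hzn : (z + h)%C <> 0) by (apply Cmod_gt_0; lra).
 replace (/ (z + h) - (/ z) - - (/ (z * z)) * h)%C
  with (h * h * (/ (z * z * (z + h))))%C by (field; auto).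
 rewrite !Cmod_mult, Cmod_inv, !Cmod_mult by (repeat apply Cmult_neq_0; assumption).
 assert (Hd : 0 < Cmod z * Cmod z * Cmod (z + h)) by pos.
 apply (Rmult_le_reg_r (Cmod z * Cmod z * Cmod (z + h))); trivial.
 rewrite Rmult_assoc, Rinv_l, Rmult_1_r by lra.
 assert (Cmod h <= eps * (Cmod z * Cmod z * Cmod (z + h))).
 { nra. }
 nra.
Qed.

Lemma hder_eq (f : C -> C) (z l m : C) : l = m -> hder f z l -> hder f z m.
Proof. intros ->. trivial. Qed.

Lemma hder_ext_loc (f g : C -> C) (z l : C) :
  (exists r, 0 < r /\ forall w, Cmod (w - z) < r -> f w = g w) -> hder f z l -> hder g z l.
Proof.
 rewrite !hder_is_derive. intros [r [Hr E]]. apply (is_derive_ext_loc (V := AbsRing_NormedModule C_AbsRing)). exists (mkposreal r Hr). exact E.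
Qed.

Lemma hder_div (f g : C -> C) (z l m : C) : g z <> 0 ->
  hder f z l -> hder g z m ->
  hder (fun w => (f w / g w)%C) z ((l * g z - f z * m) / (g z * g z))%C.
Proof.
 intros Hn Hf Hg.
 eapply hder_eq; [| apply (hder_mult f (fun w => (/ g w)%C) z l _ Hf
  (hder_comp Cinv g z _ m (hder_inv (g z) Hn) Hg))]. field; pos.
Qed.

Lemma hder_unique (f : C -> C) (z l m : C) : hder f z l -> hder f z m -> l = m.
Proof.
 intros H1 H2. apply NNPP. intros Hn.
 assert (Hp : 0 < Cmod (l - m)) by (apply Cmod_gt_0, Cminus_eq_contra, Hn).
 destruct (H1 (Cmod (l - m) / 4)) as [d1 [Hd1 Hb1]]; [lra|].
 destruct (H2 (Cmod (l - m) / 4)) as [d2 [Hd2 Hb2]]; [lra|].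
 pose proof (Rmin_pos _ _ Hd1 Hd2) as Hd. pose proof (Rmin_l d1 d2). pose proof (Rmin_r d1 d2).
 set (h := RtoC (Rmin d1 d2 / 2)). assert (Hh : Cmod h = Rmin d1 d2 / 2).
 { unfold h. rewrite Cmod_R. apply Rabs_right. lra. }
 specialize (Hb1 h ltac:(lra)). specialize (Hb2 h ltac:(lra)).
 set (r1 := (f (z + h) - f z - l * h)%C) in *.
 set (r2 := (f (z + h) - f z - m * h)%C) in *.
 assert (Cmod ((l - m) * h)%C <= Cmod r2 + Cmod r1).
 { replace ((l - m) * h)%C with (r2 - r1)%C by ceq.
  apply Cmod_triangle_minus. }
 rewrite Cmod_mult in H3. nra.
Qed.

Lemma C_differentiable_hder (f : C -> C) (z : C) :
  C_differentiable_at f z <-> exists l, hder f z l.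
Proof.
 split.
 - intros [l H]. exists l. intros eps He. destruct (H eps He) as [d [Hd Hb]].
  exists d. split; trivial. intros h Hh. destruct (Ceq_dec h 0) as [->|Hn].
  + replace (z + 0)%C with z by ring.
   replace (f z - f z - l * 0)%C with (RtoC 0) by ring.
   rewrite Cmod_0. lra.
  + assert (Hp : 0 < Cmod h) by (apply Cmod_gt_0; exact Hn).
   specialize (Hb h (conj Hp Hh)).
   replace (f (z + h) - f z - l * h)%C
    with (((f (z + h) - f z) / h - l) * h)%C by (field; pos).
   rewrite Cmod_mult. nra.
 - intros [l H]. exists l. intros eps He. destruct (H (eps / 2)) as [d [Hd Hb]]; [lra|].
  exists d. split; trivial. intros h [Hp Hh]. specialize (Hb h Hh).
  assert (Hn : h <> 0) by (apply Cmod_gt_0; exact Hp).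
  replace (f (z + h) - f z - l * h)%C
   with (((f (z + h) - f z) / h - l) * h)%C in Hb by (field; pos).
  rewrite Cmod_mult in Hb. nra.
Qed.

Lemma cder_horiz (x y : R) : cder (fun t => (t, y)) x 1.
Proof. split; simpl; auto_derive; trivial. Qed.

Lemma cder_vert (x y : R) : cder (fun t => (x, t)) y Ci.
Proof. split; simpl; auto_derive; trivial. Qed.

Lemma cder_eq (c : R -> C) (t : R) (l m : C) : l = m -> cder c t l -> cder c t m.
Proof. intros ->. trivial. Qed.

Lemma ccont_curve (f : C -> C) (c : R -> C) (t : R) (c' : C) :
  ccont f (c t) -> cder c t c' ->
  continuous (fun t => fst (f (c t))) t /\ continuous (fun t => snd (f (c t))) t.
Proof.
 intros Hf Hc.
 assert (forall eps, 0 < eps -> exists d, 0 < d /\ forall s, Rabs (s - t) < d -> Cmod (f (c s) - f (c t))%C < eps) as H.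
 { intros eps He. destruct (Hf eps He) as [d [Hd Hb]].
  rewrite cder_eps in Hc. destruct (Hc 1 Rlt_0_1) as [d2 [Hd2 Hb2]].
  exists (Rmin d2 (d / (Cmod c' + 1))). split.
  { pos. }
  intros s Hs. apply Hb. specialize (Hb2 (s - t) (Rlt_min_l Hs)).
  pose proof (Rlt_min_r Hs) as H3.
  replace (t + (s - t)) with s in Hb2 by ring.
  pose proof (Cmod_triangle (c s - c t - c' * RtoC (s - t))%C (c' * RtoC (s - t))%C) as Ht.
  replace (c s - c t - c' * RtoC (s - t) + c' * RtoC (s - t))%C
   with (c s - c t)%C in Ht by ring.
  rewrite Cmod_mult, Cmod_R in Ht.
  apply (Rmult_lt_compat_l (Cmod c' + 1)) in H3; [|lra].
  replace ((Cmod c' + 1) * (d / (Cmod c' + 1))) with d in H3 by (field; lra). lra. }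
 split; apply continuity_pt_filterlim; intros eps He; destruct (H eps He) as [d [Hd Hb]];
  exists d; split; trivial; intros s [_ Hs]; simpl in *; unfold Rdist in *;
  (eapply Rle_lt_trans; [| apply (Hb s Hs)]).
 - eapply Rle_trans; [| apply Re_le_Cmod]. easy.
 - eapply Rle_trans; [| apply Im_le_Cmod]. easy.
Qed.

(** * Goursat's theorem *)

(** Bisection: if [Q] fails on a rectangle it fails on one of its quarters, and the failing
    rectangles shrink to a point at which the local hypothesis gives [Q]. The shape [a : b] is
    fixed, so that one scale [k] describes a rectangle. *)
Lemma cousin_rectangle (a b : R) (Q : R -> R -> R -> Prop) :
  0 < a -> 0 < b ->
  (forall x y k, 0 < k ->
  Q x y (k / 2) -> Q (x + a * (k / 2)) y (k / 2) ->
  Q x (y + b * (k / 2)) (k / 2) -> Q (x + a * (k / 2)) (y + b * (k / 2)) (k / 2) -> Q x y k) ->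
  forall x0 y0 k0, 0 < k0 ->
  (forall x y, x0 <= x <= x0 + a * k0 -> y0 <= y <= y0 + b * k0 ->
  exists delta, 0 < delta /\ forall x' y' k, 0 < k < delta ->
  x' <= x <= x' + a * k -> y' <= y <= y' + b * k -> Q x' y' k) ->
  Q x0 y0 k0.
Proof.
 intros Ha Hb HQ x0 y0 k0 Hk0 Hloc. apply NNPP. intros Hbad.
 pose (dec := excluded_middle_informative).
 (* The first failing quarter. When three quarters satisfy [Q] the fourth must fail, so it is taken
    without a test. *)
 pose (next := fun r : R * R * R => let '(x, y, k) := r in
  if dec (Q x y (k / 2)) then
  if dec (Q (x + a * (k / 2)) y (k / 2)) then
  if dec (Q x (y + b * (k / 2)) (k / 2)) then (x + a * (k / 2), y + b * (k / 2), k / 2)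
  else (x, y + b * (k / 2), k / 2)
  else (x + a * (k / 2), y, k / 2)
  else (x, y, k / 2)).
 pose (bx := fun r : R * R * R => fst (fst r)).
 pose (by_ := fun r : R * R * R => snd (fst r)).
 pose (bk := fun r : R * R * R => snd r).
 pose (s := fix s (n : nat) := match n with O => (x0, y0, k0) | S m => next (s m) end).
 assert (Hs : forall n, ~ Q (bx (s n)) (by_ (s n)) (bk (s n)) /\ bk (s n) = k0 * / 2 ^ n).
 { induction n as [|n [IH1 IH2]]; [simpl; split; [pos|lra]|].
  change (s (S n)) with (next (s n)). destruct (s n) as [[x y] k].
  simpl in IH1, IH2.
  assert (Hk : 0 < k). { rewrite IH2. pos. }
  assert (E : k / 2 = k0 * / 2 ^ S n).
  { rewrite IH2. simpl. field; pos. }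
  unfold next. destruct (dec (Q x y (k / 2))) as [h1|h1]; [|pos].
  destruct (dec (Q (x + a * (k / 2)) y (k / 2))) as [h2|h2]; [|pos].
  destruct (dec (Q x (y + b * (k / 2)) (k / 2))) as [h3|h3]; [|pos]. auto. }
 assert (Hkpos : forall n, 0 < bk (s n)).
 { intros n. rewrite (proj2 (Hs n)). pos. }
 assert (Hstep : forall n, bx (s n) <= bx (s (S n)) /\ bx (s (S n)) + a * bk (s (S n)) <= bx (s n) + a * bk (s n)
  /\ by_ (s n) <= by_ (s (S n)) /\ by_ (s (S n)) + b * bk (s (S n)) <= by_ (s n) + b * bk (s n)).
 { intros n. pose proof (Hkpos n) as Hk. change (s (S n)) with (next (s n)).
  destruct (s n) as [[x y] k]. unfold bx, by_, bk in *. simpl in Hk.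
  unfold next. destruct (dec _); [destruct (dec _); [destruct (dec _)|]|]; simpl; repeat split; nra. }
 assert (Hmono : forall n m : nat, bx (s n) <= bx (s (n + m)%nat) /\ bx (s (n + m)%nat) + a * bk (s (n + m)%nat) <= bx (s n) + a * bk (s n)
  /\ by_ (s n) <= by_ (s (n + m)%nat) /\ by_ (s (n + m)%nat) + b * bk (s (n + m)%nat) <= by_ (s n) + b * bk (s n)).
 { induction m as [|m IH].
  - rewrite Nat.add_0_r. easy.
  - rewrite Nat.add_succ_r. pose proof (Hstep (n + m)%nat). lra. }
 assert (Hx : exists x, forall n, bx (s n) <= x <= bx (s n) + a * bk (s n)).
 { destruct (completeness (fun x => exists n, x = bx (s n))) as [x [Hu Hl]].
  - exists (x0 + a * k0). intros z [n ->]. destruct (Hmono O n) as [_ [H _]].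
   pose proof (Hkpos n). unfold bx, bk in *. simpl in *. nra.
  - exists (bx (s O)). exists O. reflexivity.
  - exists x. split; [apply Hu; exists n; reflexivity|].
   apply Hl. intros z [m ->]. destruct (Nat.le_ge_cases n m) as [Hnm|Hnm].
   + replace m with (n + (m - n))%nat by lia. pose proof (Hmono n (m - n)%nat).
    pose proof (Hkpos (n + (m - n))%nat). nra.
   + pose proof (Hmono m (n - m)%nat) as H. replace (m + (n - m))%nat with n in H by lia.
    pose proof (Hkpos n). nra. }
 assert (Hy : exists y, forall n, by_ (s n) <= y <= by_ (s n) + b * bk (s n)).
 { destruct (completeness (fun x => exists n, x = by_ (s n))) as [x [Hu Hl]].
  - exists (y0 + b * k0). intros z [n ->]. destruct (Hmono O n) as [_ [_ [_ H]]].
   pose proof (Hkpos n). unfold by_, bk in *. simpl in *. nra.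
  - exists (by_ (s O)). exists O. reflexivity.
  - exists x. split; [apply Hu; exists n; reflexivity|].
   apply Hl. intros z [m ->]. destruct (Nat.le_ge_cases n m) as [Hnm|Hnm].
   + replace m with (n + (m - n))%nat by lia. pose proof (Hmono n (m - n)%nat).
    pose proof (Hkpos (n + (m - n))%nat). nra.
   + pose proof (Hmono m (n - m)%nat) as H. replace (m + (n - m))%nat with n in H by lia.
    pose proof (Hkpos n). nra. }
 destruct Hx as [x Hx]. destruct Hy as [y Hy].
 destruct (Hloc x y (Hx O) (Hy O)) as [d [Hd Hq]].
 destruct (pow_lt_1_zero (/ 2)) with (y := d / k0) as [N HN].
 { lra. }
 { pos. }
 apply (proj1 (Hs N)). apply Hq; [|pos|pos]. split; [pos|].
 rewrite (proj2 (Hs N)). specialize (HN N (Nat.le_refl N)).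
 rewrite pow_inv in HN.
 assert (0 < / 2 ^ N) by pos.
 rewrite Rabs_right in HN by lra.
 apply (Rmult_lt_compat_l k0) in HN; trivial.
 replace (k0 * (d / k0)) with d in HN by (field; lra). lra.
Qed.

(** Heine-Borel as an induction principle: a property of sets that passes to subsets and to finite
    unions and holds near every point holds for the whole square. *)
Lemma square_compactness (P : (C -> Prop) -> Prop) (M : R) : 0 < M ->
  (forall A B : C -> Prop, (forall z, A z -> B z) -> P B -> P A) ->
  (forall A B : C -> Prop, P A -> P B -> P (fun z => A z \/ B z)) ->
  (forall z, exists r, 0 < r /\ P (fun w => Cmod (w - z) < r)) ->
  P (fun z => Rabs (fst z) <= M /\ Rabs (snd z) <= M).
Proof.
 intros HM Hmon Hun Hloc.
 set (Q := fun x y k => P (fun z : C => x <= fst z <= x + 1 * k /\ y <= snd z <= y + 1 * k)).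
 assert (H : Q (- M) (- M) (2 * M)).
 { apply (cousin_rectangle 1 1); try lra.
  - intros x y k Hk H1 H2 H3 H4.
   eapply Hmon; [| apply (Hun _ _ (Hun _ _ H1 H2) (Hun _ _ H3 H4))].
   intros z [Hz1 Hz2]. lra.
  - intros x y _ _. destruct (Hloc (x, y)) as [r [Hr HP]]. exists (r / 2). split; [lra|].
   intros x' y' k Hk Hx Hy. eapply Hmon; [|exact HP].
   intros z [Hz1 Hz2]. lt_via Cmod_le_sum. simpl.
   assert (Rabs (fst z + - x) <= k) by lra.
   assert (Rabs (snd z + - y) <= k) by lra. lra. }
 eapply Hmon; [|exact H]. intros z [Hz1 Hz2]. simpl. lra.
Qed.

(** * Integrals of complex-valued functions of a real variable *)

Definition CInt (c : R -> C) (a b : R) : C :=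
  (RInt (fun t => fst (c t)) a b, RInt (fun t => snd (c t)) a b).

Definition ccontR (c : R -> C) (t : R) : Prop :=
  continuous (fun t => fst (c t)) t /\ continuous (fun t => snd (c t)) t.

Lemma ccontR_ex_RInt (c : R -> C) (a b : R) :
  (forall t, Rmin a b <= t <= Rmax a b -> ccontR c t) ->
  ex_RInt (fun t => fst (c t)) a b /\ ex_RInt (fun t => snd (c t)) a b.
Proof. split; apply (ex_RInt_continuous (V := R_CompleteNormedModule)); intros z Hz; apply (H z Hz). Qed.

Lemma CInt_ftc (c c' : R -> C) (a b : R) :
  (forall t, Rmin a b <= t <= Rmax a b -> cder c t (c' t)) ->
  (forall t, Rmin a b <= t <= Rmax a b -> ccontR c' t) ->
  CInt c' a b = (c b - c a)%C.
Proof.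
 intros Hd Hc. apply injective_projections; simpl.
 - rewrite (is_RInt_unique _ _ _ (fst (c b) - fst (c a))); [lra|].
  apply (is_RInt_derive (V := R_CompleteNormedModule) (fun t => fst (c t)) (fun t => fst (c' t))); intros t Ht; [apply Hd | apply Hc]; trivial.
 - rewrite (is_RInt_unique _ _ _ (snd (c b) - snd (c a))); [lra|].
  apply (is_RInt_derive (V := R_CompleteNormedModule) (fun t => snd (c t)) (fun t => snd (c' t))); intros t Ht; [apply Hd | apply Hc]; trivial.
Qed.

Lemma abs_RInt_bound (g : R -> R) (a b M : R) :
  ex_RInt g a b -> (forall t, Rmin a b <= t <= Rmax a b -> Rabs (g t) <= M) ->
  Rabs (RInt g a b) <= M * Rabs (b - a).
Proof.
 intros Hg HM. destruct (Rle_dec a b) as [H|H].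
 - rewrite (Rabs_right (b - a)) by lra. rewrite Rmult_comm. apply abs_RInt_le_const; trivial.
  intros t Ht. apply HM. lra.
 - rewrite <- (opp_RInt_swap (V := R_CompleteNormedModule)) by (apply ex_RInt_swap; exact Hg).
  rewrite Rabs_Ropp. rewrite (Rabs_left1 (b - a)) by lra.
  rewrite Rmult_comm. replace (- (b - a)) with (a - b) by ring. apply abs_RInt_le_const; [lra|apply ex_RInt_swap; exact Hg|].
  intros t Ht. apply HM. lra.
Qed.

(** The factor 2 comes from bounding the real and the imaginary part separately; it explains the
    constants [4 * PI] and [8 * PI] in the integrals over circles. *)
Lemma CInt_bound (c : R -> C) (a b M : R) :
  (forall t, Rmin a b <= t <= Rmax a b -> ccontR c t) ->
  (forall t, Rmin a b <= t <= Rmax a b -> Cmod (c t) <= M) ->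
  Cmod (CInt c a b) <= 2 * M * Rabs (b - a).
Proof.
 intros Hc HM. destruct (ccontR_ex_RInt c a b Hc) as [H1 H2].
 le_via Cmod_le_sum. simpl.
 assert (Rabs (RInt (fun t => fst (c t)) a b) <= M * Rabs (b - a)).
 { apply abs_RInt_bound; trivial. intros t Ht. eapply Rle_trans; [apply Re_le_Cmod | apply HM, Ht]. }
 assert (Rabs (RInt (fun t => snd (c t)) a b) <= M * Rabs (b - a)).
 { apply abs_RInt_bound; trivial. intros t Ht. eapply Rle_trans; [apply Im_le_Cmod | apply HM, Ht]. }
 lra.
Qed.

Lemma CInt_Chasles (c : R -> C) (p q r : R) :
  (forall t, Rmin p (Rmin q r) <= t <= Rmax p (Rmax q r) -> ccontR c t) ->
  (CInt c p q + CInt c q r)%C = CInt c p r.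
Proof.
 intros Hc.
 assert (E : forall u v, Rmin p (Rmin q r) <= Rmin u v -> Rmax u v <= Rmax p (Rmax q r) ->
  ex_RInt (fun t => fst (c t)) u v /\ ex_RInt (fun t => snd (c t)) u v).
 { intros u v H1 H2. apply ccontR_ex_RInt. intros t Ht. apply Hc. lra. }
 destruct (E p q) as [A1 A2].
 { unfold Rmin; repeat destruct Rle_dec; lra. }
 { unfold Rmax; repeat destruct Rle_dec; lra. }
 destruct (E q r) as [B1 B2].
 { lra. }
 { lra. }
 apply injective_projections; simpl;
  [ apply (RInt_Chasles (V := R_CompleteNormedModule) (fun t => fst (c t)))
  | apply (RInt_Chasles (V := R_CompleteNormedModule) (fun t => snd (c t)))]; trivial.
Qed.

Lemma CInt_ext (c1 c2 : R -> C) (a b : R) :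
  (forall t, Rmin a b < t < Rmax a b -> c1 t = c2 t) -> CInt c1 a b = CInt c2 a b.
Proof.
 intros H. unfold CInt. f_equal; apply RInt_ext; intros t Ht; rewrite (H t Ht); reflexivity.
Qed.

Lemma CInt_plus (c1 c2 : R -> C) (a b : R) :
  (forall t, Rmin a b <= t <= Rmax a b -> ccontR c1 t) ->
  (forall t, Rmin a b <= t <= Rmax a b -> ccontR c2 t) ->
  CInt (fun t => (c1 t + c2 t)%C) a b = (CInt c1 a b + CInt c2 a b)%C.
Proof.
 intros H1 H2. destruct (ccontR_ex_RInt c1 a b H1). destruct (ccontR_ex_RInt c2 a b H2).
 unfold CInt, Cplus; simpl. f_equal;
  apply (RInt_plus (V := R_CompleteNormedModule)); trivial.
Qed.

Lemma CInt_scal (l : C) (c : R -> C) (a b : R) :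
  (forall t, Rmin a b <= t <= Rmax a b -> ccontR c t) ->
  CInt (fun t => (l * c t)%C) a b = (l * CInt c a b)%C.
Proof.
 intros H1. destruct (ccontR_ex_RInt c a b H1) as [E1 E2].
 unfold CInt, Cmult; simpl. f_equal.
 - rewrite <- (RInt_scal (V := R_CompleteNormedModule) _ a b (fst l)) by trivial.
  rewrite <- (RInt_scal (V := R_CompleteNormedModule) _ a b (snd l)) by trivial.
  apply (RInt_minus (V := R_CompleteNormedModule) (fun t => fst l * fst (c t)) (fun t => snd l * snd (c t)));
   apply (ex_RInt_scal (V := R_CompleteNormedModule)); trivial.
 - rewrite <- (RInt_scal (V := R_CompleteNormedModule) _ a b (fst l)) by trivial.
  rewrite <- (RInt_scal (V := R_CompleteNormedModule) _ a b (snd l)) by trivial.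
  apply (RInt_plus (V := R_CompleteNormedModule) (fun t => fst l * snd (c t)) (fun t => snd l * fst (c t)));
   apply (ex_RInt_scal (V := R_CompleteNormedModule)); trivial.
Qed.

(** The counterclockwise contour integral of [f] over the boundary of the rectangle, with
    [dz = i dy] on the vertical sides. *)
Definition rect_int (f : C -> C) (x1 x2 y1 y2 : R) : C :=
  ((CInt (fun t => f (t, y1)) x1 x2) + Ci * (CInt (fun t => f (x2, t)) y1 y2) - (CInt (fun t => f (t, y2)) x1 x2) - Ci * (CInt (fun t => f (x1, t)) y1 y2))%C.

(** The corners may come in any order, because the paths that define a primitive run in either
    direction. *)
Definition in_box (x1 x2 y1 y2 x y : R) : Prop :=
  Rmin x1 x2 <= x <= Rmax x1 x2 /\ Rmin y1 y2 <= y <= Rmax y1 y2.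

Lemma Rminmax_l (a b : R) : Rmin a b <= a <= Rmax a b.
Proof. lra. Qed.

Lemma Rminmax_three (a b c v : R) : Rmin a (Rmin b c) <= v <= Rmax a (Rmax b c) ->
  (Rmin b a <= v <= Rmax b a) \/ (Rmin c a <= v <= Rmax c a).
Proof.
 unfold Rmin, Rmax. destruct (Rle_dec b c), (Rle_dec b a), (Rle_dec c a), (Rle_dec a b), (Rle_dec a c);
  intros H; destruct (Rle_dec v a); lra.
Qed.

Lemma Rminmax_r (a b : R) : Rmin a b <= b <= Rmax a b.
Proof. lra. Qed.

Lemma ccontR_horiz (f : C -> C) (t y : R) : ccont f (t, y) -> ccontR (fun t => f (t, y)) t.
Proof. intros H. apply (ccont_curve f (fun t => (t, y)) t 1 H). apply cder_horiz. Qed.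

Lemma ccontR_vert (f : C -> C) (x t : R) : ccont f (x, t) -> ccontR (fun t => f (x, t)) t.
Proof. intros H. apply (ccont_curve f (fun t => (x, t)) t Ci H). apply cder_vert. Qed.

Lemma rect_int_split (f : C -> C) (x1 x2 x3 y1 y2 y3 : R) :
  x1 <= x2 <= x3 -> y1 <= y2 <= y3 ->
  (forall x y, x1 <= x <= x3 -> y1 <= y <= y3 -> ccont f (x, y)) ->
  rect_int f x1 x3 y1 y3 =
  (rect_int f x1 x2 y1 y2 + rect_int f x2 x3 y1 y2 + (rect_int f x1 x2 y2 y3 + rect_int f x2 x3 y2 y3))%C.
Proof.
 intros Hx Hy Hf.
 assert (HH : forall y, y1 <= y <= y3 -> ((CInt (fun t => f (t, y)) x1 x2) + (CInt (fun t => f (t, y)) x2 x3))%C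
  = CInt (fun t => f (t, y)) x1 x3).
 { intros y Hy'. apply CInt_Chasles. intros t Ht. apply ccontR_horiz, Hf; trivial.
  unfold Rmin, Rmax in Ht. repeat destruct Rle_dec; lra. }
 assert (HV : forall x, x1 <= x <= x3 -> ((CInt (fun t => f (x, t)) y1 y2) + (CInt (fun t => f (x, t)) y2 y3))%C
  = CInt (fun t => f (x, t)) y1 y3).
 { intros x Hx'. apply CInt_Chasles. intros t Ht. apply ccontR_vert, Hf; trivial.
  unfold Rmin, Rmax in Ht. repeat destruct Rle_dec; lra. }
 unfold rect_int. rewrite <- (HH y1), <- (HH y3), <- (HV x1), <- (HV x3) by lra. ring.
Qed.

Lemma rect_int_primitive (F f : C -> C) (x1 x2 y1 y2 : R) :
  (forall x y, in_box x1 x2 y1 y2 x y -> hder F (x, y) (f (x, y))) ->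
  (forall x y, in_box x1 x2 y1 y2 x y -> ccont f (x, y)) ->
  rect_int f x1 x2 y1 y2 = 0.
Proof.
 intros HF Hf.
 assert (HH : forall y, Rmin y1 y2 <= y <= Rmax y1 y2 ->
  CInt (fun t => f (t, y)) x1 x2 = ((F (x2, y)) - (F (x1, y)))%C).
 { intros y Hy. apply (CInt_ftc (fun t => F (t, y))).
  - intros t Ht. eapply cder_eq; [|apply (hder_comp_curve F (fun t => (t, y)) t _ _
    (HF t y (conj Ht Hy)) (cder_horiz t y))]. ring.
  - intros t Ht. apply ccontR_horiz, Hf. easy. }
 assert (HV : forall x, Rmin x1 x2 <= x <= Rmax x1 x2 ->
  (Ci * (CInt (fun t => f (x, t)) y1 y2))%C = ((F (x, y2)) - (F (x, y1)))%C).
 { intros x Hx. rewrite <- CInt_scal.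
  2:{ intros t Ht. apply ccontR_vert, Hf. easy. }
  apply (CInt_ftc (fun t => F (x, t))).
  - intros t Ht. eapply cder_eq; [|apply (hder_comp_curve F (fun t => (x, t)) t _ _
    (HF x t (conj Hx Ht)) (cder_vert x t))]. ring.
  - intros t Ht. destruct (ccontR_vert f x t (Hf x t (conj Hx Ht))) as [C1 C2].
   split; simpl.
   + apply (continuous_minus (fun t => 0 * fst (f (x, t))) (fun t => 1 * snd (f (x, t))));
     apply (continuous_mult (K := R_AbsRing)); trivial; apply continuous_const.
   + apply (continuous_plus (fun t => 0 * snd (f (x, t))) (fun t => 1 * fst (f (x, t))));
     apply (continuous_mult (K := R_AbsRing)); trivial; apply continuous_const. }
 unfold rect_int. rewrite (HH y1), (HH y2), (HV x1), (HV x2).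
 - ring.
 - lra.
 - lra.
 - lra.
 - lra.
Qed.

Lemma rect_int_plus (f g : C -> C) (x1 x2 y1 y2 : R) :
  (forall x y, in_box x1 x2 y1 y2 x y -> ccont f (x, y)) ->
  (forall x y, in_box x1 x2 y1 y2 x y -> ccont g (x, y)) ->
  rect_int (fun z => (f z + g z)%C) x1 x2 y1 y2 =
  (rect_int f x1 x2 y1 y2 + rect_int g x1 x2 y1 y2)%C.
Proof.
 intros Hf Hg. unfold rect_int.
 rewrite !CInt_plus; [ring|..]; intros t Ht; first [apply ccontR_horiz | apply ccontR_vert];
  first [apply Hf | apply Hg]; split; trivial; first [apply Rminmax_l | apply Rminmax_r].
Qed.

Lemma rect_int_bound (f : C -> C) (x1 x2 y1 y2 M : R) :
  (forall x y, in_box x1 x2 y1 y2 x y -> ccont f (x, y)) ->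
  (forall x y, in_box x1 x2 y1 y2 x y -> Cmod (f (x, y)) <= M) ->
  Cmod (rect_int f x1 x2 y1 y2) <= 4 * M * (Rabs (x2 - x1) + Rabs (y2 - y1)).
Proof.
 intros Hf HM.
 assert (HH : forall y, Rmin y1 y2 <= y <= Rmax y1 y2 ->
  Cmod (CInt (fun t => f (t, y)) x1 x2) <= 2 * M * Rabs (x2 - x1)).
 { intros y Hy. apply CInt_bound; intros t Ht.
  - apply ccontR_horiz, Hf. easy.
  - apply HM. easy. }
 assert (HV : forall x, Rmin x1 x2 <= x <= Rmax x1 x2 ->
  Cmod (Ci * (CInt (fun t => f (x, t)) y1 y2))%C <= 2 * M * Rabs (y2 - y1)).
 { intros x Hx. rewrite Cmod_mult, Cmod_Ci, Rmult_1_l. apply CInt_bound; intros t Ht.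
  - apply ccontR_vert, Hf. easy.
  - apply HM. easy. }
 pose proof (HH y1 (Rminmax_l _ _)). pose proof (HH y2 (Rminmax_r _ _)).
 pose proof (HV x1 (Rminmax_l _ _)). pose proof (HV x2 (Rminmax_r _ _)).
 le_via Cmod_triangle_minus.
 eapply Rle_trans; [apply Rplus_le_compat_r, Cmod_triangle_minus|].
 eapply Rle_trans; [apply Rplus_le_compat_r, Rplus_le_compat_r, Cmod_triangle|]. lra.
Qed.

Lemma rect_int_ext (f g : C -> C) (x1 x2 y1 y2 : R) :
  (forall z, f z = g z) -> rect_int f x1 x2 y1 y2 = rect_int g x1 x2 y1 y2.
Proof.
 intros E. unfold rect_int.
 rewrite (CInt_ext (fun t => f (t, y1)) (fun t => g (t, y1))) by easy.
 rewrite (CInt_ext (fun t => f (t, y2)) (fun t => g (t, y2))) by easy.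
 rewrite (CInt_ext (fun t => f (x1, t)) (fun t => g (x1, t))) by easy.
 rewrite (CInt_ext (fun t => f (x2, t)) (fun t => g (x2, t))) by easy. easy.
Qed.

Lemma hder_affine (c l z0 z : C) : hder (fun w => (c + l * (w - z0))%C) z l.
Proof.
 exists 1. split; [lra|]. intros h _.
 match goal with |- Cmod ?x <= _ => replace x with (RtoC 0) by ring end.
 rewrite Cmod_0. pos.
Qed.

(** The bound [eps * (k * k)] is additive over the four quarters of a rectangle of scale [k], so
    bisection reduces it to small rectangles around a point. There the affine part of [f] has a
    primitive, and only the remainder contributes. *)
Lemma goursat_ordered (f : C -> C) (x1 x2 y1 y2 : R) : x1 < x2 -> y1 < y2 ->
  (forall x y, x1 <= x <= x2 -> y1 <= y <= y2 -> exists l, hder f (x, y) l) ->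
  rect_int f x1 x2 y1 y2 = 0.
Proof.
 intros Hx Hy Hf.
 assert (Hc : forall x y, x1 <= x <= x2 -> y1 <= y <= y2 -> ccont f (x, y)).
 { intros x y H1 H2. destruct (Hf x y H1 H2) as [l Hl]. apply (hder_ccont _ _ _ Hl). }
 set (a := x2 - x1). set (b := y2 - y1).
 assert (Ha : 0 < a) by (unfold a; lra). assert (Hb : 0 < b) by (unfold b; lra).
 assert (H : forall eps, 0 < eps -> Cmod (rect_int f x1 x2 y1 y2) <= eps).
 { intros eps He.
  set (Q := fun x y k => x1 <= x -> x + a * k <= x2 -> y1 <= y -> y + b * k <= y2 ->
   Cmod (rect_int f x (x + a * k) y (y + b * k)) <= eps * (k * k)).
  assert (HQ : Q x1 y1 1).
  { apply (cousin_rectangle a b); trivial; try lra.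
   - intros x y k Hk H1 H2 H3 H4 G1 G2 G3 G4.
    assert (0 < a * (k / 2)) by pos.
    assert (0 < b * (k / 2)) by pos.
    rewrite (rect_int_split f x (x + a * (k / 2)) (x + a * k) y (y + b * (k / 2)) (y + b * k)); try lra.
    2:{ intros u v Hu Hv. apply Hc; lra. }
    specialize (H1 ltac:(lra) ltac:(lra) ltac:(lra) ltac:(lra)).
    specialize (H2 ltac:(lra) ltac:(lra) ltac:(lra) ltac:(lra)).
    specialize (H3 ltac:(lra) ltac:(lra) ltac:(lra) ltac:(lra)).
    specialize (H4 ltac:(lra) ltac:(lra) ltac:(lra) ltac:(lra)).
    replace (x + a * (k / 2) + a * (k / 2)) with (x + a * k) in * by lra.
    replace (y + b * (k / 2) + b * (k / 2)) with (y + b * k) in * by lra.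
    le_via Cmod_triangle.
    eapply Rle_trans; [apply Rplus_le_compat; apply Cmod_triangle|]. lra.
   - intros x y Hx' Hy'. replace (x1 + a * 1) with x2 in Hx' by (unfold a; ring).
    replace (y1 + b * 1) with y2 in Hy' by (unfold b; ring).
    destruct (Hf x y Hx' Hy') as [l Hl].
    (* The remainder is at most [e * (a + b) * k] and the contour contributes another factor
       [4 * (a + b) * k]; the product is [eps * (k * k)]. *)
    set (e := eps / (4 * (a + b) * (a + b))).
    assert (He' : 0 < e). { unfold e. pos. }
    destruct (Hl e He') as [d [Hd Hr]].
    exists (d / (a + b)). split; [pos|].
    intros x' y' k [Hk Hkd] Gx Gy G1 G2 G3 G4.
    apply (Rmult_lt_compat_l (a + b)) in Hkd; [|lra].
    replace ((a + b) * (d / (a + b))) with d in Hkd by (field; lra).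
    set (aff := fun w => ((f (x, y)) + l * (w - (x, y)))%C).
    set (r := fun w => (f w - aff w)%C).
    assert (Ca : forall w, ccont aff w). { intros w. apply (hder_ccont aff w l), hder_affine. }
    assert (Cf : forall u v, in_box x' (x' + a * k) y' (y' + b * k) u v -> ccont f (u, v)).
    { intros u v [Hu Hv]. rewrite Rmin_left, Rmax_right in Hu, Hv by lra. apply Hc; lra. }
    assert (Cr : forall u v, in_box x' (x' + a * k) y' (y' + b * k) u v -> ccont r (u, v)).
    { intros u v Huv ep Hep. destruct (Cf u v Huv (ep / 2)) as [d1 [Hd1 Hb1]]; [lra|].
     destruct (Ca (u, v) (ep / 2)) as [d2 [Hd2 Hb2]]; [lra|].
     exists (Rmin d1 d2). split; [pos|]. intros w Hw.
     specialize (Hb1 w (Rlt_min_l Hw)).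
     specialize (Hb2 w (Rlt_min_r Hw)).
     unfold r. replace (f w - aff w - ((f (u, v)) - (aff (u, v))))%C
      with (f w - (f (u, v)) - (aff w - (aff (u, v))))%C by ring.
     lt_via Cmod_triangle_minus. lra. }
    assert (E : rect_int f x' (x' + a * k) y' (y' + b * k) = rect_int r x' (x' + a * k) y' (y' + b * k)).
    { transitivity (rect_int (fun w => (aff w + r w)%C) x' (x' + a * k) y' (y' + b * k)).
     - apply rect_int_ext. intros w. ceq.
     - rewrite rect_int_plus; [|pos|pos].
      rewrite (rect_int_primitive (fun w => Cplus (Cmult (f (x, y)) w)
       (Cmult (Cmult l (/ 2)) (Cmult (Cminus w (x, y)) (Cminus w (x, y))))) aff).
      + ring.
      + intros u v _. eapply hder_eq; [|apply hder_plus; [apply hder_mult; [apply hder_const|apply hder_id]|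
        apply hder_mult; [apply hder_const|apply hder_mult; apply hder_plus;
        [apply hder_id|apply hder_const|apply hder_id|apply hder_const]]]].
       unfold aff. field.
      + pos. }
    rewrite E. le_via (rect_int_bound r _ _ _ _ (e * ((a + b) * k)) Cr).
    + intros u v [Hu Hv]. rewrite Rmin_left, Rmax_right in Hu, Hv by lra.
     assert (Hh : Cmod ((u, v) - (x, y))%C <= (a + b) * k).
     { le_via Cmod_le_sum. simpl.
      assert (Rabs (u + - x) <= a * k) by lra.
      assert (Rabs (v + - y) <= b * k) by lra. lra. }
     specialize (Hr ((u, v) - (x, y))%C (Rle_lt_trans _ _ _ Hh Hkd)).
     rewrite Cplus_minus_cancel in Hr.
     replace (r (u, v)) with ((f (u, v)) - (f (x, y)) - l * ((u, v) - (x, y)))%C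
      by ceq. nra.
    +
     rewrite !Rabs_right by lra. right. unfold e. field. lra. }
  unfold Q in HQ. replace (x1 + a * 1) with x2 in HQ by (unfold a; ring).
  replace (y1 + b * 1) with y2 in HQ by (unfold b; ring). lra. }
 apply Cmod_eq_0. apply Rle_antisym; [|lra].
 apply Rnot_lt_le. intros Hp. specialize (H (Cmod (rect_int f x1 x2 y1 y2) / 2) ltac:(lra)). lra.
Qed.

Lemma CInt_swap (c : R -> C) (a b : R) :
  (forall t, Rmin a b <= t <= Rmax a b -> ccontR c t) -> CInt c b a = (- CInt c a b)%C.
Proof.
 intros H. destruct (ccontR_ex_RInt c a b H) as [E1 E2].
 unfold CInt, Copp; simpl. rewrite <- (opp_RInt_swap (V := R_CompleteNormedModule) (fun t => fst (c t)) a b E1),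
  <- (opp_RInt_swap (V := R_CompleteNormedModule) (fun t => snd (c t)) a b E2). easy.
Qed.

Lemma CInt_point (c : R -> C) (a : R) : CInt c a a = 0.
Proof. unfold CInt. rewrite !RInt_point. easy. Qed.

Lemma goursat (f : C -> C) (x1 x2 y1 y2 : R) :
  (forall x y, in_box x1 x2 y1 y2 x y -> exists l, hder f (x, y) l) ->
  rect_int f x1 x2 y1 y2 = 0.
Proof.
 intros Hf.
 assert (W : forall a b c d, a <= b -> c <= d ->
  (forall x y, a <= x <= b -> c <= y <= d -> exists l, hder f (x, y) l) -> rect_int f a b c d = 0).
 { intros a b c d Hab Hcd H.
  destruct Hab as [Hab| <-]; [destruct Hcd as [Hcd| <-]|].
  - apply goursat_ordered; trivial.
  - unfold rect_int. rewrite !CInt_point. ring.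
  - unfold rect_int. rewrite !CInt_point. ring. }
 assert (Hc : forall x y, in_box x1 x2 y1 y2 x y -> ccont f (x, y)).
 { intros x y H. destruct (Hf x y H) as [l Hl]. apply (hder_ccont _ _ _ Hl). }
 assert (SH : forall y, Rmin y1 y2 <= y <= Rmax y1 y2 ->
  CInt (fun t => f (t, y)) x2 x1 = (- (CInt (fun t => f (t, y)) x1 x2))%C).
 { intros y Hy. apply CInt_swap. intros t Ht. apply ccontR_horiz, Hc. easy. }
 assert (SV : forall x, Rmin x1 x2 <= x <= Rmax x1 x2 ->
  CInt (fun t => f (x, t)) y2 y1 = (- (CInt (fun t => f (x, t)) y1 y2))%C).
 { intros x Hx. apply CInt_swap. intros t Ht. apply ccontR_vert, Hc. easy. }
 pose proof (SH y1 (Rminmax_l _ _)) as SH1. pose proof (SH y2 (Rminmax_r _ _)) as SH2.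
 pose proof (SV x1 (Rminmax_l _ _)) as SV1. pose proof (SV x2 (Rminmax_r _ _)) as SV2.
 destruct (Rle_dec x1 x2) as [Hx|Hx]; destruct (Rle_dec y1 y2) as [Hy|Hy].
 - apply W; trivial. intros x y H1 H2. apply Hf. split; [lra|lra]; lra.
 - assert (E := W x1 x2 y2 y1 Hx ltac:(lra)).
  replace (rect_int f x1 x2 y1 y2) with (- rect_int f x1 x2 y2 y1)%C.
  + rewrite E; [ring|]. intros x y H1 H2. apply Hf. split; [lra|lra]; lra.
  + unfold rect_int. rewrite SV1, SV2. ring.
 - assert (E := W x2 x1 y1 y2 ltac:(lra) Hy).
  replace (rect_int f x1 x2 y1 y2) with (- rect_int f x2 x1 y1 y2)%C.
  + rewrite E; [ring|]. intros x y H1 H2. apply Hf. split; [lra|lra]; lra.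
  + unfold rect_int. rewrite SH1, SH2. ring.
 - assert (E := W x2 x1 y2 y1 ltac:(lra) ltac:(lra)).
  replace (rect_int f x1 x2 y1 y2) with (rect_int f x2 x1 y2 y1).
  + rewrite E; [ring|]. intros x y H1 H2. apply Hf. split; [lra|lra]; lra.
  + unfold rect_int. rewrite SH1, SH2, SV1, SV2. ring.
Qed.

(** Squares and vertical strips have this property, discs do not: a corner of the box spanned by two
    points of a disc may lie outside. *)
Definition box_convex (D : C -> Prop) : Prop :=
  forall x1 y1 x2 y2 x y, D (x1, y1) -> D (x2, y2) -> in_box x1 x2 y1 y2 x y -> D (x, y).

Lemma CInt_const (c : C) (a b : R) : CInt (fun _ => c) a b = (c * RtoC (b - a))%C.
Proof. unfold CInt. rewrite !RInt_const. unfold scal; simpl. unfold mult; simpl. ceq. Qed.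

Lemma ccontR_const (c : C) (t : R) : ccontR (fun _ => c) t.
Proof. split; apply continuous_const. Qed.

(** The primitive integrates [f] horizontally at height [y0] and then vertically. Goursat's theorem
    on a rectangle in [D] allows the horizontal leg of an increment to be moved to the height of the
    base point. *)
Lemma box_primitive (D : C -> Prop) (f : C -> C) :
  planar_open D -> box_convex D -> (exists z, D z) -> (forall z, D z -> exists l, hder f z l) ->
  exists F, forall z, D z -> hder F z (f z).
Proof.
 intros HO HB [[x0 y0] H0] Hf.
 assert (Hc : forall z, D z -> ccont f z).
 { intros z Hz. destruct (Hf z Hz) as [l Hl]. apply (hder_ccont _ _ _ Hl). }
 exists (fun z => ((CInt (fun t => f (t, y0)) x0 (fst z)) + Ci * (CInt (fun t => f (fst z, t)) y0 (snd z)))%C).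
 intros [x y] Hz eps He.
 destruct (HO _ Hz) as [r [Hr Hball]]. destruct (Hc _ Hz (eps / 8)) as [d [Hd Hb]]; [lra|].
 exists (Rmin r d). split; [pos|]. intros [hx hy] Hh.
 set (x' := x + hx). set (y' := y + hy).
 assert (Hz' : D (x', y')).
 { apply Hball. replace ((x', y') - (x, y))%C with ((hx, hy) : C).
  - lra.
  - unfold x', y', Cminus, Cplus, Copp; simpl; f_equal; ring. }
 assert (Dnear : forall u v, in_box x x' y y' u v -> Cmod ((u, v) - (x, y))%C <= Cmod (hx, hy)).
 { intros u v [Hu Hv]. unfold Cmod; simpl. apply sqrt_le_1_alt.
  assert (Rabs (u - x) <= Rabs hx). { unfold x', Rmin, Rmax, Rabs in *. repeat destruct Rle_dec; repeat destruct Rcase_abs; lra. }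
  assert (Rabs (v - y) <= Rabs hy). { unfold y', Rmin, Rmax, Rabs in *. repeat destruct Rle_dec; repeat destruct Rcase_abs; lra. }
  apply Rsqr_le_abs_1 in H, H1. unfold Rsqr in *. nra. }
 assert (Dpt : forall u v, in_box x x' y y' u v -> D (u, v) /\ Cmod ((f (u, v)) - (f (x, y)))%C <= eps / 8).
 { intros u v Huv. pose proof (Dnear u v Huv). split.
  - apply Hball. lra.
  - left. apply Hb. lra. }
 assert (Dx : forall u v, Rmin x x' <= u <= Rmax x x' -> Rmin y0 (Rmin y y') <= v <= Rmax y0 (Rmax y y') -> D (u, v)).
 { intros u v Hu Hv.
  assert (U1 : D (u, y)). { apply (HB x y x' y' u y Hz Hz'). split; trivial. lra. }
  assert (U2 : D (u, y')). { apply (HB x y x' y' u y' Hz Hz'). split; trivial. lra. }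
  assert (U0 : D (u, y0)). { apply (HB u y x0 y0); trivial. split; [lra|lra]. }
  destruct (Rminmax_three _ _ _ _ Hv) as [Hv'|Hv'].
  - apply (HB u y u y0); trivial. split; [lra|lra].
  - apply (HB u y' u y0); trivial. split; [lra|lra]. }
 assert (G : rect_int f x x' y0 y = 0).
 { apply goursat. intros u v [Hu Hv]. apply Hf, Dx; trivial.
  unfold Rmin at 1, Rmax at 1 in Hv. destruct (Rle_dec y0 y); lra. }
 simpl fst. simpl snd. fold x' y'.
 assert (E1 : ((CInt (fun t => f (t, y0)) x0 x) + (CInt (fun t => f (t, y0)) x x'))%C = CInt (fun t => f (t, y0)) x0 x').
 { apply CInt_Chasles. intros t Ht. apply ccontR_horiz, Hc.
  assert (D (x, y0)). { apply (HB x y x0 y0); trivial. split; [lra|lra]. }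
  assert (D (x', y0)). { apply (HB x' y' x0 y0); trivial. split; [lra|lra]. }
  destruct (Rminmax_three _ _ _ _ Ht) as [Ht'|Ht'].
  - apply (HB x y0 x0 y0); trivial. split; [lra|lra].
  - apply (HB x' y0 x0 y0); trivial. split; [lra|lra]. }
 assert (E2 : ((CInt (fun t => f (x', t)) y0 y) + (CInt (fun t => f (x', t)) y y'))%C = CInt (fun t => f (x', t)) y0 y').
 { apply CInt_Chasles. intros t Ht. apply ccontR_vert, Hc. apply Dx; trivial. lra. }
 set (g1 := fun t => ((f (t, y)) + (- (f (x, y))))%C).
 set (g2 := fun t => ((f (x', t)) + (- (f (x, y))))%C).
 assert (K1 : forall t, Rmin x x' <= t <= Rmax x x' -> ccontR (fun t => f (t, y)) t).
 { intros t Ht. apply ccontR_horiz, Hc. apply (Dpt t y). split; trivial. lra. }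
 assert (K2 : forall t, Rmin y y' <= t <= Rmax y y' -> ccontR (fun t => f (x', t)) t).
 { intros t Ht. apply ccontR_vert, Hc. apply (Dpt x' t). split; trivial. lra. }
 assert (E3 : CInt g1 x x' = ((CInt (fun t => f (t, y)) x x') - (f (x, y)) * hx)%C).
 { unfold g1. rewrite CInt_plus, CInt_const; trivial; [|intros; apply ccontR_const].
  replace (x' - x) with hx by (unfold x'; ring). ring. }
 assert (E4 : CInt g2 y y' = ((CInt (fun t => f (x', t)) y y') - (f (x, y)) * hy)%C).
 { unfold g2. rewrite CInt_plus, CInt_const; trivial; [|intros; apply ccontR_const].
  replace (y' - y) with hy by (unfold y'; ring). ring. }
 (* The increment minus its linear part is the integral of [f - f (x, y)] along the horizontal and
    then the vertical leg from the base point; [G] has moved the horizontal leg from height [y0] to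
    height [y]. *)
 match goal with |- Cmod ?e <= _ => replace e with (CInt g1 x x' + Ci * CInt g2 y y')%C end.
 2:{ rewrite E3, E4, <- E1, <- E2. unfold rect_int in G.
  replace ((hx, hy) : C) with (hx + Ci * hy)%C.
  2:{ unfold Cplus, Cmult, Ci, RtoC; simpl. f_equal; ring. }
  apply Ceq_minus.
  match goal with |- ?l = _ => replace l with (- ((CInt (fun t => f (t, y0)) x x') + Ci * (CInt (fun t => f (x', t)) y0 y) - (CInt (fun t => f (t, y)) x x') - Ci * (CInt (fun t => f (x, t)) y0 y)))%C by ring end.
  rewrite G. ring. }
 le_via Cmod_triangle. rewrite Cmod_mult, Cmod_Ci, Rmult_1_l.
 assert (B1 : Cmod (CInt g1 x x') <= 2 * (eps / 8) * Rabs (x' - x)).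
 { apply CInt_bound; intros t Ht.
  - destruct (K1 t Ht) as [C1 C2]. split; simpl;
    [apply (continuous_plus (fun t => fst (f (t, y))))|apply (continuous_plus (fun t => snd (f (t, y))))];
    trivial; apply continuous_const.
  - apply (Dpt t y). split; trivial. lra. }
 assert (B2 : Cmod (CInt g2 y y') <= 2 * (eps / 8) * Rabs (y' - y)).
 { apply CInt_bound; intros t Ht.
  - destruct (K2 t Ht) as [C1 C2]. split; simpl;
    [apply (continuous_plus (fun t => fst (f (x', t))))|apply (continuous_plus (fun t => snd (f (x', t))))];
    trivial; apply continuous_const.
  - apply (Dpt x' t). split; trivial. lra. }
 replace (x' - x) with hx in B1 by (unfold x'; ring). replace (y' - y) with hy in B2 by (unfold y'; ring).
 pose proof (Re_le_Cmod (hx, hy)) as R1. pose proof (Im_le_Cmod (hx, hy)) as R2.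
 set (m := Cmod (hx, hy)) in *.
 assert (2 * (eps / 8) * Rabs hx <= 2 * (eps / 8) * m) by pos.
 assert (2 * (eps / 8) * Rabs hy <= 2 * (eps / 8) * m) by pos.
 lra.
Qed.

(** * The derivative of a holomorphic function *)

Lemma ccontR_plus (c1 c2 : R -> C) (t : R) :
  ccontR c1 t -> ccontR c2 t -> ccontR (fun t => (c1 t + c2 t)%C) t.
Proof. intros [A1 A2] [B1 B2]. split; simpl; cont. Qed.

Lemma ccontR_mult (c1 c2 : R -> C) (t : R) :
  ccontR c1 t -> ccontR c2 t -> ccontR (fun t => (c1 t * c2 t)%C) t.
Proof. intros [A1 A2] [B1 B2]. split; simpl; cont. Qed.

Lemma ccontR_opp (c : R -> C) (t : R) : ccontR c t -> ccontR (fun t => (- c t)%C) t.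
Proof. intros [A1 A2]. split; simpl; cont. Qed.

Lemma ccontR_RtoC (g : R -> R) (t : R) : continuous g t -> ccontR (fun t => RtoC (g t)) t.
Proof. split; simpl; [pos|apply continuous_const]. Qed.

Lemma is_derive_cont (g : R -> R) (t l : R) : is_derive g t l -> continuous g t.
Proof. intros H. exact (ex_derive_continuous g t (ex_intro _ l H)). Qed.

Lemma cder_ccontR (c : R -> C) (t : R) (l : C) : cder c t l -> ccontR c t.
Proof.
 intros [A1 A2]. split; [apply (is_derive_cont _ _ _ A1)|apply (is_derive_cont _ _ _ A2)].
Qed.

Lemma cder_plus (c1 c2 : R -> C) (t : R) (l1 l2 : C) :
  cder c1 t l1 -> cder c2 t l2 -> cder (fun t => (c1 t + c2 t)%C) t (l1 + l2).
Proof. intros [A1 A2] [B1 B2]. split; simpl; der; ring. Qed.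

Lemma cder_mult (c1 c2 : R -> C) (t : R) (l1 l2 : C) :
  cder c1 t l1 -> cder c2 t l2 -> cder (fun t => (c1 t * c2 t)%C) t (l1 * c2 t + c1 t * l2).
Proof. intros [A1 A2] [B1 B2]. split; simpl; der; ring. Qed.

Lemma cder_comp (h : R -> C) (g : R -> R) (t k : R) (l : C) : cder h (g t) l -> is_derive g t k -> cder (fun t => h (g t)) t (k * l).
Proof.
 intros [H1 H2] D. split; (evar_last; [apply (der_comp (fun x => _ (h x)) g); [eassumption|exact D]|simpl; ring]).
Qed.

Lemma cder_const (a : C) (t : R) : cder (fun _ => a) t 0.
Proof. split; simpl; auto_derive; trivial. Qed.

Lemma cder_segment (w h : C) (t : R) : cder (fun t => (w + t * h)%C) t h.
Proof. split; simpl; auto_derive; trivial; ring. Qed.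

Lemma ccont_cder (f : C -> C) (c : R -> C) (t : R) (l : C) :
  ccont f (c t) -> cder c t l -> ccontR (fun t => f (c t)) t.
Proof. apply (ccont_curve f c t l); trivial. Qed.

(** Integrates [f - a] along the segment. With [a] the derivative at one point, continuity of [f]
    becomes differentiability of [F] that is uniform near this point. *)
Lemma C_mean_value (F f : C -> C) (w h a : C) (M : R) :
  (forall t, 0 <= t <= 1 -> hder F (w + t * h)%C (f (w + t * h)%C)) ->
  (forall t, 0 <= t <= 1 -> ccont f (w + t * h)%C) ->
  (forall t, 0 <= t <= 1 -> Cmod (f (w + t * h) - a)%C <= M) ->
  Cmod (F (w + h) - F w - a * h)%C <= 2 * M * Cmod h.
Proof.
 intros HF Hf HM.
 set (c := fun t => Cplus (F (Cplus w (Cmult (RtoC t) h))) (Copp (Cmult a (Cmult (RtoC t) h)))).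
 set (c' := fun t => Cmult (Cplus (f (Cplus w (Cmult (RtoC t) h))) (Copp a)) h).
 assert (R01 : forall t, Rmin 0 1 <= t <= Rmax 0 1 -> 0 <= t <= 1).
 { intros t. rewrite Rmin_left, Rmax_right; lra. }
 assert (Hc' : forall t, Rmin 0 1 <= t <= Rmax 0 1 -> ccontR c' t).
 { intros t Ht. apply R01 in Ht. apply ccontR_mult; [apply ccontR_plus|]; try apply ccontR_const.
  apply (ccont_cder f (fun t => Cplus w (Cmult (RtoC t) h)) t h); [apply Hf, Ht|apply cder_segment]. }
 assert (E : CInt c' 0 1 = Cminus (c 1) (c 0)).
 { apply CInt_ftc; trivial. intros t Ht. apply R01 in Ht. unfold c, c'.
  eapply cder_eq; [|apply cder_plus; [apply (hder_comp_curve F (fun t => (w + t * h)%C));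
   [apply HF, Ht|apply cder_segment]|]].
  2:{ assert (Hd : cder (fun t => (0 + t * (- (a * h)))%C) t (- (a * h))%C) by apply cder_segment.
   replace (fun t0 : R => (- (a * (t0 * h)))%C) with (fun t => Cplus 0 (Cmult (RtoC t) (Copp (Cmult a h)))).
   - exact Hd.
   - apply functional_extensionality. intros s. ring. }
  ring. }
 assert (E2 : (F (w + h) - F w - a * h)%C = CInt c' 0 1).
 { rewrite E. unfold c. replace (w + 1 * h)%C with (w + h)%C by ring.
  replace (w + 0 * h)%C with w by ring. ring. }
 rewrite E2. le_via (CInt_bound c' 0 1 (M * Cmod h) Hc').
 - intros t Ht. unfold c'. rewrite Cmod_mult. apply Rmult_le_compat_r; [lra|]. eauto.
 - rewrite Rminus_0_r, Rabs_R1. lra.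
Qed.

Lemma Cmod_segment (w h : C) (t : R) : 0 <= t <= 1 ->
  Cmod (w + t * h - w) <= Cmod h.
Proof.
 intros Ht. replace (w + t * h - w)%C with (t * h)%C by ring.
 rewrite Cmod_mult, Cmod_R, Rabs_right by lra. nra.
Qed.

Lemma disc_compactness (P : (C -> Prop) -> Prop) (z0 : C) (c : R) :
  (forall A B : C -> Prop, (forall z, A z -> B z) -> P B -> P A) ->
  (forall A B : C -> Prop, P A -> P B -> P (fun z => A z \/ B z)) ->
  (P (fun _ => False)) ->
  (forall z, Cmod (z - z0) <= c -> exists r, 0 < r /\ P (fun w => Cmod (w - z) < r)) ->
  P (fun z => Cmod (z - z0) <= c).
Proof.
 intros Hmon Hun Hemp Hloc.
 set (P' := fun A : C -> Prop => P (fun w => A w /\ Cmod (w - z0) <= c)).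
 assert (H : P' (fun z => Rabs (fst z) <= Cmod z0 + Rabs c + 1 /\ Rabs (snd z) <= Cmod z0 + Rabs c + 1)).
 { apply (square_compactness P').
  - pos.
  - intros A B HAB HB. eapply Hmon; [|exact HB]. intros z [H1 H2]. auto.
  - intros A B HA HB. eapply Hmon; [|apply (Hun _ _ HA HB)]. tauto.
  - intros z. destruct (Rle_dec (Cmod (z - z0)) c) as [Hz|Hz].
   + destruct (Hloc z Hz) as [r [Hr HP]]. exists r. split; trivial.
    eapply Hmon; [|exact HP]. easy.
   + exists (Cmod (z - z0) - c). split; [lra|]. eapply Hmon; [|exact Hemp].
    intros w [Hw1 Hw2]. pose proof (Cmod_minus_triangle z w z0) as Ht.
    rewrite (Cmod_minus_sym z w) in Ht. lra. }
 eapply Hmon; [|exact H]. split; trivial.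
 assert (Cmod z <= Cmod z0 + Rabs c).
 { pose proof (Cmod_triangle_inv z z0). lra. }
 pose proof (Re_le_Cmod z). pose proof (Im_le_Cmod z). lra.
Qed.

Lemma disc_uniform (Q : C -> C -> Prop) (z0 : C) (c : R) :
  (forall z, Cmod (z - z0) <= c -> exists r, 0 < r /\ forall w h, Cmod (w - z) < r -> Cmod h < r -> Q w h) ->
  exists delta, 0 < delta /\ forall w h, Cmod (w - z0) <= c -> Cmod h < delta -> Q w h.
Proof.
 intros H. apply (disc_compactness (fun A => exists d, 0 < d /\ forall w h, A w -> Cmod h < d -> Q w h)).
 - intros A B HAB [d [Hd Hb]]. exists d. auto.
 - intros A B [d1 [Hd1 Hb1]] [d2 [Hd2 Hb2]]. exists (Rmin d1 d2). split; [pos|].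
  intros w h [Hw|Hw] Hh; [apply Hb1|apply Hb2]; trivial; lra.
 - exists 1. split; [lra|tauto].
 - intros z Hz. destruct (H z Hz) as [r [Hr Hb]]. exists r. split; trivial. exists r. auto.
Qed.

Lemma uniform_hder (D : C -> Prop) (F f : C -> C) (z0 : C) (c : R) :
  planar_open D -> (forall z, D z -> hder F z (f z)) -> (forall z, D z -> ccont f z) ->
  (forall z, Cmod (z - z0) <= c -> D z) ->
  forall eps, 0 < eps -> exists delta, 0 < delta /\ forall w h,
  Cmod (w - z0) <= c -> Cmod h < delta -> Cmod (F (w + h) - F w - f w * h)%C <= eps * Cmod h.
Proof.
 intros HO HF Hf HD eps He. apply disc_uniform. intros z Hz. destruct (HO z (HD z Hz)) as [r [Hr Hball]].
 destruct (Hf z (HD z Hz) (eps / 4)) as [d [Hd Hb]]; [lra|].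
 exists (Rmin r d / 2). split; [pose proof (Rmin_pos r d Hr Hd); lra|]. intros w h Hw Hh.
 assert (Hseg : forall t, 0 <= t <= 1 -> Cmod (w + t * h - z) < Rmin r d).
 { intros t Ht. pose proof (Cmod_segment w h t Ht). pose proof (Cmod_minus_triangle (w + t * h)%C w z). lra. }
 assert (B1 : Cmod (F (w + h) - F w - f z * h)%C <= 2 * (eps / 4) * Cmod h).
 { apply (C_mean_value F f); intros t Ht; specialize (Hseg t Ht); [apply HF, Hball|apply Hf, Hball|left; apply Hb]; lra. }
 assert (B2 : Cmod (f w - f z) < eps / 4) by (apply Hb; lra).
 replace (F (w + h) - F w - f w * h)%C with (F (w + h) - F w - f z * h - (f w - f z) * h)%C by ring.
 le_via Cmod_triangle_minus. rewrite Cmod_mult. nra.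
Qed.

Lemma uniform_ccont (D : C -> Prop) (f : C -> C) (z0 : C) (c : R) :
  planar_open D -> (forall z, D z -> ccont f z) -> (forall z, Cmod (z - z0) <= c -> D z) ->
  forall eps, 0 < eps -> exists delta, 0 < delta /\ forall w h,
  Cmod (w - z0) <= c -> Cmod h < delta -> Cmod (f (w + h) - f w)%C <= eps.
Proof.
 intros HO Hf HD eps He. apply disc_uniform. intros z Hz. destruct (Hf z (HD z Hz) (eps / 2)) as [d [Hd Hb]]; [lra|].
 exists (d / 2). split; [lra|]. intros w h Hw Hh. pose proof (Hb w ltac:(lra)).
 assert (B1 : Cmod (f (w + h) - f z)%C < eps / 2).
 { apply Hb. replace (w + h - z)%C with (w - z + h)%C by ring. lt_via Cmod_triangle. lra. }
 pose proof (Cmod_minus_triangle (f (w + h)%C) (f z) (f w)). rewrite (Cmod_minus_sym (f z)) in *. lra.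
Qed.

(** * Integrals over circles *)

Definition cis (t : R) : C := (cos t, sin t).

Lemma Cmod_cis (t : R) : Cmod (cis t) = 1.
Proof.
 unfold Cmod, cis; simpl. transitivity (sqrt 1); [f_equal|apply sqrt_1].
 pose proof (sin2_cos2 t) as H. unfold Rsqr in H. nra.
Qed.

Lemma cder_cis (t : R) : cder cis t (Ci * cis t)%C.
Proof. split; simpl; auto_derive; trivial; ring. Qed.

Lemma cis_add (s t : R) : cis (s + t) = (cis s * cis t)%C.
Proof. unfold cis, Cmult; simpl. rewrite cos_plus, sin_plus. ceq. Qed.

Lemma cis_0 : cis 0 = 1.
Proof. unfold cis. rewrite cos_0, sin_0. easy. Qed.

Lemma cis_2PI : cis (2 * PI) = 1.
Proof. unfold cis. rewrite cos_2PI, sin_2PI. easy. Qed.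

Lemma cder_circle (z : C) (r t : R) :
  cder (fun t => (z + r * cis t)%C) t (r * (Ci * cis t))%C.
Proof. split; simpl; auto_derive; trivial; ring. Qed.

Lemma circle_in_disc (z z0 : C) (r c : R) (t : R) : Cmod (z - z0) <= c / 2 -> Rabs r <= c / 2 ->
  Cmod (z + r * cis t - z0) <= c.
Proof.
 intros H1 H2. replace (z + r * cis t - z0)%C
  with (z - z0 + r * cis t)%C by ring.
 le_via Cmod_triangle. rewrite Cmod_mult, Cmod_cis, Cmod_R. lra.
Qed.

Definition circ_int (F : C -> C) (k : R -> C) (z : C) (r : R) : C :=
  CInt (fun t => (k t * F (z + r * cis t))%C) 0 (2 * PI).

Lemma circ_int_contR (D : C -> Prop) (F : C -> C) (k : R -> C) (z0 z : C) (c r t : R) :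
  (forall z, Cmod (z - z0) <= c -> D z) -> (forall z, D z -> ccont F z) ->
  Cmod (z - z0) <= c / 2 -> Rabs r <= c / 2 -> ccontR k t ->
  ccontR (fun t => (k t * F (z + r * cis t))%C) t.
Proof.
 intros HD HF Hz Hr Hk. apply ccontR_mult; trivial.
 eapply ccont_cder; [|apply (cder_circle z r t)]. apply HF, HD, circle_in_disc; trivial.
Qed.

(** Differentiation under the integral sign over a circle of fixed radius with moving centre;
    centres within [c / 2] keep all circles in the disc of radius [c], where differentiability of
    [F] is uniform. *)
Lemma hder_circ_int (D : C -> Prop) (F f : C -> C) (k : R -> C) (z0 : C) (c : R) :
  planar_open D -> 0 < c -> (forall z, D z -> hder F z (f z)) -> (forall z, D z -> ccont f z) ->
  (forall z, Cmod (z - z0) <= c -> D z) ->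
  (forall t, ccontR k t) -> (forall t, Cmod (k t) <= 1) ->
  forall z, Cmod (z - z0) < c / 2 ->
  hder (fun z => circ_int F k z (c / 2)) z (circ_int f k z (c / 2)).
Proof.
 intros HO Hc0 HF Hf HD Hk Hk1 z Hz eps He.
 assert (HcF : forall z, D z -> ccont F z). { intros w Hw. apply (hder_ccont F w (f w)), HF, Hw. }
 destruct (uniform_hder D F f z0 c HO HF Hf HD (eps / (4 * PI))) as [d [Hd Hb]].
 { pos. }
 exists (Rmin d (c / 2 - Cmod (z - z0))). split; [pos|]. intros h Hh.
 assert (Hr : Rabs (c / 2) <= c / 2) by lra.
 assert (Hzh : Cmod (z + h - z0) <= c / 2).
 { replace (z + h - z0)%C with (z - z0 + h)%C by ring.
  le_via Cmod_triangle. lra. }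
 set (w := fun t => (z + RtoC (c / 2) * cis t)%C).
 set (g := fun t => (k t * (F (w t + h) - F (w t) - f (w t) * h))%C).
 assert (K1 : forall t, ccontR (fun t => (k t * F (z + h + RtoC (c / 2) * cis t))%C) t).
 { intros t. apply (circ_int_contR D F k z0 (z + h)%C c); trivial. }
 assert (K2 : forall t, ccontR (fun t => (k t * F (w t))%C) t).
 { intros t. apply (circ_int_contR D F k z0 z c); trivial. lra. }
 assert (K3 : forall t, ccontR (fun t => (k t * f (w t))%C) t).
 { intros t. apply (circ_int_contR D f k z0 z c); trivial. lra. }
 assert (E : (circ_int F k (z + h) (c / 2)%R - circ_int F k z (c / 2)%R - circ_int f k z (c / 2)%R * h)%C
  = CInt g 0 (2 * PI)).
 { transitivity (CInt (fun t => (k t * F (z + h + RtoC (c / 2) * cis t) + ((-1)%R * (k t * F (w t)) + - h * (k t * f (w t))))%C) 0 (2 * PI)).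
  - rewrite CInt_plus, CInt_plus, !CInt_scal; trivial.
   + unfold circ_int, w. ring.
   + intros t _. apply ccontR_mult; [apply ccontR_const|pos].
   + intros t _. apply ccontR_mult; [apply ccontR_const|pos].
   + intros t _. apply ccontR_plus; apply ccontR_mult; try apply ccontR_const; [pos|pos].
  - apply CInt_ext. intros t _. unfold g.
   replace (z + h + RtoC (c / 2) * cis t)%C with (w t + h)%C by ceq. ring. }
 rewrite E. le_via (CInt_bound g 0 (2 * PI) (eps / (4 * PI) * Cmod h)).
 - intros t _. unfold g.
  assert (Kg : ccontR (fun t => (k t * F (z + h + RtoC (c / 2) * cis t) + ((-1)%R * (k t * F (w t)) + - h * (k t * f (w t))))%C) t).
  { apply ccontR_plus; [pos|]. apply ccontR_plus; apply ccontR_mult; try apply ccontR_const; [pos|pos]. }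
  destruct Kg as [G1 G2]. split; [eapply continuous_ext; [|exact G1]|eapply continuous_ext; [|exact G2]];
   intros s; cbv beta; f_equal;
   replace (z + h + RtoC (c / 2) * cis s)%C with (w s + h)%C by ceq; ring.
 - intros t _. unfold g. rewrite Cmod_mult.
  specialize (Hb (w t) h (circle_in_disc z z0 (c / 2) c t ltac:(lra) Hr) ltac:(lra)).
  specialize (Hk1 t). nra.
 - rewrite Rminus_0_r, (Rabs_right (2 * PI)) by lra. right. field. lra.
Qed.

Lemma ccont_circ_int (D : C -> Prop) (f : C -> C) (k : R -> C) (z0 : C) (c : R) :
  planar_open D -> 0 < c -> (forall z, D z -> ccont f z) ->
  (forall z, Cmod (z - z0) <= c -> D z) ->
  (forall t, ccontR k t) -> (forall t, Cmod (k t) <= 1) ->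
  forall z, Cmod (z - z0) < c / 2 -> ccont (fun z => circ_int f k z (c / 2)) z.
Proof.
 intros HO Hc0 Hf HD Hk Hk1 z Hz eps He.
 destruct (uniform_ccont D f z0 c HO Hf HD (eps / (8 * PI))) as [d [Hd Hb]].
 { pos. }
 exists (Rmin d (c / 2 - Cmod (z - z0))). split; [pos|]. intros w' Hw'.
 set (h := (w' - z)%C) in *.
 assert (Hr : Rabs (c / 2) <= c / 2) by lra.
 assert (Hzh : Cmod (w' - z0) <= c / 2).
 { replace (w' - z0)%C with (z - z0 + h)%C by ceq.
  le_via Cmod_triangle. lra. }
 set (w := fun t => (z + RtoC (c / 2) * cis t)%C).
 set (g := fun t => (k t * f (w' + RtoC (c / 2) * cis t) + (-1)%R * (k t * f (w t)))%C).
 assert (K1 : forall t, ccontR (fun t => (k t * f (w' + RtoC (c / 2) * cis t))%C) t).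
 { intros t. apply (circ_int_contR D f k z0 w' c); trivial. }
 assert (K2 : forall t, ccontR (fun t => (k t * f (w t))%C) t).
 { intros t. apply (circ_int_contR D f k z0 z c); trivial. lra. }
 assert (E : (circ_int f k w' (c / 2)%R - circ_int f k z (c / 2)%R)%C = CInt g 0 (2 * PI)).
 { unfold g. rewrite CInt_plus, CInt_scal; trivial.
  - unfold circ_int, w. ring.
  - intros t _. apply ccontR_mult; [apply ccontR_const|pos]. }
 rewrite E. lt_via (CInt_bound g 0 (2 * PI) (eps / (8 * PI))).
 - intros t _. apply ccontR_plus; [pos|]. apply ccontR_mult; [apply ccontR_const|pos].
 - intros t _. unfold g.
  replace (w' + RtoC (c / 2) * cis t)%C with (w t + h)%C by ceq.
  replace (k t * f (w t + h) + (-1)%R * (k t * f (w t)))%C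
   with (k t * (f (w t + h) - f (w t)))%C by ring.
  rewrite Cmod_mult.
  specialize (Hb (w t) h (circle_in_disc z z0 (c / 2) c t ltac:(lra) Hr) ltac:(lra)).
  specialize (Hk1 t). nra.
 - rewrite Rminus_0_r, (Rabs_right (2 * PI)) by lra. apply Rle_lt_trans with (eps / 2); [|lra]. right. field. lra.
Qed.

Lemma cder_cis_opp (t : R) : cder (fun t => cis (- t)) t (- Ci * cis (- t)%R)%C.
Proof. split; simpl; auto_derive; trivial; ring. Qed.

Lemma ccontR_cis (t : R) : ccontR cis t.
Proof. eapply cder_ccontR, cder_cis. Qed.

Lemma ccontR_cis_opp (t : R) : ccontR (fun t => cis (- t)) t.
Proof. eapply cder_ccontR, cder_cis_opp. Qed.

Lemma circle_in_disc' (z z0 : C) (r c : R) (t : R) : Cmod (z - z0) + Rabs r <= c ->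
  Cmod (z + r * cis t - z0) <= c.
Proof.
 intros H1. replace (z + r * cis t - z0)%C
  with (z - z0 + r * cis t)%C by ring.
 le_via Cmod_triangle. rewrite Cmod_mult, Cmod_cis, Cmod_R. lra.
Qed.

Section MeanValue.

Context (D : C -> Prop) (F f : C -> C) (z0 : C) (c : R).
Context (HO : planar_open D) (Hc0 : 0 < c) (HF : forall z, D z -> hder F z (f z))
  (Hf : forall z, D z -> ccont f z) (HD : forall z, Cmod (z - z0) <= c -> D z).

(** Up to the factor [r * Ci], the integrand is the derivative of [F] along the closed circle. The
    integral is also the radial derivative of the circle mean of [F], which is its use in
    [holomorphic_mean_value]. *)
Lemma circ_int_cis_zero (z : C) (r : R) : Cmod (z - z0) + Rabs r <= c -> circ_int f cis z r = 0.
Proof.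
 intros Hz.
 assert (Hw : forall t, D (z + r * cis t)%C) by (intros t; apply HD, circle_in_disc', Hz).
 assert (K : forall t, ccontR (fun t => (cis t * f (z + r * cis t))%C) t).
 { intros t. apply ccontR_mult; [apply ccontR_cis|].
  eapply ccont_cder; [|apply (cder_circle z r t)]. auto. }
 destruct (Req_dec r 0) as [->|Hr].
 - unfold circ_int. rewrite (CInt_ext _ (fun t => (f z * cis t)%C)).
  2:{ intros t _. replace (z + 0 * cis t)%C with z by ring. ring. }
  rewrite CInt_scal by (intros; apply ccontR_cis).
  rewrite (CInt_ftc (fun t => (- Ci * cis t)%C)).
  + rewrite cis_2PI, cis_0. ring.
  + intros t _. eapply cder_eq; [|apply cder_mult; [apply cder_const|apply cder_cis]]. ceq.
  + intros; apply ccontR_cis.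
 - assert (E : (r * Ci * circ_int f cis z r)%C = 0).
  { unfold circ_int. rewrite <- CInt_scal by easy.
   rewrite (CInt_ftc (fun t => F (z + r * cis t)%C)).
   - rewrite cis_2PI, cis_0. ring.
   - intros t _. eapply cder_eq; [|apply (hder_comp_curve F (fun t => (z + r * cis t)%C) t);
     [apply HF, Hw|apply cder_circle]]. ring.
   - intros t _. apply ccontR_mult; [apply ccontR_const|pos]. }
  destruct (Ceq_dec (circ_int f cis z r) 0) as [|Hn]; trivial. exfalso.
  revert E. apply Cmult_neq_0; trivial. apply Cmult_neq_0; [|apply Ci_nz].
  intros E. apply RtoC_inj in E. easy.
Qed.

(** The circle mean has zero derivative in the radius, so it equals its value at radius 0. *)
Lemma holomorphic_mean_value (z : C) : Cmod (z - z0) < c / 2 ->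
  circ_int F (fun _ => 1) z (c / 2) = (RtoC (2 * PI) * F z)%C.
Proof.
 intros Hz.
 assert (HcF : forall z, D z -> ccont F z). { intros w Hw. apply (hder_ccont F w (f w)), HF, Hw. }
 set (J := fun r => circ_int F (fun _ => 1) z r).
 assert (HJ : forall r, 0 <= r <= c / 2 -> cder J r 0).
 { intros r Hr. apply cder_eps. intros eps He.
  destruct (uniform_hder D F f z0 c HO HF Hf HD (eps / (4 * PI))) as [d [Hd Hb]].
  { pos. }
  exists (Rmin d (c / 2 - Cmod (z - z0))). split; [pos|]. intros k Hk.
  pose proof (Rmin_l d (c / 2 - Cmod (z - z0))). pose proof (Rmin_r d (c / 2 - Cmod (z - z0))).
  assert (R1 : Cmod (z - z0) + Rabs r <= c) by (rewrite (Rabs_right r); lra).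
  assert (R2 : Cmod (z - z0) + Rabs (r + k) <= c).
  { pose proof (Rabs_triang r k). rewrite (Rabs_right r) in H1 by lra. lra. }
  set (w := fun t => (z + r * cis t)%C).
  assert (K1 : forall t, ccontR (fun t => (1 * F (z + RtoC (r + k) * cis t))%C) t).
  { intros t. apply ccontR_mult; [apply ccontR_const|]. eapply ccont_cder; [|apply (cder_circle z (r + k) t)].
   apply HcF, HD, circle_in_disc', R2. }
  assert (K2 : forall t, ccontR (fun t => (1 * F (w t))%C) t).
  { intros t. apply ccontR_mult; [apply ccontR_const|]. eapply ccont_cder; [|apply (cder_circle z r t)].
   apply HcF, HD, circle_in_disc', R1. }
  assert (K3 : forall t, ccontR (fun t => (cis t * f (w t))%C) t).
  { intros t. apply ccontR_mult; [apply ccontR_cis|]. eapply ccont_cder; [|apply (cder_circle z r t)].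
   apply Hf, HD, circle_in_disc', R1. }
  set (g := fun t => (1 * F (z + RtoC (r + k) * cis t) + ((-1)%R * (1 * F (w t)) + - k * (cis t * f (w t))))%C).
  assert (E : (J (r + k)%R - J r - 0 * k)%C = CInt g 0 (2 * PI)).
  { unfold g. rewrite CInt_plus, CInt_plus, (CInt_scal (-1)), (CInt_scal (- k)%C); trivial.
   - change (CInt (fun t => (cis t * f (w t))%C) 0 (2 * PI)) with (circ_int f cis z r).
    rewrite circ_int_cis_zero by exact R1. unfold J, circ_int, w. ring.
   - intros t _. apply ccontR_mult; [apply ccontR_const|pos].
   - intros t _. apply ccontR_mult; [apply ccontR_const|pos].
   - intros t _. apply ccontR_plus; apply ccontR_mult; try apply ccontR_const; [pos|pos]. }
  rewrite E. le_via (CInt_bound g 0 (2 * PI) (eps / (4 * PI) * Rabs k)).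
  - intros t _. apply ccontR_plus; [pos|]. apply ccontR_plus; apply ccontR_mult; try apply ccontR_const; [pos|pos].
  - intros t _. unfold g.
   assert (Hh : Cmod (k * cis t) = Rabs k) by (rewrite Cmod_mult, Cmod_cis, Cmod_R; ring).
   specialize (Hb (w t) (k * cis t)%C (circle_in_disc' z z0 r c t R1) ltac:(lra)).
   rewrite Hh in Hb. eapply Rle_trans; [|exact Hb]. right. f_equal.
   replace (z + RtoC (r + k) * cis t)%C with (w t + k * cis t)%C
    by ceq. ring.
  - rewrite Rminus_0_r, (Rabs_right (2 * PI)) by lra. right. field. lra. }
 assert (E : J 0 = J (c / 2)).
 { apply injective_projections.
  - apply (eq_is_derive (V := R_NormedModule) (fun r => fst (J r)) 0 (c / 2)); [|lra].
   intros t Ht. apply (HJ t Ht).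
  - apply (eq_is_derive (V := R_NormedModule) (fun r => snd (J r)) 0 (c / 2)); [|lra].
   intros t Ht. apply (HJ t Ht). }
 rewrite <- E. unfold J, circ_int.
 rewrite (CInt_ext _ (fun _ => F z)).
 - rewrite CInt_const, Rminus_0_r. ring.
 - intros t _. replace (z + 0 * cis t)%C with z by ring. ring.
Qed.

(** Cauchy's formula for [F'] at the centre of a circle expresses [f] as an integral of [F] against
    [cis (- t)]. The centre enters only through [F], so the formula can be differentiated once more
    without a singular kernel. *)
Lemma derivative_of_holomorphic_local :
  exists f1, forall z, Cmod (z - z0) < c / 2 -> hder f z (f1 z) /\ ccont f1 z.
Proof.
 set (r := c / 2).
 set (k := fun t => cis (- t)). set (A := RtoC (/ (2 * PI * r))).
 assert (HcF : forall z, D z -> ccont F z). { intros w Hw. apply (hder_ccont F w (f w)), HF, Hw. }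
 assert (Hk : forall t, ccontR k t) by (intros; apply ccontR_cis_opp).
 assert (Hk1 : forall t, Cmod (k t) <= 1) by (intros; right; apply Cmod_cis).
 assert (H1 : forall t, ccontR (fun _ : R => RtoC 1) t) by (intros; apply ccontR_const).
 assert (H2 : forall t : R, Cmod ((fun _ => RtoC 1) t) <= 1) by (intros; right; apply Cmod_1).
 exists (fun z => (A * circ_int f k z r)%C).
 (* The mean value property of [F], differentiated in the centre, is the one of [f], although [f] is
    not yet known to be differentiable. *)
 assert (Mf : forall z, Cmod (z - z0) < r -> circ_int f (fun _ => 1) z r = (RtoC (2 * PI) * f z)%C).
 { intros z Hz. apply (hder_unique (fun z => circ_int F (fun _ => 1) z r) z).
  - apply (hder_circ_int D F f (fun _ => 1) z0 c); trivial.
  - apply (hder_ext_loc (fun z => (RtoC (2 * PI) * F z)%C)).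
   + exists (r - Cmod (z - z0)). split; [lra|]. symmetry. apply holomorphic_mean_value.
    pose proof (Cmod_minus_triangle w z z0). unfold r in *. lra.
   + eapply hder_eq; [|apply hder_mult; [apply hder_const|apply HF, HD; unfold r in Hz; lra]]. ceq. }
 assert (Ef : forall z, Cmod (z - z0) < r -> f z = (A * circ_int F k z r)%C).
 { intros z Hz.
  assert (Hz1 : Cmod (z - z0) <= c / 2) by (unfold r in Hz; lra).
  assert (Hr1 : Rabs r <= c / 2) by (unfold r; rewrite Rabs_right; lra).
  set (w := fun t => (z + r * cis t)%C).
  assert (K2 : forall t, ccontR (fun t => (k t * F (w t))%C) t).
  { intros t. apply (circ_int_contR D F k z0 z c); trivial. }
  assert (K3 : forall t, ccontR (fun t => (1 * f (w t))%C) t).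
  { intros t. apply (circ_int_contR D f (fun _ => 1) z0 z c); trivial. }
  (* Integration by parts: the integrand is the derivative of the periodic function
     [k t * F (w t)]. *)
  assert (E : CInt (fun t => (r * Ci * (1 * f (w t)) + - Ci * (k t * F (w t)))%C) 0 (2 * PI) = 0).
  { rewrite (CInt_ftc (fun t => (k t * F (w t))%C)).
   - unfold k, w. rewrite cis_2PI, cis_0, Ropp_0, cis_0.
    replace (cis (- (2 * PI))) with (RtoC 1); [ring|].
    unfold cis. rewrite cos_neg, sin_neg, cos_2PI, sin_2PI, Ropp_0. easy.
   - intros t _. eapply cder_eq; [|apply cder_mult; [apply cder_cis_opp|apply (hder_comp_curve F w t);
     [apply HF, HD, (circle_in_disc z z0 r c t); trivial|apply cder_circle]]].
    assert (E : (k t * cis t)%C = 1).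
    { unfold k. rewrite <- cis_add. replace (- t + t) with 0 by ring. apply cis_0. }
    transitivity (- Ci * k t * F (w t) + k t * cis t * (f (w t) * (r * Ci)))%C; [unfold k; ring|].
    rewrite E. ring.
   - intros t _. apply ccontR_plus; apply ccontR_mult; try apply ccontR_const; [pos|pos]. }
  rewrite CInt_plus, (CInt_scal (r * Ci)%C), (CInt_scal (- Ci)%C) in E; trivial;
   [|intros t _; apply ccontR_mult; [apply ccontR_const|pos]|intros t _; apply ccontR_mult; [apply ccontR_const|pos]].
  change (CInt (fun t => (1 * f (w t))%C) 0 (2 * PI)) with (circ_int f (fun _ => 1) z r) in E.
  change (CInt (fun t => (k t * F (w t))%C) 0 (2 * PI)) with (circ_int F k z r) in E.
  rewrite (Mf z Hz) in E.
  assert (E2 : circ_int F k z r = (RtoC (2 * PI * r) * f z)%C).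
  { apply NNPP. intros Hn. apply Cminus_eq_contra in Hn. revert E.
   replace (r * Ci * (RtoC (2 * PI) * f z) + - Ci * circ_int F k z r)%C
    with (- Ci * (circ_int F k z r - RtoC (2 * PI * r) * f z))%C.
   - apply Cmult_neq_0; trivial. intros Hi. apply Ci_nz. rewrite <- (Copp_0), <- Hi. ring.
   - rewrite (RtoC_mult (2 * PI) r). ring. }
  rewrite E2. ceq. }
 intros z Hz. split.
 - apply (hder_ext_loc (fun z => (A * circ_int F k z r)%C)).
  + exists (r - Cmod (z - z0)). split; [lra|]. symmetry. apply Ef.
   pose proof (Cmod_minus_triangle w z z0). lra.
  + eapply hder_eq; [|apply hder_mult; [apply hder_const|apply (hder_circ_int D F f k z0 c); trivial]].
   change (c / 2) with r. ceq.
 - intros eps He.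
  destruct (ccont_circ_int D f k z0 c HO Hc0 Hf HD Hk Hk1 z Hz (eps / (Cmod A + 1))) as [d [Hd Hb]].
  { pos. }
  exists d. split; trivial. intros w Hw. specialize (Hb w Hw). fold r in Hb.
  replace (A * circ_int f k w r - A * circ_int f k z r)%C
   with (A * (circ_int f k w r - circ_int f k z r))%C by ring.
  rewrite Cmod_mult.
  apply (Rmult_lt_compat_l (Cmod A + 1)) in Hb; [|lra].
  replace ((Cmod A + 1) * (eps / (Cmod A + 1))) with eps in Hb by (field; lra). nra.
Qed.

End MeanValue.

Lemma planar_open_disc (z0 : C) (r : R) : planar_open (fun w => Cmod (w - z0) < r).
Proof.
 intros z Hz. exists (r - Cmod (z - z0)). split; [lra|]. intros w Hw.
 pose proof (Cmod_minus_triangle w z z0). lra.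
Qed.

Lemma local_primitive (O : C -> Prop) (f : C -> C) (z0 : C) :
  planar_open O -> holomorphic_on O f -> O z0 ->
  exists F r, 0 < r /\ (forall z, Cmod (z - z0) <= r -> O z) /\
  forall z, Cmod (z - z0) <= r -> hder F z (f z).
Proof.
 intros HO Hf H0. destruct (HO z0 H0) as [r [Hr Hb]].
 set (D := fun z : C => Rabs (fst z - fst z0) < r / 2 /\ Rabs (snd z - snd z0) < r / 2).
 assert (HDO : forall z, D z -> O z).
 { intros z [H1 H2]. apply Hb. lt_via Cmod_le_sum. simpl.
  unfold Rminus in *. lra. }
 destruct (box_primitive D f) as [F HF].
 - intros z [H1 H2]. exists (Rmin (r / 2 - Rabs (fst z - fst z0)) (r / 2 - Rabs (snd z - snd z0))).
  split; [pos|]. intros w Hw.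
  pose proof (Re_le_Cmod (w - z)%C) as A1. pose proof (Im_le_Cmod (w - z)%C) as A2. simpl in A1, A2.
  split.
  + lra.
  + lra.
 - intros x1 y1 x2 y2 x y [A1 A2] [B1 B2] [Hx Hy]. simpl in *.
  split; simpl; apply Rabs_def1;
   unfold Rmin, Rmax in *; destruct (Rle_dec x1 x2), (Rle_dec y1 y2); lra.
 - exists z0. split; rewrite Rminus_diag, Rabs_R0; lra.
 - intros z Hz. apply C_differentiable_hder, Hf, HDO, Hz.
 - exists F, (r / 4). split; [lra|].
  assert (HD : forall z, Cmod (z - z0) <= r / 4 -> D z).
  { intros z Hz. pose proof (Re_le_Cmod (z - z0)%C) as A1. pose proof (Im_le_Cmod (z - z0)%C) as A2.
   simpl in A1, A2. split; unfold Rminus; lra. }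
  split; intros z Hz; [apply HDO, HD, Hz|apply HF, HD, Hz].
Qed.

(** Total by choice: the value is meaningful only where a derivative exists. *)
Definition Cderive (f : C -> C) (z : C) : C := epsilon (inhabits (RtoC 0)) (fun l => hder f z l).

Lemma Cderive_spec (f : C -> C) (z : C) : (exists l, hder f z l) -> hder f z (Cderive f z).
Proof. intros H. unfold Cderive. apply epsilon_spec. exact H. Qed.

Lemma Cderive_eq (f : C -> C) (z l : C) : hder f z l -> Cderive f z = l.
Proof. intros H. apply (hder_unique f z); trivial. apply Cderive_spec. eauto. Qed.

Lemma holomorphic_hder (O : C -> Prop) (f : C -> C) (z : C) :
  holomorphic_on O f -> O z -> hder f z (Cderive f z).
Proof. intros Hf Hz. apply Cderive_spec, C_differentiable_hder, Hf, Hz. Qed.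

Lemma holomorphic_ccont (O : C -> Prop) (f : C -> C) (z : C) :
  holomorphic_on O f -> O z -> ccont f z.
Proof. intros Hf Hz. apply (hder_ccont f z _ (holomorphic_hder O f z Hf Hz)). Qed.

(** The local result is applied twice on shrinking discs: to a primitive and [f], which gives a
    continuous derivative [f1] of [f], and then to [f] and [f1], which differentiates [f1]. *)
Lemma holomorphic_Cderive (O : C -> Prop) (f : C -> C) :
  planar_open O -> holomorphic_on O f -> holomorphic_on O (Cderive f).
Proof.
 intros HO Hf z0 H0. apply C_differentiable_hder.
 destruct (local_primitive O f z0 HO Hf H0) as [F [r [Hr [HrO HF]]]].
 destruct (derivative_of_holomorphic_local (fun w => Cmod (w - z0) < r) F f z0 (r / 2)) as [f1 Hf1].
 - apply planar_open_disc.
 - lra.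
 - intros z Hz. apply HF. lra.
 - intros z Hz. apply (holomorphic_ccont O); trivial. apply HrO. lra.
 - intros z Hz. lra.
 - destruct (derivative_of_holomorphic_local (fun w => Cmod (w - z0) < r / 2 / 2) f f1 z0 (r / 8)) as [f2 Hf2].
  + apply planar_open_disc.
  + lra.
  + intros z Hz. apply Hf1, Hz.
  + intros z Hz. apply Hf1, Hz.
  + intros z Hz. lra.
  + exists (f2 z0). apply (hder_ext_loc f1).
   * exists (r / 4). split; [lra|]. symmetry. apply Cderive_eq. apply Hf1. lra.
   * apply Hf2. replace (z0 - z0)%C with (RtoC 0) by ring. rewrite Cmod_0. lra.
Qed.

(** * Maximum principle and gradient bound *)

Definition jet (f : R -> R) (x a b : R) : Prop :=
  exists f' : R -> R, (exists r, 0 < r /\ forall t, Rabs (t - x) < r -> is_derive f t (f' t)) /\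
  f' x = a /\ is_derive f' x b.

(** Only the pure second derivatives are recorded: they determine the Laplacian and can be computed
    in one variable at a time. *)
Definition zjet (f : C -> R) (z : C) (a1 a2 b1 b2 : R) : Prop :=
  jet (fun x => f (x, snd z)) (fst z) a1 b1 /\ jet (fun y => f (fst z, y)) (snd z) a2 b2.

Lemma is_derive_cont_eps (g : R -> R) (t l : R) : is_derive g t l ->
  forall eps, 0 < eps -> exists d, 0 < d /\ forall s, Rabs (s - t) < d -> Rabs (g s - g t) < eps.
Proof.
 intros H eps He. apply is_derive_cont, continuity_pt_filterlim in H.
 destruct (H eps He) as [d [Hd Hb]]. exists d. split; trivial. intros s Hs.
 destruct (Req_dec s t) as [->|Hn]; [lra|].
 apply (Hb s). easy.
Qed.

Lemma jet_is_derive (f : R -> R) (x a b : R) : jet f x a b -> is_derive f x a.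
Proof. intros [f' [[r [Hr H]] [E _]]]. rewrite <- E. apply H. lra. Qed.

Lemma jet_plus (f g : R -> R) (x a b c d : R) :
  jet f x a b -> jet g x c d -> jet (fun t => f t + g t) x (a + c) (b + d).
Proof.
 intros [f' [[r [Hr H]] [E K]]] [g' [[s [Hs H2]] [E2 K2]]].
 exists (fun t => f' t + g' t). split; [|split].
 - exists (Rmin r s). split; [pos|]. intros t Ht.
  apply (is_derive_plus f g); [apply H|apply H2]; eapply Rlt_le_trans; try exact Ht; [lra|lra].
 - lra.
 - apply (is_derive_plus f' g'); trivial.
Qed.

Lemma jet_scal (k : R) (f : R -> R) (x a b : R) : jet f x a b -> jet (fun t => k * f t) x (k * a) (k * b).
Proof.
 intros [f' [[r [Hr H]] [E K]]].
 exists (fun t => k * f' t). split; [|split].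
 - exists r. split; trivial. intros t Ht. apply (is_derive_scal f), H, Ht.
 - nra.
 - apply (is_derive_scal f'), K.
Qed.

Lemma jet_const (k x : R) : jet (fun _ => k) x 0 0.
Proof.
 exists (fun _ => 0). split; [|split; [lra|]].
 - exists 1. split; [lra|]. intros t _. auto_derive; trivial.
 - auto_derive; trivial.
Qed.

Lemma jet_eq (f : R -> R) (x a b c d : R) : a = c -> b = d -> jet f x a b -> jet f x c d.
Proof. intros -> ->. trivial. Qed.

Lemma jet_ext_loc (f g : R -> R) (x a b : R) :
  (exists r, 0 < r /\ forall t, Rabs (t - x) < r -> f t = g t) -> jet f x a b -> jet g x a b.
Proof.
 intros [s [Hs E]] [f' [[r [Hr H]] K]]. exists f'. split; trivial.
 exists (Rmin r s). split; [pos|]. intros t Ht.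
 pose proof (Rlt_min_l Ht) as H1.
 apply (is_derive_ext_loc f); [|apply H, H1].
 assert (Hp : 0 < s - Rabs (t - x)) by lra.
 exists (mkposreal _ Hp). intros y Hy. apply E. unfold ball in Hy; simpl in Hy. unfold AbsRing_ball, abs, minus, plus, opp in Hy; simpl in Hy.
 lra.
Qed.

Lemma jet_comp (G f : R -> R) (x a b g1 g2 : R) :
  jet f x a b -> jet G (f x) g1 g2 -> jet (fun t => G (f t)) x (g1 * a) (g2 * (a * a) + g1 * b).
Proof.
 intros [f' [[r [Hr H]] [E K]]] [G' [[s [Hs H2]] [E2 K2]]].
 assert (Hfx : is_derive f x (f' x)) by (apply H; rewrite Rminus_diag, Rabs_R0; exact Hr).
 destruct (is_derive_cont_eps f x _ Hfx s Hs) as [d [Hd Hb]].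
 exists (fun t => G' (f t) * f' t). split; [|split].
 - exists (Rmin r d). split; [pos|]. intros t Ht.
  pose proof (Rlt_min_l Ht) as T1. pose proof (Rlt_min_r Ht) as T2.
  rewrite Rmult_comm. apply (is_derive_comp G f); [apply H2, Hb, T2|apply H, T1].
 - nra.
 - replace (g2 * (a * a) + g1 * b) with ((f' x * g2) * f' x + G' (f x) * b) by nra.
  apply (Derive.is_derive_mult (fun t => G' (f t)) f'); [|pos].
  apply (is_derive_comp G' f); trivial.
Qed.

(** If [b > 0], the first derivative has a strict sign on the right of [x] when [a >= 0] and on the
    left when [a < 0], so [f] exceeds [f x] on that side. *)
Lemma jet_local_max (f : R -> R) (x a b : R) : jet f x a b ->
  (exists r, 0 < r /\ forall t, Rabs (t - x) < r -> f t <= f x) -> b <= 0.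
Proof.
 intros [f' [[r [Hr H]] [E K]]] [s [Hs Hmax]]. apply Rnot_lt_le. intros Hb.
 rewrite is_derive_eps in K. destruct (K (b / 2)) as [d [Hd Hk]]; [lra|].
 set (h := Rmin (Rmin r s) d / 2).
 assert (Hh : 0 < h) by (unfold h; pose proof (Rmin_pos _ _ (Rmin_pos _ _ Hr Hs) Hd); lra).
 assert (h < r /\ h < s /\ h < d) as [H1 [H2 H3]].
 { unfold h. lra. }
 assert (Hq : forall k, Rabs k <= h -> Rabs (f' (x + k) - a - b * k) <= b / 2 * Rabs k).
 { intros k Hk'. rewrite <- E. apply Hk. lra. }
 destruct (Rle_dec 0 a) as [Ha|Ha].
 - destruct (MVT_cor2 f f' x (x + h)) as [c [Hc1 Hc2]]; [lra| |].
  + intros c Hc. apply is_derive_Reals, H. lra.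
  + specialize (Hq (c - x)). replace (x + (c - x)) with c in Hq by ring.
   rewrite Rabs_right in Hq by lra. specialize (Hq ltac:(lra)).
   specialize (Hmax (x + h)).
   specialize (Hmax ltac:(lra)).
   assert (0 < b / 2 * (c - x)) by pos. nra.
 - destruct (MVT_cor2 f f' (x - h) x) as [c [Hc1 Hc2]]; [lra| |].
  + intros c Hc. apply is_derive_Reals, H. lra.
  + specialize (Hq (c - x)). replace (x + (c - x)) with c in Hq by ring.
   rewrite Rabs_left in Hq by lra. specialize (Hq ltac:(lra)).
   specialize (Hmax (x - h)). rewrite Rabs_left in Hmax by lra. nra.
Qed.

Lemma zjet_plus (f g : C -> R) (z : C) (a1 a2 b1 b2 c1 c2 d1 d2 : R) :
  zjet f z a1 a2 b1 b2 -> zjet g z c1 c2 d1 d2 ->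
  zjet (fun w => f w + g w) z (a1 + c1) (a2 + c2) (b1 + d1) (b2 + d2).
Proof.
 intros [H1 H2] [H3 H4]. split;
  [apply (jet_plus (fun x => f (x, snd z)) (fun x => g (x, snd z)))
  |apply (jet_plus (fun y => f (fst z, y)) (fun y => g (fst z, y)))]; trivial.
Qed.

Lemma zjet_scal (k : R) (f : C -> R) (z : C) (a1 a2 b1 b2 : R) :
  zjet f z a1 a2 b1 b2 -> zjet (fun w => k * f w) z (k * a1) (k * a2) (k * b1) (k * b2).
Proof.
 intros [H1 H2]. split; [apply (jet_scal k (fun x => f (x, snd z)))|apply (jet_scal k (fun y => f (fst z, y)))]; trivial.
Qed.

Lemma zjet_comp (G : R -> R) (f : C -> R) (z : C) (a1 a2 b1 b2 g1 g2 : R) :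
  zjet f z a1 a2 b1 b2 -> jet G (f z) g1 g2 ->
  zjet (fun w => G (f w)) z (g1 * a1) (g1 * a2) (g2 * (a1 * a1) + g1 * b1) (g2 * (a2 * a2) + g1 * b2).
Proof.
 intros [H1 H2] HG. destruct z as [x y]. split; simpl in *.
 - apply (jet_comp G (fun x => f (x, y))); trivial.
 - apply (jet_comp G (fun y => f (x, y))); trivial.
Qed.

Lemma zjet_const (k : R) (z : C) : zjet (fun _ => k) z 0 0 0 0.
Proof. split; apply jet_const. Qed.

Lemma zjet_eq (f : C -> R) (z : C) (a1 a2 b1 b2 c1 c2 d1 d2 : R) :
  a1 = c1 -> a2 = c2 -> b1 = d1 -> b2 = d2 -> zjet f z a1 a2 b1 b2 -> zjet f z c1 c2 d1 d2.
Proof. intros -> -> -> ->. trivial. Qed.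

Lemma Cmod_horiz (t x y : R) : Cmod ((t, y) - (x, y))%C = Rabs (t - x).
Proof.
 unfold Cmod; simpl. replace ((t + - x) * ((t + - x) * 1) + (y + - y) * ((y + - y) * 1)) with (Rsqr (t - x)) by (unfold Rsqr; ring).
 apply sqrt_Rsqr_abs.
Qed.

Lemma Cmod_vert (t x y : R) : Cmod ((x, t) - (x, y))%C = Rabs (t - y).
Proof.
 unfold Cmod; simpl. replace ((x + - x) * ((x + - x) * 1) + (t + - y) * ((t + - y) * 1)) with (Rsqr (t - y)) by (unfold Rsqr; ring).
 apply sqrt_Rsqr_abs.
Qed.

Lemma zjet_ext_loc (f g : C -> R) (z : C) (a1 a2 b1 b2 : R) :
  (exists r, 0 < r /\ forall w, Cmod (w - z) < r -> f w = g w) -> zjet f z a1 a2 b1 b2 -> zjet g z a1 a2 b1 b2.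
Proof.
 intros [r [Hr E]] [H1 H2]. destruct z as [x y]; simpl in *. split; simpl.
 - apply (jet_ext_loc (fun x => f (x, y))); trivial. exists r. split; trivial. intros t Ht. apply E. rewrite Cmod_horiz. easy.
 - apply (jet_ext_loc (fun y => f (x, y))); trivial. exists r. split; trivial. intros t Ht. apply E. rewrite Cmod_vert. lra.
Qed.

Lemma rcont_continuous (f : C -> R) (z : C) : rcont f z <-> continuous f z.
Proof.
 split.
 - intros H P [[eps He] HP]. destruct (H eps He) as [d [Hd Hb]]. exists (mkposreal (d / 2) (Rdiv_lt_0_compat _ _ Hd Rlt_0_2)).
  intros w [H1 H2]. apply HP, Hb. lt_via Cmod_le_sum.
  change (Rabs (fst w - fst z) < d / 2) in H1. change (Rabs (snd w - snd z) < d / 2) in H2. change (Rabs (fst w - fst z) + Rabs (snd w - snd z) < d). lra.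
 - intros H eps He. destruct (H (fun y => Rabs (y - f z) < eps)) as [d Hd]; [exists (mkposreal eps He); easy|].
  exists d. split; [apply d|]. intros w Hw. apply Hd. split; (eapply Rle_lt_trans; [|exact Hw]); [apply (Re_le_Cmod (w - z)%C)|apply (Im_le_Cmod (w - z)%C)].
Qed.

Lemma rcont_plus (f g : C -> R) (z : C) : rcont f z -> rcont g z -> rcont (fun w => f w + g w) z.
Proof. rewrite !rcont_continuous. apply (continuous_plus f g). Qed.

Lemma rcont_mult (f g : C -> R) (z : C) : rcont f z -> rcont g z -> rcont (fun w => f w * g w) z.
Proof. rewrite !rcont_continuous. apply (continuous_mult f g). Qed.

Lemma rcont_comp (G : R -> R) (f : C -> R) (z : C) : rcont f z -> continuous G (f z) -> rcont (fun w => G (f w)) z.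
Proof. rewrite !rcont_continuous. apply continuous_comp. Qed.

Lemma rcont_const (k : R) (z : C) : rcont (fun _ => k) z.
Proof. apply rcont_continuous, continuous_const. Qed.

Lemma rcont_scal (k : R) (f : C -> R) (z : C) : rcont f z -> rcont (fun w => k * f w) z.
Proof. apply rcont_mult, rcont_const. Qed.

Lemma rcont_fst (z : C) : rcont (fun w => fst w) z.
Proof.
 intros eps He. exists eps. split; trivial. intros w Hw. eapply Rle_lt_trans; [|exact Hw].
 apply (Re_le_Cmod (w - z)%C).
Qed.

Lemma rcont_snd (z : C) : rcont (fun w => snd w) z.
Proof.
 intros eps He. exists eps. split; trivial. intros w Hw. eapply Rle_lt_trans; [|exact Hw].
 apply (Im_le_Cmod (w - z)%C).
Qed.

Lemma ccont_Cmod (f : C -> C) (z : C) : ccont f z -> rcont (fun w => Cmod (f w)) z.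
Proof.
 intros Hf eps He. destruct (Hf eps He) as [d [Hd Hb]]. exists d. split; trivial. intros w Hw.
 eapply Rle_lt_trans; [|apply (Hb w Hw)].
 pose proof (Cmod_triangle_inv (f w) (f z)). pose proof (Cmod_triangle_inv (f z) (f w)).
 rewrite (Cmod_minus_sym (f z)) in H0. lra.
Qed.

(** A positive value would lead to an attained maximum, where both pure second derivatives are at
    most 0. The Laplacian is tested only where [phi] is positive, which is the form that comparison
    of two metrics needs. *)
Lemma max_principle (O : C -> Prop) (phi : C -> R) :
  planar_open O -> bounded_set O ->
  (forall z, O z -> rcont phi z) ->
  (forall b, boundary O b -> forall eps, 0 < eps -> exists delta, 0 < delta /\
  forall z, O z -> Cmod (z - b) < delta -> phi z < eps) ->
  (forall z, O z -> 0 < phi z -> exists a1 a2 b1 b2, zjet phi z a1 a2 b1 b2 /\ 0 < b1 + b2) ->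
  forall z, O z -> phi z <= 0.
Proof.
 intros HO [M HM] Hc Hbd Hlap z1 Hz1. apply Rnot_lt_le. intros Hpos.
 assert (Hmax : exists zs, O zs /\ phi z1 <= phi zs /\ forall z, O z -> phi z <= phi zs).
 { apply NNPP. intros Hno.
  (* Without a maximum every point is strictly exceeded by another; compactness of a closed disc
     containing [O] then produces one point of [O] that strictly exceeds all of [O], including
     itself. *)
  assert (Hbig : forall z, O z -> exists z', O z' /\ phi z1 <= phi z' /\ phi z < phi z').
  { intros z Hz. apply NNPP. intros Hn.
   assert (Hz' : forall z', O z' -> phi z1 <= phi z' -> phi z' <= phi z).
   { intros z' Hz' Hle. apply Rnot_lt_le. intros Hlt. eauto. }
   apply Hno. exists z. split; trivial. split; [apply Hz'; trivial; lra|].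
   intros z' Hz''. destruct (Rle_dec (phi z1) (phi z')); [apply Hz'; trivial|].
   pose proof (Hz' z1 Hz1 (Rle_refl _)). lra. }
  set (P := fun A : C -> Prop => exists zs, O zs /\ phi z1 <= phi zs /\ forall z, A z -> O z -> phi z < phi zs).
  assert (H : P (fun z => Cmod (z - 0) <= M)).
  { apply (disc_compactness P).
   - intros A B HAB [zs [K1 [K2 K3]]]. exists zs. auto.
   - intros A B [zs [K1 [K2 K3]]] [zt [L1 [L2 L3]]].
    destruct (Rle_dec (phi zs) (phi zt)) as [Hle|Hle].
    + exists zt. split; trivial. split; trivial. intros z [Hz|Hz] HOz; [specialize (K3 z Hz HOz); lra|auto].
    + exists zs. split; trivial. split; trivial. intros z [Hz|Hz] HOz; [auto|specialize (L3 z Hz HOz); lra].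
   - exists z1. easy.
   - intros z _. destruct (classic (O z)) as [HOz|HOz].
    + destruct (Hbig z HOz) as [z' [K1 [K2 K3]]].
     destruct (Hc z HOz (phi z' - phi z)) as [d [Hd Hb]]; [lra|].
     exists d. split; trivial. exists z'. split; trivial. split; trivial.
     intros w Hw _. specialize (Hb w Hw). lra.
    + destruct (classic (boundary O z)) as [HB|HB].
     * destruct (Hbd z HB (phi z1) Hpos) as [d [Hd Hb]]. exists d. split; trivial.
      exists z1. split; trivial. split; [lra|]. auto.
     * assert (Hr : exists r, 0 < r /\ forall w, O w -> ~ Cmod (w - z) < r).
      { apply NNPP. intros Hn. apply HB. split; trivial. intros r Hr. apply NNPP. intros Hn2.
       apply Hn. exists r. split; trivial. eauto. }
      destruct Hr as [r [Hr Hfree]]. exists r. split; trivial.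
      exists z1. split; trivial. split; [lra|]. intros w Hw HOw. exfalso. apply (Hfree w HOw Hw). }
  destruct H as [zs [K1 [K2 K3]]]. specialize (K3 zs).
  replace (zs - 0)%C with zs in K3 by ring. specialize (K3 (HM zs K1) K1). lra. }
 destruct Hmax as [zs [K1 [K2 K3]]].
 destruct (Hlap zs K1 ltac:(lra)) as [a1 [a2 [b1 [b2 [[J1 J2] Hb]]]]].
 destruct (HO zs K1) as [r [Hr Hball]]. destruct zs as [x y].
 assert (b1 <= 0).
 { apply (jet_local_max _ _ _ _ J1). exists r. split; trivial. intros t Ht. apply K3, Hball. rewrite Cmod_horiz. pos. }
 assert (b2 <= 0).
 { apply (jet_local_max _ _ _ _ J2). exists r. split; trivial. intros t Ht. apply K3, Hball. rewrite Cmod_vert. pos. }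
 lra.
Qed.

Lemma ln_Cmod (z : C) : z <> 0 -> ln (Cmod z) = / 2 * ln (fst z * fst z + snd z * snd z).
Proof.
 intros Hz. apply Cmod_gt_0 in Hz. rewrite <- Cmod_sqr, ln_mult by trivial. field.
Qed.

Lemma is_derive_ln_Cmod (c : R -> C) (t : R) (c' : C) : cder c t c' -> c t <> 0 ->
  is_derive (fun t => ln (Cmod (c t))) t (fst (c' / c t)%C).
Proof.
 intros [H1 H2] Hn.
 assert (Hp : 0 < fst (c t) * fst (c t) + snd (c t) * snd (c t)).
 { rewrite <- Cmod_sqr. apply Cmod_gt_0 in Hn. nra. }
 assert (Hq : is_derive (fun s => fst (c s) * fst (c s) + snd (c s) * snd (c s)) t
  ((fst c' * fst (c t) + fst (c t) * fst c') + (snd c' * snd (c t) + snd (c t) * snd c'))).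
 { apply (is_derive_plus (fun s => fst (c s) * fst (c s)) (fun s => snd (c s) * snd (c s)));
   apply Derive.is_derive_mult; trivial. }
 assert (Hl : is_derive (fun s => / 2 * ln (fst (c s) * fst (c s) + snd (c s) * snd (c s))) t (fst (c' / c t)%C)).
 { replace (fst (c' / c t)%C) with (/ 2 * (((fst c' * fst (c t) + fst (c t) * fst c') + (snd c' * snd (c t) + snd (c t) * snd c'))
   * / (fst (c t) * fst (c t) + snd (c t) * snd (c t)))).
  - apply (is_derive_scal (fun s => ln (fst (c s) * fst (c s) + snd (c s) * snd (c s)))).
   apply (is_derive_comp ln (fun s => fst (c s) * fst (c s) + snd (c s) * snd (c s))); trivial. auto_derive; [pos|lra].
  - unfold Cdiv, Cmult, Cinv; simpl. field. lra. }
 eapply is_derive_ext_loc; [|exact Hl].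
 destruct (is_derive_cont_eps _ _ _ Hq _ Hp) as [d [Hd Hb]].
 exists (mkposreal d Hd). intros s Hs.
 specialize (Hb s Hs).
 symmetry. apply ln_Cmod. intros E. rewrite E in Hb. simpl in Hb. lra.
Qed.

(** With [psi] the logarithmic derivative of [h], the Cauchy-Riemann equations give the gradient of
    [ln |h|] as the conjugate of [psi]; the second derivatives are opposite, so the function is
    harmonic. *)
Lemma zjet_ln_Cmod (h psi : C -> C) (z psi' : C) :
  (exists r, 0 < r /\ forall w, Cmod (w - z) < r -> h w <> 0 /\ hder h w (psi w * h w)%C) ->
  hder psi z psi' ->
  zjet (fun w => ln (Cmod (h w))) z (fst (psi z)) (- snd (psi z)) (fst psi') (- fst psi').
Proof.
 intros [r [Hr Hh]] Hpsi. destruct z as [x y]. split; simpl.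
 - exists (fun t => fst (psi (t, y))). split; [|split; [lra|]].
  + exists r. split; trivial. intros t Ht.
   destruct (Hh (t, y)) as [Hn Hd]; [rewrite Cmod_horiz; exact Ht|].
   replace (fst (psi (t, y))) with (fst ((psi (t, y)) * (h (t, y)) / (h (t, y)))%C).
   * apply (is_derive_ln_Cmod (fun t => h (t, y))); trivial.
    eapply cder_eq; [|apply (hder_comp_curve h (fun t => (t, y)) t _ _ Hd (cder_horiz t y))]. ring.
   * f_equal. field; pos.
  + assert (Hc := hder_comp_curve psi (fun t => (t, y)) x _ _ Hpsi (cder_horiz x y)).
   destruct Hc as [Hc _]. simpl in Hc. replace (fst psi' * 1 - snd psi' * 0) with (fst psi') in Hc by ring. easy.
 - exists (fun t => - snd (psi (x, t))). split; [|split; [lra|]].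
  + exists r. split; trivial. intros t Ht.
   destruct (Hh (x, t)) as [Hn Hd]; [rewrite Cmod_vert; exact Ht|].
   replace (- snd (psi (x, t))) with (fst ((psi (x, t)) * (h (x, t)) * Ci / (h (x, t)))%C).
   * apply (is_derive_ln_Cmod (fun t => h (x, t))); trivial.
    apply (hder_comp_curve h (fun t => (x, t)) t _ _ Hd (cder_vert x t)).
   * replace ((psi (x, t)) * (h (x, t)) * Ci / (h (x, t)))%C with ((psi (x, t)) * Ci)%C by (field; pos).
    simpl. ring.
  + assert (Hc := hder_comp_curve psi (fun t => (x, t)) y _ _ Hpsi (cder_vert x y)).
   destruct Hc as [_ Hc]. replace (- fst psi') with (- (fst psi' * 1 + snd psi' * 0)) by ring.
   apply (is_derive_opp (fun t => snd (psi (x, t)))). pos.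
Qed.

Lemma rcont_ln_Cmod (h : C -> C) (z : C) : ccont h z -> h z <> 0 -> rcont (fun w => ln (Cmod (h w))) z.
Proof.
 intros Hh Hn. apply (rcont_comp ln (fun w => Cmod (h w))).
 - apply ccont_Cmod, Hh.
 - apply Cmod_gt_0 in Hn. apply (is_derive_cont _ _ (/ Cmod (h z))), is_derive_Reals, derivable_pt_lim_ln, Hn.
Qed.

Lemma jet_poly2 (c0 c1 c2 x : R) : jet (fun t => c0 + c1 * t + c2 * (t * t)) x (c1 + 2 * c2 * x) (2 * c2).
Proof.
 exists (fun t => c1 + 2 * c2 * t). split; [|split; [lra|]].
 - exists 1. split; [lra|]. intros t _. auto_derive; trivial; ring.
 - auto_derive; trivial; ring.
Qed.

Lemma jet_reflect (f : R -> R) (m x a b : R) : jet f (m - x) a b -> jet (fun t => f (m - t)) x (- a) b.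
Proof.
 intros H. eapply jet_eq; [| |apply (jet_comp f (fun t => m - t) x (-1) 0 a b)].
 - ring.
 - ring.
 - eapply jet_eq; [| |apply (jet_ext_loc (fun t => m + -1 * t + 0 * (t * t)) (fun t => m - t)); [|apply jet_poly2]].
  + ring.
  + ring.
  + exists 1. split; [lra|]. intros t _. ring.
 - exact H.
Qed.

Lemma rcont_reflect (f : C -> R) (m : R) (z : C) : rcont f (m - fst z, snd z) -> rcont (fun w => f (m - fst w, snd w)) z.
Proof.
 intros H eps He. destruct (H eps He) as [d [Hd Hb]]. exists d. split; trivial. intros w Hw.
 apply Hb. eapply Rle_lt_trans; [|exact Hw]. right. unfold Cmod; simpl. f_equal. ring.
Qed.

Lemma rcont_le_0_boundary (phi : C -> R) (b : C) : rcont phi b -> phi b <= 0 ->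
  forall eps, 0 < eps -> exists delta, 0 < delta /\ forall z, Cmod (z - b) < delta -> phi z < eps.
Proof.
 intros Hc Hb eps He. destruct (Hc eps He) as [d [Hd H]]. exists d. split; trivial. intros z Hz.
 specialize (H z Hz). lra.
Qed.

(* Odd reflection in x and a quadratic barrier on the half square (Gilbarg-Trudinger, section 3.4). *)
Lemma gradient_bound_aux (d : C -> R) (x0 y0 r M N : R) : 0 < r -> 0 <= M -> 0 < N ->
  (forall x y, Rabs (x - x0) <= r -> Rabs (y - y0) <= r -> rcont d (x, y) /\ Rabs (d (x, y)) <= M /\
  exists a1 a2 b1 b2, zjet d (x, y) a1 a2 b1 b2 /\ Rabs (b1 + b2) <= N) ->
  forall l : R, is_derive (fun x : R => d (x, y0)) x0 l -> l <= 2 * M / r + N * r.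
Proof.
 intros Hr HM HN Hd l Hl.
 set (O := fun z : C => 0 < fst z - x0 < r /\ Rabs (snd z - y0) < r).
 (* The barrier has Laplacian [- 2 * N], is nonnegative on the side [fst z = x0] and at least [M] on
    the three others; its slope at the centre is [2 * M / r + N * r], which is the bound. *)
 set (B := fun z : C => M / (r * r) * ((snd z - y0) * (snd z - y0) + 2 * r * (fst z - x0) - (fst z - x0) * (fst z - x0))
  + N * ((fst z - x0) * (r - (fst z - x0)))).
 set (phi := fun z : C => (/ 2 * d z + (- / 2) * d (2 * x0 - fst z, snd z)) + (-1) * B z).
 assert (HrB : forall z, rcont B z).
 { intros z.
  assert (C1 : rcont (fun z : C => fst z - x0) z). { apply (rcont_plus (fun z => fst z) (fun _ => - x0)); [apply rcont_fst|apply rcont_const]. }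
  assert (C2 : rcont (fun z : C => snd z - y0) z). { apply (rcont_plus (fun z => snd z) (fun _ => - y0)); [apply rcont_snd|apply rcont_const]. }
  apply rcont_plus; apply rcont_scal.
  - apply (rcont_plus (fun z : C => (snd z - y0) * (snd z - y0) + 2 * r * (fst z - x0)) (fun z : C => - ((fst z - x0) * (fst z - x0)))).
   + apply rcont_plus; [apply rcont_mult; trivial|apply (rcont_scal (2 * r)); trivial].
   + apply (rcont_comp (fun t => - (t * t)) (fun z : C => fst z - x0)); trivial.
    apply (is_derive_cont _ _ (- (2 * (fst z - x0)))). auto_derive; trivial; ring.
  - apply rcont_mult; trivial. apply (rcont_comp (fun t => r - t) (fun z : C => fst z - x0)); trivial.
   apply (is_derive_cont _ _ (-1)). auto_derive; trivial; ring. }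
 assert (Hcl : forall x y, 0 <= x - x0 <= r -> Rabs (y - y0) <= r ->
  rcont phi (x, y) /\ Rabs (/ 2 * d (x, y) + (- / 2) * d (2 * x0 - x, y)) <= M).
 { intros x y Hx Hy.
  destruct (Hd x y ltac:(lra) Hy) as [A1 [A2 _]].
  destruct (Hd (2 * x0 - x) y ltac:(lra) Hy) as [A3 [A4 _]].
  split.
  - apply rcont_plus; [apply rcont_plus|]; apply rcont_scal; trivial.
   apply (rcont_reflect d (2 * x0) (x, y)). pos.
  - lra. }
 assert (Hmp : forall z, O z -> phi z <= 0).
 { apply max_principle.
  - intros z [H1 H2]. exists (Rmin (Rmin (fst z - x0) (r - (fst z - x0))) (r - Rabs (snd z - y0))).
   split; [pos|]. intros w Hw.
   pose proof (Rlt_min_l Hw) as W1.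
   pose proof (Re_le_Cmod (w - z)%C) as A1. pose proof (Im_le_Cmod (w - z)%C) as A2. simpl in A1, A2.
   split; [lra|].
   lra.
  - exists (Rabs x0 + r + (Rabs y0 + r)). intros z [H1 H2]. le_via Cmod_le_sum.
   apply Rplus_le_compat.
   + lra.
   + lra.
  - intros [x y] [H1 H2]. simpl in *. apply Hcl; lra.
  - intros [x y] [Hn Hlim] eps He.
   assert (Hin : 0 <= x - x0 <= r /\ Rabs (y - y0) <= r).
   { split; [split|].
    - apply Rnot_lt_le. intros Hlt. destruct (Hlim (x0 - x)) as [w [[W1 W2] W3]]; [lra|].
     pose proof (Re_le_Cmod (w - (x, y))%C) as A1. simpl in A1. lra.
    - apply Rnot_lt_le. intros Hlt. destruct (Hlim (x - x0 - r)) as [w [[W1 W2] W3]]; [lra|].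
     pose proof (Re_le_Cmod (w - (x, y))%C) as A1. simpl in A1. lra.
    - apply Rnot_lt_le. intros Hlt. destruct (Hlim (Rabs (y - y0) - r)) as [w [[W1 W2] W3]]; [lra|].
     pose proof (Im_le_Cmod (w - (x, y))%C) as A1. simpl in A1.
     assert (Rabs (y - y0) <= Rabs (snd w + - y) + Rabs (snd w - y0)).
     { lra. }
     lra. }
   destruct Hin as [Hx Hy]. destruct (Hcl x y Hx Hy) as [Hc HM'].
   destruct (rcont_le_0_boundary phi (x, y) Hc) with (eps := eps) as [dl [Hdl Hb]]; trivial.
   2:{ eauto. }
   unfold phi, B; simpl.
   assert (Hq : 0 <= M / (r * r)) by pos.
   assert (HNx : 0 <= N * ((x - x0) * (r - (x - x0)))).
   { pos. }
   pose proof (Rle_0_sqr (y - y0)) as Hyy. unfold Rsqr in Hyy.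
   destruct (Req_dec (x - x0) 0) as [Ex|Ex].
   + replace (2 * x0 - x) with x by lra. nra.
   + assert (HMM : M / (r * r) * (r * r) = M) by (field; lra).
    assert (Hge : r * r <= (y - y0) * (y - y0) + 2 * r * (x - x0) - (x - x0) * (x - x0)).
    { destruct (Req_dec (x - x0) r) as [Er|Er]; [nra|].
     assert (Ey : Rabs (y - y0) = r).
     { apply Rle_antisym; trivial. apply Rnot_lt_le. intros Hlt. apply Hn. split; simpl; lra. }
     assert (Ey2 : (y - y0) * (y - y0) = r * r). { rewrite <- Ey. unfold Rabs; destruct Rcase_abs; ring. }
     nra. }
    nra.
  - intros [x y] [H1 H2] Hpos. simpl in *.
   destruct (Hd x y ltac:(lra) ltac:(lra)) as [_ [_ [a1 [a2 [b1 [b2 [[J1 J2] HL1]]]]]]].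
   destruct (Hd (2 * x0 - x) y ltac:(lra) ltac:(lra)) as [_ [_ [c1 [c2 [e1 [e2 [[J3 J4] HL2]]]]]]].
   assert (JB : zjet B (x, y) (M / (r * r) * (2 * r - 2 * (x - x0)) + N * (r - 2 * (x - x0)))
    (M / (r * r) * (2 * (y - y0))) (- 2 * (M / (r * r)) - 2 * N) (2 * (M / (r * r)))).
   { split; simpl.
    - eapply jet_eq; [| |apply (jet_ext_loc (fun t => (M / (r * r) * ((y - y0) * (y - y0) - 2 * r * x0 - x0 * x0) + N * (- x0 * r - x0 * x0))
      + (M / (r * r) * (2 * r + 2 * x0) + N * (r + 2 * x0)) * t + (- (M / (r * r)) - N) * (t * t))); [|apply jet_poly2]].
     + ring.
     + ring.
     + exists 1. split; [lra|]. intros t _. unfold B; simpl. ring.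
    - eapply jet_eq; [| |apply (jet_ext_loc (fun t => (M / (r * r) * (y0 * y0 + 2 * r * (x - x0) - (x - x0) * (x - x0)) + N * ((x - x0) * (r - (x - x0))))
      + (M / (r * r) * (- 2 * y0)) * t + (M / (r * r)) * (t * t))); [|apply jet_poly2]].
     + ring.
     + ring.
     + exists 1. split; [lra|]. intros t _. unfold B; simpl. ring. }
   assert (JR : zjet (fun w => d (2 * x0 - fst w, snd w)) (x, y) (- c1) c2 e1 e2).
   { split; simpl; [apply (jet_reflect (fun t => d (t, y))); exact J3|pos]. }
   do 4 eexists. split.
   + apply zjet_plus; [apply zjet_plus|]; apply zjet_scal; [split; [exact J1|exact J2]|exact JR|exact JB].
   + lra. }
 apply Rnot_lt_le. intros Hlt. set (K := 2 * M / r + N * r) in *.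
 pose proof (proj1 (is_derive_eps (fun x : R => d (x, y0)) x0 l) Hl) as Hl'. destruct (Hl' ((l - K) / 2)) as [dl [Hdl Hb]]; [lra|].
 set (h := Rmin r dl / 2).
 assert (Hh : 0 < h /\ h < r /\ h < dl).
 { unfold h. pos. }
 assert (HOh : O (x0 + h, y0)).
 { split; simpl; [lra|]. lra. }
 specialize (Hmp _ HOh). unfold phi, B in Hmp; simpl in Hmp.
 replace (x0 + h - x0) with h in Hmp by ring. replace (y0 - y0) with 0 in Hmp by ring.
 replace (2 * x0 - (x0 + h)) with (x0 + - h) in Hmp by ring.
 pose proof (Hb h ltac:(lra)) as B1. pose proof (Hb (- h) ltac:(lra)) as B2.
 rewrite (Rabs_right h) in B1 by lra. rewrite (Rabs_left (- h)) in B2 by lra.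
 assert (E : M / (r * r) * (0 * 0 + 2 * r * h - h * h) + N * (h * (r - h)) <= K * h).
 { assert (Hq : 0 <= M / (r * r)) by pos.
  unfold K. replace ((2 * M / r + N * r) * h) with (M / (r * r) * (2 * r * h) + N * (h * r)) by (field; lra).
  nra. }
 nra.
Qed.

Lemma gradient_bound_x (d : C -> R) (x0 y0 r M N : R) : 0 < r -> 0 <= M -> 0 < N ->
  (forall x y, Rabs (x - x0) <= r -> Rabs (y - y0) <= r -> rcont d (x, y) /\ Rabs (d (x, y)) <= M /\
  exists a1 a2 b1 b2, zjet d (x, y) a1 a2 b1 b2 /\ Rabs (b1 + b2) <= N) ->
  forall l : R, is_derive (fun x : R => d (x, y0)) x0 l -> Rabs l <= 2 * M / r + N * r.
Proof.
 intros Hr HM HN Hd l Hl. apply Rabs_le. split; [|apply (gradient_bound_aux d x0 y0 r M N); trivial].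
 apply Ropp_le_cancel. rewrite Ropp_involutive.
 apply (gradient_bound_aux (fun z => -1 * d z) x0 y0 r M N); trivial.
 - intros x y Hx Hy. destruct (Hd x y Hx Hy) as [H1 [H2 [a1 [a2 [b1 [b2 [H3 H4]]]]]]].
  split; [apply rcont_scal, H1|]. split.
  + lra.
  + do 4 eexists. split; [apply zjet_scal, H3|]. lra.
 - replace (- l) with (-1 * l) by ring. apply (is_derive_scal (fun x => d (x, y0))). pos.
Qed.

Lemma rcont_swap (d : C -> R) (x y : R) : rcont d (x, y) -> rcont (fun z => d (snd z, fst z)) (y, x).
Proof.
 intros H eps He. destruct (H eps He) as [r [Hr Hb]]. exists r. split; trivial. intros w Hw.
 apply Hb. eapply Rle_lt_trans; [|exact Hw]. right. unfold Cmod; simpl. f_equal. ring.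
Qed.

Lemma gradient_bound_y (d : C -> R) (x0 y0 r M N : R) : 0 < r -> 0 <= M -> 0 < N ->
  (forall x y, Rabs (x - x0) <= r -> Rabs (y - y0) <= r -> rcont d (x, y) /\ Rabs (d (x, y)) <= M /\
  exists a1 a2 b1 b2, zjet d (x, y) a1 a2 b1 b2 /\ Rabs (b1 + b2) <= N) ->
  forall l : R, is_derive (fun y : R => d (x0, y)) y0 l -> Rabs l <= 2 * M / r + N * r.
Proof.
 intros Hr HM HN Hd l Hl.
 apply (gradient_bound_x (fun z => d (snd z, fst z)) y0 x0 r M N); trivial.
 intros y x Hy Hx. destruct (Hd x y Hx Hy) as [H1 [H2 [a1 [a2 [b1 [b2 [[J1 J2] H4]]]]]]].
 split; [apply rcont_swap, H1|]. split; [pos|].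
 exists a2, a1, b2, b1. pos.
Qed.

(** * The strip metric of an annular domain *)

Lemma C2_on_zjet (O : C -> Prop) (u : C -> R) (z : C) : planar_open O -> C2_on O u -> O z ->
  zjet u z (Defs.d1 u z) (Defs.d2 u z) (Defs.d1 (Defs.d1 u) z) (Defs.d2 (Defs.d2 u) z).
Proof.
 intros HO Hu Hz. destruct (HO z Hz) as [r [Hr Hb]]. destruct z as [x y]. split; simpl.
 - exists (fun t => Defs.d1 u (t, y)). split; [|split; [lra|]].
  + exists r. split; trivial. intros t Ht. apply Derive_correct.
   apply (proj1 (Hu (t, y) (Hb (t, y) ltac:(rewrite Cmod_horiz; exact Ht)))).
  + apply Derive_correct. destruct (Hu (x, y) Hz) as [_ [_ [H _]]]. exact H.
 - exists (fun t => Defs.d2 u (x, t)). split; [|split; [lra|]].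
  + exists r. split; trivial. intros t Ht. apply Derive_correct.
   apply (proj1 (proj2 (Hu (x, t) (Hb (x, t) ltac:(rewrite Cmod_vert; exact Ht))))).
  + apply Derive_correct. destruct (Hu (x, y) Hz) as [_ [_ [_ [_ [_ [H _]]]]]]. exact H.
Qed.

Lemma C2_on_rcont (O : C -> Prop) (u : C -> R) (z : C) : C2_on O u -> O z -> rcont u z.
Proof. intros Hu Hz. apply rcont_continuous. apply (Hu z Hz). Qed.

Definition logder (f : C -> C) (z : C) : C := (Cderive f z / f z)%C.

Definition height (f : C -> C) (z : C) : R := - ln (Cmod (f z)).

(* The metric that f pulls back from the complete hyperbolic metric of the strip e < x < e + PI / a
   in the coordinate -log; for e = 0 and a = PI / - ln beta this is the metric of the annulus. *)
Definition strip_metric (f : C -> C) (a e : R) (z : C) : R :=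
  - ln (sin (a * (height f z - e)) / a) + ln (Cmod (logder f z)).

(** The second derivative equals [exp (2 s)] for the profile [s = - ln (sin (a * (t - e)) / a)]: a
    solution of the equation in one variable, infinite at both ends of the strip. *)
Lemma jet_strip_profile (a e t : R) : 0 < a -> 0 < a * (t - e) < PI ->
  jet (fun t => - ln (sin (a * (t - e)) / a)) t
  (- (a * cos (a * (t - e)) / sin (a * (t - e)))) (a * a / (sin (a * (t - e)) * sin (a * (t - e)))).
Proof.
 intros Ha Ht.
 exists (fun t => - (a * cos (a * (t - e)) / sin (a * (t - e)))).
 assert (Hs : 0 < sin (a * (t - e))) by (apply sin_gt_0; lra).
 assert (Hc : exists r, 0 < r /\ forall s, Rabs (s - t) < r -> 0 < sin (a * (s - e))).
 { assert (Hd : is_derive (fun s => sin (a * (s - e))) t (a * cos (a * (t - e)))) by (auto_derive; trivial; unfold Rminus; ring).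
  destruct (is_derive_cont_eps _ _ _ Hd _ Hs) as [d [Hd1 Hb]]. exists d. split; trivial.
  intros s H. specialize (Hb s H). lra. }
 destruct Hc as [r [Hr Hc]].
 split; [|split; [lra|]].
 - exists r. split; trivial. intros s H. specialize (Hc s H). auto_derive.
  + pos.
  + change (s + - e) with (s - e). field. lra.
 - auto_derive.
  + pos.
  + change (t + - e) with (t - e). pose proof (sin2_cos2 (a * (t - e))) as E. unfold Rsqr in E.
   apply (Rmult_eq_reg_r (sin (a * (t - e)) * sin (a * (t - e)))); [|nra]. field_simplify; [|lra|lra].
   nra.
Qed.

Section AnnularDomain.

Context (beta : R) (Omega : C -> Prop) (f g : C -> C).
Context (Hbeta : 0 < beta < 1) (HO : planar_open Omega)
  (Hf : holomorphic_on Omega f) (Hg : holomorphic_on (annulus beta) g)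
  (HfA : forall z, Omega z -> annulus beta (f z)) (HgO : forall w, annulus beta w -> Omega (g w))
  (Hgf : forall z, Omega z -> g (f z) = z) (Hfg : forall w, annulus beta w -> f (g w) = w).

Lemma annular_neq_0 (z : C) : Omega z -> f z <> 0.
Proof. intros Hz. apply Cmod_gt_0. destruct (HfA z Hz). lra. Qed.

Lemma annular_Cderive_neq_0 (z : C) : Omega z -> Cderive f z <> 0.
Proof.
 intros Hz E.
 assert (H1 : hder (fun w => g (f w)) z (Cderive g (f z) * Cderive f z)%C).
 { apply hder_comp; [apply (holomorphic_hder (annulus beta)); auto|apply (holomorphic_hder Omega); trivial]. }
 assert (H2 : hder (fun w => g (f w)) z 1).
 { apply (hder_ext_loc (fun w => w)); [|apply hder_id]. destruct (HO z Hz) as [r [Hr Hb]].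
  exists r. split; trivial. symmetry. auto. }
 pose proof (hder_unique _ _ _ _ H1 H2) as E2. rewrite E in E2.
 replace (Cderive g (f z) * 0)%C with (RtoC 0) in E2 by ring. apply RtoC_inj in E2. lra.
Qed.

Lemma logder_neq_0 (z : C) : Omega z -> logder f z <> 0.
Proof.
 intros Hz. apply Cmult_neq_0; [apply annular_Cderive_neq_0, Hz|].
 intros E. apply (C1_nz). rewrite <- (Cinv_r (f z) (annular_neq_0 z Hz)), E. ring.
Qed.

Lemma logder_holomorphic : holomorphic_on Omega (logder f).
Proof.
 intros z Hz. apply C_differentiable_hder. eexists. apply hder_div.
 - apply annular_neq_0, Hz.
 - apply (holomorphic_hder Omega); trivial. apply holomorphic_Cderive; trivial.
 - apply (holomorphic_hder Omega); trivial.
Qed.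

Lemma height_range (z : C) : Omega z -> 0 < height f z < - ln beta.
Proof.
 intros Hz. destruct (HfA z Hz) as [H1 H2]. unfold height.
 pose proof (ln_increasing beta (Cmod (f z)) ltac:(lra) H1).
 pose proof (ln_increasing (Cmod (f z)) 1 ltac:(lra) H2). rewrite ln_1 in H0. lra.
Qed.

Lemma zjet_height (z : C) : Omega z ->
  zjet (height f) z (- fst (logder f z)) (snd (logder f z))
  (- fst (Cderive (logder f) z)) (fst (Cderive (logder f) z)).
Proof.
 intros Hz. eapply zjet_eq; [| | | |apply (zjet_ext_loc (fun w => -1 * ln (Cmod (f w))))].
 5:{ exists 1. split; [lra|]. intros w _. unfold height. ring. }
 5:{ apply zjet_scal. apply (zjet_ln_Cmod f (logder f) z (Cderive (logder f) z)).
  - destruct (HO z Hz) as [r [Hr Hb]]. exists r. split; trivial. intros w Hw. split.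
   + apply annular_neq_0, Hb, Hw.
   + eapply hder_eq; [|apply (holomorphic_hder Omega f w Hf (Hb w Hw))].
    unfold logder. field. apply annular_neq_0, Hb, Hw.
  - apply (holomorphic_hder Omega); trivial. apply logder_holomorphic. }
 all: ring.
Qed.

Lemma zjet_ln_logder (z : C) : Omega z ->
  zjet (fun w => ln (Cmod (logder f w))) z (fst (logder (logder f) z)) (- snd (logder (logder f) z))
  (fst (Cderive (logder (logder f)) z)) (- fst (Cderive (logder (logder f)) z)).
Proof.
 intros Hz. apply (zjet_ln_Cmod (logder f) (logder (logder f))).
 - destruct (HO z Hz) as [r [Hr Hb]]. exists r. split; trivial. intros w Hw. split.
  + apply logder_neq_0, Hb, Hw.
  + eapply hder_eq; [|apply (holomorphic_hder Omega (logder f) w logder_holomorphic (Hb w Hw))].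
   unfold logder at 2. field. apply logder_neq_0, Hb, Hw.
 - apply Cderive_spec. eexists. apply hder_div.
  + apply logder_neq_0, Hz.
  + apply (holomorphic_hder Omega); trivial. apply holomorphic_Cderive; trivial. apply logder_holomorphic.
  + apply (holomorphic_hder Omega); trivial. apply logder_holomorphic.
Qed.

Lemma rcont_height (z : C) : Omega z -> rcont (height f) z.
Proof.
 intros Hz. intros eps He.
 destruct (rcont_scal (-1) _ z (rcont_ln_Cmod f z (holomorphic_ccont Omega f z Hf Hz) (annular_neq_0 z Hz)) eps He) as [d [Hd Hb]].
 exists d. split; trivial. intros w Hw. specialize (Hb w Hw). unfold height. lra.
Qed.

Lemma strip_metric_zjet (a e : R) (z : C) : Omega z -> 0 < a -> 0 < a * (height f z - e) < PI ->
  exists b1 b2, zjet (strip_metric f a e) z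
  (a * cos (a * (height f z - e)) / sin (a * (height f z - e)) * fst (logder f z) + fst (logder (logder f) z))
  (- (a * cos (a * (height f z - e)) / sin (a * (height f z - e)) * snd (logder f z) + snd (logder (logder f) z)))
  b1 b2 /\ b1 + b2 = exp (2 * strip_metric f a e z).
Proof.
 intros Hz Ha Ht.
 pose proof (zjet_comp _ _ _ _ _ _ _ _ _ (zjet_height z Hz) (jet_strip_profile a e (height f z) Ha Ht)) as J1.
 pose proof (zjet_plus _ _ _ _ _ _ _ _ _ _ _ J1 (zjet_ln_logder z Hz)) as J.
 assert (Hs : 0 < sin (a * (height f z - e))) by (apply sin_gt_0; lra).
 assert (Hp : 0 < Cmod (logder f z)) by (apply Cmod_gt_0, logder_neq_0, Hz).
 do 2 eexists. split.
 - eapply zjet_eq; [| | | |exact J].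
  + lra.
  + lra.
  + reflexivity.
  + reflexivity.
 - unfold strip_metric.
  assert (E : exp (2 * (- ln (sin (a * (height f z - e)) / a) + ln (Cmod (logder f z)))) =
   (a * a / (sin (a * (height f z - e)) * sin (a * (height f z - e)))) * (Cmod (logder f z) * Cmod (logder f z))).
  { assert (E1 : exp (- ln (sin (a * (height f z - e)) / a)) = a / sin (a * (height f z - e))).
   { rewrite exp_Ropp, exp_ln by pos. field. lra. }
   replace (2 * (- ln (sin (a * (height f z - e)) / a) + ln (Cmod (logder f z)))) with
    ((- ln (sin (a * (height f z - e)) / a) + ln (Cmod (logder f z))) + (- ln (sin (a * (height f z - e)) / a) + ln (Cmod (logder f z)))) by ring.
   rewrite !exp_plus, E1, exp_ln by trivial. field. lra. }
  rewrite E, Cmod_sqr. lra.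
Qed.

Lemma strip_metric_rcont (a e : R) (z : C) : Omega z -> 0 < a -> 0 < a * (height f z - e) < PI ->
  rcont (strip_metric f a e) z.
Proof.
 intros Hz Ha Ht. apply rcont_plus.
 - apply (rcont_comp (fun t => - ln (sin (a * (t - e)) / a)) (height f)); [apply rcont_height, Hz|].
  eapply is_derive_cont, jet_is_derive, jet_strip_profile; trivial.
 - apply rcont_ln_Cmod; [|apply logder_neq_0, Hz]. apply (holomorphic_ccont Omega); trivial. apply logder_holomorphic.
Qed.

(** A compact core of the annulus is mapped by [g] to a set at positive distance from the complement
    of [Omega]. The contrapositive, [annular_boundary], replaces the boundary behaviour of [f]: near
    the boundary [|f|] is near [beta] or [1]. *)
Lemma annular_core (e : R) : 0 < e -> exists d, 0 < d /\ forall z, Omega z ->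
  beta + e <= Cmod (f z) <= 1 - e -> forall z', Cmod (z' - z) < d -> Omega z'.
Proof.
 intros He.
 set (P := fun A : C -> Prop => exists d, 0 < d /\ forall w, A w -> beta + e <= Cmod w <= 1 - e ->
  forall z', Cmod (z' - g w) < d -> Omega z').
 assert (H : P (fun w => Cmod (w - 0) <= 1)).
 { apply (disc_compactness P).
  - intros A B HAB [d [Hd Hb]]. exists d. eauto.
  - intros A B [d [Hd Hb]] [d' [Hd' Hb']]. exists (Rmin d d'). split; [pos|].
   intros w [Hw|Hw] Hr z' Hz'; [apply (Hb w)|apply (Hb' w)]; trivial; lra.
  - exists 1. pos.
  - intros w _. destruct (classic (annulus beta w)) as [Hw|Hw].
   + destruct (HO (g w) (HgO w Hw)) as [r [Hr Hb]].
    destruct (holomorphic_ccont _ g w Hg Hw (r / 2)) as [d [Hd Hc]]; [lra|].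
    exists d. split; trivial. exists (r / 2). split; [lra|]. intros w' Hw' _ z' Hz'.
    apply Hb. specialize (Hc w' Hw'). pose proof (Cmod_minus_triangle z' (g w') (g w)). lra.
   + exists e. split; trivial. exists 1. split; [lra|]. intros w' Hw' Hr. exfalso. apply Hw.
    pose proof (Cmod_triangle_inv w' w). pose proof (Cmod_triangle_inv w w').
    rewrite (Cmod_minus_sym w w') in H0. split; lra. }
 destruct H as [d [Hd Hb]]. exists d. split; trivial. intros z Hz Hr z' Hz'.
 apply (Hb (f z)); trivial.
 - replace (f z - 0)%C with (f z) by ring. lra.
 - rewrite Hgf; trivial.
Qed.

Lemma annular_boundary (b : C) (e : R) : boundary Omega b -> 0 < e ->
  exists d, 0 < d /\ forall z, Omega z -> Cmod (z - b) < d -> Cmod (f z) < beta + e \/ 1 - e < Cmod (f z).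
Proof.
 intros [Hb _] He. destruct (annular_core e He) as [d [Hd H]]. exists d. split; trivial.
 intros z Hz Hzb. destruct (Rlt_dec (Cmod (f z)) (beta + e)); [lra|].
 destruct (Rlt_dec (1 - e) (Cmod (f z))); [lra|]. exfalso. apply Hb.
 apply (H z Hz ltac:(lra)). rewrite Cmod_minus_sym. lra.
Qed.

End AnnularDomain.

(** * Upper bound for Liouville solutions *)

Definition dot (z w : C) : R := fst z * fst w + snd z * snd w.

(* For |n|^2 = 1 - 2 k K these are exact solutions of v Lap(v) = |grad v|^2 - 1. *)
Definition quad (c n : C) (k K : R) (z : C) : R :=
  K + dot (z - c)%C n - k / 2 * dot (z - c)%C (z - c)%C.

Lemma zjet_quad (c n : C) (k K : R) (z : C) :
  zjet (quad c n k K) z (fst n - k * (fst z - fst c)) (snd n - k * (snd z - snd c)) (- k) (- k).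
Proof.
 destruct z as [x y]. split; simpl.
 - eapply jet_eq; [| |apply (jet_ext_loc (fun t => (K - fst c * fst n + (y - snd c) * snd n - k / 2 * (fst c * fst c + (y - snd c) * (y - snd c)))
   + (fst n + k * fst c) * t + (- k / 2) * (t * t))); [|apply jet_poly2]].
  + field.
  + field.
  + exists 1. split; [lra|]. intros t _. unfold quad, dot; simpl. field.
 - eapply jet_eq; [| |apply (jet_ext_loc (fun t => (K - snd c * snd n + (x - fst c) * fst n - k / 2 * (snd c * snd c + (x - fst c) * (x - fst c)))
   + (snd n + k * snd c) * t + (- k / 2) * (t * t))); [|apply jet_poly2]].
  + field.
  + field.
  + exists 1. split; [lra|]. intros t _. unfold quad, dot; simpl. field.
Qed.

Lemma rcont_quad (c n : C) (k K : R) (z : C) : rcont (quad c n k K) z.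
Proof.
 assert (C1 : rcont (fun z : C => fst z + - fst c) z) by (apply rcont_plus; [apply rcont_fst|apply rcont_const]).
 assert (C2 : rcont (fun z : C => snd z + - snd c) z) by (apply rcont_plus; [apply rcont_snd|apply rcont_const]).
 intros eps He.
 destruct (rcont_plus _ _ z (rcont_plus _ _ z (rcont_const K z) (rcont_plus _ _ z (rcont_scal (fst n) _ z C1) (rcont_scal (snd n) _ z C2)))
  (rcont_scal (- k / 2) _ z (rcont_plus _ _ z (rcont_mult _ _ z C1 C1) (rcont_mult _ _ z C2 C2))) eps He) as [d [Hd Hb]].
 exists d. split; trivial. intros w Hw. eapply Rle_lt_trans; [|apply (Hb w Hw)].
 right. f_equal. unfold quad, dot; simpl. field.
Qed.

Lemma jet_neg_ln (t : R) : 0 < t -> jet (fun t => - ln t) t (- / t) (/ (t * t)).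
Proof.
 exists (fun t => - / t). split; [|split; [lra|]].
 - exists t. split; trivial. intros s Hs. auto_derive; [lra|]. lra.
 - auto_derive; [lra|]. lra.
Qed.

(** Translates the equation [v Lap v = |grad v|^2 - 1] into Liouville's equation for [- ln v]. *)
Lemma zjet_neg_ln (v : C -> R) (z : C) (a1 a2 b1 b2 : R) :
  zjet v z a1 a2 b1 b2 -> 0 < v z -> v z * (b1 + b2) = a1 * a1 + a2 * a2 - 1 ->
  exists c1 c2, zjet (fun w => - ln (v w)) z (- a1 / v z) (- a2 / v z) c1 c2 /\
  c1 + c2 = exp (2 * - ln (v z)).
Proof.
 intros J Hv E. pose proof (zjet_comp _ _ _ _ _ _ _ _ _ J (jet_neg_ln (v z) Hv)) as J1.
 do 2 eexists. split.
 - eapply zjet_eq; [| | | |exact J1]; try reflexivity; field; lra.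
 - replace (2 * - ln (v z)) with (- ln (v z) + - ln (v z)) by ring.
  rewrite exp_plus, exp_Ropp, exp_ln by trivial.
  apply (Rmult_eq_reg_r (v z * v z)); [|nra]. field_simplify; [|lra|lra]. nra.
Qed.

Lemma quad_metric_zjet (c n : C) (k K : R) (z : C) : dot n n = 1 - 2 * k * K -> 0 < quad c n k K z ->
  exists c1 c2, zjet (fun w => - ln (quad c n k K w)) z
  (- (fst n - k * (fst z - fst c)) / quad c n k K z) (- (snd n - k * (snd z - snd c)) / quad c n k K z) c1 c2 /\
  c1 + c2 = exp (2 * - ln (quad c n k K z)).
Proof.
 intros E Hp. apply (zjet_neg_ln _ _ _ _ _ _ (zjet_quad c n k K z) Hp).
 unfold quad, dot in *; simpl. nra.
Qed.

Lemma rcont_neg_ln (v : C -> R) (z : C) : rcont v z -> 0 < v z -> rcont (fun w => - ln (v w)) z.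
Proof.
 intros Hv Hp. apply (rcont_comp (fun t => - ln t) v z Hv).
 eapply is_derive_cont, jet_is_derive, jet_neg_ln, Hp.
Qed.

(** The complete hyperbolic metric of a disc: by [ball_quad] its density is
    [2 rho / (rho^2 - |z - c|^2)]. *)
Definition ball_metric (c : C) (rho : R) (z : C) : R := - ln (quad c 0 (/ rho) (rho / 2) z).

Lemma ball_quad (c : C) (rho : R) (z : C) : 0 < rho ->
  quad c 0 (/ rho) (rho / 2) z = (rho * rho - Cmod (z - c) * Cmod (z - c)) / (2 * rho).
Proof. intros HR. rewrite Cmod_sqr. unfold quad, dot; simpl. field. lra. Qed.

Lemma ball_quad_pos (c : C) (rho : R) (z : C) : 0 < rho -> Cmod (z - c) < rho -> 0 < quad c 0 (/ rho) (rho / 2) z.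
Proof.
 intros HR Hz. rewrite ball_quad by trivial.
 apply Rdiv_lt_0_compat; nra.
Qed.

Definition liouville_at (s : C -> R) (z : C) : Prop :=
  rcont s z /\ exists a1 a2 b1 b2, zjet s z a1 a2 b1 b2 /\ b1 + b2 = exp (2 * s z).

Lemma ball_metric_liouville (c : C) (rho : R) (z : C) : 0 < rho -> Cmod (z - c) < rho ->
  liouville_at (ball_metric c rho) z.
Proof.
 intros HR Hz. pose proof (ball_quad_pos c rho z HR Hz) as Hp. split.
 - apply rcont_neg_ln; trivial. apply rcont_quad.
 - destruct (quad_metric_zjet c 0 (/ rho) (rho / 2) z) as [c1 [c2 [J E]]]; trivial.
  + unfold dot; simpl. field; pos.
  + do 4 eexists. eauto.
Qed.

Lemma boundary_closed_limit (O : C -> Prop) (phi : C -> R) (b : C) (k : R) :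
  boundary O b -> rcont phi b -> (forall z, O z -> phi z <= k) -> phi b <= k.
Proof.
 intros [_ Hl] Hc H. apply Rnot_lt_le. intros Hlt. destruct (Hc (phi b - k)) as [d [Hd Hb]]; [lra|].
 destruct (Hl d Hd) as [z [Hz Hzb]]. specialize (Hb z Hzb). specialize (H z Hz). lra.
Qed.

Lemma boundary_closed_limit_ge (O : C -> Prop) (phi : C -> R) (b : C) (k : R) :
  boundary O b -> rcont phi b -> (forall z, O z -> k <= phi z) -> k <= phi b.
Proof.
 intros [_ Hl] Hc H. apply Rnot_lt_le. intros Hlt. destruct (Hc (k - phi b)) as [d [Hd Hb]]; [lra|].
 destruct (Hl d Hd) as [z [Hz Hzb]]. specialize (Hb z Hzb). specialize (H z Hz). lra.
Qed.

Lemma rcont_dist (c z : C) : rcont (fun w => Cmod (w - c)) z.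
Proof.
 apply (ccont_Cmod (fun w => (w - c)%C)). apply (hder_ccont _ _ (1 + 0)%C).
 apply hder_plus; [apply hder_id|apply hder_const].
Qed.

Lemma neg_ln_blowup (v : C -> R) (b : C) (O : C -> Prop) (M : R) :
  rcont v b -> v b = 0 -> (forall z, O z -> 0 < v z) ->
  exists d, 0 < d /\ forall z, O z -> Cmod (z - b) < d -> M < - ln (v z).
Proof.
 intros Hc E Hp. destruct (Hc (exp (- M)) (exp_pos _)) as [d [Hd Hb]]. exists d. split; trivial.
 intros z Hz Hzb. specialize (Hb z Hzb).
 assert (Hl : ln (v z) < ln (exp (- M))) by (apply ln_increasing; [apply Hp, Hz|lra]).
 rewrite ln_exp in Hl. lra.
Qed.

(** Comparison with the disc of half the radius: there [s] stays finite up to the boundary circle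
    while the disc metric is infinite. Halving the radius turns the central value [ln (2 / rho)]
    into [ln (4 / rho)]. *)
Lemma liouville_le_ball (s : C -> R) (c : C) (rho : R) : 0 < rho ->
  (forall z, Cmod (z - c) < rho -> liouville_at s z) -> s c <= ln (4 / rho).
Proof.
 intros HR Hs. set (r := rho / 2).
 assert (Hr : 0 < r) by (unfold r; lra).
 set (O := fun z => Cmod (z - c) < r).
 assert (H : forall z, O z -> s z + -1 * ball_metric c r z <= 0).
 { apply max_principle.
  - apply planar_open_disc.
  - exists (Cmod c + r). intros z Hz. pose proof (Cmod_triangle_inv z c). unfold O in Hz. lra.
  - intros z Hz. apply rcont_plus; [apply Hs; unfold O, r in Hz; lra|apply rcont_scal].
   apply ball_metric_liouville; trivial.
  - intros b Hb eps He.
   assert (Hb1 : Cmod (b - c) <= r).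
   { apply (boundary_closed_limit O (fun z => Cmod (z - c))); trivial; [apply rcont_dist|].
    intros z Hz. left. pos. }
   assert (Hb2 : Cmod (b - c) = r).
   { apply Rle_antisym; trivial. apply Rnot_lt_le. intros Hlt. apply (proj1 Hb). pos. }
   destruct (proj1 (Hs b ltac:(unfold r in *; lra)) 1 Rlt_0_1) as [d1 [Hd1 Hc1]].
   destruct (neg_ln_blowup (quad c 0 (/ r) (r / 2)) b O (s b + 1)) as [d2 [Hd2 Hc2]].
   + apply rcont_quad.
   + rewrite ball_quad, Hb2 by trivial. lra.
   + intros z Hz. apply ball_quad_pos; trivial.
   + exists (Rmin d1 d2). split; [pos|]. intros z Hz Hzb.
    specialize (Hc1 z (Rlt_min_l Hzb)). specialize (Hc2 z Hz (Rlt_min_r Hzb)).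
    unfold ball_metric. lra.
  - intros z Hz Hpos.
   destruct (proj2 (Hs z ltac:(unfold O, r in Hz; lra))) as [a1 [a2 [b1 [b2 [J1 E1]]]]].
   destruct (proj2 (ball_metric_liouville c r z Hr Hz)) as [c1 [c2 [e1 [e2 [J2 E2]]]]].
   do 4 eexists. split; [apply zjet_plus; [exact J1|apply zjet_scal, J2]|].
   assert (exp (2 * ball_metric c r z) < exp (2 * s z)) by (apply exp_increasing; lra). lra. }
 specialize (H c). unfold O in H. replace (c - c)%C with (RtoC 0) in H by ring. rewrite Cmod_0 in H.
 unfold ball_metric in H. rewrite ball_quad in H by trivial.
 replace (c - c)%C with (RtoC 0) in H by ring. rewrite Cmod_0 in H.
 replace ((r * r - 0 * 0) / (2 * r)) with (/ (4 / rho)) in H by (unfold r; field; lra).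
 rewrite ln_Rinv in H by pos. lra.
Qed.

Section Comparison.

Context (beta : R) (Omega : C -> Prop) (f g : C -> C).
Context (Hbeta : 0 < beta < 1) (HO : planar_open Omega) (HBd : bounded_set Omega)
  (Hf : holomorphic_on Omega f) (Hg : holomorphic_on (annulus beta) g)
  (HfA : forall z, Omega z -> annulus beta (f z)) (HgO : forall w, annulus beta w -> Omega (g w))
  (Hgf : forall z, Omega z -> g (f z) = z) (Hfg : forall w, annulus beta w -> f (g w) = w).

Lemma strip_metric_liouville (a e : R) (z : C) : Omega z -> 0 < a -> 0 < a * (height f z - e) < PI ->
  liouville_at (strip_metric f a e) z.
Proof.
 intros Hz Ha Ht. split.
 - apply (strip_metric_rcont beta Omega f g); trivial.
 - destruct (strip_metric_zjet beta Omega f g Hbeta HO Hf Hg HfA Hgf a e z Hz Ha Ht) as [b1 [b2 [J E]]].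
  do 4 eexists. eauto.
Qed.

Lemma ln_beta_neg : 0 < - ln beta.
Proof. pose proof (ln_increasing beta 1 ltac:(lra) ltac:(lra)). rewrite ln_1 in H. lra. Qed.

(** The strip is first narrowed by [e] on both sides, so that the comparison domain has its boundary
    inside [Omega]; no information about [u] near the boundary of [Omega] is used. *)
Lemma liouville_le_strip_inner (u : C -> R) (e : R) : (forall z, Omega z -> liouville_at u z) ->
  0 < e -> 2 * e < - ln beta -> forall z, Omega z -> e < height f z < - ln beta - e ->
  u z <= strip_metric f (PI / (- ln beta - 2 * e)) e z.
Proof.
 intros Hu He He2. set (a := PI / (- ln beta - 2 * e)).
 assert (Ha : 0 < a) by (apply Rdiv_lt_0_compat; lra).
 set (O := fun z => Omega z /\ e < height f z < - ln beta - e).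
 assert (Hrange : forall z, O z -> 0 < a * (height f z - e) < PI).
 { intros z [_ Hz]. split; [pos|].
  unfold a. apply Rmult_lt_reg_r with ((- ln beta - 2 * e) / PI); [pos|].
  field_simplify; [|lra|lra]. lra. }
 assert (H : forall z, O z -> u z + -1 * strip_metric f a e z <= 0).
 { apply max_principle.
  - intros z [Hz1 Hz2]. destruct (HO z Hz1) as [r [Hr Hb]].
   destruct (rcont_height beta Omega f Hbeta Hf HfA z Hz1 (Rmin (height f z - e) (- ln beta - e - height f z))) as [d [Hd Hc]].
   { pos. }
   exists (Rmin r d). split; [pos|]. intros w Hw. split.
   + apply Hb. lra.
   + specialize (Hc w (Rlt_min_r Hw)). lra.
  - destruct HBd as [M HM]. exists M. intros z [Hz _]. auto.
  - intros z Hz. apply rcont_plus; [apply Hu, Hz|apply rcont_scal]. apply strip_metric_liouville; auto. apply Hz.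
  - intros b Hb eps Heps.
   (* The heights in [O] keep [|f|] in a compact part of the annulus, so by [annular_core] limits of
      points of [O] stay in [Omega]: [u] is finite at [b], whereas the strip metric is infinite
      there. *)
   assert (HbO : Omega b).
   { set (e1 := Rmin (beta * exp e - beta) (1 - exp (- e))).
    assert (He1 : 0 < e1).
    { apply Rmin_pos.
     - pose proof (exp_increasing 0 e He). rewrite exp_0 in H. nra.
     - pose proof (exp_increasing (- e) 0 ltac:(lra)). rewrite exp_0 in H. lra. }
    destruct (annular_core beta Omega f g HO Hg HgO Hgf e1 He1) as [d [Hd Hcore]]; try lra; trivial.
    destruct (proj2 Hb d Hd) as [z [[Hz1 Hz2] Hzb]]. apply (Hcore z Hz1).
    - destruct (HfA z Hz1) as [F1 F2]. unfold height in Hz2.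
     assert (G1 : Cmod (f z) <= exp (- e)).
     { rewrite <- (exp_ln (Cmod (f z))) by lra. left. apply exp_increasing. lra. }
     assert (G2 : beta * exp e <= Cmod (f z)).
     { rewrite <- (exp_ln (Cmod (f z))) by lra. rewrite <- (exp_ln beta) at 1 by lra. rewrite <- exp_plus.
      left. apply exp_increasing. lra. }
     unfold e1. lra.
    - rewrite Cmod_minus_sym. lra. }
   pose proof (rcont_height beta Omega f Hbeta Hf HfA b HbO) as Hch.
   assert (Hb1 : e <= height f b) by (apply (boundary_closed_limit_ge O); trivial; intros z [_ Hz]; lra).
   assert (Hb2 : height f b <= - ln beta - e) by (apply (boundary_closed_limit O); trivial; intros z [_ Hz]; lra).
   assert (Hb3 : height f b = e \/ height f b = - ln beta - e).
   { destruct (Req_dec (height f b) e); [lra|]. destruct (Req_dec (height f b) (- ln beta - e)); [lra|].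
    exfalso. apply (proj1 Hb). split; trivial. lra. }
   destruct (proj1 (Hu b HbO) 1 Rlt_0_1) as [d1 [Hd1 Hc1]].
   assert (Hcl : rcont (fun w => ln (Cmod (logder f w))) b).
   { apply rcont_ln_Cmod; [|apply (logder_neq_0 beta Omega f g); trivial].
    apply (holomorphic_ccont Omega); trivial. apply (logder_holomorphic beta Omega f); trivial. }
   destruct (Hcl 1 Rlt_0_1) as [d3 [Hd3 Hc3]].
   destruct (neg_ln_blowup (fun z => sin (a * (height f z - e)) / a) b O (u b - ln (Cmod (logder f b)) + 2)) as [d2 [Hd2 Hc2]].
   + apply (rcont_comp (fun t => sin (a * (t - e)) / a) (height f)); trivial.
    apply (is_derive_cont _ _ (cos (a * (height f b - e)))). auto_derive; [lra|]. unfold Rminus. field; pos.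
   + destruct Hb3 as [-> | ->].
    * replace (a * (e - e)) with 0 by ring. rewrite sin_0. lra.
    * replace (a * (- ln beta - e - e)) with PI by (unfold a; field; lra). rewrite sin_PI. lra.
   + intros z Hz. apply Rdiv_lt_0_compat; trivial. apply sin_gt_0; apply Hrange, Hz.
   + exists (Rmin (Rmin d1 d3) d2). split; [pos|]. intros z Hz Hzb.
    pose proof (Rlt_min_l Hzb) as Hz13.
    specialize (Hc2 z Hz (Rlt_min_r Hzb)).
    specialize (Hc1 z (Rlt_min_l Hz13)). specialize (Hc3 z (Rlt_min_r Hz13)).
    unfold strip_metric. lra.
  - intros z Hz Hpos. destruct (proj2 (Hu z (proj1 Hz))) as [a1 [a2 [b1 [b2 [J1 E1]]]]].
   destruct (proj2 (strip_metric_liouville a e z (proj1 Hz) Ha (Hrange z Hz))) as [c1 [c2 [e1 [e2 [J2 E2]]]]].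
   do 4 eexists. split; [apply zjet_plus; [exact J1|apply zjet_scal, J2]|].
   assert (exp (2 * strip_metric f a e z) < exp (2 * u z)) by (apply exp_increasing; lra). lra. }
 intros z Hz Hh. specialize (H z (conj Hz Hh)). lra.
Qed.

Lemma strip_range (z : C) : Omega z -> 0 < PI / - ln beta * (height f z - 0) < PI.
Proof.
 intros Hz. pose proof (height_range beta Omega f Hbeta HfA z Hz) as [H1 H2].
 split.
 - pos.
 - apply Rmult_lt_reg_r with (- ln beta / PI); [pos|].
  field_simplify; [|lra|lra]. lra.
Qed.

Lemma annulus_metric_liouville (z : C) : Omega z -> liouville_at (strip_metric f (PI / - ln beta) 0) z.
Proof.
 intros Hz. apply strip_metric_liouville; trivial; [|apply strip_range, Hz].
 apply Rdiv_lt_0_compat; [lra|apply ln_beta_neg].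
Qed.

(** The metric of the narrowed strip depends continuously on [e] at a fixed point, so a strict
    violation at [e = 0] would persist for some small [e]. *)
Lemma liouville_le_annulus_metric (u : C -> R) : (forall z, Omega z -> liouville_at u z) ->
  forall z, Omega z -> u z <= strip_metric f (PI / - ln beta) 0 z.
Proof.
 intros Hu z Hz. apply Rnot_lt_le. intros Hlt. unfold strip_metric in Hlt.
 pose proof (height_range beta Omega f Hbeta HfA z Hz) as [H1 H2].
 pose proof (strip_range z Hz) as Hr.
 set (l := - ln beta) in *. set (X := height f z) in *.
 set (G := fun e => - ln (sin (PI / (l - 2 * e) * (X - e)) / (PI / (l - 2 * e)))).
 assert (HG : exists D, is_derive G 0 D).
 { eexists. unfold G. auto_derive; [|pos].
  replace (PI * / (l + - (2 * 0)) * (X + - 0)) with (PI / l * (X - 0)) by (field; lra).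
  assert (0 < sin (PI / l * (X - 0))) by (apply sin_gt_0; lra). pos. }
 destruct HG as [D HD].
 destruct (is_derive_cont_eps _ _ _ HD (u z - (- ln (sin (PI / l * (X - 0)) / (PI / l)) + ln (Cmod (logder f z))))) as [d [Hd Hb]]; [lra|].
 set (e := Rmin d (Rmin (X / 2) ((l - X) / 2)) / 2).
 assert (He : 0 < e /\ e < d /\ e < X /\ e < l - X).
 { unfold e. pos. }
 specialize (Hb e ltac:(lra)).
 pose proof (liouville_le_strip_inner u e Hu ltac:(lra) ltac:(fold l; lra) z Hz ltac:(fold l X; lra)) as Hle.
 unfold strip_metric in Hle. fold l X in Hle. unfold G in Hb.
 replace (l - 2 * 0) with l in Hb by ring. lra.
Qed.

End Comparison.

(** * Logarithms and square roots on an annular domain *)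

Definition cexp (z : C) : C := (RtoC (exp (fst z)) * cis (snd z))%C.

Lemma cexp_add (z w : C) : cexp (z + w)%C = (cexp z * cexp w)%C.
Proof. unfold cexp; simpl. rewrite exp_plus, cis_add, RtoC_mult. ring. Qed.

Lemma Cmod_cexp (z : C) : Cmod (cexp z) = exp (fst z).
Proof. unfold cexp. rewrite Cmod_mult, Cmod_cis, Cmod_R, Rabs_right; [ring|]. pos. Qed.

Lemma cexp_neq_0 (z : C) : cexp z <> 0.
Proof. apply Cmod_gt_0. rewrite Cmod_cexp. pos. Qed.

Lemma cexp_0 : cexp 0 = 1.
Proof. unfold cexp; simpl. rewrite exp_0, cis_0. ring. Qed.

Lemma cexp_opp (z : C) : (cexp z * cexp (- z))%C = 1.
Proof. rewrite <- cexp_add. replace (z + (- z))%C with (RtoC 0) by ring. apply cexp_0. Qed.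

Lemma hder_cexp (z : C) : hder cexp z (cexp z).
Proof.
 assert (H0 : hder cexp 0 1).
 { intros eps He.
  assert (De : is_derive exp 0 1) by (apply is_derive_Reals, derivable_pt_lim_exp_0).
  assert (Dc : is_derive cos 0 0) by (apply is_derive_Reals; pose proof (derivable_pt_lim_cos 0) as Q; rewrite sin_0, Ropp_0 in Q; exact Q).
  assert (Ds : is_derive sin 0 1) by (apply is_derive_Reals; pose proof (derivable_pt_lim_sin 0) as Q; rewrite cos_0 in Q; exact Q).
  set (e := Rmin 1 (eps / 10)). assert (He' : 0 < e) by (apply Rmin_pos; lra).
  pose proof (Rmin_l 1 (eps / 10)) as M1. pose proof (Rmin_r 1 (eps / 10)) as M2. fold e in M1, M2.
  destruct (proj1 (is_derive_eps exp 0 1) De e He') as [d1 [Hd1 B1]].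
  destruct (proj1 (is_derive_eps cos 0 0) Dc e He') as [d2 [Hd2 B2]].
  destruct (proj1 (is_derive_eps sin 0 1) Ds e He') as [d3 [Hd3 B3]].
  exists (Rmin (Rmin d1 d2) (Rmin d3 (e / 2))). split; [pos|].
  intros h Hh. pose proof (Rlt_min_l Hh) as H1. pose proof (Rlt_min_r Hh) as H2.
  pose proof (Re_le_Cmod h) as R1. pose proof (Im_le_Cmod h) as R2.
  destruct h as [a b]; simpl in R1, R2.
  specialize (B1 a ltac:(lra)). specialize (B2 b ltac:(lra)). specialize (B3 b ltac:(lra)).
  rewrite !Rplus_0_l, exp_0, Rmult_1_l in B1. rewrite !Rplus_0_l, cos_0, Rmult_0_l, Rminus_0_r in B2.
  rewrite !Rplus_0_l, sin_0, Rminus_0_r, Rmult_1_l in B3.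
  rewrite cexp_0, Cplus_0_l. set (m := Cmod (a, b)) in *.
  pose proof (Rabs_pos b) as Pb.
  assert (Ea : Rabs (exp a - 1) <= 2 * m).
  { replace (exp a - 1) with ((exp a - 1 - a) + a) by ring. le_via Rabs_triang. nra. }
  le_via Cmod_le_sum. unfold cexp, cis; simpl.
  replace (exp a * cos b - 0 * sin b + - (1) + - (1 * a - 0 * b)) with ((exp a - 1 - a) + exp a * (cos b - 1)) by ring.
  replace (exp a * sin b + 0 * cos b + - 0 + - (1 * b + 0 * a)) with (exp a * (sin b - b) + (exp a - 1) * b) by ring.
  assert (T1 : Rabs (exp a - 1 - a + exp a * (cos b - 1)) <= e * m + 2 * (e * m)).
  { le_via Rabs_triang. rewrite Rabs_mult.
   assert (e * Rabs a <= e * m) by pos.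
   assert (e * Rabs b <= e * m) by pos.
   assert (Rabs (exp a) * Rabs (cos b - 1) <= 2 * (e * m)).
   { pos. }
   lra. }
  assert (T2 : Rabs (exp a * (sin b - b) + (exp a - 1) * b) <= 2 * (e * m) + e * m).
  { le_via Rabs_triang. rewrite !Rabs_mult.
   assert (e * Rabs b <= e * m) by pos.
   assert (Rabs (exp a) * Rabs (sin b - b) <= 2 * (e * m)).
   { pos. }
   assert (Rabs (exp a - 1) * Rabs b <= e * m).
   { pos. }
   lra. }
  nra. }
 intros eps He. destruct (H0 (eps / Cmod (cexp z))) as [d [Hd Hb]].
 { apply Rdiv_lt_0_compat; trivial. apply Cmod_gt_0, cexp_neq_0. }
 exists d. split; trivial. intros h Hh. specialize (Hb h Hh). rewrite Cplus_0_l, cexp_0 in Hb.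
 rewrite cexp_add.
 replace (cexp z * cexp h - cexp z - cexp z * h)%C
  with (cexp z * (cexp h - 1 - 1 * h))%C by ring.
 rewrite Cmod_mult. assert (Hz : 0 < Cmod (cexp z)) by (apply Cmod_gt_0, cexp_neq_0).
 apply (Rmult_le_compat_l (Cmod (cexp z))) in Hb; [|lra].
 replace (Cmod (cexp z) * (eps / Cmod (cexp z) * Cmod h)) with (eps * Cmod h) in Hb by (field; lra). lra.
Qed.

Lemma cexp_eq_1 (z : C) : cexp z = 1 -> exists k : Z, z = (0, 2 * IZR k * PI).
Proof.
 intros E. assert (Ex : exp (fst z) = 1). { rewrite <- Cmod_cexp, E. apply Cmod_1. }
 assert (Hx : fst z = 0). { rewrite <- (ln_exp (fst z)), Ex. apply ln_1. }
 unfold cexp in E. rewrite Ex in E. apply (f_equal fst) in E. simpl in E.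
 assert (Hc : cos (snd z) = 1) by lra.
 assert (Hs : sin (snd z / 2) = 0).
 { replace (snd z) with (2 * (snd z / 2)) in Hc by field. rewrite cos_2a_sin in Hc. nra. }
 destruct (sin_eq_0_0 _ Hs) as [k Hk]. exists k. destruct z as [x y]; simpl in *. subst x. f_equal. lra.
Qed.

Lemma cexp_eq_1_small (z : C) : cexp z = 1 -> Cmod z < 1 -> z = 0.
Proof.
 intros E Hz. destruct (cexp_eq_1 z E) as [k Hk].
 pose proof (Im_le_Cmod z) as Hi. rewrite Hk in Hi at 1. simpl in Hi.
 assert (Hk0 : k = 0%Z).
 { destruct (Z.eq_dec k 0) as [|Hn]; trivial.
  assert (1 <= Rabs (IZR k)). { rewrite <- abs_IZR. apply IZR_le. lia. }
  pose proof PI2_1. rewrite !Rabs_mult, (Rabs_right 2), (Rabs_right PI) in Hi by lra. nra. }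
 rewrite Hk, Hk0. ceq.
Qed.

Lemma unit_is_cis (w : C) : Cmod w = 1 -> exists t, w = cis t.
Proof.
 intros H. destruct w as [x y].
 assert (E : x * x + y * y = 1). { pose proof (Cmod_sqr (x, y)) as E. rewrite H in E. simpl in E. lra. }
 assert (Hx : -1 <= x <= 1) by nra.
 destruct (Rle_dec 0 y) as [Hy|Hy].
 - exists (acos x). unfold cis. rewrite cos_acos, sin_acos by trivial. f_equal.
  rewrite <- (sqrt_Rsqr y Hy). f_equal. unfold Rsqr. lra.
 - exists (- acos x). unfold cis. rewrite cos_neg, sin_neg, cos_acos, sin_acos by trivial. f_equal.
  assert (Hy' : 0 <= - y) by lra.
  replace y with (- - y) at 1 by ring. f_equal. rewrite <- (sqrt_Rsqr (- y) Hy'). f_equal. unfold Rsqr. lra.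
Qed.

Lemma polar_form (w : C) : w <> 0 -> exists z, cexp z = w.
Proof.
 intros Hw. assert (Hp : 0 < Cmod w) by (apply Cmod_gt_0; trivial).
 destruct (unit_is_cis (w / RtoC (Cmod w))%C) as [t Ht].
 - rewrite Cmod_div, Cmod_R, Rabs_right by (try lra; intros E; apply RtoC_inj in E; lra). field; pos.
 - exists (ln (Cmod w), t). unfold cexp; simpl. rewrite exp_ln, <- Ht by trivial. ceq.
Qed.

(** The quotient [w / cexp z0] is close to 1, hence in the right half plane, where the logarithm is
    explicit through [ln] and [atan]. *)
Lemma cexp_local_inverse (z0 : C) (eps : R) : 0 < eps -> exists d, 0 < d /\
  forall w, Cmod (w - cexp z0) < d -> exists z, Cmod (z - z0) < eps /\ cexp z = w.
Proof.
 intros He.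
 assert (Hc1 : ccont (fun w => w) 1) by (apply (hder_ccont _ _ 1), hder_id).
 destruct (rcont_ln_Cmod (fun w => w) 1 Hc1 C1_nz (eps / 2)) as [d1 [Hd1 B1]]; [lra|].
 assert (Ra : rcont (fun w => atan (snd w * / fst w)) 1).
 { apply (rcont_comp atan (fun w : C => snd w * / fst w)).
  - apply rcont_mult; [apply rcont_snd|]. apply (rcont_comp Rinv (fun w : C => fst w)); [apply rcont_fst|].
   simpl. apply (is_derive_cont _ _ (- / 1)). auto_derive; [lra|]. field.
  - apply (is_derive_cont _ _ (/ (1 + (snd (RtoC 1) * / fst (RtoC 1)) ^ 2))). apply is_derive_Reals, derivable_pt_lim_atan. }
 destruct (Ra (eps / 2)) as [d2 [Hd2 B2]]; [lra|].
 assert (Hz : 0 < Cmod (cexp z0)) by (apply Cmod_gt_0, cexp_neq_0).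
 set (r := Rmin (Rmin d1 d2) (/ 2)).
 assert (Hr : 0 < r) by (repeat apply Rmin_pos; lra).
 exists (r * Cmod (cexp z0)). split; [pos|]. intros w Hw.
 set (v := (w / cexp z0)%C).
 assert (Hv : Cmod (v - 1) < r).
 { replace (v - 1)%C with ((w - cexp z0) / cexp z0)%C by (unfold v; field; apply cexp_neq_0).
  rewrite Cmod_div by apply cexp_neq_0. apply (Rmult_lt_reg_r (Cmod (cexp z0))); trivial.
  replace (Cmod (w - cexp z0) / Cmod (cexp z0) * Cmod (cexp z0)) with (Cmod (w - cexp z0)) by (field; lra). easy. }
 assert (Ew : w = (cexp z0 * v)%C) by (unfold v; field; apply cexp_neq_0). clearbody v.
 assert (r <= d1 /\ r <= d2 /\ r <= / 2) as [R1 [R2 R3]].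
 { unfold r. lra. }
 specialize (B1 v ltac:(lra)). specialize (B2 v ltac:(lra)). rewrite Cmod_1, ln_1 in B1.
 assert (E0 : atan (snd (RtoC 1) * / fst (RtoC 1)) = 0) by (simpl; rewrite Rmult_0_l; apply atan_0).
 rewrite E0 in B2. rewrite !Rminus_0_r in *.
 assert (Hx : 0 < fst v).
 { pose proof (Re_le_Cmod (v - 1)%C) as Hre.
  assert (Ef : forall z : C, fst (z - 1)%C = fst z - 1) by reflexivity.
  rewrite Ef in Hre. lra. }
 exists (z0 + (ln (Cmod v), atan (snd v * / fst v)))%C. split.
 - replace (z0 + (ln (Cmod v), atan (snd v * / fst v)) - z0)%C with ((ln (Cmod v), atan (snd v * / fst v)) : C).
  + lt_via Cmod_le_sum. simpl. lra.
  + apply injective_projections; simpl; ring.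
 - rewrite cexp_add, Ew.
  unfold cexp, cis; simpl.
  assert (Hvp : 0 < Cmod v).
  { apply Cmod_gt_0. intros E. rewrite E in Hx. simpl in Hx. lra. }
  rewrite exp_ln by trivial. rewrite cos_atan, sin_atan.
  assert (Es : sqrt (1 + (snd v * / fst v)²) = Cmod v / fst v).
  { rewrite <- (sqrt_Rsqr (Cmod v / fst v)) by pos.
   f_equal. unfold Rsqr. replace (Cmod v / fst v * (Cmod v / fst v)) with ((Cmod v * Cmod v) / (fst v * fst v)) by (field; lra).
   rewrite Cmod_sqr. field. lra. }
  rewrite Es. ceq.
Qed.

Lemma cder_CInt (k : R -> C) (a t : R) : (forall s, ccontR k s) -> cder (fun t => CInt k a t) t (k t).
Proof.
 intros Hk. split; simpl.
 - apply (is_derive_RInt (fun s => fst (k s)) (fun t => RInt (fun s => fst (k s)) a t) a t); [|apply Hk].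
  apply filter_forall. intros s. apply (RInt_correct (V := R_CompleteNormedModule)).
  apply (ex_RInt_continuous (V := R_CompleteNormedModule)). intros; apply Hk.
 - apply (is_derive_RInt (fun s => snd (k s)) (fun t => RInt (fun s => snd (k s)) a t) a t); [|apply Hk].
  apply filter_forall. intros s. apply (RInt_correct (V := R_CompleteNormedModule)).
  apply (ex_RInt_continuous (V := R_CompleteNormedModule)). intros; apply Hk.
Qed.

Lemma cder_zero_const (c : R -> C) (a b : R) : (forall t, cder c t 0) -> c a = c b.
Proof.
 intros H.
 assert (W : forall a b, a < b -> c a = c b).
 { intros s t Hst. apply injective_projections;
   [apply (eq_is_derive (V := R_NormedModule) (fun r => fst (c r)))|apply (eq_is_derive (V := R_NormedModule) (fun r => snd (c r)))];
   trivial; intros r _; apply (H r). }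
 destruct (Rtotal_order a b) as [Hl|[->|Hl]]; [apply W; trivial|pos|symmetry; apply W; trivial].
Qed.

Lemma ccontR_inv (c : R -> C) (t : R) (l : C) : cder c t l -> c t <> 0 -> ccontR (fun t => (/ c t)%C) t.
Proof.
 intros Hc Hn. apply (ccont_cder Cinv c t l); trivial. eapply hder_ccont, hder_inv, Hn.
Qed.

(** The product of [h] with the exponential of minus the integral has derivative zero. For a closed
    curve the integral is therefore a period of [cexp]; all integrality statements about winding and
    flux rest on this. *)
Lemma exp_log_integral (h h' : R -> C) (a b : R) :
  (forall t, cder h t (h' t)) -> (forall t, ccontR h' t) -> (forall t, h t <> 0) ->
  h b = (h a * (cexp (CInt (fun t => (h' t / h t)) a b)))%C.
Proof.
 intros Hd Hc Hn.
 set (k := fun t => (h' t / h t)%C). set (E := fun t => CInt k a t).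
 assert (Hk : forall t, ccontR k t).
 { intros t. apply ccontR_mult; [pos|]. apply (ccontR_inv h t (h' t)); trivial. }
 assert (HE : forall t, cder E t (k t)) by (intros; apply cder_CInt; trivial).
 assert (HK : forall t, cder (fun t => (h t * cexp ((-1)%R * E t))%C) t 0).
 { intros t. eapply cder_eq; [|apply cder_mult; [pos|apply (hder_comp_curve cexp (fun t => ((-1)%R * E t)%C) t);
   [apply hder_cexp|apply cder_mult; [apply cder_const|pos]]]].
  unfold k. field; pos. }
 pose proof (cder_zero_const _ a b HK) as EK. cbv beta in EK.
 assert (Ea : E a = 0) by apply CInt_point. rewrite Ea in EK.
 replace ((-1)%R * 0)%C with (RtoC 0) in EK by ring. rewrite cexp_0 in EK.
 pose proof (cexp_opp (E b)) as Eo. replace (- E b)%C with ((-1)%R * E b)%C in Eo by ring.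
 replace (h a) with (h a * 1)%C by ring. rewrite EK.
 transitivity (h b * (cexp (E b) * cexp ((-1)%R * E b)))%C; [rewrite Eo; ring|ring].
Qed.

Lemma log_integral_period (h h' : R -> C) (a b : R) :
  (forall t, cder h t (h' t)) -> (forall t, ccontR h' t) -> (forall t, h t <> 0) -> h b = h a ->
  cexp (CInt (fun t => (h' t / h t)%C) a b) = 1.
Proof.
 intros Hd Hc Hn E. pose proof (exp_log_integral h h' a b Hd Hc Hn) as H. rewrite E in H.
 replace (cexp (CInt (fun t => (h' t / h t)%C) a b)) with (h a * (cexp (CInt (fun t => (h' t / h t)) a b)) / h a)%C by (field; pos).
 rewrite <- H. field; pos.
Qed.

Lemma ccontR_continuity_Cmod (c : R -> C) (t : R) : ccontR c t -> continuity_pt (fun s => Cmod (c s)) t.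
Proof.
 intros [H1 H2]. apply continuity_pt_filterlim.
 apply (continuous_comp (fun s => fst (c s) ^ 2 + snd (c s) ^ 2) sqrt).
 - apply (continuous_plus (fun s => fst (c s) ^ 2) (fun s => snd (c s) ^ 2)).
  + apply (continuous_comp (fun s => fst (c s)) (fun x => x ^ 2)); trivial.
   apply (is_derive_cont _ _ (2 * fst (c t))). auto_derive; trivial; ring.
  + apply (continuous_comp (fun s => snd (c s)) (fun x => x ^ 2)); trivial.
   apply (is_derive_cont _ _ (2 * snd (c t))). auto_derive; trivial; ring.
 - apply continuous_sqrt.
Qed.

Lemma ccontR_bounded (c : R -> C) (a b : R) : a <= b -> (forall t, ccontR c t) ->
  exists M, 0 < M /\ forall t, a <= t <= b -> Cmod (c t) <= M.
Proof.
 intros Hab Hc. destruct (continuity_ab_maj (fun s => Cmod (c s)) a b Hab) as [m [Hm _]].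
 - intros t _. apply ccontR_continuity_Cmod, Hc.
 - exists (Cmod (c m) + 1). split; [lra|]. intros t Ht. specialize (Hm t Ht). lra.
Qed.

Lemma ccontR_away (c : R -> C) (a b : R) : a <= b -> (forall t, ccontR c t) -> (forall t, c t <> 0) ->
  exists m, 0 < m /\ forall t, a <= t <= b -> m <= Cmod (c t).
Proof.
 intros Hab Hc Hn. destruct (continuity_ab_min (fun s => Cmod (c s)) a b Hab) as [m [Hm _]].
 - intros t _. apply ccontR_continuity_Cmod, Hc.
 - exists (Cmod (c m)). split; [apply Cmod_gt_0, Hn|]. easy.
Qed.

Lemma hder_zero_segment (K : C -> C) (w h : C) :
  (forall t, 0 <= t <= 1 -> hder K (w + t * h)%C 0) -> K (w + h)%C = K w.
Proof.
 intros H. apply Ceq_minus, Cmod_eq_0. apply Rle_antisym; [|lra].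
 pose proof (C_mean_value K (fun _ => 0) w h 0 0) as B.
 replace (K (w + h) - K w - 0 * h)%C with (K (w + h) - K w)%C in B by ring.
 eapply Rle_trans; [apply B|lra]; trivial.
 - exists 1. split; [lra|]. replace (0 - 0)%C with (RtoC 0) by ring. rewrite Cmod_0. easy.
 - intros t Ht. replace (0 - 0)%C with (RtoC 0) by ring. rewrite Cmod_0. lra.
Qed.

Lemma convex_between (a b x y t : R) : a < x < b -> a < y < b -> 0 <= t <= 1 -> a < x + t * (y - x) < b.
Proof.
 intros Hx Hy Ht. destruct (Rle_dec x y).
 - nra.
 - nra.
Qed.

Section SquareRoot.

Context (beta : R) (Omega : C -> Prop) (f g : C -> C).
Context (Hbeta : 0 < beta < 1) (HO : planar_open Omega)
  (Hf : holomorphic_on Omega f) (Hg : holomorphic_on (annulus beta) g)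
  (HfA : forall z, Omega z -> annulus beta (f z)) (HgO : forall w, annulus beta w -> Omega (g w))
  (Hgf : forall z, Omega z -> g (f z) = z) (Hfg : forall w, annulus beta w -> f (g w) = w).

(** The universal cover of the domain: the strip [D] covers the annulus by [cexp], and [g] carries
    the annulus to [Omega]. Logarithms that are multivalued on [Omega] become functions on [D]. *)
Let D (z : C) : Prop := ln beta < fst z < 0.
Let F (z : C) : C := g (cexp z).
Let F' (z : C) : C := (Cderive g (cexp z) * cexp z)%C.

Lemma planar_open_annulus : planar_open (annulus beta).
Proof.
 intros w [H1 H2]. exists (Rmin (Cmod w - beta) (1 - Cmod w)). split; [pos|].
 intros w' Hw'. pose proof (Rlt_min_l Hw'). pose proof (Rlt_min_r Hw').
 pose proof (Cmod_triangle_inv w' w). pose proof (Cmod_triangle_inv w w').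
 rewrite (Cmod_minus_sym w w') in H4. split; lra.
Qed.

Lemma strip_annulus (z : C) : D z -> annulus beta (cexp z).
Proof.
 intros [H1 H2]. unfold annulus. rewrite Cmod_cexp. split.
 - rewrite <- (exp_ln beta) by lra. apply exp_increasing, H1.
 - rewrite <- exp_0. apply exp_increasing, H2.
Qed.

Lemma annulus_strip (z : C) : annulus beta (cexp z) -> D z.
Proof.
 intros [H1 H2]. rewrite Cmod_cexp in *. split.
 - rewrite <- (ln_exp (fst z)). apply ln_increasing; lra.
 - rewrite <- (ln_exp (fst z)), <- ln_1. apply ln_increasing; [lra|lra].
Qed.

Lemma strip_open : planar_open D.
Proof.
 intros z [H1 H2]. exists (Rmin (fst z - ln beta) (- fst z)). split; [pos|]. intros w Hw.
 pose proof (Re_le_Cmod (w - z)%C) as A. simpl in A. split; lra.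
Qed.

Lemma strip_shift (z : C) (y : R) : D z -> D (z + (0, y))%C.
Proof. intros [H1 H2]. split; simpl; lra. Qed.

Lemma cover_hder (z : C) : D z -> hder F z (F' z).
Proof.
 intros Hz. apply (hder_comp g cexp); [|apply hder_cexp]. apply (holomorphic_hder (annulus beta)); trivial. apply strip_annulus, Hz.
Qed.

Lemma cover_der_holomorphic (z : C) : D z -> exists l, hder F' z l.
Proof.
 intros Hz. eexists. apply hder_mult; [|apply hder_cexp]. apply (hder_comp (Cderive g) cexp); [|apply hder_cexp].
 apply (holomorphic_hder (annulus beta)); [|apply strip_annulus, Hz]. apply holomorphic_Cderive; trivial. apply planar_open_annulus.
Qed.

Lemma cover_Omega (z : C) : D z -> Omega (F z) /\ f (F z) = cexp z.
Proof. intros Hz. apply strip_annulus in Hz. eauto. Qed.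

Lemma cexp_period (z : C) : cexp (z + (0, 2 * PI)%R)%C = cexp z.
Proof.
 rewrite cexp_add.
 unfold cexp; simpl. rewrite exp_0, cis_2PI. ring.
Qed.

(** The winding number about [p] of the image of a middle circle of the annulus, times [2 PI i]. *)
Definition loop_winding (x1 : R) (p : C) : C :=
  CInt (fun y => (Ci * (F' (x1, y)) / ((F (x1, y)) - p))%C) 0 (2 * PI).

Lemma loop_cder (x1 y : R) (p : C) : ln beta < x1 < 0 ->
  cder (fun y => ((F (x1, y)) - p)%C) y (Ci * (F' (x1, y)))%C.
Proof.
 intros Hx. eapply cder_eq; [|apply cder_plus; [apply (hder_comp_curve F (fun y => (x1, y)) y);
  [apply cover_hder; exact Hx|apply cder_vert]|apply cder_const]]. ring.
Qed.

Lemma loop_der_cont (x1 y : R) : ln beta < x1 < 0 -> ccontR (fun y => (Ci * (F' (x1, y)))%C) y.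
Proof.
 intros Hx. apply ccontR_mult; [apply ccontR_const|]. apply ccontR_vert.
 destruct (cover_der_holomorphic (x1, y)) as [l Hl]; [pos|]. apply (hder_ccont _ _ _ Hl).
Qed.

Lemma loop_winding_exp (x1 : R) (p : C) : ln beta < x1 < 0 -> (forall y, F (x1, y) <> p) ->
  cexp (loop_winding x1 p) = 1.
Proof.
 intros Hx Hp. apply log_integral_period.
 - intros y. apply loop_cder, Hx.
 - intros y. apply loop_der_cont, Hx.
 - intros y. apply Cminus_eq_contra, Hp.
 - f_equal. unfold F. f_equal.
  replace ((x1, 2 * PI) : C) with ((x1, 0) + (0, 2 * PI)%R)%C; [apply cexp_period|]. ceq.
Qed.

(** The integral varies by less than 1 for small changes of the point and takes values in the
    periods of [cexp]. *)
Lemma loop_winding_locally_const (x1 : R) (p : C) : ln beta < x1 < 0 -> (forall y, F (x1, y) <> p) ->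
  exists d, 0 < d /\ forall q, Cmod (q - p) < d -> (forall y, F (x1, y) <> q) ->
  loop_winding x1 q = loop_winding x1 p.
Proof.
 intros Hx Hp.
 assert (HcF : forall q t, ccontR (fun y => ((F (x1, y)) - q)%C) t).
 { intros q t. eapply cder_ccontR, loop_cder, Hx. }
 destruct (ccontR_away (fun y => ((F (x1, y)) - p)%C) 0 (2 * PI)) as [m [Hm Hmin]]; [lra|pos|intros; apply Cminus_eq_contra, Hp|].
 destruct (ccontR_bounded (fun y => (Ci * (F' (x1, y)))%C) 0 (2 * PI)) as [B [HB Hmax]]; [lra|intros; apply loop_der_cont, Hx|].
 set (k := B * 2 / (m * m)). assert (Hk : 0 < k) by (unfold k; apply Rdiv_lt_0_compat; nra).
 exists (Rmin (m / 2) (/ (8 * PI * k))). split.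
 { pos. }
 intros q Hq Hqn. pose proof (Rlt_min_r Hq) as Q2.
 assert (Kp : forall r, (forall y, F (x1, y) <> r) -> forall t, ccontR (fun y => (Ci * (F' (x1, y)) / ((F (x1, y)) - r))%C) t).
 { intros r Hr t. apply ccontR_mult; [apply loop_der_cont, Hx|]. eapply ccontR_inv; [apply loop_cder, Hx|]. apply Cminus_eq_contra, Hr. }
 set (G := fun y => (Ci * (F' (x1, y)) / ((F (x1, y)) - q) + (-1)%R * (Ci * (F' (x1, y)) / ((F (x1, y)) - p)))%C).
 assert (E : (loop_winding x1 q - loop_winding x1 p)%C = CInt G 0 (2 * PI)).
 { unfold G. rewrite CInt_plus, CInt_scal.
  - unfold loop_winding. ring.
  - intros; apply Kp, Hp.
  - intros; apply Kp, Hqn.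
  - intros; apply ccontR_mult; [apply ccontR_const|apply Kp, Hp]. }
 assert (Bd : Cmod (CInt G 0 (2 * PI)) <= 2 * (k * Cmod (q - p)) * Rabs (2 * PI - 0)).
 { apply CInt_bound.
  - intros t _. apply ccontR_plus; [apply Kp, Hqn|]. apply ccontR_mult; [apply ccontR_const|apply Kp, Hp].
  - intros t Ht. rewrite Rmin_left, Rmax_right in Ht by lra. unfold G.
   assert (N1 : ((F (x1, t)) - p)%C <> 0) by apply Cminus_eq_contra, Hp.
   assert (N2 : ((F (x1, t)) - q)%C <> 0) by apply Cminus_eq_contra, Hqn.
   replace (Ci * (F' (x1, t)) / ((F (x1, t)) - q) + (-1)%R * (Ci * (F' (x1, t)) / ((F (x1, t)) - p)))%C
    with (Ci * (F' (x1, t)) * (q - p) / (((F (x1, t)) - q) * ((F (x1, t)) - p)))%C by (field; pos).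
   rewrite Cmod_div by (apply Cmult_neq_0; trivial). rewrite Cmod_mult.
   rewrite (Cmod_mult ((F (x1, t)) - q)%C).
   specialize (Hmin t Ht). specialize (Hmax t Ht).
   assert (Hm2 : m / 2 <= Cmod ((F (x1, t)) - q)%C).
   { pose proof (Cmod_minus_triangle (F (x1, t)) q p). lra. }
   assert (Hden : m * m / 2 <= Cmod ((F (x1, t)) - q)%C * Cmod ((F (x1, t)) - p)%C).
   { nra. }
   unfold k. replace (B * 2 / (m * m) * Cmod (q - p)) with (B * Cmod (q - p) / (m * m / 2)) by (field; lra).
   pose proof (Cmod_ge_0 (q - p)%C).
   apply Rmult_le_compat.
   + pos.
   + pos.
   + pos.
   + apply Rinv_le_contravar; [nra|lra]. }
 apply Ceq_minus. apply cexp_eq_1_small.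
 - pose proof (loop_winding_exp x1 q Hx Hqn) as E1. pose proof (loop_winding_exp x1 p Hx Hp) as E2.
  pose proof (cexp_opp (loop_winding x1 p)) as E3. rewrite E2 in E3. unfold Cminus. rewrite cexp_add, E1. easy.
 - rewrite E. lt_via Bd. rewrite Rminus_0_r, Rabs_right by lra.
  apply (Rmult_lt_compat_l (8 * PI * k)) in Q2; [|nra]. rewrite Rinv_r in Q2 by nra. nra.
Qed.

Context (x1 : R) (Hx1 : ln beta < x1 < 0) (Sd : R -> Prop).
Context (Hconv : forall x y t, Sd x -> Sd y -> 0 <= t <= 1 -> Sd (x + t * (y - x))) (Hsd1 : ~ Sd x1).

(** [Sd] stands for the real parts on one side of the line [fst z = x1]; off this line [|f|] differs
    from its value on the loop. *)
Lemma side_off_loop (z : C) : D z -> Sd (fst z) -> forall y, F (x1, y) <> F z.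
Proof.
 intros Hz HS y E. assert (Hz1 : D (x1, y)) by exact Hx1.
 apply (f_equal f) in E. rewrite (proj2 (cover_Omega _ Hz1)), (proj2 (cover_Omega _ Hz)) in E.
 apply (f_equal Cmod) in E. rewrite !Cmod_cexp in E. simpl in E. apply exp_inv in E. apply Hsd1. rewrite E. pos.
Qed.

Lemma exterior_off_loop (p : C) : ~ Omega p -> forall y, F (x1, y) <> p.
Proof. intros Hp y E. apply Hp. rewrite <- E. apply (cover_Omega (x1, y)). pos. Qed.

Lemma winding_same_side (z w : C) : D z -> D w -> Sd (fst z) -> Sd (fst w) ->
  loop_winding x1 (F z) = loop_winding x1 (F w).
Proof.
 intros Hz Hw Sz Sw.
 set (s := fun t => (z + t * (w - z))%C).
 assert (Hs : forall t, 0 <= t <= 1 -> D (s t) /\ Sd (fst (s t))).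
 { intros t Ht. assert (E : fst (s t) = fst z + t * (fst w - fst z)) by (unfold s; simpl; ring).
  split; [|rewrite E; apply Hconv; trivial]. unfold D in *. rewrite E. apply convex_between; trivial. }
 (* The parameter is clamped to the unit interval, because [cder_zero_const] asks for a zero
    derivative on the whole line. *)
 set (W := fun t => loop_winding x1 (F (s (Rmax 0 (Rmin 1 t))))).
 assert (Hclip : forall t, 0 <= Rmax 0 (Rmin 1 t) <= 1).
 { split; [lra|]. apply Rmax_lub; [lra|lra]. }
 assert (Hlip : forall t t', Rabs (Rmax 0 (Rmin 1 t') - Rmax 0 (Rmin 1 t)) <= Rabs (t' - t)).
 { intros t t'. unfold Rmax, Rmin. destruct (Rle_dec 1 t), (Rle_dec 1 t'); repeat destruct Rle_dec; unfold Rabs; repeat destruct Rcase_abs; lra. }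
 assert (HW : forall t, cder W t 0).
 { intros t. rewrite cder_eps. set (t0 := Rmax 0 (Rmin 1 t)).
  destruct (Hs t0 (Hclip t)) as [H1 H2].
  destruct (loop_winding_locally_const x1 (F (s t0)) Hx1 (side_off_loop _ H1 H2)) as [d [Hd Hc]].
  destruct (hder_ccont _ _ _ (cover_hder (s t0) H1) d Hd) as [d' [Hd' Hc']].
  set (m := Cmod (w - z) + 1). assert (Hm : 0 < m) by (unfold m; pose proof (Cmod_ge_0 (w - z)%C); lra).
  exists (d' / m). split; [pos|]. intros h Hh.
  assert (E : W (t + h) = W t).
  { unfold W. set (t1 := Rmax 0 (Rmin 1 (t + h))). destruct (Hs t1 (Hclip _)) as [H3 H4].
   apply Hc; [|apply side_off_loop; trivial]. apply Hc'.
   replace (s t1 - s t0)%C with (RtoC (t1 - t0) * (w - z))%C by ceq.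
   rewrite Cmod_mult, Cmod_R. pose proof (Hlip t (t + h)) as Hl. fold t0 t1 in Hl. replace (t + h - t) with h in Hl by ring.
   apply (Rmult_lt_compat_r m) in Hh; trivial. replace (d' / m * m) with d' in Hh by (field; lra).
   unfold m in Hh. nra. }
  rewrite E. replace (W t - W t - 0 * h)%C with (RtoC 0) by ring. rewrite Cmod_0. pos. }
 pose proof (cder_zero_const W 0 1 HW) as E. unfold W in E.
 replace (Rmax 0 (Rmin 1 0)) with 0 in E by (rewrite Rmin_right, Rmax_left; lra).
 replace (Rmax 0 (Rmin 1 1)) with 1 in E by (rewrite Rmin_left, Rmax_right; lra).
 replace (s 0) with z in E by ceq. replace (s 1) with w in E by ceq. exact E.
Qed.

(** Exterior points approached by [Omega] from one side of the loop. This stands for membership in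
    one complementary component, without any topology of the complement. *)
Definition on_side (p : C) : Prop :=
  ~ Omega p /\ forall r, 0 < r -> exists a, Omega a /\ Cmod (a - p) < r /\ Sd (ln (Cmod (f a))).

Lemma Omega_cover (a : C) : Omega a -> exists z, D z /\ F z = a /\ fst z = ln (Cmod (f a)).
Proof.
 intros Ha. destruct (polar_form (f a)) as [z Hz].
 - apply Cmod_gt_0. destruct (HfA a Ha). lra.
 - exists z. split; [apply annulus_strip; rewrite Hz; apply HfA, Ha|]. split.
  + unfold F. rewrite Hz. auto.
  + rewrite <- Hz, Cmod_cexp, ln_exp. easy.
Qed.

Lemma winding_on_side (p q : C) : on_side p -> on_side q -> loop_winding x1 p = loop_winding x1 q.
Proof.
 assert (H : forall p, on_side p -> exists z, D z /\ Sd (fst z) /\ loop_winding x1 (F z) = loop_winding x1 p).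
 { intros r [Hr1 Hr2]. destruct (loop_winding_locally_const x1 r Hx1 (exterior_off_loop r Hr1)) as [d [Hd Hc]].
  destruct (Hr2 d Hd) as [a [Ha [Hd2 Hs]]]. destruct (Omega_cover a Ha) as [z [Hz [E1 E2]]].
  rewrite <- E2 in Hs. exists z. split; trivial. split; trivial. apply Hc; [rewrite E1; exact Hd2|].
  apply side_off_loop; trivial. }
 intros Hp Hq. destruct (H p Hp) as [z [Z1 [Z2 Z3]]]. destruct (H q Hq) as [w [W1 [W2 W3]]].
 rewrite <- Z3, <- W3. apply winding_same_side; trivial.
Qed.

(** [L] is a logarithm of [F - p] on the simply connected strip up to the constant [c]; its
    increment over a period does not depend on [z] and is computed on the loop. *)
Lemma cover_log (p : C) : ~ Omega p -> exists (L : C -> C) (c : C), c <> 0 /\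
  (forall z, D z -> hder L z (F' z / (F z - p))%C) /\
  (forall z, D z -> (F z - p)%C = (c * cexp (L z))%C) /\
  (forall z, D z -> ((L (z + (0, 2 * PI)%R)%C)%R - L z)%C = loop_winding x1 p).
Proof.
 intros Hp. assert (Hn : forall z, D z -> (F z - p)%C <> 0).
 { intros z Hz. apply Cminus_eq_contra. intros E. apply Hp. rewrite <- E. apply cover_Omega, Hz. }
 assert (Hseg : forall z h t, D z -> D (z + h)%C -> 0 <= t <= 1 -> D (z + t * h)%C).
 { intros z h t H1 H2 Ht. pose proof (convex_between _ _ _ _ t H1 H2 Ht) as H3. simpl in H3. unfold D. simpl. lra. }
 destruct (box_primitive D (fun z => (F' z / (F z - p))%C)) as [L HL].
 - apply strip_open.
 - intros a1 b1 a2 b2 x y [A1 A2] [B1 B2] [Hx Hy]. simpl in *. split; simpl;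
   unfold Rmin, Rmax in *; destruct (Rle_dec a1 a2); lra.
 - exists (x1, 0). easy.
 - intros z Hz. destruct (cover_der_holomorphic z Hz) as [l Hl]. eexists. apply hder_div; [apply Hn, Hz|exact Hl|].
  apply hder_plus; [apply cover_hder, Hz|apply hder_const].
 - set (K := fun z => ((F z - p) * cexp ((-1)%R * L z))%C).
  assert (HK : forall z, D z -> hder K z 0).
  { intros z Hz. eapply hder_eq; [|apply hder_mult; [apply hder_plus; [apply cover_hder, Hz|apply hder_const]|
    apply (hder_comp cexp (fun z => ((-1)%R * L z)%C)); [apply hder_cexp|apply hder_mult; [apply hder_const|apply HL, Hz]]]].
   cbv beta. field. auto. }
  assert (HKc : forall z w, D z -> D w -> K w = K z).
  { intros z w Hz Hw. replace w with (z + (w - z))%C by ring. apply hder_zero_segment.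
   intros t Ht. apply HK, Hseg; trivial. rewrite Cplus_minus_cancel. pos. }
  exists L, (K (x1, 0)). split; [|split; [pos|split]].
  + apply Cmult_neq_0; [apply Hn; exact Hx1|apply cexp_neq_0].
  + intros z Hz. rewrite (HKc z (x1, 0) Hz Hx1). unfold K. pose proof (cexp_opp (L z)) as E.
   replace (- L z)%C with ((-1)%R * L z)%C in E by ring.
   transitivity ((F z - p) * (cexp (L z) * cexp ((-1)%R * L z)))%C; [rewrite E; ring|ring].
  + set (J := fun z => ((L (z + (0, 2 * PI)%R)%C)%R + (-1)%R * L z)%C).
   assert (HJ : forall z, D z -> hder J z 0).
   { intros z Hz. eapply hder_eq; [|apply hder_plus; [apply (hder_comp L (fun z => (z + (0, 2 * PI)%R)%C)); [apply HL, strip_shift, Hz|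
     apply hder_plus; [apply hder_id|apply hder_const]]|apply hder_mult; [apply hder_const|apply HL, Hz]]].
    unfold F', F. rewrite cexp_period. ring. }
   intros z Hz. transitivity (J z); [unfold J; ring|].
   replace (J z) with (J (x1, 0)).
   * unfold J, loop_winding. rewrite (CInt_ftc (fun y => L (x1, y))).
    -- replace ((x1, 0) + (0, 2 * PI)%R)%C with ((x1, 2 * PI) : C); [ring|]. ceq.
    -- intros t _. eapply cder_eq; [|apply (hder_comp_curve L (fun y => (x1, y)) t); [apply HL; exact Hx1|apply cder_vert]]. ceq.
    -- intros t _. apply ccontR_mult; [apply loop_der_cont, Hx1|]. eapply ccontR_inv; [apply loop_cder, Hx1|]. auto.
   * replace ((x1, 0) : C) with (z + ((x1, 0) - z))%C by apply Cplus_minus_cancel. apply hder_zero_segment.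
    intros t Ht. apply HJ, Hseg; trivial. rewrite Cplus_minus_cancel. pos.
Qed.

(** Over one period, half the difference of the logarithms of [F - p] and [F - q] changes by half
    the difference of the two winding integrals, which is zero for points on the same side. Its
    exponential therefore descends from the strip to [Omega]. *)
Lemma continuous_sqrt_quotient (p q : C) : on_side p -> on_side q -> exists (phi : C -> C) (k : C), k <> 0 /\
  (forall z, Omega z -> ccont phi z) /\
  (forall z, Omega z -> (phi z * phi z)%C = (k * ((z - p) / (z - q)))%C).
Proof.
 intros Hp Hq. destruct (cover_log p (proj1 Hp)) as [L [c [Hc [HL [EL WL]]]]].
 destruct (cover_log q (proj1 Hq)) as [M [d [Hd [HM [EM WM]]]]].
 pose proof (winding_on_side p q Hp Hq) as EW.
 set (Phi := fun z => cexp (RtoC (/ 2) * (L z - M z))%C).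
 assert (HPhi : forall z, D z -> ccont Phi z).
 { intros z Hz. eapply hder_ccont. apply (hder_comp cexp); [apply hder_cexp|].
  apply hder_mult; [apply hder_const|]. apply (hder_plus L (fun z => (- M z)%C)); [apply HL, Hz|].
  assert (HC := hder_mult (fun _ => (-1)%C) M z _ _ (hder_const _ z) (HM z Hz)).
  eapply hder_ext_loc; [|exact HC]. exists 1. split; [lra|]. intros w _. ring. }
 assert (HPer : forall z, D z -> Phi (z + (0, 2 * PI)%R)%C = Phi z).
 { intros z Hz. unfold Phi. f_equal.
  replace (L (z + (0, 2 * PI)%R)%C) with (L z + loop_winding x1 p)%C by (rewrite <- (WL z Hz); ring).
  replace (M (z + (0, 2 * PI)%R)%C) with (M z + loop_winding x1 q)%C by (rewrite <- (WM z Hz); ring).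
  rewrite EW. ring. }
 assert (HPerN : forall n z, D z -> Phi (z + (0, 2 * INR n * PI)%R)%C = Phi z).
 { induction n as [|n IH]; intros z Hz.
  - simpl INR. replace (z + (0, 2 * 0 * PI)%R)%C with z; trivial. ceq.
  - rewrite S_INR. replace (z + (0, 2 * (INR n + 1) * PI)%R)%C with (z + (0, 2 * INR n * PI)%R + (0, 2 * PI)%R)%C.
   + rewrite HPer by (apply strip_shift, Hz). apply IH, Hz.
   + apply injective_projections; simpl; ring. }
 assert (HPerZ : forall z w, D z -> cexp z = cexp w -> Phi w = Phi z).
 { intros z w Hz E. assert (Hw : D w) by (apply annulus_strip; rewrite <- E; apply strip_annulus, Hz).
  destruct (cexp_eq_1 (w - z)%C) as [k Hk].
  { unfold Cminus. rewrite cexp_add, <- E. apply cexp_opp. }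
  assert (Ew : w = (z + (0, 2 * IZR k * PI)%R)%C) by (rewrite <- Hk; ring).
  destruct (Z.le_gt_cases 0 k) as [Hk0|Hk0].
  - rewrite Ew. rewrite <- (Z2Nat.id k Hk0), <- INR_IZR_INZ. auto.
  - assert (Ez : z = (w + (0, 2 * INR (Z.to_nat (- k)) * PI)%R)%C).
   { rewrite Ew, INR_IZR_INZ, Z2Nat.id, opp_IZR by lia. ceq. }
   rewrite Ez. symmetry. auto. }
 (* An arbitrary, possibly discontinuous logarithm. [Phi] does not depend on the choice, so
    continuity may be checked with the local logarithm of [cexp_local_inverse]. *)
 set (lift := fun w => epsilon (inhabits (RtoC 0)) (fun z => cexp z = w)).
 assert (Hlift : forall z, Omega z -> cexp (lift (f z)) = f z).
 { intros z Hz. apply epsilon_spec. apply polar_form. apply Cmod_gt_0. destruct (HfA z Hz). lra. }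
 assert (HliftD : forall z, Omega z -> D (lift (f z))).
 { intros z Hz. apply annulus_strip. rewrite Hlift; auto. }
 exists (fun z => Phi (lift (f z))), (d / c)%C. split; [|split].
 - intros E. apply Hd. replace d with (d / c * c)%C by (field; pos). rewrite E. ring.
 - intros z Hz eps He. destruct (HPhi _ (HliftD z Hz) eps He) as [e1 [He1 H1]].
  destruct (strip_open _ (HliftD z Hz)) as [e3 [He3 H3]].
  destruct (cexp_local_inverse (lift (f z)) (Rmin e1 e3)) as [e2 [He2 H2]]; [pos|].
  destruct (holomorphic_ccont Omega f z Hf Hz e2 He2) as [e4 [He4 H4]].
  destruct (HO z Hz) as [r [Hr Hb]].
  exists (Rmin e4 r). split; [pos|]. intros w Hw.
  assert (HwO : Omega w) by (apply Hb; eapply Rlt_le_trans; [exact Hw|lra]).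
  specialize (H4 w (Rlt_min_l Hw)). rewrite <- (Hlift z Hz) in H4.
  destruct (H2 _ H4) as [y [Hy1 Hy2]].
  pose proof (Rlt_min_l Hy1) as Y1. pose proof (Rlt_min_r Hy1) as Y2.
  rewrite (HPerZ y (lift (f w))); [apply H1, Y1|apply H3, Y2|]. rewrite Hy2, Hlift; trivial.
 - intros z Hz. set (y := lift (f z)). assert (Hy : D y) by apply HliftD, Hz.
  assert (EF : F y = z) by (unfold F, y; rewrite Hlift; auto).
  pose proof (EL y Hy) as E1. pose proof (EM y Hy) as E2. rewrite EF in E1, E2. rewrite E1, E2.
  unfold Phi. rewrite <- cexp_add.
  replace (RtoC (/ 2) * (L y - M y) + RtoC (/ 2) * (L y - M y))%C
   with (L y + (- M y))%C.
  + rewrite cexp_add. pose proof (cexp_opp (M y)) as Eo.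
   replace (cexp (- M y)%C) with (/ cexp (M y))%C.
   * field. repeat split; trivial. apply cexp_neq_0.
   * replace (cexp (- M y)%C) with (/ cexp (M y) * (cexp (M y) * cexp (- M y)))%C by (field; apply cexp_neq_0).
    rewrite Eo. ring.
  + ceq.
Qed.

End SquareRoot.

(** * Lower bound for blow-up solutions *)

Lemma segment_boundary (O : C -> Prop) (z w : C) : planar_open O -> O z -> ~ O w ->
  exists t, 0 <= t <= 1 /\ boundary O (z + t * (w - z))%C.
Proof.
 intros HO Hz Hw. set (c := fun t => Cplus z (Cmult (RtoC t) (Cminus w z))).
 set (E := fun t => 0 <= t <= 1 /\ forall s, 0 <= s <= t -> O (c s)).
 set (m := Cmod (Cminus w z) + 1). assert (Hm : 0 < m) by (unfold m; pose proof (Cmod_ge_0 (Cminus w z)); lra).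
 assert (Hc0 : c 0 = z) by ceq. assert (Hc1 : c 1 = w) by ceq.
 assert (Hlip : forall s t, Cmod (c s - c t) <= Rabs (s - t) * m).
 { intros s t. replace (c s - c t)%C with (RtoC (s - t) * (w - z))%C by ceq.
  rewrite Cmod_mult, Cmod_R. apply Rmult_le_compat_l; [lra|unfold m; lra]. }
 destruct (completeness E) as [T [Hub Hlub]].
 - exists 1. intros t [Ht _]. lra.
 - exists 0. split; [lra|]. intros s Hs. replace s with 0 by lra. rewrite Hc0. easy.
 - assert (HT : 0 <= T <= 1).
  { split; [apply Hub; split; [lra|]; intros s Hs; replace s with 0 by lra; rewrite Hc0; exact Hz|].
   apply Hlub. intros t [Ht _]. lra. }
  assert (HbelowT : forall s, 0 <= s < T -> O (c s)).
  { intros s Hs. apply NNPP. intros Hn. assert (T <= s); [|lra]. apply Hlub. intros t [Ht1 Ht2].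
   apply Rnot_lt_le. intros Hlt. apply Hn, Ht2. lra. }
  assert (HnT : ~ O (c T)).
  { intros HcT. destruct (HO _ HcT) as [r [Hr Hb]].
   assert (HT1 : T < 1). { destruct (Req_dec T 1) as [E1|]; [|lra]. exfalso. apply Hw. rewrite <- Hc1, <- E1. pos. }
   set (T' := Rmin 1 (T + r / m / 2)).
   assert (HrM : 0 < r / m / 2) by pos.
   assert (T < T') by (unfold T'; apply Rmin_glb_lt; lra).
   assert (HE : E T').
   { split; [unfold T'; split; [apply Rmin_glb; lra|lra]|]. intros s Hs.
    destruct (Rlt_dec s T); [apply HbelowT; lra|]. apply Hb. lt_via Hlip.
    assert (s - T <= r / m / 2) by (unfold T' in Hs; pose proof (Rmin_r 1 (T + r / m / 2)); lra).
    apply Rle_lt_trans with (r / m / 2 * m); [pos|].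
    replace (r / m / 2 * m) with (r / 2) by (field; lra). lra. }
   specialize (Hub T' HE). lra. }
  assert (HTpos : 0 < T). { destruct (Req_dec T 0) as [E0|]; [|lra]. exfalso. apply HnT. rewrite E0, Hc0. pos. }
  exists T. split; trivial. split; [pos|]. intros r Hr.
  set (s := Rmax 0 (T - r / m / 2)).
  assert (HrM : 0 < r / m / 2) by pos.
  exists (c s). split.
  + apply HbelowT. split; [apply Rmax_l|]. apply Rmax_lub_lt; lra.
  + lt_via Hlip.
   assert (Hs1 : s < T) by (unfold s; apply Rmax_lub_lt; lra).
   assert (Hs2 : T - r / m / 2 <= s) by apply Rmax_r.
   apply Rle_lt_trans with (r / m / 2 * m); [pos|].
   replace (r / m / 2 * m) with (r / 2) by (field; lra). lra.
Qed.

(** A boundary point within twice the radius of a disc contained in [O] serves in place of a nearest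
    one; it comes from a supremum of radii and the last exit of a segment. *)
Lemma nearly_nearest_boundary (O : C -> Prop) (z b : C) (t : R) : planar_open O -> O z -> ~ O b ->
  Cmod (b - z) < t ->
  exists rho p, 0 < rho /\ boundary O p /\ (forall w, Cmod (w - z) < rho -> O w) /\
  rho <= Cmod (p - z) < 2 * rho /\ Cmod (p - z) < t.
Proof.
 intros HO Hz Hb Ht.
 set (E := fun r => forall w, Cmod (w - z) < r -> O w).
 destruct (HO z Hz) as [r0 [Hr0 Hball]].
 destruct (completeness E) as [m [Hub Hlub]].
 - exists (Cmod (b - z)). intros r Hr. apply Rnot_lt_le. intros Hlt. apply Hb, Hr, Hlt.
 - exists r0. pos.
 - assert (Hm0 : r0 <= m) by auto.
  assert (Hmt : m < t).
  { apply Rle_lt_trans with (Cmod (b - z)); trivial. apply Hlub. intros r Hr. apply Rnot_lt_le. auto. }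
  assert (Hmball : forall w, Cmod (w - z) < m -> O w).
  { intros w Hw. apply NNPP. intros Hn. assert (m <= Cmod (w - z)); [|lra]. apply Hlub. intros r Hr.
   apply Rnot_lt_le. auto. }
  set (r := Rmin (2 * m) t). assert (Hr : m < r) by (apply Rmin_glb_lt; lra).
  assert (Hex : exists w, Cmod (w - z) < r /\ ~ O w).
  { apply NNPP. intros Hn. assert (r <= m); [|lra]. apply Hub. intros w Hw. apply NNPP. eauto. }
  destruct Hex as [w [Hw1 Hw2]].
  destruct (segment_boundary O z w HO Hz Hw2) as [s [Hs Hbd]].
  set (p := (z + s * (w - z))%C) in *.
  assert (Hp : Cmod (p - z) <= Cmod (w - z)) by (apply Cmod_segment; trivial).
  exists m, p. pose proof (Rmin_l (2 * m) t) as M1. pose proof (Rmin_r (2 * m) t) as M2. fold r in M1, M2.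
  split; [lra|]. split; [pos|]. split; [pos|]. split; [|lra]. split; [|lra].
  apply Rnot_lt_le. intros Hlt. apply (proj1 Hbd), Hmball, Hlt.
Qed.

Lemma ln_Cmod_harmonic (O : C -> Prop) (h : C -> C) (z : C) : planar_open O -> holomorphic_on O h ->
  (forall w, O w -> h w <> 0) -> O z ->
  rcont (fun w => ln (Cmod (h w))) z /\
  exists a1 a2 b1 b2, zjet (fun w => ln (Cmod (h w))) z a1 a2 b1 b2 /\ b1 + b2 = 0.
Proof.
 intros HO Hh Hn Hz. split; [apply rcont_ln_Cmod; [apply (holomorphic_ccont O); trivial|apply Hn, Hz]|].
 destruct (HO z Hz) as [r [Hr Hb]]. do 4 eexists. split.
 - apply (zjet_ln_Cmod h (logder h)).
  + exists r. split; trivial. intros w Hw. split; [apply Hn, Hb, Hw|].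
   eapply hder_eq; [|apply (holomorphic_hder O h w Hh (Hb w Hw))]. unfold logder. field. apply Hn, Hb, Hw.
  + apply hder_div; [apply Hn, Hz| |apply (holomorphic_hder O); trivial].
   apply (holomorphic_hder O); trivial. apply holomorphic_Cderive; trivial.
 - ring.
Qed.

Lemma hder_sqrt (phi m : C -> C) (z m' : C) (O : C -> Prop) : planar_open O -> O z -> ccont phi z ->
  (forall w, O w -> (phi w * phi w)%C = m w) -> hder m z m' -> phi z <> 0 ->
  hder phi z (m' / (2 * phi z))%C.
Proof.
 intros HO Hz Hc Hsq Hm Hn eps He.
 assert (Hp : 0 < Cmod (phi z)) by (apply Cmod_gt_0; trivial).
 assert (H2 : (2 * phi z)%C <> 0). { apply Cmult_neq_0; trivial. intros E. apply RtoC_inj in E. lra. }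
 set (q := Cmod m' + 1). assert (Hq : 0 < q) by (unfold q; pose proof (Cmod_ge_0 m'); lra).
 destruct (HO z Hz) as [r [Hr Hb]].
 destruct (Hc (Rmin (Cmod (phi z) / 2) (eps * (Cmod (phi z) * Cmod (phi z)) / q))) as [d1 [Hd1 B1]].
 { pos. }
 destruct (Hm (eps * Cmod (phi z) / 2)) as [d2 [Hd2 B2]]; [nra|].
 exists (Rmin r (Rmin d1 d2)). split; [pos|]. intros h Hh.
 pose proof (Rlt_min_l Hh) as h1. pose proof (Rlt_min_r Hh) as h'.
 pose proof (Rlt_min_l h') as h2. pose proof (Rlt_min_r h') as h3.
 assert (Ez : (z + h - z)%C = h) by ring.
 specialize (B1 (z + h)%C). rewrite Ez in B1. specialize (B1 h2). specialize (B2 h h3).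
 assert (HOh : O (z + h)%C) by (apply Hb; rewrite Ez; exact h1).
 rewrite <- (Hsq z Hz), <- (Hsq _ HOh) in B2.
 set (a := phi (z + h)%C) in *. set (b := phi z) in *.
 pose proof (Rlt_min_r B1) as A2.
 assert (Hs : Cmod b <= Cmod (a + b)).
 { replace (a + b)%C with (2 * b - (b - a))%C by ring.
  eapply Rle_trans; [|apply Cmod_triangle_inv]. rewrite Cmod_mult, Cmod_R, Rabs_right by lra.
  rewrite (Cmod_minus_sym b a). lra. }
 assert (Hsn : (a + b)%C <> 0) by (apply Cmod_gt_0; lra).
 replace (a - b - m' / (2 * b) * h)%C
  with ((a * a - b * b - m' * h) / (a + b) + m' * h * (b - a) / (2 * b * (a + b)))%C by (field; pos).
 le_via Cmod_triangle.
 rewrite !Cmod_div by (try apply Cmult_neq_0; trivial).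
 rewrite !Cmod_mult, Cmod_R, (Rabs_right 2), (Cmod_minus_sym b a) by lra.
 assert (T1 : Cmod (a * a - b * b - m' * h) / Cmod (a + b) <= eps / 2 * Cmod h).
 { apply Rle_trans with (eps * Cmod b / 2 * Cmod h / Cmod b).
  - apply Rmult_le_compat; [lra|pos|lra|].
   apply Rinv_le_contravar; trivial.
  - right. field. lra. }
 assert (T2 : Cmod m' * Cmod h * Cmod (a - b) / (2 * Cmod b * Cmod (a + b)) <= eps / 2 * Cmod h).
 { apply Rle_trans with (q * Cmod h * (eps * (Cmod b * Cmod b) / q) / (2 * Cmod b * Cmod b)).
  - apply Rmult_le_compat.
   + pos.
   + pos.
   + apply Rmult_le_compat; [pos|lra| |lra].
    unfold q. lra.
   + apply Rinv_le_contravar; [nra|]. pos.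
  - right. field. lra. }
 lra.
Qed.

Lemma sqrt_relation (P Q y X : C) : (X * (Q + y) * P)%C = ((P + y) * Q)%C ->
  (y * Q)%C = ((X - 1) * Q * P + X * y * P)%C.
Proof.
 intros H. replace (y * Q)%C with ((P + y) * Q - P * Q)%C by ring. rewrite <- H. ring.
Qed.

(* Two points where a branch of the square root takes nearly opposite values are separated by a
   zero of its real part along the segment joining them, where its square would be negative. *)
Lemma sqrt_branch_away (O : C -> Prop) (phi : C -> C) (k p q z0 z : C) (rho : R) :
  ~ O p -> ~ O q -> (forall w, O w -> ccont phi w) ->
  (forall w, O w -> (phi w * phi w)%C = (k * ((w - p) / (w - q)))%C) ->
  0 < rho -> (forall w, Cmod (w - z0) < rho -> O w) -> Cmod (z0 - p) < 2 * rho ->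
  1000 * Cmod (z0 - p) <= Cmod (z0 - q) -> phi z0 <> 0 -> O z ->
  Cmod (phi z0) / 20 <= Cmod (phi z + phi z0).
Proof.
 intros Hp Hq Hc Hsq Hrho Hball Hd Hdq Hb Hz.
 assert (Hz0 : O z0) by (apply Hball; replace (z0 - z0)%C with (RtoC 0) by ring; rewrite Cmod_0; trivial).
 set (b := phi z0) in *. set (P := (z0 - p)%C) in *. set (Q := (z0 - q)%C) in *.
 assert (HP : P <> 0). { intros E. apply Hp. replace p with z0; trivial. unfold P in E. rewrite <- (Cplus_0_r p), <- E. ring. }
 assert (HQ : forall w, O w -> (w - q)%C <> 0).
 { intros w Hw E. apply Hq. replace q with w; trivial. rewrite <- (Cplus_0_r q), <- E. ring. }
 assert (Hk : (b * b * Q)%C = (k * P)%C).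
 { unfold b. rewrite (Hsq z0 Hz0). unfold P, Q. field. auto. }
 assert (Hrel : forall w, O w -> forall y, w = (z0 + y)%C ->
  (phi w / b * (phi w / b) * (Q + y) * P)%C = ((P + y) * Q)%C).
 { intros w Hw y Ey. assert (E1 : (phi w * phi w * (Q + y))%C = (k * (P + y))%C).
  { rewrite (Hsq w Hw). replace (Q + y)%C with (w - q)%C by (unfold Q; rewrite Ey; ring).
   replace (P + y)%C with (w - p)%C by (unfold P; rewrite Ey; ring). field. auto. }
  replace (phi w / b * (phi w / b) * (Q + y) * P)%C
   with (phi w * phi w * (Q + y) * P / (b * b))%C by (field; pos).
  rewrite E1. replace (k * (P + y) * P)%C with (b * b * Q * (P + y))%C by (rewrite Hk; ring). field; pos. }
 assert (HPp : 0 < Cmod P) by (apply Cmod_gt_0; trivial).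
 assert (Hbp : 0 < Cmod b) by (apply Cmod_gt_0; trivial).
 apply Rnot_lt_le. intros Hlt.
 set (y := (z - z0)%C). assert (Ey : z = (z0 + y)%C) by ceq.
 set (eta := (phi z / b + 1)%C).
 assert (Heta : Cmod eta < / 20).
 { unfold eta. replace (phi z / b + 1)%C with ((phi z + b) / b)%C by (field; pos).
  rewrite Cmod_div by trivial. apply Rmult_lt_reg_r with (Cmod b); trivial. field_simplify; lra. }
 (* If [phi z / b] is within [1 / 20] of [-1], its square is within [41 / 400 = 2 / 20 + 1 / 400] of
    1. The square is a Moebius function of the point, so [z] is close to [z0], and the segment stays
    in the disc of radius [rho > |P| / 2]. *)
 assert (Hy : Cmod y <= 11 / 100 * Cmod P).
 { pose proof (sqrt_relation P Q y _ (Hrel z Hz y Ey)) as R.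
  set (X := (phi z / b * (phi z / b))%C) in *.
  assert (HX : (X - 1)%C = (eta * eta - 2 * eta)%C) by ceq.
  assert (HX1 : Cmod (X - 1) <= 41 / 400).
  { rewrite HX. le_via Cmod_triangle_minus. rewrite !Cmod_mult, Cmod_R, Rabs_right by lra.
   nra. }
  assert (HX2 : Cmod X <= 441 / 400).
  { replace X with (X - 1 + 1)%C by ring. le_via Cmod_triangle. rewrite Cmod_1. lra. }
  assert (R2 : Cmod y * Cmod Q <= 41 / 400 * Cmod Q * Cmod P + 441 / 400 * Cmod y * Cmod P).
  { rewrite <- Cmod_mult, R. le_via Cmod_triangle. rewrite !Cmod_mult.
   apply Rplus_le_compat; (apply Rmult_le_compat_r; [lra|]; apply Rmult_le_compat_r; [lra|]; trivial). }
  nra. }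
 assert (Hseg : forall t, 0 <= t <= 1 -> O (z0 + t * y)%C).
 { intros t Ht. apply Hball. eapply Rle_lt_trans; [apply Cmod_segment; trivial|]. lra. }
 set (F := fun t => - fst (phi (z0 + t * y) / b)%C).
 destruct (Ranalysis5.IVT_interv F 0 1) as [t [Ht E]].
 - intros t Ht. apply (continuity_pt_opp (fun t => fst (phi (z0 + t * y) / b)%C)). apply continuity_pt_filterlim.
  apply (proj1 (ccontR_mult _ _ t (ccont_cder phi (fun t => (z0 + t * y)%C) t y (Hc _ (Hseg t Ht)) (cder_segment z0 y t)) (ccontR_const (/ b)%C t))).
 - lra.
 - unfold F. replace (z0 + 0 * y)%C with z0 by ring. fold b.
  replace (b / b)%C with (RtoC 1) by (field; pos). simpl. lra.
 - unfold F. replace (z0 + 1 * y)%C with z by ceq.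
  pose proof (Re_le_Cmod eta) as Hr. assert (E : fst eta = fst (phi z / b)%C + 1) by reflexivity.
  lra.
 - set (w := (z0 + t * y)%C) in *.
  pose proof (Hrel w (Hseg t Ht) (t * y)%C eq_refl) as R.
  set (s := snd (phi w / b)%C).
  assert (EX : (phi w / b * (phi w / b))%C = RtoC (- (s * s))).
  { assert (E1 : (phi w / b)%C = (0, s)). { apply injective_projections; simpl; [|pos]. unfold F in E. fold w in E. simpl in E. lra. }
   rewrite E1. ceq. }
  rewrite EX in R.
  assert (R1 : (P * Q * RtoC (1 + s * s))%C = (- (t * y * (Q + RtoC (s * s) * P)))%C).
  { replace (P * Q * RtoC (1 + s * s))%C with
    ((P + t * y) * Q - t * y * Q - P * Q * RtoC (- (s * s)))%C
    by ceq.
   rewrite <- R, RtoC_opp. ring. }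
  apply (f_equal Cmod) in R1. rewrite Cmod_opp, !Cmod_mult, !Cmod_R in R1.
  assert (0 <= s * s) by nra. rewrite !Rabs_right in R1 by lra.
  assert (Hle : Cmod (Q + RtoC (s * s) * P)%C <= Cmod Q * (1 + s * s)).
  { le_via Cmod_triangle. rewrite Cmod_mult, Cmod_R, Rabs_right by lra. nra. }
  assert (Hf : t * Cmod y * Cmod (Q + RtoC (s * s) * P)%C <= (11 / 100 * Cmod P) * (Cmod Q * (1 + s * s))).
  { apply Rmult_le_compat; trivial; [pos|lra|]. nra. }
  assert (Hpos : 0 < Cmod P * Cmod Q * (1 + s * s)) by pos. lra.
Qed.

Definition boundary_blowup (O : C -> Prop) (u : C -> R) : Prop :=
  forall w, boundary O w -> forall M, exists delta, 0 < delta /\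
  forall z, O z -> Cmod (z - w) < delta -> M < u z.

(** Each boundary point has an exterior partner at distance at least [rho0] such that the square
    root of the quotient is single valued on [O]. The uniform distance makes the barrier estimates
    independent of the boundary point. *)
Definition sqrt_separated (O : C -> Prop) (rho0 : R) : Prop :=
  0 < rho0 /\ forall p, boundary O p -> exists (q : C) (phi : C -> C) (k : C), k <> 0 /\ ~ O q /\ rho0 <= Cmod (p - q) /\
  (forall z, O z -> ccont phi z) /\
  (forall z, O z -> (phi z * phi z)%C = (k * ((z - p) / (z - q)))%C).

Lemma ln_40_pos : 0 < ln 40.
Proof. rewrite <- ln_1. apply ln_increasing; lra. Qed.

(* The harmonic function [ln |phi + b|] absorbs the deficit of [u] on the circle of radius [r] but only
   half of it at the point [z0], where [phi = b]. *)
Lemma lower_bound_step (O : C -> Prop) (u : C -> R) (rho0 r e : R) : planar_open O -> bounded_set O ->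
  (forall z, O z -> liouville_at u z) -> boundary_blowup O u -> sqrt_separated O rho0 -> 0 < r -> r <= rho0 / 8 ->
  (forall z b, O z -> boundary O b -> Cmod (z - b) <= r -> - ln r + e <= u z) ->
  forall z b, O z -> boundary O b -> Cmod (z - b) <= r / 19683 -> - ln r - / 2 * Rmax 0 (1 - e) <= u z.
Proof.
 intros HO HB Hu Hblow [Hrho0 Hsep] Hr Hrr HS z0 b0 Hz0 Hb0 Hzb.
 destruct (nearly_nearest_boundary O z0 b0 (2 * r / 19683) HO Hz0 (proj1 Hb0)) as [rho [p [Hrho [Hp [Hball [Hd Hdt]]]]]].
 { rewrite Cmod_minus_sym. lra. }
 destruct (Hsep p Hp) as [q [phi [k [Hk [Hq [Hpq [Hc Hsq]]]]]]].
 rewrite (Cmod_minus_sym p z0) in Hd, Hdt. set (d := Cmod (z0 - p)) in *.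
 assert (HzP : forall w, O w -> (w - p)%C <> 0).
 { intros w Hw E. apply (proj1 Hp). replace p with w; trivial. rewrite <- (Cplus_0_r p), <- E. ring. }
 assert (HzQ : forall w, O w -> (w - q)%C <> 0).
 { intros w Hw E. apply Hq. replace q with w; trivial. rewrite <- (Cplus_0_r q), <- E. ring. }
 assert (Hphi : forall w, O w -> phi w <> 0).
 { intros w Hw E. assert (E2 := Hsq w Hw). rewrite E, Cmult_0_l in E2. symmetry in E2. revert E2.
  apply Cmult_neq_0; trivial. apply Cmod_gt_0. rewrite Cmod_div by auto. apply Rdiv_lt_0_compat; apply Cmod_gt_0; auto. }
 set (b := phi z0). assert (Hb : b <> 0) by eauto.
 assert (Hbp : 0 < Cmod b) by (apply Cmod_gt_0; trivial).
 assert (HQ0 : 7 * r <= Cmod (z0 - q)).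
 { pose proof (Cmod_minus_triangle p z0 q) as T. rewrite (Cmod_minus_sym p z0) in T. fold d in T. lra. }
 assert (Haway : forall w, O w -> Cmod b / 20 <= Cmod (phi w + b)).
 { intros w Hw. apply (sqrt_branch_away O phi k p q z0 w rho); trivial; [apply Hp|pos|fold d; lra]. }
 set (h := fun w => (phi w + b)%C).
 assert (Hh0 : forall w, O w -> h w <> 0).
 { intros w Hw. apply Cmod_gt_0. unfold h. specialize (Haway w Hw). lra. }
 assert (Hhol : holomorphic_on O h).
 { intros w Hw. apply C_differentiable_hder. eexists. apply hder_plus; [|apply hder_const].
  eapply (hder_sqrt phi (fun w => (k * ((w - p) / (w - q)))%C) w _ O HO Hw (Hc w Hw) Hsq); [|apply Hphi, Hw].
  apply hder_mult; [apply hder_const|]. apply (hder_div (fun w => (w - p)%C) (fun w => (w - q)%C)); [apply HzQ, Hw| |];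
   apply hder_plus; try apply hder_id; apply hder_const. }
 set (kk := fun w => ln (Cmod (h w)) + - ln (Cmod b / 20)).
 assert (Hkk0 : forall w, O w -> 0 <= kk w).
 { intros w Hw. specialize (Haway w Hw). unfold kk, h.
  pose proof (ln_le (Cmod b / 20) (Cmod (phi w + b)) ltac:(lra) Haway). lra. }
 assert (Hkz : kk z0 = ln 40).
 { unfold kk, h. fold b. replace (b + b)%C with (2 * b)%C by ring. rewrite Cmod_mult, Cmod_R, Rabs_right by lra.
  rewrite <- Rminus_def, <- ln_div by lra. f_equal. field. lra. }
 (* The square of [|phi|] is proportional to the quotient of the distances to [p] and [q]. Since
    [d < 2 * r / 19683] with [19683 = 3^9], it grows from [z0] to the circle by at least
    [6561 = 81^2]; then [|phi + b| >= 80 |b|] and [80 * 20 = 40^2]. *)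
 assert (Hkr : forall w, O w -> Cmod (w - p) = r -> 2 * ln 40 <= kk w).
 { intros w Hw Hwr. assert (H81 : 81 * Cmod b <= Cmod (phi w)).
  { assert (E1 : Cmod (phi w) * Cmod (phi w) = Cmod k * (r / Cmod (w - q))).
   { rewrite <- Cmod_mult, Hsq, Cmod_mult, Cmod_div, Hwr by (try apply HzQ; trivial). easy. }
   assert (E2 : Cmod b * Cmod b = Cmod k * (d / Cmod (z0 - q))).
   { unfold b. rewrite <- Cmod_mult, Hsq, Cmod_mult, Cmod_div by (try apply HzQ; trivial). easy. }
   assert (Hwq : Cmod (w - q) <= 9 / 7 * Cmod (z0 - q)).
   { pose proof (Cmod_minus_triangle w p q). pose proof (Cmod_minus_triangle p z0 q) as T.
    rewrite (Cmod_minus_sym p z0) in T. fold d in T. lra. }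
   assert (Hwq0 : 0 < Cmod (w - q)) by (apply Cmod_gt_0, HzQ, Hw).
   assert (H2 : 6561 * (d / Cmod (z0 - q)) <= r / Cmod (w - q)).
   { apply Rmult_le_reg_r with (Cmod (w - q) * Cmod (z0 - q)); [pos|].
    replace (6561 * (d / Cmod (z0 - q)) * (Cmod (w - q) * Cmod (z0 - q))) with (6561 * d * Cmod (w - q)) by (field; lra).
    replace (r / Cmod (w - q) * (Cmod (w - q) * Cmod (z0 - q))) with (r * Cmod (z0 - q)) by (field; lra). nra. }
   nra. }
  assert (H80 : 80 * Cmod b <= Cmod (h w)).
  { unfold h. replace (phi w + b)%C with (phi w - (- b))%C by ring. pose proof (Cmod_triangle_inv (phi w) (- b)%C) as T.
   rewrite Cmod_opp in T. lra. }
  unfold kk. pose proof (ln_le (80 * Cmod b) (Cmod (h w)) ltac:(lra) H80) as T.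
  replace (2 * ln 40) with (ln (80 * Cmod b) + - ln (Cmod b / 20)); [lra|].
  rewrite <- Rminus_def, <- ln_div by lra. replace (80 * Cmod b / (Cmod b / 20)) with (40 * 40) by (field; lra).
  rewrite ln_mult by lra. ring. }
 pose proof ln_40_pos as H40.
 (* On the circle the harmonic term is then at least [Rmax 0 (1 - e)], which exceeds the deficit
    [- e] of [u] plus the amount [ln (4 / 3)] by which the metric of the disc of radius [2 * r]
    exceeds [- ln r]. *)
 set (K := Rmax 0 (1 - e) / (2 * ln 40)).
 assert (HK : 0 <= K). { apply Rmult_le_pos; [lra|]. pos. }
 set (O' := fun z => O z /\ Cmod (z - p) < r).
 assert (H : forall z, O' z -> (ball_metric p (2 * r) z + - K * kk z) + -1 * u z <= 0).
 { apply max_principle.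
  - intros z [Hz1 Hz2]. destruct (HO z Hz1) as [r1 [Hr1 B1]]. destruct (planar_open_disc p r z Hz2) as [r2 [Hr2 B2]].
   exists (Rmin r1 r2). split; [pos|]. intros w Hw.
   split; [apply B1|apply B2]; (eapply Rlt_le_trans; [exact Hw|]); [lra|lra].
  - destruct HB as [M HM]. exists M. intros z [Hz _]. auto.
  - intros z [Hz1 Hz2]. apply rcont_plus; [apply rcont_plus|apply rcont_scal, Hu, Hz1].
   + apply ball_metric_liouville; lra.
   + apply rcont_scal. apply rcont_plus; [|apply rcont_const]. apply (ln_Cmod_harmonic O h z); trivial.
  - intros bb Hbb eps He.
   assert (Hb1 : Cmod (bb - p) <= r).
   { apply (boundary_closed_limit O' (fun z => Cmod (z - p))); trivial; [apply rcont_dist|]. intros z [_ Hz]. lra. }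
   assert (Hcb : rcont (ball_metric p (2 * r)) bb) by (apply ball_metric_liouville; lra).
   destruct (classic (O bb)) as [HObb|HnO].
   + assert (Hbr : Cmod (bb - p) = r).
    { apply Rle_antisym; trivial. apply Rnot_lt_le. intros Hlt. apply (proj1 Hbb). easy. }
    destruct (rcont_le_0_boundary (fun z => (ball_metric p (2 * r) z + - K * kk z) + -1 * u z) bb) with (eps := eps) as [dl [Hdl Hdb]]; trivial.
    * apply rcont_plus; [apply rcont_plus; trivial|apply rcont_scal, Hu, HObb].
     apply rcont_scal. apply rcont_plus; [|apply rcont_const]. apply (ln_Cmod_harmonic O h bb); trivial.
    * specialize (HS bb p HObb Hp ltac:(lra)). specialize (Hkr bb HObb Hbr).
     assert (EB : ball_metric p (2 * r) bb <= - ln r + / 3).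
     { unfold ball_metric. rewrite ball_quad, Hbr by lra.
      replace ((2 * r * (2 * r) - r * r) / (2 * (2 * r))) with (r * (/ (4 / 3))) by (field; lra).
      rewrite ln_mult by lra. rewrite ln_Rinv by lra.
      pose proof (exp_ineq1_le (/ 3)) as T. assert (ln (4 / 3) <= / 3); [|lra].
      rewrite <- (ln_exp (/ 3)). apply ln_le; lra. }
     assert (EK : K * (2 * ln 40) = Rmax 0 (1 - e)) by (unfold K; field; lra).
     nra.
    * exists dl. split; trivial. intros z _ Hz. apply Hdb, Hz.
   + assert (HbO : boundary O bb).
    { split; trivial. intros r' Hr'. destruct (proj2 Hbb r' Hr') as [z [[Hz _] Hz']]. eauto. }
    destruct (Hcb 1 Rlt_0_1) as [dl1 [Hdl1 D1]].
    destruct (Hblow bb HbO (ball_metric p (2 * r) bb + 1)) as [dl2 [Hdl2 D2]].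
    exists (Rmin dl1 dl2). split; [pos|]. intros z [Hz _] Hzb'.
    specialize (D1 z (Rlt_min_l Hzb')). specialize (D2 z Hz (Rlt_min_r Hzb')).
    assert (0 <= K * kk z) by (apply Rmult_le_pos; auto). lra.
  - intros z [Hz1 Hz2] Hpos.
   destruct (proj2 (Hu z Hz1)) as [a1 [a2 [b1 [b2 [J1 E1]]]]].
   destruct (proj2 (ball_metric_liouville p (2 * r) z ltac:(lra) ltac:(lra))) as [c1 [c2 [e1 [e2 [J2 E2]]]]].
   destruct (proj2 (ln_Cmod_harmonic O h z HO Hhol Hh0 Hz1)) as [m1 [m2 [n1 [n2 [J3 E3]]]]].
   do 4 eexists. split.
   + apply zjet_plus; [apply zjet_plus; [exact J2|]|apply zjet_scal, J1]. apply zjet_scal.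
    apply zjet_plus; [exact J3|apply zjet_const].
   + assert (0 <= K * kk z) by (apply Rmult_le_pos; auto).
    assert (exp (2 * u z) < exp (2 * ball_metric p (2 * r) z)) by (apply exp_increasing; lra).
    nra. }
 assert (HO'0 : O' z0) by (split; [pos|fold d; lra]). specialize (H z0 HO'0). rewrite Hkz in H.
 assert (EK : K * ln 40 = / 2 * Rmax 0 (1 - e)) by (unfold K; field; lra).
 assert (EB : - ln r <= ball_metric p (2 * r) z0).
 { unfold ball_metric. rewrite ball_quad by lra. fold d. apply Ropp_le_contravar. apply ln_le.
  - apply Rdiv_lt_0_compat; [|lra]. nra.
  - apply Rmult_le_reg_r with (2 * (2 * r)); [lra|]. field_simplify; [|lra]. nra. }
 lra.
Qed.

Lemma geometric_bracket (t0 x A : R) : 1 < A -> 0 < x -> x <= t0 -> exists n, t0 / A ^ S n < x <= t0 / A ^ n.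
Proof.
 intros HA Hx Hxt.
 assert (Hp : forall n, 0 < A ^ n) by (intros n; apply pow_lt; lra).
 assert (Hex : exists N, t0 / A ^ N < x).
 { destruct (Pow_x_infinity A ltac:(lra) (t0 / x + 1)) as [N HN]. exists N.
  specialize (HN N (le_n N)). rewrite Rabs_right in HN by pos.
  apply Rmult_lt_reg_r with (A ^ N / x); [pos|].
  specialize (Hp N). replace (t0 / A ^ N * (A ^ N / x)) with (t0 / x) by (field; lra).
  replace (x * (A ^ N / x)) with (A ^ N) by (field; lra). lra. }
 destruct Hex as [N HN]. induction N as [|N IH]; [simpl in HN; lra|].
 destruct (Rlt_dec (t0 / A ^ N) x); [apply IH; trivial|]. exists N. lra.
Qed.

Lemma blowup_bounded_below (O : C -> Prop) (u : C -> R) : bounded_set O ->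
  (forall z, O z -> rcont u z) -> boundary_blowup O u -> exists m, forall z, O z -> m <= u z.
Proof.
 intros [M HM] Hu Hb.
 destruct (disc_compactness (fun A => exists m, forall z, O z -> A z -> m <= u z) 0 M) as [m Hm].
 - intros A B HAB [m Hm]. eauto.
 - intros A B [m1 H1] [m2 H2]. exists (Rmin m1 m2). intros z Hz [HA|HB].
  + le_via Rmin_l; auto.
  + le_via Rmin_r; auto.
 - exists 0. tauto.
 - intros z _. destruct (classic (O z)) as [Hz|Hz].
  + destruct (Hu z Hz 1 Rlt_0_1) as [d [Hd Hdb]]. exists d. split; trivial. exists (u z - 1).
   intros w _ Hw. specialize (Hdb w Hw). lra.
  + destruct (classic (boundary O z)) as [Hbz|Hbz].
   * destruct (Hb z Hbz 0) as [d [Hd Hdb]]. exists d. split; trivial. exists 0. left. auto.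
   * assert (Hex : exists r, 0 < r /\ forall w, O w -> ~ Cmod (w - z) < r).
    { apply NNPP. intros Hn. apply Hbz. split; trivial. intros r Hr. apply NNPP. intros Hn2. apply Hn. exists r. split; trivial. eauto. }
    destruct Hex as [r [Hr Hn]]. exists r. split; trivial. exists 0. intros w Hw Hwr. destruct (Hn w Hw Hwr).
 - exists m. intros z Hz. apply Hm; trivial. replace (z - 0)%C with z by ring. auto.
Qed.

(** One step turns a deficit [E] at scale [r] into [(1 + E) / 2], and measuring it at the scale
    [r / A] instead costs [ln A]. Hence [E >= 2 * ln A + 1] reproduces itself at all scales; the
    other term of the maximum starts the induction. *)
Lemma blowup_log_lower_bound (O : C -> Prop) (u : C -> R) (rho0 : R) : planar_open O -> bounded_set O ->
  (forall z, O z -> liouville_at u z) -> boundary_blowup O u -> sqrt_separated O rho0 ->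
  exists t0 K, 0 < t0 /\ forall z b, O z -> boundary O b -> Cmod (z - b) <= t0 -> - ln (Cmod (z - b)) - K <= u z.
Proof.
 intros HO HB Hu Hbl Hs.
 destruct (blowup_bounded_below O u HB (fun z Hz => proj1 (Hu z Hz)) Hbl) as [m Hm].
 pose proof (proj1 Hs) as Hr0. set (t0 := rho0 / 8). set (A := 19683).
 assert (HlA : 0 < ln A) by (rewrite <- ln_1; apply ln_increasing; unfold A; lra).
 set (E := Rmax (2 * ln A + 1) (- (m + ln t0))).
 assert (HE1 : 2 * ln A + 1 <= E) by apply Rmax_l. assert (HE2 : - (m + ln t0) <= E) by apply Rmax_r.
 assert (Ht0 : 0 < t0) by (unfold t0; lra).
 assert (HA1 : 1 < A) by (unfold A; lra).
 assert (Hp : forall n, 1 <= A ^ n) by (intros n; apply pow_R1_Rle; lra).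
 assert (HS : forall n z b, O z -> boundary O b -> Cmod (z - b) <= t0 / A ^ n -> - ln (t0 / A ^ n) + - E <= u z).
 { induction n as [|n IH]; intros z b Hz Hb Hzb.
  - specialize (Hm z Hz). simpl. replace (t0 / 1) with t0 by field. lra.
  - specialize (Hp n). assert (Hr : 0 < t0 / A ^ n) by pos.
   assert (Hsp : t0 / A ^ S n = t0 / A ^ n / A) by (simpl; field; lra). rewrite Hsp in Hzb |- *.
   assert (Hle : t0 / A ^ n <= t0).
   { apply Rmult_le_reg_r with (A ^ n); [lra|]. unfold Rdiv. rewrite Rmult_assoc, Rinv_l by lra. nra. }
   pose proof (lower_bound_step O u rho0 (t0 / A ^ n) (- E) HO HB Hu Hbl Hs Hr Hle IH z b Hz Hb Hzb) as Hst.
   rewrite ln_div by lra. rewrite Rmax_right in Hst by lra. lra. }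
 exists t0, (E + ln A). split; trivial. intros z b Hz Hb Hzb.
 assert (Hx : 0 < Cmod (z - b)).
 { apply Cmod_gt_0. intros E0. apply (proj1 Hb). replace b with z; trivial. rewrite <- (Cplus_0_r b), <- E0. ring. }
 destruct (geometric_bracket t0 (Cmod (z - b)) A HA1 Hx Hzb) as [n [Hn1 Hn2]].
 specialize (HS n z b Hz Hb Hn2). specialize (Hp n).
 assert (Hl : ln (t0 / A ^ n) - ln A <= ln (Cmod (z - b))).
 { rewrite <- ln_div by lra. apply ln_le; [pos|].
  replace (t0 / A ^ n / A) with (t0 / A ^ S n) by (simpl; field; lra). lra. }
 lra.
Qed.

Section Uniqueness.
Context (beta : R) (Omega : C -> Prop) (f g : C -> C).
Context (Hbeta : 0 < beta < 1) (HO : planar_open Omega) (HBd : bounded_set Omega)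
  (Hf : holomorphic_on Omega f) (Hg : holomorphic_on (annulus beta) g)
  (HfA : forall z, Omega z -> annulus beta (f z)) (HgO : forall w, annulus beta w -> Omega (g w))
  (Hgf : forall z, Omega z -> g (f z) = z) (Hfg : forall w, annulus beta w -> f (g w) = w).

Let x1 := / 2 * ln beta.
Let side (sg x : R) := sg * (x - x1) < 0.

(** By [annular_boundary], [|f|] avoids the middle value [exp x1] near [b], so points on at least
    one side of the loop accumulate there. *)
Lemma boundary_on_some_side (b : C) : boundary Omega b ->
  on_side Omega f (side 1) b \/ on_side Omega f (side (-1)) b.
Proof.
 intros Hb. destruct (classic (on_side Omega f (side 1) b)) as [H1|H1]; [left; trivial|right].
 assert (Hex : exists r, 0 < r /\ forall a, Omega a -> Cmod (a - b) < r -> x1 <= ln (Cmod (f a))).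
 { apply NNPP. intros Hn. apply H1. split; [apply Hb|]. intros r Hr. apply NNPP. intros Hn2. apply Hn. exists r. split; trivial.
  intros a Ha Hab. apply Rnot_lt_le. intros Hlt. apply Hn2. exists a. split; trivial. unfold side. lra. }
 destruct Hex as [r [Hr Hra]].
 pose proof (ln_beta_neg beta Hbeta) as Hl.
 assert (Hx1 : beta < exp x1 < 1).
 { split; [rewrite <- (exp_ln beta) at 1 by lra; apply exp_increasing; unfold x1; lra|].
  rewrite <- exp_0. apply exp_increasing. unfold x1. lra. }
 set (e := Rmin (exp x1 - beta) (1 - exp x1)).
 assert (He : 0 < e) by (apply Rmin_pos; lra).
 pose proof (Rmin_l (exp x1 - beta) (1 - exp x1)) as He1. pose proof (Rmin_r (exp x1 - beta) (1 - exp x1)) as He2. fold e in He1, He2.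
 destruct (annular_boundary beta Omega f g HO Hg HgO Hgf b e Hb He) as [d [Hd Hdb]].
 split; [apply Hb|]. intros r' Hr'.
 destruct (proj2 Hb (Rmin r' (Rmin r d))) as [a [Ha Hab]]; [pos|].
 pose proof (Rlt_min_r Hab) as A2.
 pose proof (Rlt_min_l A2) as A3. pose proof (Rlt_min_r A2) as A4.
 exists a. split; trivial. unfold side. specialize (Hra a Ha A3). destruct (HfA a Ha) as [F1 F2].
 assert (Hge : exp x1 <= Cmod (f a)).
 { rewrite <- (exp_ln (Cmod (f a))) by lra. destruct Hra as [Hra|Hra]; [left; apply exp_increasing, Hra|right; f_equal; exact Hra]. }
 destruct (Hdb a Ha A4) as [D1|D1]; [lra|].
 assert (ln (exp x1) < ln (Cmod (f a))) by (apply ln_increasing; [lra|lra]). rewrite ln_exp in H. lra.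
Qed.

(** A single point is removable: [hs] is harmonic, negative on the side and zero on the loop, and
    the pole of [ln |z - p|] hides the only other boundary point. So
    [ln |z - p| + |z|^2 - C0 - K * hs <= 0] for every [K], which is absurd for large [K]. The term
    [|z|^2], written as [quad 0 0 (-2) 0], makes the Laplacian strictly positive. *)
Lemma two_points_on_side (sg : R) : sg * sg = 1 ->
  exists a b, boundary Omega a /\ boundary Omega b /\ on_side Omega f (side sg) a /\ on_side Omega f (side sg) b /\ a <> b.
Proof.
 apply NNPP. intros Hn. destruct HBd as [M HM].
 assert (Hp : exists p, ~ Omega p /\ forall b, boundary Omega b -> on_side Omega f (side sg) b -> b = p).
 { destruct (classic (exists p, boundary Omega p /\ on_side Omega f (side sg) p)) as [[p [P1 P2]]|Hno].
  - exists p. split; [apply P1|]. intros b B1 B2. apply NNPP. intros Hne. apply Hn. exists b, p. tauto.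
  - exists (RtoC (Rabs M + 1)). split.
   + intros Hc. specialize (HM _ Hc). rewrite Cmod_R in HM. lra.
   + intros b B1 B2. destruct Hno. eauto. }
 destruct Hp as [p [Hp Hpu]].
 set (hs := fun z => sg * (ln (Cmod (f z)) + - x1)).
 assert (HfN : forall z, Omega z -> f z <> 0) by (intros z Hz; apply (annular_neq_0 beta Omega f); trivial).
 assert (Hharm : forall z, Omega z -> rcont hs z /\ exists a1 a2 b1 b2, zjet hs z a1 a2 b1 b2 /\ b1 + b2 = 0).
 { intros z Hz. destruct (ln_Cmod_harmonic Omega f z HO Hf HfN Hz) as [H1 [a1 [a2 [b1 [b2 [J E]]]]]]. split.
  - apply rcont_scal, rcont_plus; [pos|apply rcont_const].
  - do 4 eexists. split; [unfold hs; apply zjet_scal, zjet_plus; [exact J|apply zjet_const]|]. nra. }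
 assert (HzP : forall w, Omega w -> (w - p)%C <> 0).
 { intros w Hw E. apply Hp. replace p with w; trivial. rewrite <- (Cplus_0_r p), <- E. ring. }
 set (O := fun z => Omega z /\ hs z < 0).
 set (C0 := M + Cmod p + M * M).
 assert (Hupper : forall z, Omega z -> ln (Cmod (z - p)) + quad 0 0 (-2) 0 z <= C0).
 { intros z Hz. assert (Ep : 0 < Cmod (z - p)) by (apply Cmod_gt_0, HzP, Hz).
  assert (Hq : quad 0 0 (-2) 0 z = Cmod z * Cmod z) by (rewrite Cmod_sqr; unfold quad, dot; simpl; field).
  specialize (HM z Hz).
  assert (Hl : ln (Cmod (z - p)) <= Cmod (z - p)).
  { pose proof (exp_ineq1_le (ln (Cmod (z - p)))) as T. rewrite exp_ln in T by trivial. lra. }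
  pose proof (Cmod_triangle_minus z p). unfold C0. nra. }
 assert (Hlnp : holomorphic_on Omega (fun z => (z - p)%C)).
 { intros z Hz. apply C_differentiable_hder. eexists. apply hder_plus; [apply hder_id|apply hder_const]. }
 assert (Hall : forall K, 0 < K -> forall z, O z ->
  (ln (Cmod (z - p)) + quad 0 0 (-2) 0 z) + (- C0 + - K * hs z) <= 0).
 { intros K HK. apply max_principle.
  - intros z [Hz1 Hz2]. destruct (HO z Hz1) as [r1 [Hr1 B1]].
   destruct (proj1 (Hharm z Hz1) (- hs z)) as [r2 [Hr2 B2]]; [lra|].
   exists (Rmin r1 r2). split; [pos|]. intros w Hw.
   split; [apply B1; eapply Rlt_le_trans; [exact Hw|lra]|].
   specialize (B2 w (Rlt_min_r Hw)). lra.
  - exists M. intros z [Hz _]. auto.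
  - intros z [Hz _]. apply rcont_plus; [apply rcont_plus; [|apply rcont_quad]|apply rcont_plus; [apply rcont_const|apply rcont_scal, Hharm, Hz]].
   apply (ln_Cmod_harmonic Omega (fun z => (z - p)%C) z HO Hlnp HzP Hz).
  - intros b Hb eps He. destruct (classic (Omega b)) as [HOb|HOb].
   + assert (Hs0 : 0 <= hs b). { apply Rnot_lt_le. intros Hlt. apply (proj1 Hb). easy. }
    assert (Hc : rcont (fun z => (ln (Cmod (z - p)) + quad 0 0 (-2) 0 z) + (- C0 + - K * hs z)) b).
    { apply rcont_plus; [apply rcont_plus; [|apply rcont_quad]|apply rcont_plus; [apply rcont_const|apply rcont_scal, Hharm, HOb]].
     apply (ln_Cmod_harmonic Omega (fun z => (z - p)%C) b HO Hlnp HzP HOb). }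
    destruct (rcont_le_0_boundary _ b Hc) with (eps := eps) as [d [Hd Hdb]]; trivial.
    * specialize (Hupper b HOb). nra.
    * exists d. split; trivial. intros z _. apply Hdb.
   + assert (HbO : boundary Omega b).
    { split; trivial. intros r Hr. destruct (proj2 Hb r Hr) as [z [[Hz _] Hz2]]. eauto. }
    assert (Eb : b = p).
    { apply Hpu; trivial. split; trivial. intros r Hr. destruct (proj2 Hb r Hr) as [z [[Hz Hz1] Hz2]]. eauto. }
    assert (Hdist : forall z, O z -> 0 < Cmod (z - p)) by (intros z [Hz _]; apply Cmod_gt_0, HzP, Hz).
    destruct (neg_ln_blowup (fun z => Cmod (z - p)) b O (M * M - C0 + K * (2 * - ln beta))) as [d [Hd Hdb]].
    * apply rcont_dist.
    * rewrite Eb. replace (p - p)%C with (RtoC 0) by ring. apply Cmod_0.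
    * easy.
    * exists d. split; trivial. intros z Hz Hzb. specialize (Hdb z Hz Hzb).
     assert (Hq : quad 0 0 (-2) 0 z = Cmod z * Cmod z) by (rewrite Cmod_sqr; unfold quad, dot; simpl; field).
     specialize (HM z (proj1 Hz)).
     pose proof (height_range beta Omega f Hbeta HfA z (proj1 Hz)) as Hh. unfold height in Hh.
     assert (Hhs : - hs z <= 2 * - ln beta). { unfold hs, x1. assert (sg = 1 \/ sg = -1) as [->| ->] by nra; lra. }
     nra.
  - intros z [Hz Hz2] _.
   destruct (proj2 (ln_Cmod_harmonic Omega (fun z => (z - p)%C) z HO Hlnp HzP Hz)) as [a1 [a2 [b1 [b2 [J1 E1]]]]].
   destruct (proj2 (Hharm z Hz)) as [c1 [c2 [e1 [e2 [J2 E2]]]]].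
   do 4 eexists. split; [apply zjet_plus; [apply zjet_plus; [exact J1|apply zjet_quad]|apply zjet_plus; [apply zjet_const|apply zjet_scal, J2]]|]. nra. }
 pose proof (ln_beta_neg beta Hbeta) as Hlb.
 set (w0 := RtoC (exp (x1 + sg * (ln beta / 4)))).
 assert (Hcw : Cmod w0 = exp (x1 + sg * (ln beta / 4))).
 { unfold w0. rewrite Cmod_R, Rabs_right; trivial. pos. }
 assert (Hw0 : annulus beta w0).
 { unfold annulus. rewrite Hcw. split.
  - rewrite <- (exp_ln beta) at 1 by lra. apply exp_increasing. unfold x1. nra.
  - rewrite <- exp_0. apply exp_increasing. unfold x1. nra. }
 assert (Hhs0 : hs (g w0) = ln beta / 4).
 { unfold hs. rewrite Hfg, Hcw, ln_exp by trivial. nra. }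
 assert (HOg : O (g w0)) by (split; [auto|lra]).
 set (Q := ln (Cmod (g w0 - p)) + quad 0 0 (-2) 0 (g w0) - C0).
 specialize (Hall ((Rabs Q + 1) / (- ln beta / 4))). specialize (Hall ltac:(pos)).
 specialize (Hall (g w0) HOg). rewrite Hhs0 in Hall.
 replace (- ((Rabs Q + 1) / (- ln beta / 4)) * (ln beta / 4)) with (Rabs Q + 1) in Hall by (field; lra).
 pose proof (Rle_abs (- Q)) as T. rewrite Rabs_Ropp in T. unfold Q in T at 1. lra.
Qed.

(** Of two fixed boundary points on the side of [p], at least one is at distance [rho0] or more from
    [p] and can serve as its partner. *)
Lemma annular_sqrt_separated : exists rho0, sqrt_separated Omega rho0.
Proof.
 destruct (two_points_on_side 1) as [a [b [A1 [B1 [A2 [B2 Hab]]]]]]; [ring|].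
 destruct (two_points_on_side (-1)) as [c [d [A3 [B3 [A4 [B4 Hcd]]]]]]; [ring|].
 assert (Hne : forall x y : C, x <> y -> 0 < Cmod (x - y)).
 { intros x y Hxy. apply Cmod_gt_0. intros E. apply Hxy. rewrite <- (Cplus_0_r y), <- E. ring. }
 set (rho0 := Rmin (Cmod (a - b)) (Cmod (c - d)) / 2).
 assert (Hrho0 : 0 < rho0) by (unfold rho0; pose proof (Rmin_pos _ _ (Hne a b Hab) (Hne c d Hcd)); lra).
 assert (R1 : 2 * rho0 <= Cmod (a - b)) by (unfold rho0; pose proof (Rmin_l (Cmod (a - b)) (Cmod (c - d))); lra).
 assert (R2 : 2 * rho0 <= Cmod (c - d)) by (unfold rho0; pose proof (Rmin_r (Cmod (a - b)) (Cmod (c - d))); lra).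
 assert (Hfar : forall x y p : C, 2 * rho0 <= Cmod (x - y) -> rho0 <= Cmod (p - x) \/ rho0 <= Cmod (p - y)).
 { intros x y p Hxy.
  pose proof (Cmod_minus_triangle x p y) as T. rewrite (Cmod_minus_sym x p) in T. lra. }
 pose proof (ln_beta_neg beta Hbeta) as Hlb.
 assert (Hmain : forall sg p q, sg * sg = 1 -> on_side Omega f (side sg) p -> on_side Omega f (side sg) q -> rho0 <= Cmod (p - q) ->
  exists (q : C) (phi : C -> C) (k : C), k <> 0 /\ ~ Omega q /\ rho0 <= Cmod (p - q) /\
  (forall z, Omega z -> ccont phi z) /\
  (forall z, Omega z -> (phi z * phi z)%C = (k * ((z - p) / (z - q)))%C)).
 { intros sg p q Hsg Hp Hq Hpq.
  destruct (continuous_sqrt_quotient beta Omega f g Hbeta HO Hf Hg HfA HgO Hgf Hfg x1 ltac:(unfold x1; lra) (side sg)) with (p := p) (q := q)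
   as [phi [k [K1 [K2 K3]]]]; trivial.
  - intros x y t Hx Hy Ht. unfold side in *. destruct (Req_dec t 0) as [->|Ht0].
   + lra.
   +
    nra.
  - unfold side. lra.
  - exists q, phi, k. split; trivial. split; [apply Hq|]. auto. }
 exists rho0. split; trivial. intros p Hp. destruct (boundary_on_some_side p Hp) as [Hs|Hs].
 - destruct (Hfar a b p R1); [apply (Hmain 1 p a)|apply (Hmain 1 p b)]; trivial; ring.
 - destruct (Hfar c d p R2); [apply (Hmain (-1) p c)|apply (Hmain (-1) p d)]; trivial; ring.
Qed.

End Uniqueness.

(** * Uniqueness of the blow-up solution *)

Lemma one_minus_exp_neg_lower (w : R) : 0 <= w -> 2 * w / (1 + 2 * w) <= 1 - exp (- (2 * w)).
Proof.
 intros Hw. rewrite exp_Ropp. pose proof (exp_ineq1_le (2 * w)) as T.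
 assert (/ exp (2 * w) <= / (1 + 2 * w)) by (apply Rinv_le_contravar; lra).
 replace (2 * w / (1 + 2 * w)) with (1 - / (1 + 2 * w)) by (field; lra). lra.
Qed.

Lemma jet_exp_scal (q t : R) : jet (fun t => exp (q * t)) t (q * exp (q * t)) (q * q * exp (q * t)).
Proof.
 exists (fun t => q * exp (q * t)). split; [|split; [lra|]].
 - exists 1. split; [lra|]. intros s _. auto_derive; trivial; ring.
 - auto_derive; trivial; ring.
Qed.

Section UniquenessMain.
Context (beta : R) (Omega : C -> Prop) (f g : C -> C).
Context (Hbeta : 0 < beta < 1) (HO : planar_open Omega) (HBd : bounded_set Omega)
  (Hf : holomorphic_on Omega f) (Hg : holomorphic_on (annulus beta) g)
  (HfA : forall z, Omega z -> annulus beta (f z)) (HgO : forall w, annulus beta w -> Omega (g w))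
  (Hgf : forall z, Omega z -> g (f z) = z) (Hfg : forall w, annulus beta w -> f (g w) = w).

(** Both metrics are [- ln d] up to bounded terms near the boundary: the annulus metric from above
    by a disc inside the domain, [u] from below by the logarithmic bound. *)
Lemma annulus_metric_minus_blowup_bounded (u : C -> R) : (forall z, Omega z -> liouville_at u z) -> boundary_blowup Omega u ->
  exists N, 0 <= N /\ forall z, Omega z -> strip_metric f (PI / - ln beta) 0 z - u z <= N.
Proof.
 intros Hu Hb.
 destruct (annular_sqrt_separated beta Omega f g Hbeta HO HBd Hf Hg HfA HgO Hgf Hfg) as [rho0 Hs].
 destruct (blowup_log_lower_bound Omega u rho0 HO HBd Hu Hb Hs) as [t0 [K [Ht0 HK]]].
 destruct (blowup_bounded_below Omega u HBd (fun z Hz => proj1 (Hu z Hz)) Hb) as [m Hm].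
 set (N := Rmax 0 (Rmax (ln 8 + K) (ln (8 / t0) - m))).
 assert (N1 : 0 <= N) by apply Rmax_l.
 assert (N2 : ln 8 + K <= N) by (eapply Rle_trans; [apply Rmax_l|apply Rmax_r]).
 assert (N3 : ln (8 / t0) - m <= N) by (eapply Rle_trans; [apply Rmax_r|apply Rmax_r]).
 exists N. split; trivial. intros z Hz. destruct HBd as [M HM].
 assert (HnO : ~ Omega (RtoC (Rabs M + 1))).
 { intros Hc. specialize (HM _ Hc). rewrite Cmod_R in HM. lra. }
 destruct (nearly_nearest_boundary Omega z (RtoC (Rabs M + 1)) (Cmod (RtoC (Rabs M + 1) - z)%C + 1) HO Hz HnO) as [rho [p [R1 [R2 [R3 [R4 R5]]]]]]; [lra|].
 assert (Hle : strip_metric f (PI / - ln beta) 0 z <= ln (4 / rho)).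
 { apply liouville_le_ball; trivial. intros w Hw. apply (annulus_metric_liouville beta Omega f g); auto. }
 rewrite Cmod_minus_sym in R4. set (d := Cmod (z - p)) in *.
 assert (Hl2 : ln (4 / rho) <= ln (8 / d)).
 { apply ln_le; [pos|]. apply Rmult_le_reg_r with (rho * d); [pos|].
  field_simplify; [|lra|lra]. lra. }
 destruct (Rle_dec d t0) as [Hd|Hd].
 - specialize (HK z p Hz R2 Hd). fold d in HK. rewrite (ln_div 8 d) in Hl2 by lra. lra.
 - assert (ln (8 / d) <= ln (8 / t0)).
  { apply ln_le; [pos|]. apply Rmult_le_compat_l; [lra|]. apply Rinv_le_contravar; lra. }
  specialize (Hm z Hz). lra.
Qed.

(** Near the boundary the angle in the sine is close to 0 or [PI], and the sine is smaller than the
    distance to that end. *)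
Lemma strip_profile_blowup (M : R) (b : C) : boundary Omega b -> exists d, 0 < d /\ forall z, Omega z -> Cmod (z - b) < d ->
  M < - ln (sin (PI / - ln beta * (height f z - 0)) / (PI / - ln beta)).
Proof.
 intros Hb. pose proof (ln_beta_neg beta Hbeta) as Hl. set (a := PI / - ln beta).
 assert (Ha : 0 < a) by (apply Rdiv_lt_0_compat; lra).
 set (eta := Rmin (exp (- M)) (- ln beta / 2)).
 assert (Heta : 0 < eta) by (apply Rmin_pos; [lra|lra]).
 assert (He1 : eta <= exp (- M)) by apply Rmin_l.
 assert (Hb1 : beta < beta * exp eta).
 { rewrite <- (Rmult_1_r beta) at 1. apply Rmult_lt_compat_l; [lra|]. rewrite <- exp_0. apply exp_increasing, Heta. }
 assert (Hb2 : exp (- eta) < 1) by (rewrite <- exp_0; apply exp_increasing; lra).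
 set (e := Rmin (beta * exp eta - beta) (1 - exp (- eta))).
 assert (E1 : e <= beta * exp eta - beta) by apply Rmin_l. assert (E2 : e <= 1 - exp (- eta)) by apply Rmin_r.
 destruct (annular_boundary beta Omega f g HO Hg HgO Hgf b e Hb) as [d [Hd Hdb]]; [apply Rmin_pos; lra|].
 exists d. split; trivial. intros z Hz Hzb. specialize (Hdb z Hz Hzb).
 pose proof (strip_range beta Omega f Hbeta HfA z Hz) as Hr. fold a in Hr.
 unfold height in *. destruct (HfA z Hz) as [F1 F2].
 set (X := - ln (Cmod (f z))) in *.
 assert (Hs : 0 < sin (a * (X - 0)) / a) by (apply Rdiv_lt_0_compat; trivial; apply sin_gt_0; lra).
 assert (Hlt : sin (a * (X - 0)) / a < exp (- M)).
 { apply Rmult_lt_reg_r with a; trivial. replace (sin (a * (X - 0)) / a * a) with (sin (a * (X - 0))) by (field; lra).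
  destruct Hdb as [D|D].
  - assert (Hln : ln (Cmod (f z)) < ln beta + eta).
   { rewrite <- (ln_exp eta), <- ln_mult by lra. apply ln_increasing; lra. }
   rewrite <- sin_PI_x. apply Rlt_trans with (PI - a * (X - 0)); [apply sin_lt_x; lra|].
   replace PI with (a * - ln beta) at 1 by (unfold a; field; lra). unfold X. nra.
  - assert (Hln : - eta < ln (Cmod (f z))).
   { rewrite <- (ln_exp (- eta)). apply ln_increasing; [lra|lra]. }
   apply Rlt_trans with (a * (X - 0)); [apply sin_lt_x; lra|]. unfold X. nra. }
 assert (ln (sin (a * (X - 0)) / a) < - M); [|lra]. rewrite <- (ln_exp (- M)). apply ln_increasing; trivial.
Qed.

(* A small negative power of the strip density is a supersolution of the equation
   satisfied by the bounded difference of the two metrics, and is infinite on the boundary. *)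
Lemma annulus_metric_unique (u : C -> R) : (forall z, Omega z -> liouville_at u z) -> boundary_blowup Omega u ->
  forall z, Omega z -> u z = strip_metric f (PI / - ln beta) 0 z.
Proof.
 intros Hu Hb.
 assert (Hup := liouville_le_annulus_metric beta Omega f g Hbeta HO HBd Hf Hg HfA HgO Hgf u Hu).
 destruct (annulus_metric_minus_blowup_bounded u Hu Hb) as [N [HN0 HN]].
 pose proof (ln_beta_neg beta Hbeta) as Hl.
 assert (Ha : 0 < PI / - ln beta) by pos.
 pose proof (strip_profile_blowup) as Hbl.
 pose proof (strip_range beta Omega f Hbeta HfA) as Hrange.
 pose proof (annulus_metric_liouville beta Omega f g Hbeta HO Hf Hg HfA Hgf) as HuO.
 (* With [q = 1 / (2 + 2 N)] and [0 <= w <= N], the rate [(q + q * q) * w <= 2 * q * w] is at most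
    [2 * w / (1 + 2 * w) <= 1 - exp (- 2 w)]: the power of the density grows slowly enough to be
    absorbed by the nonlinearity. *)
 set (a := PI / - ln beta) in *. set (q := / (2 + 2 * N)).
 assert (Hq : 0 < q) by (apply Rinv_0_lt_compat; lra).
 assert (Hq1 : q <= 1) by (rewrite <- Rinv_1; apply Rinv_le_contravar; lra).
 set (s := fun t => - ln (sin (a * (t - 0)) / a)).
 set (psi := fun z => exp (q * s (height f z))).
 set (uO := strip_metric f a 0) in *.
 assert (Hjet : forall z, Omega z -> rcont psi z /\ exists c1 c2 b1 b2, zjet psi z c1 c2 b1 b2 /\ b1 + b2 <= exp (2 * uO z) * (q + q * q) * psi z).
 { intros z Hz. pose proof (jet_strip_profile a 0 (height f z) Ha (Hrange z Hz)) as J1.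
  pose proof (jet_comp (fun t => exp (q * t)) s (height f z) _ _ _ _ J1 (jet_exp_scal q _)) as J2.
  split.
  - apply (rcont_comp (fun t => exp (q * s t))); [apply (rcont_height beta Omega); trivial|].
   eapply is_derive_cont, jet_is_derive, J2.
  - pose proof (zjet_comp _ _ _ _ _ _ _ _ _ (zjet_height beta Omega f Hbeta HO Hf HfA z Hz) J2) as J3.
   do 4 eexists. split; [exact J3|].
   fold (psi z).
   assert (HS : 0 < sin (a * (height f z - 0))) by (apply sin_gt_0; apply Hrange; trivial).
   assert (HC := sin2_cos2 (a * (height f z - 0))). unfold Rsqr in HC.
   set (S := sin (a * (height f z - 0))) in *. set (Co := cos (a * (height f z - 0))) in *.
   assert (Hp : 0 < Cmod (logder f z)) by (apply Cmod_gt_0, (logder_neq_0 beta Omega f g); trivial).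
   assert (EuO : exp (2 * uO z) = a * a / (S * S) * (Cmod (logder f z) * Cmod (logder f z))).
   { unfold uO, strip_metric. fold S. replace (2 * (- ln (S / a) + ln (Cmod (logder f z)))) with
     (- ln (S / a) + ln (Cmod (logder f z)) + (- ln (S / a) + ln (Cmod (logder f z)))) by ring.
    rewrite !exp_plus, exp_Ropp, !exp_ln by pos. field; pos. }
   rewrite EuO, Cmod_sqr. set (px := fst (logder f z)). set (py := snd (logder f z)).
   assert (Hpsi : 0 < psi z) by apply exp_pos. set (ps := psi z) in *.
   match goal with |- ?l <= ?r => replace l with (a * a / (S * S) * (px * px + py * py) * ps * (q + q * q * (Co * Co))) by (field; lra);
    replace r with (a * a / (S * S) * (px * px + py * py) * ps * (q + q * q)) by ring end.
   apply Rmult_le_compat_l; [|nra]. pos. }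
 assert (Hmax : forall eps, 0 < eps -> forall z, Omega z -> (uO z + -1 * u z) + - eps * psi z <= 0).
 { intros eps Heps. apply max_principle; trivial.
  - intros z Hz. apply rcont_plus; [apply rcont_plus; [apply HuO, Hz|apply rcont_scal, Hu, Hz]|apply rcont_scal, Hjet, Hz].
  - intros b Hbb e He.
   destruct (Hbl (ln ((N + 1) / eps) / q) b Hbb) as [d [Hd Hdb]]. exists d. split; trivial. intros z Hz Hzb.
   specialize (Hdb z Hz Hzb). specialize (HN z Hz).
   assert (Hps : (N + 1) / eps < psi z).
   { rewrite <- (exp_ln ((N + 1) / eps)) by pos. unfold psi, s. apply exp_increasing.
    apply Rmult_lt_reg_r with (/ q); [pos|].
    replace (q * - ln (sin (a * (height f z - 0)) / a) * / q) with (- ln (sin (a * (height f z - 0)) / a)) by (field; lra). lra. }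
   apply (Rmult_lt_compat_l eps) in Hps; trivial. replace (eps * ((N + 1) / eps)) with (N + 1) in Hps by (field; lra). lra.
  - intros z Hz Hpos.
   destruct (proj2 (Hu z Hz)) as [a1 [a2 [b1 [b2 [J1 E1]]]]].
   destruct (proj2 (HuO z Hz)) as [c1 [c2 [e1 [e2 [J2 E2]]]]].
   destruct (proj2 (Hjet z Hz)) as [m1 [m2 [n1 [n2 [J3 E3]]]]].
   do 4 eexists. split; [apply zjet_plus; [apply zjet_plus; [exact J2|apply zjet_scal, J1]|apply zjet_scal, J3]|].
   set (w := uO z - u z). assert (Hw : eps * psi z < w) by (unfold w; lra).
   assert (Hps : 0 < psi z) by apply exp_pos.
   assert (Hep : 0 < eps * psi z) by pos.
   assert (HwN : w <= N) by eauto.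
   pose proof (one_minus_exp_neg_lower w ltac:(lra)) as HL.
   assert (EX : exp (2 * u z) = exp (2 * uO z) * exp (- (2 * w))) by (rewrite <- exp_plus; f_equal; unfold w; ring).
   assert (Hkey : (q + q * q) * (eps * psi z) < 1 - exp (- (2 * w))).
   { apply Rlt_le_trans with (2 * w / (1 + 2 * w)); trivial.
    apply Rlt_le_trans with (q * (2 * w)); [assert (q * q <= q) by nra; assert (q * (eps * psi z) < q * w) by pos; nra|]. unfold Rdiv. rewrite (Rmult_comm (2 * w)).
    apply Rmult_le_compat_r; [lra|]. apply Rinv_le_contravar; lra. }
   nra. }
 intros z Hz. apply Rle_antisym; [apply Hup, Hz|]. apply Rnot_lt_le. intros Hlt.
 assert (Hps : 0 < psi z) by apply exp_pos.
 specialize (Hmax ((uO z - u z) / (2 * psi z))).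
 assert (Hp : 0 < (uO z - u z) / (2 * psi z)) by pos.
 specialize (Hmax Hp z Hz). replace (- ((uO z - u z) / (2 * psi z)) * psi z) with (- (uO z - u z) / 2) in Hmax by (field; lra). lra.
Qed.

End UniquenessMain.

(** * Arc length and collar of the outer curve *)

Lemma real_mean_value (h h' : R -> R) (a b B : R) :
  (forall t, Rmin a b <= t <= Rmax a b -> is_derive h t (h' t)) ->
  (forall t, Rmin a b <= t <= Rmax a b -> Rabs (h' t) <= B) -> Rabs (h b - h a) <= B * Rabs (b - a).
Proof.
 intros H1 H2. destruct (MVT_gen h a b h') as [c [Hc E]].
 - intros x Hx. apply H1. lra.
 - intros x Hx. apply continuity_pt_filterlim, (is_derive_cont h x (h' x)), H1, Hx.
 - rewrite E, Rabs_mult. apply Rmult_le_compat_r; [lra|apply H2, Hc].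
Qed.

Lemma curve_mean_value (c c' : R -> C) (a b B : R) :
  (forall t, Rmin a b <= t <= Rmax a b -> cder c t (c' t)) ->
  (forall t, Rmin a b <= t <= Rmax a b -> Cmod (c' t) <= B) -> Cmod (c b - c a) <= 2 * B * Rabs (b - a).
Proof.
 intros H1 H2. le_via Cmod_le_sum.
 assert (E1 : Rabs (fst (c b) - fst (c a)) <= B * Rabs (b - a)).
 { apply (real_mean_value (fun t => fst (c t)) (fun t => fst (c' t))); intros t Ht; [apply H1, Ht|].
  eapply Rle_trans; [apply Re_le_Cmod|apply H2, Ht]. }
 assert (E2 : Rabs (snd (c b) - snd (c a)) <= B * Rabs (b - a)).
 { apply (real_mean_value (fun t => snd (c t)) (fun t => snd (c' t))); intros t Ht; [apply H1, Ht|].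
  eapply Rle_trans; [apply Im_le_Cmod|apply H2, Ht]. }
 replace (Rabs (fst (c b - c a)%C) + Rabs (snd (c b - c a)%C)) with
  (Rabs (fst (c b) - fst (c a)) + Rabs (snd (c b) - snd (c a))) by reflexivity. lra.
Qed.

Lemma Rabs_le_of_between (a b t : R) : Rmin a b <= t <= Rmax a b -> Rabs (t - a) <= Rabs (b - a).
Proof.
 unfold Rmin, Rmax. destruct (Rle_dec a b); intros Ht.
 - lra.
 - lra.
Qed.

Lemma period_reduce (L s : R) : 0 < L -> exists k : Z, 0 <= s - IZR k * L < L.
Proof.
 destruct (archimed (s / L)) as [A1 A2]. exists (up (s / L) - 1)%Z. rewrite minus_IZR.
 set (q := s / L) in *. assert (E : s = q * L) by (unfold q; field; lra). nra.
Qed.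

Lemma period_Z {T : Type} (h : R -> T) (L : R) : (forall s, h (s + L) = h s) -> forall (k : Z) s, h (s - IZR k * L) = h s.
Proof.
 intros H.
 assert (Hn : forall (k : nat) s, h (s + INR k * L) = h s).
 { induction k as [|k IH]; intros s; [simpl; f_equal; ring|]. rewrite S_INR.
  replace (s + (INR k + 1) * L) with ((s + INR k * L) + L) by ring. rewrite H. pos. }
 intros k s. destruct (Z_le_dec 0 k) as [Hk|Hk].
 - rewrite <- (Hn (Z.to_nat k) (s - IZR k * L)). rewrite INR_IZR_INZ, Z2Nat.id by lia. f_equal. ring.
 - rewrite <- (Hn (Z.to_nat (- k)) s). rewrite INR_IZR_INZ, Z2Nat.id by lia. rewrite opp_IZR. f_equal. ring.
Qed.

Lemma periodic_bounded_by (h : R -> R) (L B : R) : 0 < L -> (forall s, h (s + L) = h s) ->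
  (forall s, 0 <= s < L -> Rabs (h s) <= B) -> forall s, Rabs (h s) <= B.
Proof.
 intros HL Hp H s. destruct (period_reduce L s HL) as [k Hk]. rewrite <- (period_Z h L Hp k s). auto.
Qed.

Definition tangent (g : R -> C) (s : R) : C := (Derive (gx g) s, Derive (gy g) s).

Section ArcLength.
Context (gam : R -> C) (L alpha : R) (Ha : 0 < alpha < 1) (HJ : C3alpha_jordan_arclength gam L alpha).

Lemma length_pos : 0 < L.
Proof. apply HJ. Qed.

Lemma gamma_period (s : R) : gam (s + L) = gam s.
Proof. apply HJ. Qed.

Lemma Derive_n_period (h : R -> R) (n : nat) : (forall s, h (s + L) = h s) -> forall s, Derive_n h n (s + L) = Derive_n h n s.
Proof. intros H s. rewrite <- Derive_n_comp_trans. apply Derive_n_ext, H. Qed.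

Lemma tangent_period (s : R) : tangent gam (s + L) = tangent gam s.
Proof.
 unfold tangent. f_equal.
 - apply (Derive_n_period (gx gam) 1). intros t. unfold gx. rewrite gamma_period. easy.
 - apply (Derive_n_period (gy gam) 1). intros t. unfold gy. rewrite gamma_period. easy.
Qed.

Lemma normal_period (s : R) : left_normal gam (s + L) = left_normal gam s.
Proof. pose proof (tangent_period s) as H. injection H as H1 H2. unfold left_normal. rewrite H1, H2. easy. Qed.

Lemma curvature_period (s : R) : curvature gam (s + L) = curvature gam s.
Proof.
 pose proof (tangent_period s) as H. injection H as H1 H2. unfold curvature. rewrite H1, H2.
 rewrite (Derive_n_period (gx gam) 2), (Derive_n_period (gy gam) 2); trivial; intros t; unfold gx, gy; rewrite gamma_period; reflexivity.
Qed.

Lemma unit_speed (s : R) : Derive (gx gam) s * Derive (gx gam) s + Derive (gy gam) s * Derive (gy gam) s = 1.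
Proof. rewrite <- (proj1 (proj2 (proj2 (proj2 HJ))) s). ring. Qed.

Lemma Cmod_tangent (s : R) : Cmod (tangent gam s) = 1.
Proof.
 pose proof (Cmod_sqr (tangent gam s)) as E. simpl in E. rewrite unit_speed in E. nra.
Qed.

Lemma normal_eq (s : R) : left_normal gam s = (Ci * tangent gam s)%C.
Proof. apply injective_projections; simpl; ring. Qed.

Lemma Cmod_normal (s : R) : Cmod (left_normal gam s) = 1.
Proof. rewrite normal_eq, Cmod_mult, Cmod_tangent. unfold Ci, Cmod; simpl. replace (0 * (0 * 1) + 1 * (1 * 1)) with 1 by ring. rewrite sqrt_1. ring. Qed.

Lemma is_derive_gamma1 (h : R -> R) : is_C3alpha h alpha -> forall s, is_derive h s (Derive h s).
Proof. intros [H _] s. apply Derive_correct, H. Qed.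

Lemma is_derive_gamma2 (h : R -> R) : is_C3alpha h alpha -> forall s, is_derive (Derive h) s (Derive_n h 2 s).
Proof. intros [_ [H _]] s. apply (Derive_correct (Derive_n h 1)), H. Qed.

Lemma is_derive_gamma3 (h : R -> R) : is_C3alpha h alpha -> forall s, is_derive (Derive_n h 2) s (Derive_n h 3 s).
Proof. intros [_ [_ [H _]]] s. apply (Derive_correct (Derive_n h 2)), H. Qed.

Lemma Hx3 : is_C3alpha (gx gam) alpha. Proof. apply HJ. Qed.
Lemma Hy3 : is_C3alpha (gy gam) alpha. Proof. apply HJ. Qed.

Lemma cder_gamma (s : R) : cder gam s (tangent gam s).
Proof. split; [apply (is_derive_gamma1 (gx gam) Hx3)|apply (is_derive_gamma1 (gy gam) Hy3)]. Qed.

Lemma accel_orth (s : R) : Derive (gx gam) s * Derive_n (gx gam) 2 s + Derive (gy gam) s * Derive_n (gy gam) 2 s = 0.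
Proof.
 assert (H1 : is_derive (fun s : R => Derive (gx gam) s * Derive (gx gam) s + Derive (gy gam) s * Derive (gy gam) s) s
  (2 * (Derive (gx gam) s * Derive_n (gx gam) 2 s + Derive (gy gam) s * Derive_n (gy gam) 2 s))).
 { pose proof (is_derive_gamma2 _ Hx3 s) as D1. pose proof (is_derive_gamma2 _ Hy3 s) as D2.
  der. ring. }
 assert (H2 : is_derive (fun s : R => Derive (gx gam) s * Derive (gx gam) s + Derive (gy gam) s * Derive (gy gam) s) s 0).
 { apply (is_derive_ext (fun _ => 1)); [intros t; symmetry; apply unit_speed|]. apply (is_derive_const 1). }
 pose proof (is_derive_unique _ _ _ H1) as E1. pose proof (is_derive_unique _ _ _ H2) as E2. lra.
Qed.

Lemma accel_x (s : R) : Derive_n (gx gam) 2 s = - curvature gam s * Derive (gy gam) s.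
Proof. pose proof (accel_orth s) as E. pose proof (unit_speed s) as U. unfold curvature.
 set (x := Derive (gx gam) s) in *. set (y := Derive (gy gam) s) in *. set (X := Derive_n (gx gam) 2 s) in *. set (Y := Derive_n (gy gam) 2 s) in *.
 transitivity (X * (x * x + y * y)); [rewrite U; ring|]. replace (X * (x * x + y * y)) with ((x * X + y * Y) * x - (x * Y - y * X) * y) by ring. rewrite E. ring. Qed.

Lemma accel_y (s : R) : Derive_n (gy gam) 2 s = curvature gam s * Derive (gx gam) s.
Proof. pose proof (accel_orth s) as E. pose proof (unit_speed s) as U. unfold curvature.
 set (x := Derive (gx gam) s) in *. set (y := Derive (gy gam) s) in *. set (X := Derive_n (gx gam) 2 s) in *. set (Y := Derive_n (gy gam) 2 s) in *.
 transitivity (Y * (x * x + y * y)); [rewrite U; ring|]. replace (Y * (x * x + y * y)) with ((x * X + y * Y) * y + (x * Y - y * X) * x) by ring. rewrite E. ring. Qed.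

Lemma cder_tangent (s : R) : cder (tangent gam) s (RtoC (curvature gam s) * left_normal gam s)%C.
Proof.
 split; simpl.
 - evar_last; [apply (is_derive_gamma2 _ Hx3)|]. rewrite accel_x. ring.
 - evar_last; [apply (is_derive_gamma2 _ Hy3)|]. rewrite accel_y. ring.
Qed.

Lemma cder_normal (s : R) : cder (left_normal gam) s (RtoC (- curvature gam s) * tangent gam s)%C.
Proof.
 pose proof (cder_tangent s) as [H1 H2]. split; simpl in *.
 - der. ring.
 - evar_last; [exact H1|]. ring.
Qed.

(** The Hoelder condition compares each value on one period with the value at 0. *)
Lemma third_derivative_bounded (h : R -> R) : is_C3alpha h alpha -> (forall s, h (s + L) = h s) ->
  exists B, 0 <= B /\ forall s, Rabs (Derive_n h 3 s) <= B.
Proof.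
 intros [_ [_ [_ [H HH]]]] Hp. pose proof length_pos as HL.
 exists (Rabs (Derive_n h 3 0) + Rabs H * Rpower L alpha).
 split. { assert (0 <= Rabs H * Rpower L alpha); [|lra]. apply Rmult_le_pos; [lra|left; apply exp_pos]. }
 apply (periodic_bounded_by _ L); trivial; [apply Derive_n_period; trivial|].
 intros s Hs. destruct (Req_dec s 0) as [->|Hs0].
 { assert (0 <= Rabs H * Rpower L alpha); [|lra]. apply Rmult_le_pos; [lra|left; apply exp_pos]. }
 specialize (HH s 0 Hs0).
 assert (H * Rpower (Rabs (s - 0)) alpha <= Rabs H * Rpower L alpha); [|lra].
 eapply Rle_trans; [apply Rmult_le_compat_r; [left; apply exp_pos|apply Rle_abs]|].
 apply Rmult_le_compat_l; [lra|]. apply Rle_Rpower_l; [lra|]. pos.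
Qed.

Lemma is_derive_curvature (s : R) : is_derive (curvature gam) s
  (Derive (gx gam) s * Derive_n (gy gam) 3 s - Derive (gy gam) s * Derive_n (gx gam) 3 s).
Proof.
 pose proof (is_derive_gamma2 _ Hx3 s) as D1. pose proof (is_derive_gamma2 _ Hy3 s) as D2.
 pose proof (is_derive_gamma3 _ Hx3 s) as E1. pose proof (is_derive_gamma3 _ Hy3 s) as E2.
 unfold curvature. der. ring.
Qed.

Lemma curvature_bounds : exists M, 1 <= M /\ (forall s, Rabs (curvature gam s) <= M) /\
  (forall s t, Rabs (curvature gam s - curvature gam t) <= M * Rabs (s - t)).
Proof.
 pose proof length_pos as HL.
 destruct (third_derivative_bounded (gx gam) Hx3) as [B1 [HB1 H1]]; [intros t; unfold gx; rewrite gamma_period; reflexivity|].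
 destruct (third_derivative_bounded (gy gam) Hy3) as [B2 [HB2 H2]]; [intros t; unfold gy; rewrite gamma_period; reflexivity|].
 set (B := B1 + B2).
 assert (Hlip : forall s t, Rabs (curvature gam s - curvature gam t) <= B * Rabs (s - t)).
 { intros s t. apply (real_mean_value (curvature gam) (fun s => Derive (gx gam) s * Derive_n (gy gam) 3 s - Derive (gy gam) s * Derive_n (gx gam) 3 s)).
  - intros r _. apply is_derive_curvature.
  - intros r _. pose proof (unit_speed r) as U. specialize (H1 r). specialize (H2 r).
   assert (U1 : Rabs (Derive (gx gam) r) <= 1) by nra.
   assert (U2 : Rabs (Derive (gy gam) r) <= 1) by nra.
   le_via Rabs_triang. rewrite Rabs_Ropp, !Rabs_mult.
   unfold B. nra. }
 assert (HB : 0 <= B) by (unfold B; lra).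
 exists (1 + B + (Rabs (curvature gam 0) + B * L)).
 assert (0 <= B * L) by nra.
 split; [lra|]. split.
 - apply (periodic_bounded_by _ L); trivial; [apply curvature_period|].
  intros s Hs. specialize (Hlip s 0).
  rewrite (Rabs_right (s - 0)) in Hlip by lra. nra.
 - intros s t. le_via Hlip. pos.
Qed.

Lemma taylor_bounds : exists G, 1 <= G /\ (forall s, Rabs (curvature gam s) <= G) /\
  (forall s t, Rabs (curvature gam s - curvature gam t) <= G * Rabs (s - t)) /\
  (forall s t, Cmod (gam t - gam s) <= 2 * Rabs (t - s)) /\
  (forall s t, Cmod (left_normal gam t - left_normal gam s) <= G * Rabs (t - s)) /\
  (forall s t, Cmod (gam t - gam s - RtoC (t - s) * tangent gam s)%C <= G * (Rabs (t - s) * Rabs (t - s))) /\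
  (forall s t, Cmod (left_normal gam t - left_normal gam s + RtoC (curvature gam s * (t - s)) * tangent gam s)%C
  <= G * (Rabs (t - s) * Rabs (t - s))) /\
  (forall s t, Cmod (gam t - gam s - RtoC (t - s) * tangent gam s - RtoC (/ 2 * curvature gam s * ((t - s) * (t - s))) * left_normal gam s)%C
  <= G * (Rabs (t - s) * Rabs (t - s) * Rabs (t - s))).
Proof.
 destruct curvature_bounds as [M [HM [K1 K2]]].
 assert (T1 : forall s t, Cmod (tangent gam t - tangent gam s) <= 2 * M * Rabs (t - s)).
 { intros s t. apply (curve_mean_value _ (fun r => (RtoC (curvature gam r) * left_normal gam r)%C)); intros r _; [apply cder_tangent|].
  rewrite Cmod_mult, Cmod_R, Cmod_normal. specialize (K1 r). lra. }
 assert (N1 : forall s t, Cmod (left_normal gam t - left_normal gam s) <= 2 * M * Rabs (t - s)).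
 { intros s t. apply (curve_mean_value _ (fun r => (RtoC (- curvature gam r) * tangent gam r)%C)); intros r _; [apply cder_normal|].
  rewrite Cmod_mult, Cmod_R, Cmod_tangent, Rabs_Ropp. specialize (K1 r). lra. }
 assert (Hlin : forall (a : C) (s t : R), cder (fun r : R => (RtoC (r - s) * a)%C) t a).
 { split; simpl; (auto_derive; [lra|ring]). }
 assert (T2 : forall s t, Cmod (gam t - gam s - RtoC (t - s) * tangent gam s)%C <= 4 * M * (Rabs (t - s) * Rabs (t - s))).
 { intros s t.
  pose proof (curve_mean_value (fun r => (gam r + RtoC (r - s) * (- tangent gam s))%C) (fun r => (tangent gam r + (- tangent gam s))%C)
   s t (2 * M * Rabs (t - s))) as T.
  replace (gam t - gam s - RtoC (t - s) * tangent gam s)%C with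
   (gam t + RtoC (t - s) * (- tangent gam s) - (gam s + RtoC (s - s) * (- tangent gam s)))%C
   by ceq.
  le_via T.
  - intros r _. apply cder_plus; [apply cder_gamma|pos].
  - intros r Hr. le_via (T1 s r). apply Rmult_le_compat_l; [lra|]. apply Rabs_le_of_between, Hr.
  - lra. }
 assert (T3 : forall s t, Cmod (tangent gam t - tangent gam s - RtoC (curvature gam s * (t - s)) * left_normal gam s)%C
  <= 2 * (M + 2 * M * M) * (Rabs (t - s) * Rabs (t - s))).
 { intros s t. set (a := (RtoC (curvature gam s) * left_normal gam s)%C).
  pose proof (curve_mean_value (fun r => (tangent gam r + RtoC (r - s) * (- a))%C) (fun r => (RtoC (curvature gam r) * left_normal gam r + (- a))%C)
   s t ((M + 2 * M * M) * Rabs (t - s))) as T.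
  replace (tangent gam t - tangent gam s - RtoC (curvature gam s * (t - s)) * left_normal gam s)%C with
   (tangent gam t + RtoC (t - s) * (- a) - (tangent gam s + RtoC (s - s) * (- a)))%C
   by ceq.
  le_via T.
  - intros r _. apply cder_plus; [apply cder_tangent|pos].
  - intros r Hr. pose proof (Rabs_le_of_between s t r Hr) as Hb.
   replace (RtoC (curvature gam r) * left_normal gam r + (- a))%C with
    (RtoC (curvature gam r - curvature gam s) * left_normal gam r + RtoC (curvature gam s) * (left_normal gam r - left_normal gam s))%C
    by ceq.
   le_via Cmod_triangle. rewrite !Cmod_mult, !Cmod_R, Cmod_normal.
   specialize (K2 r s). pose proof (Rabs_pos (curvature gam s)).
   assert (Rabs (curvature gam s) * Cmod (left_normal gam r - left_normal gam s) <= M * (2 * M * Rabs (r - s))).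
   { pos. }
   nra.
  - lra. }
 set (G := 4 * (M + 2 * M * M)).
 assert (HG : M <= G /\ 2 * M <= G /\ 4 * M <= G /\ 1 <= G /\ 2 * (M + 2 * M * M) <= G) by (unfold G; nra).
 exists G. pose proof (fun s t : R => Rabs_pos (t - s)) as Hp.
 split; [lra|]. split; [intros s; specialize (K1 s); lra|].
 split; [intros s t; specialize (K2 s t); specialize (Hp t s); nra|]. split.
 { intros s t. replace 2 with (2 * 1) by ring. apply (curve_mean_value _ (tangent gam)); intros r _; [apply cder_gamma|rewrite Cmod_tangent; lra]. }
 split; [intros s t; specialize (N1 s t); specialize (Hp s t); nra|].
 split; [intros s t; specialize (T2 s t); specialize (Hp s t); assert (0 <= Rabs (t - s) * Rabs (t - s)) by nra; nra|].
 split.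
 - intros s t. replace (left_normal gam t - left_normal gam s + RtoC (curvature gam s * (t - s)) * tangent gam s)%C
   with (Ci * (tangent gam t - tangent gam s - RtoC (curvature gam s * (t - s)) * left_normal gam s))%C.
  + rewrite Cmod_mult. replace (Cmod Ci) with 1 by (unfold Ci, Cmod; simpl; replace (0 * (0 * 1) + 1 * (1 * 1)) with 1 by ring; rewrite sqrt_1; ring).
   specialize (T3 s t). nra.
  + apply injective_projections; simpl; ring.
 - intros s t. set (a := (RtoC (/ 2 * curvature gam s) * left_normal gam s)%C).
  assert (Hsq : forall r, cder (fun r : R => (RtoC ((r - s) * (r - s)) * (- a))%C) r (RtoC (2 * (r - s)) * (- a))%C).
  { split; simpl; (auto_derive; [lra|ring]). }
  pose proof (curve_mean_value (fun r => (gam r + RtoC (r - s) * (- tangent gam s) + RtoC ((r - s) * (r - s)) * (- a))%C)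
   (fun r => (tangent gam r + (- tangent gam s) + RtoC (2 * (r - s)) * (- a))%C)
   s t (2 * (M + 2 * M * M) * (Rabs (t - s) * Rabs (t - s)))) as T.
  cbv beta in T.
  match type of T with _ -> _ -> Cmod ?x <= _ =>
   replace x with (gam t - gam s - RtoC (t - s) * tangent gam s - RtoC (/ 2 * curvature gam s * ((t - s) * (t - s))) * left_normal gam s)%C in T end.
  + le_via T.
   * intros r _. apply cder_plus; [apply cder_plus; [apply cder_gamma|pos]|pos].
   * intros r Hr. replace (tangent gam r + (- tangent gam s) + RtoC (2 * (r - s)) * (- a))%C with
     (tangent gam r - tangent gam s - RtoC (curvature gam s * (r - s)) * left_normal gam s)%C.
    -- le_via T3. pose proof (Rabs_le_of_between s t r Hr) as Hb.
     pos.
    -- apply injective_projections; simpl; field.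
   * right. unfold G. ring.
  + ceq.
Qed.

End ArcLength.

Lemma dot_self (z : C) : dot z z = Cmod z * Cmod z.
Proof. rewrite Cmod_sqr. easy. Qed.

Lemma dot_le (z w : C) : Rabs (dot z w) <= Cmod z * Cmod w.
Proof.
 rewrite <- (Rabs_right (Cmod z * Cmod w)) by nra. apply Rsqr_le_abs_0. unfold Rsqr.
 replace (Cmod z * Cmod w * (Cmod z * Cmod w)) with ((Cmod z * Cmod z) * (Cmod w * Cmod w)) by ring. rewrite !Cmod_sqr. unfold dot.
 pose proof (Rle_0_sqr (fst z * snd w - snd z * fst w)) as T. unfold Rsqr in T. lra.
Qed.

(** * The tubular neighbourhood of the outer curve *)

Section Collar.
Context (gam : R -> C) (L alpha : R) (Ha : 0 < alpha < 1) (HJ : C3alpha_jordan_arclength gam L alpha).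

Let tau := tangent gam.
Let nu := left_normal gam.
Let kappa := curvature gam.

Lemma Cmod_nu (s : R) : Cmod (nu s) = 1.
Proof. apply (Cmod_normal gam L alpha HJ). Qed.

Lemma dot_nu_nu (s : R) : dot (nu s) (nu s) = 1.
Proof. rewrite dot_self. rewrite Cmod_nu. ring. Qed.

Lemma dot_tau_nu (s : R) : dot (tau s) (nu s) = 0.
Proof. unfold dot, tau, nu, tangent, left_normal; simpl. ring. Qed.

Lemma frame (s : R) (w : C) : dot w (tau s) = 0 -> w = (RtoC (dot w (nu s)) * nu s)%C.
Proof.
 pose proof (unit_speed gam L alpha HJ s) as U. unfold dot, tau, nu, tangent, left_normal. destruct w as [x y]. simpl.
 set (a := Derive (gx gam) s) in *. set (b := Derive (gy gam) s) in *. intros E.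
 apply injective_projections; simpl.
 - transitivity (x * (a * a + b * b) - a * (x * a + y * b)); [rewrite U, E; ring|ring].
 - transitivity (y * (a * a + b * b) - b * (x * a + y * b)); [rewrite U, E; ring|ring].
Qed.

Lemma gamma_injective (s t : R) : 0 < t - s < L -> gam s <> gam t.
Proof.
 intros Hst E. pose proof (length_pos gam L alpha HJ) as HL. destruct HJ as [_ [_ [_ [_ [Hp Hi]]]]].
 destruct (period_reduce L s HL) as [k Hk].
 rewrite <- (period_Z gam L Hp k s), <- (period_Z gam L Hp k t) in E.
 destruct (Rlt_dec (t - IZR k * L) L) as [H|H].
 - revert E. apply Hi; lra.
 - rewrite <- (period_Z gam L Hp 1 (t - IZR k * L)) in E. symmetry in E. revert E. apply Hi; lra.
Qed.

(** Close parameters are handled by the Taylor estimate, the others by compactness and injectivity.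
    Parameter distances up to [L / 2] suffice because of periodicity. *)
Lemma bilipschitz : exists c, 0 < c <= 1 /\ forall s t, Rabs (t - s) <= L / 2 -> c * Rabs (t - s) <= Cmod (gam t - gam s).
Proof.
 pose proof (length_pos gam L alpha HJ) as HL.
 destruct (taylor_bounds gam L alpha Ha HJ) as [G [HG [_ [_ [HLip [_ [HT _]]]]]]].
 set (eta := / (2 * G)). assert (Heta : 0 < eta) by (apply Rinv_0_lt_compat; lra).
 assert (Hnear : forall s t, Rabs (t - s) <= eta -> / 2 * Rabs (t - s) <= Cmod (gam t - gam s)).
 { intros s t Hst. specialize (HT s t).
  pose proof (Cmod_triangle_inv (RtoC (t - s) * tangent gam s)%C (- (gam t - gam s - RtoC (t - s) * tangent gam s))%C) as T.
  rewrite Cmod_opp, Cmod_mult, Cmod_R, (Cmod_tangent gam L alpha HJ) in T.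
  replace (RtoC (t - s) * tangent gam s - (- (gam t - gam s - RtoC (t - s) * tangent gam s)))%C
   with (gam t - gam s)%C in T by ring.
  assert (G * Rabs (t - s) <= / 2).
  { apply Rle_trans with (G * eta); [pos|]. unfold eta. right. field. lra. }
  nra. }
 destruct (disc_compactness (fun A => exists c, 0 < c /\ forall s t, A (s, t) -> eta <= Rabs (t - s) <= L / 2 -> c <= Cmod (gam t - gam s)) 0 (3 * L)) as [c [Hc Hfar]].
 - intros A B HAB [c [Hc H]]. eauto.
 - intros A B [c1 [Hc1 H1]] [c2 [Hc2 H2]]. exists (Rmin c1 c2). split; [pos|]. intros s t [HA|HB] Hst.
  + le_via Rmin_l. auto.
  + le_via Rmin_r. auto.
 - exists 1. pos.
 - intros [s0 t0] _.
  assert (Hcl : forall s t r, Cmod ((s, t) - (s0, t0))%C < r -> Rabs (s - s0) < r /\ Rabs (t - t0) < r).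
  { split; eapply Rle_lt_trans; [apply (Re_le_Cmod ((s, t) - (s0, t0))%C)|lra|apply (Im_le_Cmod ((s, t) - (s0, t0))%C)|lra]. }
  assert (Habs : forall s t r, Cmod ((s, t) - (s0, t0))%C < r -> Rabs (t0 - s0) - 2 * r < Rabs (t - s) < Rabs (t0 - s0) + 2 * r).
  { intros s t r H. destruct (Hcl s t r H) as [C1 C2].
   unfold Rabs; destruct (Rcase_abs (t - s)); destruct (Rcase_abs (t0 - s0)); lra. }
  destruct (Rlt_dec (Rabs (t0 - s0)) eta) as [H1|H1].
  + exists ((eta - Rabs (t0 - s0)) / 2). split; [lra|]. exists 1. split; [lra|]. intros s t H Hst. specialize (Habs s t _ H). lra.
  + destruct (Rlt_dec (L / 2) (Rabs (t0 - s0))) as [H2|H2].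
   * exists ((Rabs (t0 - s0) - L / 2) / 2). split; [lra|]. exists 1. split; [lra|]. intros s t H Hst. specialize (Habs s t _ H). lra.
   * set (D := Cmod (gam t0 - gam s0)).
    assert (HD : 0 < D).
    { apply Cmod_gt_0. intros E. assert (Eq : gam t0 = gam s0) by (rewrite <- (Cplus_0_r (gam s0)), <- E; ring).
     unfold Rabs in H1, H2. destruct (Rcase_abs (t0 - s0)).
     - apply (gamma_injective t0 s0); [lra|pos].
     - apply (gamma_injective s0 t0); [lra|pos]. }
    exists (D / 8). split; [lra|]. exists (D / 2). split; [lra|]. intros s t H _. destruct (Hcl s t _ H) as [C1 C2].
    pose proof (HLip s0 s) as L1. pose proof (HLip t0 t) as L2.
    pose proof (Cmod_minus_triangle (gam t0) (gam t) (gam s0)) as T1. pose proof (Cmod_minus_triangle (gam t) (gam s) (gam s0)) as T2.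
    rewrite (Cmod_minus_sym (gam t0) (gam t)) in T1. fold D in T1. lra.
 - set (k := Rmin (/ 2) (c / (L / 2))).
  assert (Hk : 0 < k <= / 2). { split; [apply Rmin_pos; [lra|pos]|apply Rmin_l]. }
  assert (Hk2 : k <= c / (L / 2)) by apply Rmin_r.
  exists k. split; [lra|].
  assert (Hmain : forall s t, 0 <= s < L -> Rabs (t - s) <= L / 2 -> k * Rabs (t - s) <= Cmod (gam t - gam s)).
  { intros s t Hs Hst. destruct (Rle_dec (Rabs (t - s)) eta) as [H1|H1].
   - specialize (Hnear s t H1). nra.
   - apply Rle_trans with c.
    + apply Rle_trans with (c / (L / 2) * (L / 2)); [pos|right; field; lra].
    + apply Hfar; [|lra]. replace ((s, t) - 0)%C with ((s, t) : C) by ceq.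
     le_via Cmod_le_sum. simpl.
     unfold Rabs in Hst |- *. destruct (Rcase_abs (t - s)); destruct (Rcase_abs t); destruct (Rcase_abs s); lra. }
  intros s t Hst. destruct (period_reduce L s HL) as [q Hq]. pose proof (gamma_period gam L alpha HJ) as Hper.
  rewrite <- (period_Z gam L Hper q s), <- (period_Z gam L Hper q t).
  replace (t - s) with ((t - IZR q * L) - (s - IZR q * L)) in Hst |- * by ring. auto.
Qed.

Lemma near_parameter (s t : R) : exists r, Rabs (r - s) <= L / 2 /\ forall (h : R -> C), (forall x, h (x + L) = h x) -> h r = h t.
Proof.
 pose proof (length_pos gam L alpha HJ) as HL. destruct (period_reduce L (t - s + L / 2) HL) as [k Hk].
 exists (t - IZR k * L). split; [lra|]. intros h Hh. apply period_Z, Hh.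
Qed.

Lemma dot_chord_normal (G : R) (s t : R) :
  Cmod (gam t - gam s - RtoC (t - s) * tangent gam s)%C <= G * (Rabs (t - s) * Rabs (t - s)) ->
  Rabs (dot (gam t - gam s)%C (nu s)) <= G * (Rabs (t - s) * Rabs (t - s)).
Proof.
 intros H. replace (dot (gam t - gam s)%C (nu s)) with
  (dot (gam t - gam s - RtoC (t - s) * tau s)%C (nu s) + (t - s) * dot (tau s) (nu s)).
 - rewrite dot_tau_nu, Rmult_0_r, Rplus_0_r. le_via dot_le. rewrite Cmod_nu, Rmult_1_r. exact H.
 - unfold dot; simpl. ring.
Qed.

(** For a chord [D] with parameter distance [x], the squared distance is
    [t^2 - 2 t (D . nu) + |D|^2]. The normal part of the chord is only [G x^2], while
    [|D|^2 >= c^2 x^2], which wins for [t < c^2 / (2 G)]. *)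
Lemma tubular_distance : exists d, 0 < d /\ forall s t r, 0 < t < d ->
  t <= Cmod (gam s + t * nu s - gam r).
Proof.
 destruct (taylor_bounds gam L alpha Ha HJ) as [G [HG [_ [_ [HLip [_ [HT _]]]]]]].
 destruct bilipschitz as [c [Hc Hbl]].
 exists (c * c / (2 * G)). split; [pos|]. intros s t r0 Ht.
 destruct (near_parameter s r0) as [r [Hr Hper]]. rewrite <- (Hper gam (gamma_period gam L alpha HJ)).
 specialize (Hbl s r Hr). pose proof (dot_chord_normal G s r (HT s r)) as Hd.
 set (D := (gam r - gam s)%C) in *. set (x := Rabs (r - s)) in *. assert (Hx : 0 <= x) by apply Rabs_pos.
 replace (gam s + t * nu s - gam r)%C with (t * nu s - D)%C by ceq.
 set (m := Cmod (t * nu s - D)).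
 assert (E : m * m = t * t * dot (nu s) (nu s) - 2 * t * dot D (nu s) + Cmod D * Cmod D).
 { unfold m. rewrite <- !dot_self. unfold dot; simpl. ring. }
 rewrite dot_nu_nu in E.
 assert (Ht2 : t * (2 * G) <= c * c).
 { apply Rmult_le_reg_r with (/ (2 * G)); [pos|]. rewrite Rmult_assoc, Rinv_r by lra. lra. }
 assert (H1 : c * c * (x * x) <= Cmod D * Cmod D). { replace (c * c * (x * x)) with ((c * x) * (c * x)) by ring. pos. }
 assert (0 <= m) by apply Cmod_ge_0. nra.
Qed.

Context (Omega : C -> Prop) (HO : planar_open Omega) (Hout : outer_boundary_component Omega gam).

(** The definition of the outer component gives an interior normal segment whose length depends on
    [s]. A segment leaving [Omega] inside the collar would meet the curve at a point that
    [tubular_distance] forbids, which makes the depth uniform. *)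
Lemma collar : exists d, 0 < d /\ forall s t, 0 < t < d ->
  (forall w, Cmod (w - (gam s + t * nu s))%C < t -> Omega w) /\
  (forall b, boundary Omega b -> Cmod (b - (gam s + t * nu s))%C < 2 * t -> exists r, b = gam r).
Proof.
 destruct tubular_distance as [d [Hd Htub]]. destruct Hout as [Hbd [[eps [Heps Hopen]] [_ Hin]]].
 exists (Rmin d (eps / 4)). split; [pos|]. intros s t Ht.
 set (P := fun t => Cplus (gam s) (Cmult (RtoC t) (nu s))). fold (P t).
 assert (HP : forall x y, Cmod (P x - P y) = Rabs (x - y)).
 { intros x y. replace (P x - P y)%C with (RtoC (x - y) * nu s)%C by ceq.
  rewrite Cmod_mult, Cmod_R. rewrite Cmod_nu. ring. }
 assert (HP0 : P 0 = gam s) by ceq.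
 assert (Hon : forall b, boundary Omega b -> Cmod (b - P t) < 2 * t -> exists r, b = gam r).
 { intros b Hb Hbt. apply Hopen; trivial. exists s. pose proof (Cmod_minus_triangle b (P t) (gam s)) as T.
  rewrite <- HP0, HP, Rabs_right in T by lra. rewrite <- HP0. lra. }
 split; [|pos].
 assert (HPt : Omega (P t)).
 { apply NNPP. intros Hn. destruct (Hin s) as [t0 [Ht0 Hint]]. set (t1 := Rmin (t0 / 2) (t / 2)).
  assert (Ht1 : 0 < t1) by (apply Rmin_pos; lra). assert (t1 <= t0 / 2) by apply Rmin_l. assert (t1 <= t / 2) by apply Rmin_r.
  assert (HPt1 : Omega (P t1)) by (apply Hint; lra).
  destruct (segment_boundary Omega (P t1) (P t) HO HPt1 Hn) as [q [Hq Hb]].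
  replace (P t1 + q * (P t - P t1))%C with (P (t1 + q * (t - t1))) in Hb
   by ceq.
  set (t2 := t1 + q * (t - t1)) in *. assert (Ht2 : 0 < t2 <= t) by (unfold t2; nra).
  destruct (Hon (P t2) Hb) as [r Hr]; [rewrite HP, Rabs_left1; lra|].
  specialize (Htub s t2 r ltac:(lra)). change (gam s + t2 * nu s)%C with (P t2) in Htub. rewrite Hr in Htub.
  replace (gam r - gam r)%C with (RtoC 0) in Htub by ring. rewrite Cmod_0 in Htub. lra. }
 intros w Hw. apply NNPP. intros Hn. destruct (segment_boundary Omega (P t) w HO HPt Hn) as [q [Hq Hb]].
 pose proof (Cmod_segment (P t) (w - P t)%C q Hq) as Hle.
 destruct (Hon _ Hb) as [r Hr]; [lra|]. specialize (Htub s t r ltac:(lra)). fold (P t) in Htub.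
 rewrite Hr, Cmod_minus_sym in Hle. lra.
Qed.

(** The expansion of [v] is available only at a nearest boundary point, so points off the normal
    need their own foot [r]. The squared distance has an interior minimum there, and criticality
    puts the point on the normal at [r]. *)
Lemma projection : exists d B, 0 < d <= 1 /\ 0 < B /\ forall s t z, 0 < t < d ->
  Cmod (z - (gam s + t * nu s))%C <= t / 2 ->
  exists r e, Rabs (r - s) <= B * t /\ t / 2 <= e <= 2 * t /\ z = (gam r + e * nu r)%C /\
  Cmod (z - gam r) = e /\ forall b, boundary Omega b -> Cmod (z - gam r) <= Cmod (z - b).
Proof.
 destruct (taylor_bounds gam L alpha Ha HJ) as [G [HG [_ [_ [HLip [HN [HT _]]]]]]].
 destruct bilipschitz as [c [Hc Hbl]]. destruct tubular_distance as [d1 [Hd1 Htub]]. destruct collar as [d2 [Hd2 Hcol]].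
 pose proof (length_pos gam L alpha HJ) as HL.
 set (d := Rmin (Rmin d1 d2) (Rmin (c * c / (100 * G)) (c * L / 10))).
 assert (HcG : c * c / (100 * G) <= 1).
 { apply Rmult_le_reg_r with (100 * G); [lra|]. unfold Rdiv. rewrite Rmult_assoc, Rinv_l by lra. nra. }
 exists d, (3 / c). split; [split|].
 { repeat apply Rmin_pos; trivial; [pos|nra]. }
 { le_via Rmin_r. lra. }
 split; [pos|].
 intros s t z Ht Hz.
 assert (t < d1) by (eapply Rlt_le_trans; [apply Ht|]; eapply Rle_trans; [apply Rmin_l|lra]).
 assert (t < d2) by (eapply Rlt_le_trans; [apply Ht|]; eapply Rle_trans; [apply Rmin_l|lra]).
 assert (Htc : t < c * c / (100 * G)) by (eapply Rlt_le_trans; [apply Ht|]; eapply Rle_trans; [apply Rmin_r|lra]).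
 assert (HtL : t < c * L / 10) by (eapply Rlt_le_trans; [apply Ht|]; eapply Rle_trans; [apply Rmin_r|lra]).
 set (z0 := (gam s + t * nu s)%C) in *.
 set (F := fun r => (fst (gam r) - fst z) * (fst (gam r) - fst z) + (snd (gam r) - snd z) * (snd (gam r) - snd z)).
 assert (EF : forall r, F r = Cmod (z - gam r) * Cmod (z - gam r)) by (intros r; rewrite Cmod_sqr; unfold F; simpl; ring).
 assert (DF : forall r, is_derive F r (-2 * dot (z - gam r)%C (tau r))).
 { intros r. destruct (cder_gamma gam L alpha HJ r) as [D1 D2].
  unfold F. der. unfold dot; simpl. ring. }
 destruct (continuity_ab_min F (s - L / 2) (s + L / 2)) as [r [Hmin Hr]]; [lra| |].
 { intros x _. apply continuity_pt_filterlim, (is_derive_cont F x _ (DF x)). }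
 assert (Hdist0 : forall a b : C, Cmod (z - a) * Cmod (z - a) <= Cmod (z - b) * Cmod (z - b) -> Cmod (z - a) <= Cmod (z - b)).
 { intros a b H1. nra. }
 assert (Hglob : forall q, Cmod (z - gam r) <= Cmod (z - gam q)).
 { intros q. destruct (near_parameter s q) as [q' [Hq' Hper]]. rewrite <- (Hper gam (gamma_period gam L alpha HJ)).
  apply Hdist0. rewrite <- !EF. apply Hmin. lra. }
 assert (Hz0s : Cmod (z0 - gam s) = t).
 { replace (z0 - gam s)%C with (t * nu s)%C by ceq. rewrite Cmod_mult, Cmod_R, Rabs_right by lra.
  rewrite Cmod_nu. ring. }
 assert (Hzs : Cmod (z - gam s) <= 3 / 2 * t) by (pose proof (Cmod_minus_triangle z z0 (gam s)); lra).
 assert (Hdr : Cmod (z - gam r) <= 3 / 2 * t) by (specialize (Hglob s); lra).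
 assert (Hlow : forall q, t / 2 <= Cmod (z - gam q)).
 { intros q. specialize (Htub s t q ltac:(lra)). fold z0 in Htub. pose proof (Cmod_minus_triangle z0 z (gam q)) as T.
  rewrite (Cmod_minus_sym z0 z) in T. lra. }
 assert (Hrs : Rabs (r - s) <= 3 / c * t).
 { specialize (Hbl s r ltac:(lra)). pose proof (Cmod_minus_triangle (gam r) z (gam s)) as T.
  rewrite (Cmod_minus_sym (gam r) z) in T. apply Rmult_le_reg_l with c; [lra|]. replace (c * (3 / c * t)) with (3 * t) by (field; lra). lra. }
 assert (Hint : Rabs (r - s) < L / 2).
 { lt_via Hrs. apply Rlt_le_trans with (3 / c * (c * L / 10)); [pos|].
  replace (3 / c * (c * L / 10)) with (3 / 10 * L) by (field; lra). lra. }
 assert (Hcrit : dot (z - gam r)%C (tau r) = 0).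
 {
  assert (pr : derivable_pt F r) by (apply ex_derive_Reals_0; eexists; apply DF).
  assert (E := deriv_minimum F (s - L / 2) (s + L / 2) r pr ltac:(lra) ltac:(lra) (fun x H1 H2 => Hmin x ltac:(lra))).
  rewrite Derive_Reals, (is_derive_unique _ _ _ (DF r)) in E. lra. }
 set (e := dot (z - gam r)%C (nu r)).
 pose proof (frame r _ Hcrit) as Hfr. fold e in Hfr.
 assert (Hme : Cmod (z - gam r) = Rabs e).
 { rewrite Hfr, Cmod_mult, Cmod_R. rewrite Cmod_nu. ring. }
 assert (He0 : 0 < e).
 (* The first term is at least [t / 2]; by the choice of [d] the other two are at most [9 / 100 * t]
    and [9 / 200 * t], so the point lies on the inner side of its foot. *)
 { assert (Ee : e = dot (z - gam s)%C (nu s) + dot (gam s - gam r)%C (nu r) + dot (z - gam s)%C (nu r - nu s)%C)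
   by (unfold e, dot; simpl; ring).
  assert (B1 : t / 2 <= dot (z - gam s)%C (nu s)).
  { replace (dot (z - gam s)%C (nu s)) with (dot (z - z0)%C (nu s) + t * dot (nu s) (nu s)) by (unfold dot, z0; simpl; ring).
   rewrite dot_nu_nu. pose proof (dot_le (z - z0)%C (nu s)) as T. rewrite Cmod_nu in T. lra. }
  assert (B2 : Rabs (dot (gam s - gam r)%C (nu r)) <= G * (3 / c * t * (3 / c * t))).
  { le_via (dot_chord_normal G r s (HT r s)).
   pos. }
  assert (B3 : Rabs (dot (z - gam s)%C (nu r - nu s)%C) <= 3 / 2 * t * (G * (3 / c * t))).
  { le_via dot_le. apply Rmult_le_compat; try apply Cmod_ge_0; trivial. le_via HN. pos. }
  assert (B4 : G * (3 / c * t * (3 / c * t)) <= 9 / 100 * t).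
  { replace (G * (3 / c * t * (3 / c * t))) with ((9 * G / (c * c) * t) * t) by (field; lra). apply Rmult_le_compat_r; [lra|].
   apply Rle_trans with (9 * G / (c * c) * (c * c / (100 * G))); [apply Rmult_le_compat_l; [|lra]|right; field; lra]. pos. }
  assert (B5 : 3 / 2 * t * (G * (3 / c * t)) <= 9 / 200 * t).
  { replace (3 / 2 * t * (G * (3 / c * t))) with ((9 / 2 * G / c * t) * t) by lra. apply Rmult_le_compat_r; [lra|].
   apply Rle_trans with (9 / 2 * G / c * (c * c / (100 * G))); [apply Rmult_le_compat_l; [|lra]|].
   - pos.
   - replace (9 / 2 * G / c * (c * c / (100 * G))) with (9 / 200 * c) by (field; lra). lra. }
  lra. }
 rewrite (Rabs_right e) in Hme by lra.
 exists r, e. split; [lra|]. split; [specialize (Hlow r); lra|]. split.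
 { rewrite <- Hfr. ring. }
 split; [lra|]. intros b Hb. destruct (Rlt_dec (Cmod (b - z0)) (2 * t)) as [Hlt|Hge].
 - destruct (Hcol s t ltac:(lra)) as [_ Hon]. destruct (Hon b Hb Hlt) as [q ->]. easy.
 - pose proof (Cmod_minus_triangle b z z0) as T. rewrite (Cmod_minus_sym b z) in T. lra.
Qed.

End Collar.

(** * Density and gradient in the collar *)

Lemma ln_quotient_bound (v w t K : R) : 0 < t -> t / 8 <= v -> t / 8 <= w -> Rabs (v - w) <= K * (t * t * t) ->
  Rabs (ln v - ln w) <= 8 * K * (t * t).
Proof.
 intros Ht Hv Hw H.
 assert (Hg : forall a b, t / 8 <= a -> t / 8 <= b -> Rabs (a - b) <= K * (t * t * t) -> ln a - ln b <= 8 * K * (t * t)).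
 { intros a b H1 H2 H3. rewrite <- ln_div by lra. apply Rle_trans with (a / b - 1).
  - pose proof (exp_ineq1_le (ln (a / b))) as T. rewrite exp_ln in T by pos. lra.
  - replace (a / b - 1) with ((a - b) / b) by (field; lra).
   apply Rle_trans with (K * (t * t * t) / (t / 8)).
   + apply Rle_trans with (K * (t * t * t) / b).
    * apply Rmult_le_compat_r; [pos|]; lra.
    * apply Rmult_le_compat_l; [lra|]. apply Rinv_le_contravar; lra.
   + right. field. lra. }
 apply Rabs_le. split; [|apply Hg; trivial].
 assert (ln w - ln v <= 8 * K * (t * t)); [|lra]. apply Hg; trivial. lra.
Qed.

Lemma inv_sq_bound (v w t K : R) : 0 < t -> t / 8 <= v -> t / 8 <= w -> Rabs (v - w) <= K * (t * t * t) ->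
  Rabs (/ (v * v) - / (w * w)) <= 1024 * K.
Proof.
 intros Ht Hv Hw H.
 assert (Hiv : / v <= 8 / t) by (replace (8 / t) with (/ (t / 8)) by (field; lra); apply Rinv_le_contravar; lra).
 assert (Hiw : / w <= 8 / t) by (replace (8 / t) with (/ (t / 8)) by (field; lra); apply Rinv_le_contravar; lra).
 assert (0 < / v) by pos. assert (0 < / w) by pos.
 replace (/ (v * v) - / (w * w)) with ((w - v) * (/ v * / w) * (/ v + / w)) by (field; lra).
 rewrite !Rabs_mult, (Rabs_minus_sym w v), (Rabs_right (/ v)), (Rabs_right (/ w)), (Rabs_right (/ v + / w)) by lra.
 apply Rle_trans with (K * (t * t * t) * (8 / t * (8 / t)) * (8 / t + 8 / t)).
 - pos.
 - right. field. lra.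
Qed.

Section BoundaryGradient.
Context (gam : R -> C) (L alpha : R) (Ha : 0 < alpha < 1) (HJ : C3alpha_jordan_arclength gam L alpha).
Context (Omega : C -> Prop) (HO : planar_open Omega) (Hout : outer_boundary_component Omega gam).
Context (u c3 : C -> R) (Hu : forall z, Omega z -> liouville_at u z) (m : R) (Hm : forall z, Omega z -> m <= u z)
  (H3 : third_coefficient Omega u gam alpha c3).

Let tau := tangent gam.
Let nu := left_normal gam.
Let kappa := curvature gam.

(** [quad] with [K = 0] is the density of the exact metric belonging to the osculating circle at
    [gam s]. It agrees to third order with the two leading terms of [v], also at points whose foot
    [r] differs from [s]. *)
Lemma quad_expansion (G s r e B t : R) : 1 <= G -> Rabs (kappa s) <= G -> 0 <= B -> 0 < t -> 0 <= e <= 2 * t ->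
  Rabs (r - s) <= B * t ->
  (forall s t, Cmod (gam t - gam s) <= 2 * Rabs (t - s)) ->
  (forall s t, Cmod (gam t - gam s - RtoC (t - s) * tangent gam s)%C <= G * (Rabs (t - s) * Rabs (t - s))) ->
  (forall s t, Cmod (left_normal gam t - left_normal gam s + RtoC (curvature gam s * (t - s)) * tangent gam s)%C
  <= G * (Rabs (t - s) * Rabs (t - s))) ->
  (forall s t, Cmod (gam t - gam s - RtoC (t - s) * tangent gam s - RtoC (/ 2 * curvature gam s * ((t - s) * (t - s))) * left_normal gam s)%C
  <= G * (Rabs (t - s) * Rabs (t - s) * Rabs (t - s))) ->
  Rabs (quad (gam s) (nu s) (kappa s) 0 (gam r + e * nu r)%C - (e - / 2 * kappa s * (e * e))) <=
  (4 * G * G * (B * B * B + B * B)) * (t * t * t).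
Proof.
 intros HG Hk HB Ht He Hrs HLip HT HN2 HT3.
 specialize (HLip s r). pose proof (HT s r) as HTs. pose proof (dot_chord_normal gam L alpha HJ G r s (HT r s)) as Hdn.
 specialize (HN2 s r). specialize (HT3 s r).
 change (curvature gam s) with (kappa s) in HN2, HT3. change (left_normal gam) with nu in HN2, HT3, Hdn. change (tangent gam) with tau in HTs, HN2, HT3.
 set (sg := r - s) in *. set (x := Rabs sg) in *. assert (Hx : 0 <= x) by apply Rabs_pos.
 rewrite (Rabs_minus_sym s r) in Hdn.
 set (D := (gam r - gam s)%C) in *.
 set (rho3 := (D - sg * tau s - RtoC (/ 2 * kappa s * (sg * sg)) * nu s)%C) in *.
 set (rho2 := (nu r - nu s + RtoC (kappa s * sg) * tau s)%C) in *.
 set (rho1 := (D - sg * tau s)%C) in *.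
 pose proof (dot_nu_nu gam L alpha HJ s) as Enn. pose proof (dot_tau_nu gam s) as Etn.
 pose proof (dot_nu_nu gam L alpha HJ r) as Enr. fold nu in Enn, Etn, Enr. fold tau in Etn.
 assert (Ett : dot (tau s) (tau s) = 1). { rewrite dot_self. rewrite (Cmod_tangent gam L alpha HJ). ring. }
 assert (EQ : quad (gam s) (nu s) (kappa s) 0 (gam r + e * nu r)%C - (e - / 2 * kappa s * (e * e)) =
  dot rho3 (nu s) + e * dot rho2 (nu s) - / 2 * kappa s * (dot rho1 D + sg * dot rho1 (tau s)) + kappa s * e * dot (gam s - gam r)%C (nu r)).
 { transitivity (dot rho3 (nu s) + e * dot rho2 (nu s) - / 2 * kappa s * (dot rho1 D + sg * dot rho1 (tau s)) + kappa s * e * dot (gam s - gam r)%C (nu r)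
   + (e + / 2 * kappa s * (sg * sg)) * (dot (nu s) (nu s) - 1) + (sg - e * (kappa s * sg)) * dot (tau s) (nu s)
   - / 2 * kappa s * (sg * sg) * (dot (tau s) (tau s) - 1) - / 2 * kappa s * (e * e) * (dot (nu r) (nu r) - 1)).
  - unfold quad, rho1, rho2, rho3, D, dot; simpl. field.
  - nra. }
 rewrite EQ.
 assert (Hnus : Cmod (nu s) = 1) by apply (Cmod_normal gam L alpha HJ).
 assert (Htaus : Cmod (tau s) = 1) by apply (Cmod_tangent gam L alpha HJ).
 pose proof (dot_le rho3 (nu s)) as D3. pose proof (dot_le rho2 (nu s)) as D2. pose proof (dot_le rho1 D) as D1. pose proof (dot_le rho1 (tau s)) as D0.
 rewrite Hnus, Rmult_1_r in D3, D2. rewrite Htaus, Rmult_1_r in D0.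
 assert (D1' : Rabs (dot rho1 D) <= G * (x * x) * (2 * x)).
 { nra. }
 assert (Xb : x * x <= B * t * (B * t)) by pos.
 assert (Xc : x * x * x <= B * t * (B * t) * (B * t)) by pos.
 assert (D0' : Rabs (dot rho1 (tau s)) <= G * (x * x)) by lra.
 assert (T2 : Rabs (e * dot rho2 (nu s)) <= 2 * t * (G * (x * x))).
 { rewrite Rabs_mult, (Rabs_right e) by lra. pos. }
 assert (T3 : Rabs (/ 2 * kappa s * (dot rho1 D + sg * dot rho1 (tau s))) <= / 2 * G * (3 * G * (x * x * x))).
 { rewrite !Rabs_mult, (Rabs_right (/ 2)) by lra. apply Rmult_le_compat; [|lra| |].
  - lra.
  - lra.
  - le_via Rabs_triang. rewrite Rabs_mult. fold x.
   nra. }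
 assert (T4 : Rabs (kappa s * e * dot (gam s - gam r)%C (nu r)) <= G * (2 * t) * (G * (x * x))).
 { rewrite !Rabs_mult, (Rabs_right e) by lra. pos. }
 le_via Rabs_triang. eapply Rle_trans; [apply Rplus_le_compat_r, Rabs_triang|].
 rewrite Rabs_Ropp. eapply Rle_trans; [apply Rplus_le_compat_r, Rplus_le_compat_r, Rabs_triang|].
 set (y := x * x * x) in *. set (w := x * x) in *.
 assert (HGG : G <= G * G) by nra.
 assert (Y0 : 0 <= y) by nra. assert (W0 : 0 <= w) by nra.
 assert (S1 : G * y <= G * G * y) by pos.
 assert (S2 : 2 * t * (G * w) <= 2 * t * (G * G * w)) by pos.
 apply Rle_trans with (G * G * (3 * y) + G * G * (4 * (t * w))); [lra|].
 assert (S3 : t * w <= t * (B * t * (B * t))) by pos.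
 nra.
Qed.

(** At one fixed depth [t] the density lies between 0 and [exp (- m)], and the expansion can be
    solved for [c3]; this replaces continuity of [c3]. *)
Lemma third_coefficient_bounded : exists K, 0 <= K /\ forall s, Rabs (c3 (gam s)) <= K.
Proof.
 destruct (taylor_bounds gam L alpha Ha HJ) as [G [HG [Hk _]]].
 destruct (collar gam L alpha Ha HJ Omega HO Hout) as [d1 [Hd1 Hcol]].
 destruct (projection gam L alpha Ha HJ Omega HO Hout) as [d2 [B [Hd2 [HB Hpr]]]].
 destruct H3 as [dl [K [Hdl HK]]].
 set (t := Rmin (Rmin d1 d2) dl / 4).
 assert (Ht : 0 < t) by (unfold t; assert (0 < Rmin (Rmin d1 d2) dl) by pos; lra).
 assert (Ht1 : t < d1 /\ t < d2 /\ 2 * t < dl).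
 { unfold t in *. lra. }
 set (Q := (exp (- m) + t + / 2 * G * t ^ 2 + Rabs K * Rpower t (3 + alpha)) / t ^ 3).
 assert (HQ : 0 <= Q).
 { apply Rmult_le_pos; [|pos].
  assert (0 <= Rabs K * Rpower t (3 + alpha)) by (apply Rmult_le_pos; [lra|left; apply exp_pos]). pos. }
 exists Q. split; trivial. intros s.
 set (z := (gam s + t * left_normal gam s)%C).
 assert (Hz : Omega z). { apply (proj1 (Hcol s t ltac:(lra))). unfold z. replace (_ - _)%C with (RtoC 0) by ring. rewrite Cmod_0. lra. }
 assert (Hdz : Cmod (z - gam s) = t).
 { replace (z - gam s)%C with (t * left_normal gam s)%C by ceq. rewrite Cmod_mult, Cmod_R, (Cmod_normal gam L alpha HJ), Rabs_right by lra. ring. }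
 assert (Hnear : forall w, boundary Omega w -> Cmod (z - gam s) <= Cmod (z - w)).
 { intros w Hw. rewrite Hdz. apply Rnot_lt_le. intros Hlt. apply (proj1 Hw). apply (proj1 (Hcol s t ltac:(lra))). rewrite Cmod_minus_sym. pos. }
 specialize (HK z s Hz Hnear ltac:(lra)). cbv zeta in HK. rewrite Hdz in HK.
 specialize (Hm z Hz). assert (Hv : 0 < exp (- u z) <= exp (- m)).
 { split; [lra|]. destruct (Req_dec (u z) m) as [->|]; [lra|]. left. apply exp_increasing. lra. }
 specialize (Hk s).
 assert (Hk2 : Rabs (/ 2 * curvature gam s * t ^ 2) <= / 2 * G * t ^ 2).
 { nra. }
 assert (HKa : K * Rpower t (3 + alpha) <= Rabs K * Rpower t (3 + alpha)) by (apply Rmult_le_compat_r; [left; apply exp_pos|lra]).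
 assert (Ht3p : 0 < t ^ 3) by pos.
 assert (Hc : Rabs (c3 (gam s) * t ^ 3) <= Q * t ^ 3).
 { unfold Q. replace ((exp (- m) + t + / 2 * G * t ^ 2 + Rabs K * Rpower t (3 + alpha)) / t ^ 3 * t ^ 3) with
   (exp (- m) + t + / 2 * G * t ^ 2 + Rabs K * Rpower t (3 + alpha)) by (field; lra). lra. }
 nra.
Qed.

Lemma density_comparison : exists d K, 0 < d <= 1 /\ 0 < K /\ forall s t z, 0 < t < d ->
  Cmod (z - (gam s + t * nu s))%C <= t / 2 ->
  Omega z /\ t / 8 <= exp (- u z) /\ t / 8 <= quad (gam s) (nu s) (kappa s) 0 z /\
  Rabs (exp (- u z) - quad (gam s) (nu s) (kappa s) 0 z) <= K * (t * t * t).
Proof.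
 destruct (taylor_bounds gam L alpha Ha HJ) as [G [HG [Hk [Hkl [HLip [HN [HT [HN2 HT3]]]]]]]].
 destruct (collar gam L alpha Ha HJ Omega HO Hout) as [d1 [Hd1 Hcol]].
 destruct (projection gam L alpha Ha HJ Omega HO Hout) as [d2 [B [Hd2 [HB Hpr]]]].
 destruct third_coefficient_bounded as [Q [HQ0 HQ]].
 destruct H3 as [dl [K [Hdl HK]]].
 set (K1 := 4 * G * G * (B * B * B + B * B)).
 set (K2 := K1 + 2 * G * B + 8 * Q + 8 * Rabs K).
 assert (HK1 : 0 <= K1) by (unfold K1; assert (0 <= B * B * B + B * B) by pos; nra).
 assert (HK2 : 0 < K2) by (unfold K2; pose proof (Rabs_pos K); assert (0 < G * B) by nra; lra).
 set (d := Rmin (Rmin (Rmin d1 d2) (dl / 4)) (Rmin (/ (16 * G)) (Rmin (/ (8 * K2)) (/ 4)))).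
 assert (Hdp : 0 < d) by (unfold d; repeat apply Rmin_pos; try lra; apply Rinv_0_lt_compat; lra).
 assert (HDd : d <= d1 /\ d <= d2 /\ d <= dl / 4 /\ d <= / (16 * G) /\ d <= / (8 * K2) /\ d <= / 4).
 { unfold d.
  lra. }
 exists d, K2. split; [lra|]. split; trivial. intros s t z Ht Hz.
 assert (HOz : Omega z) by (apply (proj1 (Hcol s t ltac:(lra))); fold nu; lra). split; trivial.
 destruct (Hpr s t z ltac:(lra) Hz) as [r [e [Hrs [He [Ez [Hde Hnear]]]]]].
 pose proof (quad_expansion G s r e B t HG (Hk s) ltac:(lra) ltac:(lra) ltac:(lra) Hrs HLip HT HN2 HT3) as HQE. fold K1 in HQE.
 change (left_normal gam) with nu in Ez. rewrite <- Ez in HQE.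
 specialize (HK z r HOz Hnear ltac:(lra)). cbv zeta in HK. rewrite Hde in HK.
 assert (Hpow : Rpower e (3 + alpha) <= e * e * e).
 { rewrite Rpower_plus. replace 3 with (INR 3) by (simpl; lra). rewrite Rpower_pow by lra.
  assert (Rpower e alpha <= 1). { unfold Rpower. rewrite <- exp_0. assert (ln e <= 0) by (rewrite <- ln_1; apply ln_le; lra).
   destruct (Req_dec (alpha * ln e) 0) as [->|]; [lra|]. left. apply exp_increasing. nra. }
  assert (0 < e ^ 3) by pos. nra. }
 assert (He3 : 0 <= e * e * e <= 8 * (t * t * t)).
 { replace (8 * (t * t * t)) with (2 * t * (2 * t) * (2 * t)) by ring. pos. }
 assert (HR : K * Rpower e (3 + alpha) <= Rabs K * (8 * (t * t * t))).
 { apply Rle_trans with (Rabs K * Rpower e (3 + alpha)); [apply Rmult_le_compat_r; [left; apply exp_pos|lra]|]. pos. }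
 assert (HC : Rabs (c3 (gam r) * (e * e * e)) <= Q * (8 * (t * t * t))).
 { rewrite Rabs_mult, (Rabs_right (e * e * e)) by lra. pos. }
 assert (HKp : Rabs (/ 2 * (kappa r - kappa s) * (e * e)) <= G * (B * t) * (2 * (t * t))).
 { rewrite !Rabs_mult, (Rabs_right (/ 2)), (Rabs_right e) by lra.
  assert (E1 : Rabs (kappa r - kappa s) <= G * (B * t)) by (le_via Hkl; apply Rmult_le_compat_l; lra).
  assert (E2 : e * e <= 4 * (t * t)) by nra.
  replace (G * (B * t) * (2 * (t * t))) with (/ 2 * (G * (B * t)) * (4 * (t * t))) by field. pos. }
 assert (Hdiff : Rabs (exp (- u z) - quad (gam s) (nu s) (kappa s) 0 z) <= K2 * (t * t * t)).
 { replace (e - / 2 * curvature gam r * e ^ 2 + c3 (gam r) * e ^ 3) with (e - / 2 * kappa r * (e * e) + c3 (gam r) * (e * e * e)) in HK by (unfold kappa; ring).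
  set (T := t * t * t) in *.
  replace (G * (B * t) * (2 * (t * t))) with (2 * G * B * T) in HKp by (unfold T; ring).
  replace (K2 * T) with (K1 * T + 2 * G * B * T + Q * (8 * T) + Rabs K * (8 * T)) by (unfold K2; ring). lra. }
 assert (Hq : t / 4 <= quad (gam s) (nu s) (kappa s) 0 z).
 { set (z0 := (gam s + t * nu s)%C) in *.
  assert (Hnn := dot_nu_nu gam L alpha HJ s). fold nu in Hnn.
  assert (B1 : t / 2 <= dot (z - gam s)%C (nu s)).
  { replace (dot (z - gam s)%C (nu s)) with (dot (z - z0)%C (nu s) + t * dot (nu s) (nu s)) by (unfold dot, z0; simpl; ring).
   rewrite Hnn. pose proof (dot_le (z - z0)%C (nu s)) as T. unfold nu in T at 2. rewrite (Cmod_nu gam L alpha HJ s) in T. lra. }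
  assert (B2 : Cmod (z - gam s) <= 2 * t).
  { pose proof (Cmod_minus_triangle z z0 (gam s)) as T. replace (z0 - gam s)%C with (t * nu s)%C in T by ceq.
   rewrite Cmod_mult, Cmod_R, Rabs_right in T by lra. unfold nu in T. rewrite (Cmod_nu gam L alpha HJ s) in T. lra. }
  unfold quad. rewrite dot_self. assert (B3 : Cmod (z - gam s) * Cmod (z - gam s) <= 4 * (t * t)) by (pose proof (Cmod_ge_0 (z - gam s)%C); nra).
  assert (B4 : kappa s / 2 * (Cmod (z - gam s) * Cmod (z - gam s)) <= G / 2 * (4 * (t * t))).
  { specialize (Hk s). fold kappa in Hk. set (y := Cmod (z - gam s) * Cmod (z - gam s)) in *.
   assert (0 <= y) by (unfold y; nra). nra. }
  assert (B5 : 16 * G * t <= 1).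
  { apply Rle_trans with (16 * G * / (16 * G)); [pos|right; field; lra]. }
  nra. }
 assert (Hsm : K2 * (t * t * t) <= t / 8).
 { assert (B5 : 8 * K2 * t <= 1).
  { apply Rle_trans with (8 * K2 * / (8 * K2)); [pos|right; field; lra]. }
  nra. }
 lra.
Qed.

(** On a square of size comparable to [t], the difference of [u] and the osculating metric is
    [O(t^2)] and its Laplacian, a difference of inverse squares of densities, is bounded. The
    interior gradient estimate makes its gradient [O(t)]. *)
Lemma boundary_gradient : exists d K, 0 < d <= 1 /\ 0 < K /\ forall s t, 0 < t < d ->
  let z := (gam s + t * nu s)%C in
  Omega z /\ Rabs (kappa s) * t <= / 2 /\
  Rabs (exp (- u z) - (t - / 2 * kappa s * (t * t))) <= K * (t * t * t) /\
  forall a1 a2 b1 b2, zjet u z a1 a2 b1 b2 ->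
  Rabs (a1 + (1 - kappa s * t) * fst (nu s) / (t - / 2 * kappa s * (t * t))) <= K * t /\
  Rabs (a2 + (1 - kappa s * t) * snd (nu s) / (t - / 2 * kappa s * (t * t))) <= K * t.
Proof.
 destruct (taylor_bounds gam L alpha Ha HJ) as [G [HG [Hk _]]].
 destruct density_comparison as [d [K [Hd [HK Hcmp]]]].
 (* The gradient bound on half side [t / 4] is [2 * (8 * K * t^2) / (t / 4) + 1024 * K * (t / 4) =
    (64 + 256) * K * t]. *)
 set (K' := 320 * K).
 assert (HK' : K <= K') by (unfold K'; lra).
 exists (Rmin d (/ (2 * G))), K'.
 assert (HGi : 0 < / (2 * G)) by pos.
 split; [pos|]. split; [lra|].
 intros s t Ht z. assert (Htd : 0 < t < d) by lra.
 assert (Hkt : Rabs (kappa s) * t <= / 2).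
 { apply Rle_trans with (G * / (2 * G)); [pos|right; field; lra]. }
 assert (Hz0 : Cmod (z - z) <= t / 2) by (replace (z - z)%C with (RtoC 0) by ring; rewrite Cmod_0; lra).
 assert (Hnn := dot_nu_nu gam L alpha HJ s). fold nu in Hnn.
 destruct (Hcmp s t z Htd Hz0) as [HOz [Hv [Hw Hdf]]].
 assert (Eq0 : quad (gam s) (nu s) (kappa s) 0 z = t - / 2 * kappa s * (t * t)).
 { transitivity (t * dot (nu s) (nu s) - / 2 * kappa s * (t * t) * dot (nu s) (nu s)); [unfold quad, dot, z; simpl; field|nra]. }
 split; [pos|]. split; [lra|]. split.
 { nra. }
 intros a1 a2 b1 b2 J.
 set (q := quad (gam s) (nu s) (kappa s) 0) in *.
 set (df := fun w => u w + -1 * - ln (q w)).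
 assert (Hball : forall x y, Rabs (x - fst z) <= t / 4 -> Rabs (y - snd z) <= t / 4 -> Cmod ((x, y) - z)%C <= t / 2).
 { intros x y H1 H2. le_via Cmod_le_sum.
  change (Rabs (x - fst z) + Rabs (y - snd z) <= t / 2). lra. }
 assert (Hdot1 : dot (nu s) (nu s) = 1 - 2 * kappa s * 0) by lra.
 assert (Hsq : forall x y, Rabs (x - fst z) <= t / 4 -> Rabs (y - snd z) <= t / 4 ->
  rcont df (x, y) /\ Rabs (df (x, y)) <= 8 * K * (t * t) /\ exists a1 a2 b1 b2, zjet df (x, y) a1 a2 b1 b2 /\ Rabs (b1 + b2) <= 1024 * K).
 { intros x y H1 H2. destruct (Hcmp s t (x, y) Htd (Hball x y H1 H2)) as [HOx [Hvx [Hwx Hdx]]]. fold q in Hwx, Hdx.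
  destruct (Hu (x, y) HOx) as [Hcu [p1 [p2 [q1 [q2 [Ju Eu]]]]]].
  destruct (quad_metric_zjet (gam s) (nu s) (kappa s) 0 (x, y) Hdot1) as [c1 [c2 [J2 E2]]]; [fold q; lra|]. fold q in J2, E2.
  split; [|split].
  - apply rcont_plus; trivial. apply rcont_scal, rcont_neg_ln; [apply rcont_quad|lra].
  - unfold df. replace (u (x, y) + -1 * - ln (q (x, y))) with (ln (q (x, y)) - ln (exp (- u (x, y)))) by (rewrite ln_exp; ring).
   apply ln_quotient_bound; trivial; lra.
  - do 4 eexists. split; [unfold df; apply zjet_plus; [exact Ju|apply zjet_scal, J2]|].
   replace (q1 + -1 * c1 + (q2 + -1 * c2)) with ((q1 + q2) - (c1 + c2)) by ring. rewrite Eu, E2.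
   assert (X1 : exp (2 * u (x, y)) = / (exp (- u (x, y)) * exp (- u (x, y)))).
   { rewrite <- exp_plus, <- exp_Ropp. f_equal. ring. }
   assert (X2 : exp (2 * - ln (q (x, y))) = / (q (x, y) * q (x, y))).
   { replace (2 * - ln (q (x, y))) with (- (ln (q (x, y)) + ln (q (x, y)))) by ring. rewrite exp_Ropp, exp_plus, exp_ln by lra. easy. }
   rewrite X1, X2. apply (inv_sq_bound _ _ t); trivial. lra. }
 destruct (quad_metric_zjet (gam s) (nu s) (kappa s) 0 z Hdot1) as [c1 [c2 [J2 E2]]]; [fold q; lra|]. fold q in J2, E2.
 assert (Jd := zjet_plus _ _ _ _ _ _ _ _ _ _ _ J (zjet_scal (-1) _ _ _ _ _ _ J2)).
 rewrite Eq0 in Jd.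
 assert (HKt : 2 * (8 * K * (t * t)) / (t / 4) + 1024 * K * (t / 4) <= K' * t).
 { unfold K'. right. field. lra. }
 assert (HKtt : 0 <= 8 * K * (t * t)) by nra.
 destruct Jd as [Jx Jy].
 pose proof (gradient_bound_x df (fst z) (snd z) (t / 4) (8 * K * (t * t)) (1024 * K) ltac:(lra) HKtt ltac:(lra) Hsq _ (jet_is_derive _ _ _ _ Jx)) as G1.
 pose proof (gradient_bound_y df (fst z) (snd z) (t / 4) (8 * K * (t * t)) (1024 * K) ltac:(lra) HKtt ltac:(lra) Hsq _ (jet_is_derive _ _ _ _ Jy)) as G2.
 split.
 - eapply Rle_trans; [|eapply Rle_trans; [exact G1|lra]]. unfold z; simpl. lra.
 - eapply Rle_trans; [|eapply Rle_trans; [exact G2|lra]]. unfold z; simpl. lra.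
Qed.

End BoundaryGradient.

(** * Asymptotics along the normals *)

(** At the last parameter with [h <= 0] before a positive value, [h] would vanish with negative
    derivative and yet be positive just after. *)
Lemma derive_sign_barrier (h h' : R -> R) (p q : R) : p <= q -> (forall t, p <= t <= q -> is_derive h t (h' t)) ->
  (forall t, p <= t <= q -> h t = 0 -> h' t < 0) -> h p <= 0 -> h q <= 0.
Proof.
 intros Hpq Hd Hz Hp. apply Rnot_lt_le. intros Hq.
 set (E := fun t => p <= t <= q /\ h t <= 0).
 destruct (completeness E) as [m [Hub Hlub]].
 - exists q. intros t [Ht _]. lra.
 - exists p. easy.
 - assert (Hm : p <= m <= q). { split; [apply Hub; split; trivial; lra|apply Hlub; intros t [Ht _]; lra]. }
  assert (Hpos : forall t, m < t <= q -> 0 < h t).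
  { intros t Ht. apply Rnot_le_lt. intros Hle. assert (t <= m) by (apply Hub; split; trivial; lra). lra. }
  pose proof (proj1 (is_derive_eps h m (h' m)) (Hd m Hm)) as HD.
  assert (Hcont : forall eps, 0 < eps -> exists delta, 0 < delta /\ forall t, Rabs (t - m) < delta -> Rabs (h t - h m) < eps).
  { intros eps He. apply (is_derive_cont_eps h m (h' m) (Hd m Hm) eps He). }
  assert (Hm0 : h m <= 0).
  { apply Rnot_lt_le. intros Hlt. destruct (Hcont (h m) Hlt) as [dl [Hdl Hb]].
   assert (m <= m - dl / 2); [|lra]. apply Hlub. intros t [Ht1 Ht2]. apply Rnot_lt_le. intros Hl.
   assert (t <= m) by (apply Hub; split; trivial). specialize (Hb t ltac:(lra)). lra. }
  assert (Hmq : m < q). { destruct (Req_dec m q) as [E1|]; [rewrite E1 in Hm0; lra|lra]. }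
  assert (Hm1 : h m = 0).
  { apply Rle_antisym; trivial. apply Rnot_lt_le. intros Hlt. destruct (Hcont (- h m)) as [dl [Hdl Hb]]; [lra|].
   set (t := Rmin q (m + dl / 2)). assert (m < t) by (apply Rmin_glb_lt; lra). assert (t <= q) by apply Rmin_l.
   assert (t <= m + dl / 2) by apply Rmin_r. specialize (Hb t ltac:(lra)).
   specialize (Hpos t ltac:(lra)). lra. }
  specialize (Hz m Hm Hm1). destruct (HD (- h' m / 2)) as [dl [Hdl Hb]]; [lra|].
  set (x := Rmin (q - m) (dl / 2)). assert (0 < x) by (apply Rmin_pos; lra). assert (x <= q - m) by apply Rmin_l. assert (x <= dl / 2) by apply Rmin_r.
  specialize (Hb x ltac:(lra)). rewrite Hm1, (Rabs_right x) in Hb by lra.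
  specialize (Hpos (m + x) ltac:(lra)). lra.
Qed.

Lemma derive_ge (h h' : R -> R) (p q B : R) : p <= q -> (forall t, p <= t <= q -> is_derive h t (h' t)) ->
  (forall t, p <= t <= q -> B <= h' t) -> h p + B * (q - p) <= h q.
Proof.
 intros Hpq Hd HB. destruct (MVT_gen h p q h') as [x [Hx E]].
 - rewrite Rmin_left, Rmax_right by trivial. intros t Ht. apply Hd. lra.
 - rewrite Rmin_left, Rmax_right by trivial. intros t Ht. apply continuity_pt_filterlim, (is_derive_cont h t (h' t)), Hd, Ht.
 - rewrite Rmin_left, Rmax_right in Hx by trivial. specialize (HB x Hx). nra.
Qed.

(** The limit is the supremum of the lower bounds of [h] near 0; the Cauchy estimate puts it within
    [w t] of [h t]. *)
Lemma limit_at_0 (h : R -> R) (w : R -> R) (t1 : R) : 0 < t1 ->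
  (forall r t, 0 < r -> r <= t -> t <= t1 -> Rabs (h t - h r) <= w t) -> exists m, forall t, 0 < t <= t1 -> Rabs (h t - m) <= w t.
Proof.
 intros Ht1 H.
 set (E := fun x => exists t, 0 < t <= t1 /\ forall r, 0 < r <= t -> x <= h r).
 assert (HE : forall t, 0 < t <= t1 -> E (h t - w t)).
 { intros t Ht. exists t. split; trivial. intros r Hr. specialize (H r t ltac:(lra) ltac:(lra) ltac:(lra)). lra. }
 assert (HU : forall t, 0 < t <= t1 -> forall x, E x -> x <= h t + w t).
 { intros t Ht x [t' [Ht' Hx]]. set (r := Rmin t t'). assert (0 < r) by (apply Rmin_pos; lra). assert (r <= t) by apply Rmin_l. assert (r <= t') by apply Rmin_r.
  specialize (Hx r ltac:(lra)). specialize (H r t ltac:(lra) ltac:(lra) ltac:(lra)). lra. }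
 destruct (completeness E) as [m [Hub Hlub]].
 - exists (h t1 + w t1). intros x Hx. apply (HU t1); trivial; lra.
 - eexists. apply (HE t1). lra.
 - exists m. intros t Ht. specialize (Hub _ (HE t Ht)). specialize (Hlub (h t + w t) (HU t Ht)). lra.
Qed.

Lemma exp_second_order (x : R) : Rabs x <= / 2 -> Rabs (exp x - 1 - x) <= 2 * (x * x).
Proof.
 intros Hx. pose proof (exp_ineq1_le x) as E1. pose proof (exp_ineq1_le (- x)) as E2.
 rewrite exp_Ropp in E2.
 assert (E3 : exp x * (1 - x) <= 1).
 { apply Rle_trans with (exp x * / exp x); [pos|right; field; lra]. }
 nra.
Qed.

Lemma ln_third_order (x : R) : Rabs x <= / 2 -> Rabs (ln (1 + x) - x + / 2 * (x * x)) <= 2 * (Rabs x * Rabs x * Rabs x).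
Proof.
 intros Hx.
 pose proof (real_mean_value (fun x => ln (1 + x) - x + / 2 * (x * x)) (fun x => x * x / (1 + x)) 0 x (2 * (Rabs x * Rabs x))) as H.
 cbv beta in H. rewrite Rplus_0_r, ln_1 in H.
 replace (ln (1 + x) - x + / 2 * (x * x)) with (ln (1 + x) - x + / 2 * (x * x) - (0 - 0 + / 2 * (0 * 0))) by ring.
 replace (2 * (Rabs x * Rabs x * Rabs x)) with (2 * (Rabs x * Rabs x) * Rabs (x - 0)) by (rewrite Rminus_0_r; ring).
 assert (Hr : forall t, Rmin 0 x <= t <= Rmax 0 x -> Rabs t <= Rabs x).
 { intros t Ht. pose proof (Rabs_le_of_between 0 x t Ht) as Hb. rewrite !Rminus_0_r in Hb. lra. }
 apply H.
 - intros t Ht. specialize (Hr t Ht). assert (Ht2 : Rabs t <= / 2) by lra. auto_derive; [pos|field; pos].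
 - intros t Ht. specialize (Hr t Ht). assert (Ht2 : Rabs t <= / 2) by lra.
  unfold Rdiv.
  assert (/ (1 + t) <= 2) by (replace 2 with (/ / 2) by field; apply Rinv_le_contravar; lra).
  assert (0 < / (1 + t)) by pos. nra.
Qed.

Lemma Rpower_between (t al : R) : 0 < t <= 1 -> 0 < al < 1 -> t <= Rpower t al <= 1.
Proof.
 intros Ht Hal. assert (Hl : ln t <= 0) by (rewrite <- ln_1; apply ln_le; lra).
 assert (Hexp : forall p q, p <= q -> exp p <= exp q) by (intros p q Hpq; destruct (Req_dec p q) as [->|]; [lra|left; apply exp_increasing; lra]).
 split.
 - rewrite <- (exp_ln t) at 1 by lra. apply Hexp. nra.
 - rewrite <- exp_0. apply Hexp. nra.
Qed.

Lemma Rpower_3_plus (t al : R) : 0 < t -> Rpower t (3 + al) = t * t * t * Rpower t al.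
Proof. intros Ht. rewrite Rpower_plus. replace 3 with (INR 3) by (simpl; lra). rewrite Rpower_pow by trivial. lra. Qed.

(** * Remainders of order [t^n] and [t^(n + al)], uniform along the curve *)

(** The depth is chosen before the parameter [s]: this uniformity is what later allows the
    expansions to be integrated over the curve. *)
Definition near0 (Q : R -> R -> Prop) : Prop := exists d, 0 < d /\ forall s t, 0 < t <= d -> Q s t.

Lemma near0_and (P Q : R -> R -> Prop) : near0 P -> near0 Q -> near0 (fun s t => P s t /\ Q s t).
Proof.
 intros [d [Hd HP]] [e [He HQ]]. exists (Rmin d e). split; [pos|].
 split; [apply HP|apply HQ]; lra.
Qed.

Lemma near0_imp (P Q : R -> R -> Prop) : near0 P -> (forall s t, 0 < t -> P s t -> Q s t) -> near0 Q.
Proof. intros [d [Hd HP]] H. exists d. split; trivial. intros s t Ht. apply H; [lra|apply HP, Ht]. Qed.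

Lemma near0_lt (e : R) : 0 < e -> near0 (fun _ t => t < e).
Proof. exists (e / 2). split; [lra|]. intros s t Ht. lra. Qed.

Definition bigO (k : R -> R) (e : R -> R -> R) : Prop := exists K, 0 <= K /\ near0 (fun s t => Rabs (e s t) <= K * k t).

Lemma bigO_ext (k : R -> R) (e f : R -> R -> R) : bigO k e -> near0 (fun s t => e s t = f s t) -> bigO k f.
Proof.
 intros [K [HK He]] Hn. exists K. split; trivial. apply (near0_imp _ _ (near0_and _ _ He Hn)). intros s t _ [H E]. lra.
Qed.

Lemma bigO_plus (k : R -> R) (e f : R -> R -> R) : bigO k e -> bigO k f -> bigO k (fun s t => e s t + f s t).
Proof.
 intros [K [HK He]] [M [HM Hf]]. exists (K + M). split; [lra|]. apply (near0_imp _ _ (near0_and _ _ He Hf)). intros s t _ [H1 H2]. lra.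
Qed.

Lemma bigO_opp (k : R -> R) (e : R -> R -> R) : bigO k e -> bigO k (fun s t => - e s t).
Proof. intros [K [HK He]]. exists K. split; trivial. apply (near0_imp _ _ He). intros s t _ H. lra. Qed.

Lemma bigO_minus (k : R -> R) (e f : R -> R -> R) : bigO k e -> bigO k f -> bigO k (fun s t => e s t - f s t).
Proof. intros He Hf. apply (bigO_plus k e (fun s t => - f s t)); [pos|apply bigO_opp, Hf]. Qed.

Lemma bigO_le (k l : R -> R) (e f : R -> R -> R) : bigO k e -> near0 (fun _ t => k t <= l t) -> near0 (fun s t => Rabs (f s t) <= Rabs (e s t)) -> bigO l f.
Proof.
 intros [K [HK He]] Hkl Hf. exists K. split; trivial. apply (near0_imp _ _ (near0_and _ _ He (near0_and _ _ Hkl Hf))). intros s t _ [H1 [H2 H3]]. nra.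
Qed.

Lemma bigO_mult (k l : R -> R) (e f : R -> R -> R) : bigO k e -> bigO l f -> bigO (fun t => k t * l t) (fun s t => e s t * f s t).
Proof.
 intros [K [HK He]] [M [HM Hf]]. exists (K * M). split; [nra|]. apply (near0_imp _ _ (near0_and _ _ He Hf)). intros s t _ [H1 H2].
 nra.
Qed.

Definition bo (n : nat) : (R -> R -> R) -> Prop := bigO (fun t => t ^ n).
Definition bow (al : R) (n : nat) : (R -> R -> R) -> Prop := bigO (fun t => t ^ n * Rpower t al).

Lemma pow_le_pow (n m : nat) (t : R) : (n <= m)%nat -> 0 < t <= 1 -> t ^ m <= t ^ n.
Proof.
 intros Hnm Ht. replace m with (n + (m - n))%nat by lia. rewrite pow_add. pose proof (pow_lt t n ltac:(lra)).
 assert (t ^ (m - n) <= 1) by (rewrite <- (pow1 (m - n)); apply pow_incr; lra). nra.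
Qed.

Lemma near0_gauge (k l : R -> R) : (forall t, 0 < t <= 1 -> k t <= l t) -> near0 (fun _ t => k t <= l t).
Proof. exists 1. pos. Qed.

Lemma near0_refl (e : R -> R -> R) : near0 (fun s t => Rabs (e s t) <= Rabs (e s t)).
Proof. exists 1. pos. Qed.

Lemma bo_mult (i j n : nat) (e f : R -> R -> R) : bo i e -> bo j f -> (n <= i + j)%nat -> bo n (fun s t => e s t * f s t).
Proof.
 intros He Hf Hn. refine (bigO_le _ _ _ _ (bigO_mult _ _ _ _ He Hf) _ (near0_refl _)). apply near0_gauge. intros t Ht.
 rewrite <- pow_add. apply pow_le_pow; trivial.
Qed.

Lemma bow_mult (al : R) (i j n : nat) (e f : R -> R -> R) : bo i e -> bow al j f -> (n <= i + j)%nat -> bow al n (fun s t => e s t * f s t).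
Proof.
 intros He Hf Hn. refine (bigO_le _ _ _ _ (bigO_mult _ _ _ _ He Hf) _ (near0_refl _)). apply near0_gauge. intros t Ht.
 rewrite <- Rmult_assoc, <- pow_add. apply Rmult_le_compat_r; [left; apply exp_pos|apply pow_le_pow; trivial].
Qed.

Lemma bo_bow (al : R) (m n : nat) (e : R -> R -> R) : 0 < al < 1 -> bo m e -> (S n <= m)%nat -> bow al n e.
Proof.
 intros Hal He Hn. refine (bigO_le _ _ _ _ He _ (near0_refl _)). apply near0_gauge. intros t Ht.
 le_via (pow_le_pow (S n) m t Hn Ht). simpl. rewrite Rmult_comm. apply Rmult_le_compat_l; [pos|].
 apply Rpower_between; trivial.
Qed.

Lemma bo_weaken (n m : nat) (e : R -> R -> R) : bo m e -> (n <= m)%nat -> bo n e.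
Proof. intros He Hn. refine (bigO_le _ _ _ _ He _ (near0_refl _)). apply near0_gauge. intros t Ht. apply pow_le_pow; trivial. Qed.

Lemma bo_bound (n : nat) (e : R -> R -> R) (K : R) : 0 <= K -> near0 (fun s t => Rabs (e s t) <= K * t ^ n) -> bo n e.
Proof. exists K. easy. Qed.

Lemma bo_const (x : R) : bo 0 (fun _ _ => x).
Proof. apply (bo_bound 0 _ (Rabs x)); [lra|]. exists 1. split; [lra|]. intros. lra. Qed.

Lemma bo_id : bo 1 (fun _ t => t).
Proof. apply (bo_bound 1 _ 1); [lra|]. exists 1. split; [lra|]. intros s t Ht. lra. Qed.

Lemma bo_small (e : R -> R -> R) (eps : R) : bo 1 e -> 0 < eps -> near0 (fun s t => Rabs (e s t) <= eps).
Proof.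
 intros [K [HK He]] Heps. apply (near0_imp _ _ (near0_and _ _ He (near0_lt (eps / (K + 1)) ltac:(pos)))).
 intros s t Ht [H1 H2]. le_via H1. simpl. apply (Rmult_lt_compat_l (K + 1)) in H2; [|lra].
 replace ((K + 1) * (eps / (K + 1))) with eps in H2 by (field; lra). nra.
Qed.

Lemma bo_exp (e : R -> R -> R) : bo 0 e -> bo 0 (fun s t => exp (e s t)).
Proof.
 intros [K [HK He]]. apply (bo_bound 0 _ (exp K)); [lra|]. apply (near0_imp _ _ He). intros s t _ H.
 rewrite Rabs_right by lra. rewrite Rmult_1_r in *.
 destruct (Req_dec (e s t) K) as [->|]; [lra|left; apply exp_increasing; lra].
Qed.

Lemma bo_exp_second (e : R -> R -> R) : bo 1 e -> bo 2 (fun s t => exp (e s t) - 1 - e s t).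
Proof.
 intros He. pose proof (bo_mult 1 1 2 _ _ He He (le_n 2)) as H2.
 refine (bigO_le _ _ _ _ (bo_mult 0 2 2 _ _ (bo_const 2) H2 (le_n 2)) (near0_gauge _ _ (fun t _ => Rle_refl _)) _).
 apply (near0_imp _ _ (bo_small e (/ 2) He ltac:(lra))). intros s t _ H. rewrite (Rabs_right (2 * _)) by pos. apply exp_second_order, H.
Qed.

Lemma bo_ln_third (e : R -> R -> R) : bo 1 e -> bo 3 (fun s t => ln (1 + e s t) - e s t + / 2 * (e s t * e s t)).
Proof.
 intros He. pose proof (bo_mult 1 1 2 _ _ He He (le_n 2)) as H2. pose proof (bo_mult 2 1 3 _ _ H2 He (le_n 3)) as H3.
 refine (bigO_le _ _ _ _ (bo_mult 0 3 3 _ _ (bo_const 2) H3 (le_n 3)) (near0_gauge _ _ (fun t _ => Rle_refl _)) _).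
 apply (near0_imp _ _ (bo_small e (/ 2) He ltac:(lra))). intros s t _ H. rewrite !Rabs_mult, (Rabs_right 2) by lra. apply ln_third_order, H.
Qed.

Lemma bigO_level (h h' : R -> R -> R) : near0 (fun s t => is_derive (h s) t (h' s t)) -> bo 0 h' ->
  near0 (fun _ t => exists B, forall s, Rabs (h s t) <= B) -> bo 0 h.
Proof.
 intros Hd [K [HK Hh]] Hl. destruct (near0_and _ _ Hd (near0_and _ _ Hh (near0_and _ _ Hl (near0_lt 1 Rlt_0_1)))) as [d [Hd0 H]].
 destruct (H 0 d ltac:(lra)) as [_ [_ [[B HB] Hd1]]]. apply (bo_bound 0 _ (Rabs B + K)); [lra|]. exists d. split; trivial. intros s t Ht.
 pose proof (real_mean_value (h s) (h' s) d t K) as Hm. rewrite Rmin_right, Rmax_left in Hm by lra.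
 assert (Hm1 : Rabs (h s t - h s d) <= K * Rabs (t - d)).
 { apply Hm; intros r Hr; destruct (H s r ltac:(lra)) as [A1 [A2 _]]; [pos|]. lra. }
 rewrite (Rabs_left1 (t - d)) in Hm1 by lra. specialize (HB s). nra.
Qed.

(** Integration from the curve gains a factor [t]. The boundary value is produced by the Cauchy
    criterion for each [s]; the functions [chi0] and [lP0] arise in this way. *)
Lemma bigO_primitive (k : R -> R) (h h' : R -> R -> R) : (forall r t, 0 < r -> r <= t -> t <= 1 -> k r <= k t) ->
  near0 (fun s t => is_derive (h s) t (h' s t)) -> bigO k h' -> exists h0, bigO (fun t => t * k t) (fun s t => h s t - h0 s).
Proof.
 intros Hk Hd [K [HK Hh]]. destruct (near0_and _ _ Hd (near0_and _ _ Hh (near0_lt 1 Rlt_0_1))) as [d [Hd0 H]].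
 assert (HL : forall s, exists m, forall t, 0 < t <= d -> Rabs (h s t - m) <= K * (t * k t)).
 { intros s. apply (limit_at_0 (h s) (fun t => K * (t * k t)) d Hd0). intros r t Hr Hrt Htd. destruct (H s t ltac:(lra)) as [_ [A Ht1]].
  pose proof (real_mean_value (h s) (h' s) r t (K * k t)) as Hm. rewrite Rmin_left, Rmax_right in Hm by lra.
  assert (Hm1 : Rabs (h s t - h s r) <= K * k t * Rabs (t - r)).
  { apply Hm; intros q Hq; destruct (H s q ltac:(lra)) as [A1 [A2 _]]; [pos|]. le_via A2. apply Rmult_le_compat_l; [lra|]. apply Hk; lra. }
  rewrite (Rabs_right (t - r)) in Hm1 by lra. nra. }
 exists (fun s => proj1_sig (constructive_indefinite_description _ (HL s))). exists K. split; trivial. exists d. split; trivial.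
 intros s. apply (proj2_sig (constructive_indefinite_description _ (HL s))).
Qed.

Lemma bo_mult_add (i j : nat) (e f : R -> R -> R) : bo i e -> bo j f -> bo (i + j) (fun s t => e s t * f s t).
Proof. intros He Hf. exact (bo_mult i j _ e f He Hf (le_n _)). Qed.

Lemma bo_plus_min (i j : nat) (e f : R -> R -> R) : bo i e -> bo j f -> bo (Nat.min i j) (fun s t => e s t + f s t).
Proof. intros He Hf. apply bigO_plus; (eapply bo_weaken; [eassumption|lia]). Qed.

Lemma bo_minus_min (i j : nat) (e f : R -> R -> R) : bo i e -> bo j f -> bo (Nat.min i j) (fun s t => e s t - f s t).
Proof. intros He Hf. apply bigO_minus; (eapply bo_weaken; [eassumption|lia]). Qed.

Lemma bigO_div (k : R -> R) (e : R -> R -> R) : bigO (fun t => t * k t) e -> bigO k (fun s t => e s t / t).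
Proof.
 intros [K [HK He]]. exists K. split; trivial. apply (near0_imp _ _ He). intros s t Ht H. unfold Rdiv.
 rewrite Rabs_mult, (Rabs_right (/ t)) by pos.
 apply Rmult_le_reg_r with t; trivial. rewrite Rmult_assoc, Rinv_l; lra.
Qed.

Lemma bow_bo (al : R) (n : nat) (e : R -> R -> R) : 0 < al < 1 -> bow al n e -> bo n e.
Proof.
 intros Hal He. refine (bigO_le _ _ _ _ He _ (near0_refl _)). apply near0_gauge. intros t Ht. pose proof (Rpower_between t al Ht Hal).
 pose proof (pow_lt t n ltac:(lra)). nra.
Qed.

Lemma bow_div (al : R) (n : nat) (e : R -> R -> R) : bow al (S n) e -> bow al n (fun s t => e s t / t).
Proof.
 intros He. apply bigO_div. refine (bigO_le _ _ _ _ He _ (near0_refl _)). apply near0_gauge. intros t Ht. simpl. lra.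
Qed.

Lemma bo_const_zero (k : R -> R) : bo 1 (fun s _ => k s) -> forall s, k s = 0.
Proof.
 intros H s. destruct (Req_dec (k s) 0) as [|Hk]; trivial. apply Rabs_pos_lt in Hk.
 destruct (bo_small _ (Rabs (k s) / 2) H ltac:(lra)) as [d [Hd Hb]]. specialize (Hb s d ltac:(lra)). lra.
Qed.

(* [bo_level] infers the exponent of a polynomial expression from the hypotheses on its atoms. *)
Ltac bo_level := cbv beta; first [eassumption | apply bo_const | apply bo_id | eapply bo_mult_add; bo_level | eapply bo_plus_min; bo_level
  | eapply bo_minus_min; bo_level | apply bigO_opp; bo_level].
Ltac bo_tac := cbv beta; first [eassumption | eapply bo_weaken; [bo_level|simpl; lia] | eapply bo_bow; [assumption|bo_level|simpl; lia]
  | eapply bow_mult; [bo_level|eassumption|simpl; lia] | apply bigO_plus; bo_tac | apply bigO_minus; bo_tac | apply bigO_opp; bo_tac].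
Ltac bo_by e H := apply (bigO_ext _ e); [bo_tac|apply (near0_imp _ _ H); intros s t Ht Hn].

(** * The singular differential system along the normals *)

Section BoundaryODE.
Context (a K G T : R) (X lP c y S1 S2 v : R -> R -> R) (kap : R -> R).
Context (Ha : 0 < a) (HK : 0 <= K) (HG : 1 <= G) (HT : 0 < T <= 1) (Hkap : forall s, Rabs (kap s) <= G).
Context (HX : forall s t, 0 < t < T -> 0 < a * X s t < PI).
Context (DX : forall s t, 0 < t < T -> is_derive (X s) t (exp (lP s t) * c s t)).
Context (DP : forall s t, 0 < t < T -> is_derive (lP s) t (S1 s t)).
Context (Dc : forall s t, 0 < t < T -> is_derive (c s) t (- (y s t * S2 s t))).
Context (Dy : forall s t, 0 < t < T -> is_derive (y s) t (c s t * S2 s t)).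
Context (Hcy : forall s t, 0 < t < T -> c s t * c s t + y s t * y s t = 1).
Context (Hv : forall s t, 0 < t < T -> v s t = sin (a * X s t) / (a * exp (lP s t))).
Context (Hve : forall s t, 0 < t < T -> Rabs (v s t - (t - / 2 * kap s * (t * t))) <= K * (t * t * t)).
Context (HS1 : forall s t, 0 < t < T -> Rabs (S1 s t - (cos (a * X s t) * c s t / v s t - (1 - kap s * t) / (t - / 2 * kap s * (t * t)))) <= K * t).
Context (HS2 : forall s t, 0 < t < T -> Rabs (S2 s t - cos (a * X s t) * y s t / v s t) <= K * t).
Context (Hlim : forall e, 0 < e -> exists d, 0 < d /\ forall s t, 0 < t < d -> t < T -> X s t < e).
Context (Hmin : forall t, 0 < t < T -> exists m, 0 < m /\ forall s, m <= X s t).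

Let M := G + K.

Lemma density_near (s t : R) : 0 < t < T -> M * t <= / 8 -> Rabs (v s t - t) <= M * (t * t) /\ 7 / 8 * t <= v s t <= 9 / 8 * t.
Proof.
 intros Ht HM. specialize (Hve s t Ht). specialize (Hkap s).
 assert (H1 : - (G * (t * t)) <= kap s * (t * t) <= G * (t * t)) by nra.
 assert (H2 : K * (t * t * t) <= K * (t * t)) by nra.
 assert (H3 : Rabs (v s t - t) <= M * (t * t)). { unfold M. lra. }
 nra.
Qed.

(** Where [c] vanishes, [y * S2] is close to [cos (a X) / v > 0], so [c] is decreasing; thus
    [c <= 0] at some depth persists up to [t0]. Then [X] is nonincreasing there and stays above its
    minimum at depth [t0], contrary to [X] tending to 0 uniformly. *)
Lemma cos_positive_collar : exists t0, 0 < t0 < T /\ M * t0 <= / 8 /\ (forall s t, 0 < t <= t0 -> 3 / 4 <= cos (a * X s t)) /\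
  (forall s t, 0 < t <= t0 -> 0 < c s t).
Proof.
 assert (HM : 1 <= M) by (unfold M; lra).
 destruct (Hlim (/ 2 / a)) as [d [Hd HXd]]; [pos|].
 set (t0 := Rmin (Rmin (d / 2) (T / 2)) (/ (8 * M))).
 assert (Hi : 0 < / (8 * M)) by pos.
 assert (Ht0 : 0 < t0) by (repeat apply Rmin_pos; lra).
 assert (B1 : t0 <= d / 2) by (eapply Rle_trans; [apply Rmin_l|lra]).
 assert (B2 : t0 <= T / 2) by (eapply Rle_trans; [apply Rmin_l|lra]).
 assert (B3 : t0 <= / (8 * M)) by apply Rmin_r.
 assert (B4 : M * t0 <= / 8). { apply Rle_trans with (M * / (8 * M)); [pos|right; field; lra]. }
 assert (Hcos : forall s t, 0 < t <= t0 -> 3 / 4 <= cos (a * X s t)).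
 { intros s t Ht. specialize (HXd s t ltac:(lra) ltac:(lra)). specialize (HX s t ltac:(lra)).
  assert (Hs : a * X s t < / 2). { apply Rmult_lt_reg_r with (/ a); [pos|]. replace (a * X s t * / a) with (X s t) by (field; lra). lra. }
  set (th := a * X s t) in *. pose proof (sin2_cos2 th) as E. unfold Rsqr in E. pose proof PI2_3_2.
  assert (0 < cos th) by (apply cos_gt_0; lra). assert (0 < sin th) by (apply sin_gt_0; lra).
  assert (sin th < th) by (apply sin_lt_x; lra). nra. }
 assert (Hbar : forall s t, 0 < t <= t0 -> c s t = 0 -> - (y s t * S2 s t) < 0).
 { intros s t Ht Hc0. specialize (Hcy s t ltac:(lra)). specialize (HS2 s t ltac:(lra)). specialize (Hcos s t Ht).
  rewrite Hc0 in Hcy. assert (Hy : y s t * y s t = 1) by lra.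
  assert (HMt : M * t <= / 8) by nra. destruct (density_near s t ltac:(lra) HMt) as [_ [V1 V2]].
  assert (Hr : / 2 / t <= cos (a * X s t) / v s t).
  { apply Rmult_le_reg_r with (t * v s t); [pos|]. field_simplify; [|lra|lra]. nra. }
  assert (Hy1 : Rabs (y s t) = 1). { unfold Rabs. destruct (Rcase_abs (y s t)); nra. }
  assert (Hd2 : Rabs (y s t * (S2 s t - cos (a * X s t) * y s t / v s t)) <= K * t) by nra.
  replace (y s t * (S2 s t - cos (a * X s t) * y s t / v s t)) with (y s t * S2 s t - (y s t * y s t) * (cos (a * X s t) / v s t)) in Hd2 by lra.
  rewrite Hy in Hd2.
  assert (HKt : K * t <= / 8) by (unfold M in HMt; nra).
  assert (4 <= / 2 / t). { apply Rmult_le_reg_r with t; [lra|]. field_simplify; [|lra]. nra. }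
  lra. }
 destruct (Hmin t0 ltac:(lra)) as [m [Hm HmX]]. destruct (Hlim m Hm) as [d' [Hd' HXd']].
 set (t1 := Rmin t0 (d' / 2)). assert (0 < t1) by (apply Rmin_pos; lra). assert (t1 <= t0) by apply Rmin_l. assert (t1 <= d' / 2) by apply Rmin_r.
 exists t1. split; [lra|]. split; [nra|]. split; [intros s t Ht; apply Hcos; lra|].
 intros s t Ht. apply Rnot_le_lt. intros Hle.
 assert (Hc : forall r, t <= r <= t0 -> c s r <= 0).
 { intros r Hr. apply (derive_sign_barrier (c s) (fun t => - (y s t * S2 s t)) t r); trivial; [lra| |].
  - intros q Hq. apply Dc. lra.
  - intros q Hq. apply Hbar. lra. }
 assert (HXle : X s t0 <= X s t).
 { pose proof (derive_ge (fun r => - X s r) (fun r => - (exp (lP s r) * c s r)) t t0 0 ltac:(lra)) as Hg.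
  assert (- X s t + 0 * (t0 - t) <= - X s t0); [apply Hg|lra].
  - intros r Hr. apply (is_derive_opp (X s)). apply DX. lra.
  - intros r Hr. specialize (Hc r Hr). nra. }
 specialize (HmX s). specialize (HXd' s t ltac:(lra) ltac:(lra)). lra.
Qed.

(** The tangent of half the angle with cosine [c] and sine [y]. Unlike the angle it is algebraic in
    [c] and [y], and its derivative is [S2 / (1 + c)]. *)
Let Tan s t := y s t / (1 + c s t).

Lemma is_derive_Tan (s t : R) : 0 < t < T -> 0 < c s t -> is_derive (Tan s) t (S2 s t / (1 + c s t)).
Proof.
 intros Ht Hc. pose proof (Dc s t Ht) as D1. pose proof (Dy s t Ht) as D2. specialize (Hcy s t Ht). unfold Tan. der; [lra|].
 transitivity (S2 s t * (c s t + (c s t * c s t + y s t * y s t)) / ((1 + c s t) ^ 2)); [field; lra|]. rewrite Hcy. field. lra.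
Qed.

Lemma Tan_bounds (s t : R) : 0 < t < T -> 0 < c s t -> Rabs (Tan s t) <= 1 /\ 0 <= 1 - c s t <= 2 * (Tan s t * Tan s t) /\ y s t = (1 + c s t) * Tan s t /\ c s t <= 1.
Proof.
 intros Ht Hc. specialize (Hcy s t Ht). assert (E : y s t = (1 + c s t) * Tan s t) by (unfold Tan; field; lra).
 assert (c s t <= 1) by nra. split; [|nra].
 nra.
Qed.

(** The derivative of [Tan^2 / t] is at least [- 2 K], because the singular coefficient satisfies
    [t * cos (a X) / v >= / 2]. The resulting rate is crude, but it bounds [(1 - c) / t] and starts
    the bootstrap. *)
Lemma Tan_sqr_bound : exists t0 H0, 0 < t0 < T /\ 0 < H0 /\ M * t0 <= / 8 /\ (forall s t, 0 < t <= t0 -> 3 / 4 <= cos (a * X s t)) /\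
  (forall s t, 0 < t <= t0 -> 0 < c s t) /\ (forall s t, 0 < t <= t0 -> Tan s t * Tan s t <= H0 * t).
Proof.
 destruct cos_positive_collar as [t0 [Ht0 [HM [Hcos Hc]]]].
 exists t0, (/ t0 + 2 * K * t0). split; trivial.
 assert (0 < / t0) by pos. assert (0 <= K * t0) by nra.
 split; [lra|]. split; trivial. split; trivial. split; trivial. intros s t Ht.
 assert (Hder : forall r, t <= r <= t0 -> is_derive (fun r : R => Tan s r * Tan s r / r) r
  (2 * Tan s r * (S2 s r / (1 + c s r)) / r - Tan s r * Tan s r / (r * r))).
 { intros r Hr. pose proof (is_derive_Tan s r ltac:(lra) (Hc s r ltac:(lra))) as D. der; [lra|]. field. specialize (Hc s r ltac:(lra)). lra. }
 assert (Hg := derive_ge _ _ t t0 (- (2 * K)) (proj2 Ht) Hder).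
 assert (Hlow : forall r, t <= r <= t0 -> - (2 * K) <= 2 * Tan s r * (S2 s r / (1 + c s r)) / r - Tan s r * Tan s r / (r * r)).
 { intros r Hr. assert (HMr : M * r <= / 8) by nra. destruct (density_near s r ltac:(lra) HMr) as [_ [V1 V2]].
  specialize (Hcos s r ltac:(lra)). specialize (Hc s r ltac:(lra)). specialize (HS2 s r ltac:(lra)).
  destruct (Tan_bounds s r ltac:(lra) Hc) as [B1 [B2 [B3 _]]].
  set (mu := cos (a * X s r) / v s r). set (eps := S2 s r - cos (a * X s r) * y s r / v s r) in *.
  assert (Emu : S2 s r = mu * y s r + eps) by (unfold eps, mu; field; lra).
  assert (Hmu : / 2 <= mu * r). { unfold mu. apply Rmult_le_reg_r with (v s r); [lra|]. replace (cos (a * X s r) / v s r * r * v s r) with (cos (a * X s r) * r) by (field; lra). nra. }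
  replace (2 * Tan s r * (S2 s r / (1 + c s r)) / r - Tan s r * Tan s r / (r * r)) with
   ((2 * (mu * r) - 1) * (Tan s r * Tan s r / (r * r)) + 2 * (Tan s r * eps / (1 + c s r) / r)) by (rewrite Emu, B3; field; lra).
  assert (Hsq : 0 <= Tan s r * Tan s r / (r * r)) by pos.
  assert (He : Rabs (Tan s r * eps / (1 + c s r) / r) <= K).
  { unfold Rdiv. rewrite !Rabs_mult, (Rabs_right (/ r)), (Rabs_right (/ (1 + c s r))) by pos.
   assert (I1 : / (1 + c s r) <= 1) by (rewrite <- Rinv_1; apply Rinv_le_contravar; lra).
   apply Rle_trans with (1 * (K * r) * 1 * / r); [|right; field; lra]. pos. }
  nra. }
 specialize (Hg Hlow).
 destruct (Tan_bounds s t0 ltac:(lra) (Hc s t0 ltac:(lra))) as [B1 _].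
 assert (Ht0b : Tan s t0 * Tan s t0 / t0 <= / t0) by (unfold Rdiv; rewrite <- (Rmult_1_l (/ t0)) at 2; apply Rmult_le_compat_r; nra).
 assert (Hf : Tan s t * Tan s t / t <= / t0 + 2 * K * t0) by nra.
 apply Rmult_le_reg_r with (/ t); [pos|]. replace ((/ t0 + 2 * K * t0) * t * / t) with (/ t0 + 2 * K * t0) by (field; lra). lra.
Qed.

Lemma is_derive_ln_half_tan (x : R) : 0 < a * x < PI ->
  is_derive (fun x : R => ln (sin (a * x) / (1 + cos (a * x)))) x (a / sin (a * x)).
Proof.
 intros Hx. assert (H1 : 0 < sin (a * x)) by (apply sin_gt_0; lra). pose proof (sin2_cos2 (a * x)) as E. unfold Rsqr in E.
 assert (H2 : 0 < 1 + cos (a * x)) by nra.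
 auto_derive.
 - pos.
 - set (S := sin (a * x)) in *. set (Q := cos (a * x)) in *.
  transitivity (a * (Q + (S * S + Q * Q)) / (S * (1 + Q))); [field; lra|]. rewrite E. field. lra.
Qed.

(** [Z] is [tan (a X / 2)]. Along the normal the derivative of its logarithm is [c / v], in which
    the unknown [lP] no longer occurs. *)
Let Z s t := sin (a * X s t) / (1 + cos (a * X s t)).

Lemma half_tan_level : near0 (fun _ t => exists B, forall s, Rabs (ln (Z s t) - ln t) <= B).
Proof.
 destruct cos_positive_collar as [t0 [Ht0 [_ [Hcos _]]]]. exists t0. split; [lra|]. intros _ t Ht.
 destruct (Hmin t ltac:(lra)) as [m [Hm HmX]].
 exists (Rabs (ln (sin (a * m) / 2)) + Rabs (ln t)). intros s. specialize (Hcos s t Ht). specialize (HX s t ltac:(lra)). specialize (HmX s).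
 assert (Hpi2 : a * X s t < PI / 2) by (apply Rnot_le_lt; intros Hle; assert (cos (a * X s t) <= 0) by (apply cos_le_0; lra); lra).
 assert (Ham : 0 < a * m <= a * X s t) by nra.
 assert (Hs : 0 < sin (a * m)) by (apply sin_gt_0; lra). assert (Hs2 : sin (a * m) <= sin (a * X s t)) by (apply sin_incr_1; lra).
 pose proof (SIN_bound (a * X s t)) as B1. pose proof (COS_bound (a * X s t)) as B2.
 assert (HZ : sin (a * m) / 2 <= Z s t <= 1).
 { unfold Z. split; [apply Rmult_le_compat; try lra; apply Rinv_le_contravar; lra|].
  apply Rmult_le_reg_r with (1 + cos (a * X s t)); [lra|]. unfold Rdiv. rewrite Rmult_assoc, Rinv_l; lra. }
 assert (L1 : ln (sin (a * m) / 2) <= ln (Z s t)) by (apply ln_le; lra).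
 assert (L2 : ln (Z s t) <= 0) by (rewrite <- ln_1; apply ln_le; lra).
 lra.
Qed.

Lemma collar_near0 : near0 (fun s t => 0 < t < T /\ Rabs (v s t - t) <= M * (t * t) /\ 7 / 8 * t <= v s t <= 9 / 8 * t /\ 3 / 4 <= cos (a * X s t) <= 1 /\ 0 < c s t <= 1 /\
  0 < sin (a * X s t)).
Proof.
 destruct Tan_sqr_bound as [t0 [H0 [Ht0 [_ [HM [Hcos [Hc _]]]]]]]. exists t0. split; [lra|]. intros s t Ht. assert (HMt : M * t <= / 8) by nra.
 destruct (density_near s t ltac:(lra) HMt) as [V1 V2]. split; [lra|]. split; trivial. split; trivial. pose proof (COS_bound (a * X s t)). split; [specialize (Hcos s t Ht); lra|].
 specialize (HX s t ltac:(lra)). split; [|apply sin_gt_0; lra]. split; [apply Hc, Ht|apply Tan_bounds; [lra|apply Hc, Ht]].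
Qed.

(** Each quantity is first bounded at its expected rate; its derivative then has a small remainder
    and is integrated from the curve, which yields the next order. The exponent [al] enters only
    through the remainder of the expansion of [v]. *)
Lemma boundary_expansion (c3 : R -> R) (K3 Q al : R) : 0 < al < 1 -> (forall s, Rabs (c3 s) <= Q) ->
  (forall s t, 0 < t < T -> Rabs (v s t - (t - / 2 * kap s * (t * t) + c3 s * (t * t * t))) <= K3 * Rpower t (3 + al)) ->
  exists (t0 C : R) (chi0 lP0 : R -> R), 0 < t0 < T /\ 1 <= C /\ forall s t, 0 < t <= t0 ->
  Rabs (S1 s t - kap s) <= C * t /\ Rabs (S2 s t - chi0 s) <= C * t /\ Rabs (lP s t - lP0 s) <= C * t /\
  Rabs (exp (lP s t) * c s t - exp (lP0 s)) <= C * t /\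
  Rabs (lP s t - lP0 s - kap s * t - (/ 4 * (kap s * kap s) - / 4 * (chi0 s * chi0 s + a * a * (exp (lP0 s) * exp (lP0 s))) - 3 / 2 * c3 s) * (t * t))
  <= C * (t * t * Rpower t al).
Proof.
 intros Hal HQ H3. pose proof collar_near0 as HN.
 assert (Ok : bo 0 (fun s _ => kap s)) by (apply (bo_bound 0 _ G); [lra|]; apply (near0_imp _ _ HN); intros s t _ _; simpl; specialize (Hkap s); lra).
 assert (Oc3 : bo 0 (fun s _ => c3 s)) by (apply (bo_bound 0 _ (Rabs Q)); [lra|]; apply (near0_imp _ _ HN); intros s t _ _; simpl; specialize (HQ s); pose proof (Rle_abs Q); lra).
 assert (Oc : bo 0 c) by (apply (bo_bound 0 _ 1); [lra|]; apply (near0_imp _ _ HN); intros s t _ Hn; simpl; rewrite Rabs_right; lra).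
 set (Co := fun s t => cos (a * X s t)).
 assert (OCo : bo 0 Co) by (apply (bo_bound 0 _ 1); [lra|]; apply (near0_imp _ _ HN); intros s t _ Hn; simpl; unfold Co; rewrite Rabs_right; lra).
 assert (Oinv : forall (f : R -> R -> R) (b : R), 0 < b -> near0 (fun s t => b <= f s t) -> bo 0 (fun s t => / f s t)).
 { intros f b Hb Hf. apply (bo_bound 0 _ (/ b)); [pos|]. apply (near0_imp _ _ Hf). intros s t _ H.
  rewrite Rabs_right by pos. rewrite Rmult_1_r. apply Rinv_le_contravar; trivial. }
 assert (Oi : bo 0 (fun s t => t / v s t)).
 { apply (bo_bound 0 _ 2); [lra|]. apply (near0_imp _ _ HN). intros s t Ht Hn. assert (t / v s t <= 2) by (apply Rmult_le_reg_r with (v s t); [lra|]; unfold Rdiv; rewrite Rmult_assoc, Rinv_l; lra).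
  assert (0 < t / v s t) by pos. lra. }
 assert (Owc : bo 0 (fun s t => / (1 + c s t))) by (apply (Oinv _ 1); [lra|]; apply (near0_imp _ _ HN); intros; lra).
 assert (Or : bo 3 (fun s t => v s t - (t - / 2 * kap s * (t * t)))).
 { apply (bo_bound 3 _ K); trivial. apply (near0_imp _ _ HN). intros s t Ht Hn. replace (t ^ 3) with (t * t * t) by ring. apply Hve. lra. }
 assert (Ov : bo 2 (fun s t => v s t - t)) by (bo_by (fun s t => (v s t - (t - / 2 * kap s * (t * t))) - / 2 * kap s * (t * t)) HN; ring).
 pose proof (bigO_div _ _ Ov : bo 1 (fun s t => (v s t - t) / t)) as Od. pose proof (bigO_div _ _ Od : bo 0 (fun s t => (v s t - t) / t / t)) as Odt.
 assert (O1c : bo 1 (fun s t => 1 - c s t)).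
 { destruct Tan_sqr_bound as [t0 [H0 [Ht0 [HH0 [_ [_ [Hc HT2]]]]]]]. apply (bo_bound 1 _ (2 * H0)); [lra|]. exists t0. split; [lra|]. intros s t Ht.
  destruct (Tan_bounds s t ltac:(lra) (Hc s t Ht)) as [_ [B _]]. specialize (HT2 s t Ht). lra. }
 pose proof (bigO_div _ _ O1c : bo 0 (fun s t => (1 - c s t) / t)) as O1ct.
 (* [ln (tan (a X / 2)) - ln t] has bounded derivative. *)
 assert (OY : bo 0 (fun s t => ln (Z s t) - ln t)).
 { apply (bigO_level _ (fun s t => c s t / v s t - / t)); [| |exact half_tan_level].
  - apply (near0_imp _ _ HN). intros s t Ht Hn. evar_last.
   + apply (is_derive_minus (fun r : R => ln (Z s r)) ln); [|apply is_derive_ln, Ht].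
    apply (is_derive_comp (fun x : R => ln (sin (a * x) / (1 + cos (a * x)))) (X s)); [apply is_derive_ln_half_tan, HX; lra|apply DX; lra].
   + unfold minus, plus, opp, scal; simpl. unfold mult; simpl. rewrite (Hv s t) by lra. field. lra.
  - bo_by (fun s t => - (t / v s t * ((1 - c s t) / t)) - t / v s t * ((v s t - t) / t / t)) HN. field. lra. }
 pose proof (bo_exp _ OY) as OeY.
 assert (EZ : near0 (fun s t => t * exp (ln (Z s t) - ln t) = Z s t)).
 { apply (near0_imp _ _ HN). intros s t Ht Hn. assert (0 < Z s t) by (apply Rdiv_lt_0_compat; lra).
  rewrite <- ln_div, exp_ln by pos. field; lra. }
 assert (OZ : bo 1 Z) by (bo_by (fun s t => t * exp (ln (Z s t) - ln t)) EZ; exact Hn).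
 assert (OC : bo 2 (fun s t => 1 - Co s t)).
 { bo_by (fun s t => Z s t * Z s t * (1 + Co s t)) HN. unfold Z, Co. pose proof (sin2_cos2 (a * X s t)) as E. unfold Rsqr in E.
  apply Rmult_eq_reg_r with (1 + cos (a * X s t)); [|lra]. transitivity (sin (a * X s t) * sin (a * X s t)); [field; lra|lra]. }
 (* Gronwall for [U = Tan / t], using [U^2 + 1]. *)
 set (mu := fun s t => Co s t / v s t). set (eps := fun s t => S2 s t - mu s t * y s t).
 assert (Oe : bo 1 eps).
 { apply (bo_bound 1 _ K); trivial. apply (near0_imp _ _ HN). intros s t Ht Hn. simpl. rewrite Rmult_1_r. eapply Rle_trans; [|apply (HS2 s t); lra]. unfold eps, mu, Co. lra. }
 pose proof (bigO_div _ _ Oe : bo 0 (fun s t => eps s t / t)) as Oet.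
 assert (Omt : bo 1 (fun s t => mu s t * t - 1)).
 { bo_by (fun s t => - ((t / v s t) * (1 - Co s t)) - (t / v s t) * ((v s t - t) / t)) HN. unfold mu. field. lra. }
 pose proof (bigO_div _ _ Omt : bo 0 (fun s t => (mu s t * t - 1) / t)) as Omt'.
 set (U := fun s t => Tan s t / t).
 assert (OUi : bo 0 (fun s t => / (U s t * U s t + 1))) by (apply (Oinv _ 1); [lra|]; apply (near0_imp _ _ HN); intros; nra).
 assert (OU2 : bo 0 (fun s t => U s t / (U s t * U s t + 1))).
 { apply (bo_bound 0 _ 1); [lra|]. apply (near0_imp _ _ HN). intros s t _ _. set (w := U s t). assert (0 < / (w * w + 1)) by pos.
  unfold Rdiv. rewrite Rabs_mult, (Rabs_right (/ (w * w + 1))) by lra.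
  apply Rmult_le_reg_r with (w * w + 1); [nra|]. rewrite Rmult_assoc, Rinv_l by nra. rewrite !Rmult_1_r, Rmult_1_l. nra. }
 destruct HN as [d [Hd HN']]. pose proof (ex_intro _ d (conj Hd HN') : near0 _) as HN.
 assert (OlU : bo 0 (fun s t => ln (U s t * U s t + 1))).
 { apply (bigO_level _ (fun s t => 2 * U s t * ((mu s t * t - 1) / t * U s t + eps s t / t * / (1 + c s t)) / (U s t * U s t + 1))).
  - apply (near0_imp _ _ HN). intros s t Ht Hn. destruct (Tan_bounds s t ltac:(lra) ltac:(lra)) as [_ [_ [B3 _]]].
   assert (DU : is_derive (U s) t ((mu s t * t - 1) / t * U s t + eps s t / t * / (1 + c s t))).
   { pose proof (is_derive_Tan s t ltac:(lra) ltac:(lra)). unfold U at 1. der; [lra|]. unfold U, eps. rewrite B3. field. lra. }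
   assert (0 <= U s t * U s t) by nra. der; [lra|]. field. lra.
  - bo_by (fun s t => (mu s t * t - 1) / t * (2 * (1 - / (U s t * U s t + 1))) + (eps s t / t * / (1 + c s t)) * (2 * (U s t / (U s t * U s t + 1)))) HN. field; pos.
  - exists d. split; trivial. intros _ t Ht. exists (ln (/ (t * t) + 1)). intros s. specialize (HN' s t Ht).
   destruct (Tan_bounds s t ltac:(lra) ltac:(lra)) as [B _]. assert (0 <= U s t * U s t) by nra.
   assert (0 <= ln (U s t * U s t + 1)) by (rewrite <- ln_1; apply ln_le; lra). rewrite Rabs_right by lra. apply ln_le; [lra|].
   apply Rplus_le_compat_r. unfold U. replace (Tan s t / t * (Tan s t / t)) with (Tan s t * Tan s t * / (t * t)) by (field; lra).
   rewrite <- (Rmult_1_l (/ (t * t))) at 2. apply Rmult_le_compat_r; [pos|nra]. }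
 assert (OU : bo 0 U).
 { pose proof (bo_exp _ OlU) as OE. bo_by (fun s t => U s t / (U s t * U s t + 1) * exp (ln (U s t * U s t + 1))) HN. assert (0 <= U s t * U s t) by nra.
  rewrite exp_ln by lra. field. lra. }
 assert (Oyt : bo 0 (fun s t => y s t / t)) by (bo_by (fun s t => (1 + c s t) * U s t) HN; unfold U, Tan; field; lra).
 assert (Oy : bo 1 y) by (bo_by (fun s t => y s t / t * t) HN; field; lra).
 assert (O1c2 : bo 2 (fun s t => 1 - c s t)).
 { bo_by (fun s t => y s t * y s t * / (1 + c s t)) HN. replace (y s t * y s t) with (1 - c s t * c s t) by (specialize (Hcy s t ltac:(lra)); lra). field. lra. }
 pose proof (bigO_div _ _ O1c2 : bo 1 (fun s t => (1 - c s t) / t)) as O1ct1.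
 assert (E1 : bo 1 (fun s t => S2 s t - y s t / t)) by (bo_by (fun s t => eps s t + (mu s t * t - 1) * (y s t / t)) HN; unfold eps; field; lra).
 pose proof (bigO_div _ _ E1 : bo 0 (fun s t => (S2 s t - y s t / t) / t)) as E1t.
 assert (Okt : near0 (fun s t => Rabs (kap s * t) <= / 2)) by (apply bo_small; [bo_tac|lra]).
 assert (Oden : bo 0 (fun s t => / (1 - / 2 * (kap s * t)))) by (apply (Oinv _ (/ 2)); [lra|]; apply (near0_imp _ _ Okt); intros s t _ H; apply Rabs_le_between in H; lra).
 pose proof (bigO_div _ _ (bigO_div _ _ Or) : bo 1 (fun s t => (v s t - (t - / 2 * kap s * (t * t))) / t / t)) as Ort.
 pose proof (bigO_div _ _ OC : bo 1 (fun s t => (1 - Co s t) / t)) as OCt.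
 assert (Osig : bo 1 (fun s t => S1 s t - (Co s t * c s t / v s t - (1 - kap s * t) / (t - / 2 * kap s * (t * t))))).
 { apply (bo_bound 1 _ K); trivial. apply (near0_imp _ _ HN). intros s t Ht Hn. simpl. rewrite Rmult_1_r. apply HS1. lra. }
 (* The poles cancel: [1 / v] is [1 / t + kap / 2] and the subtracted quotient is [1 / t - kap / 2],
    up to [O(t)]; their difference is [kap]. *)
 assert (E2 : bo 1 (fun s t => S1 s t - kap s)).
 { bo_by (fun s t => (S1 s t - (Co s t * c s t / v s t - (1 - kap s * t) / (t - / 2 * kap s * (t * t))))
   + Co s t * (t / v s t) * (/ 4 * (kap s * kap s) * t - (v s t - (t - / 2 * kap s * (t * t))) / t / t * (1 + / 2 * (kap s * t)))
   - (1 - Co s t) / t * (1 + / 2 * (kap s * t)) - Co s t * (t / v s t) * ((1 - c s t) / t) + / 4 * (kap s * kap s) * t * / (1 - / 2 * (kap s * t))) (near0_and _ _ HN Okt).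
  destruct Hn as [Hn Hk]. field. nra. }
 (* By [E1], [S2] is [y / t] up to [O(t)], so the singular terms in the derivative of [y / t]
    cancel. Hence [y / t], and with it [S2], has the limit [chi0]. *)
 destruct (bigO_primitive (fun t => t ^ 0) (fun s t => y s t / t) (fun s t => c s t * ((S2 s t - y s t / t) / t) - (1 - c s t) / t * (y s t / t))) as [chi0 Ochi].
 { easy. }
 { apply (near0_imp _ _ HN). intros s t Ht Hn. pose proof (Dy s t ltac:(lra)). der; [lra|]. field. lra. }
 { bo_tac. }
 change (bo 1 (fun s t => y s t / t - chi0 s)) in Ochi.
 destruct (bigO_primitive (fun t => t ^ 1) (fun s t => lP s t - kap s * t) (fun s t => S1 s t - kap s)) as [lP0 Oz2]; [intros; simpl; lra| |pos|].
 { apply (near0_imp _ _ HN). intros s t Ht Hn. pose proof (DP s t ltac:(lra)). der. ring. }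
 change (bo 2 (fun s t => lP s t - kap s * t - lP0 s)) in Oz2.
 assert (Oz : bo 1 (fun s t => lP s t - lP0 s)) by (bo_by (fun s t => (lP s t - kap s * t - lP0 s) + kap s * t) HN; ring).
 assert (Ochi0 : bo 0 (fun s _ => chi0 s)) by (bo_by (fun s t => y s t / t - (y s t / t - chi0 s)) HN; ring).
 assert (OP : bo 0 (fun s t => exp (lP s t))).
 { bo_by (fun s t => exp (ln (Z s t) - ln t) * (1 + Co s t) * (t / v s t) * / a) (near0_and _ _ HN EZ). destruct Hn as [Hn E].
  transitivity (t * exp (ln (Z s t) - ln t) * (1 + Co s t) / (a * v s t)); [field; lra|]. rewrite E. unfold Z, Co. rewrite (Hv s t) by lra. field. lra. }
 assert (OP0 : bo 0 (fun s _ => exp (lP0 s))).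
 { assert (Oz0 : bo 0 (fun s t => - (lP s t - lP0 s))) by bo_tac. apply bo_exp in Oz0. bo_by (fun s t => exp (lP s t) * exp (- (lP s t - lP0 s))) HN.
  rewrite <- exp_plus. f_equal. ring. }
 pose proof (bo_exp_second _ Oz) as Oez.
 assert (OdP : bo 1 (fun s t => exp (lP s t) - exp (lP0 s))).
 { bo_by (fun s t => exp (lP0 s) * ((exp (lP s t - lP0 s) - 1 - (lP s t - lP0 s)) + (lP s t - lP0 s))) HN.
  transitivity (exp (lP0 s + (lP s t - lP0 s)) - exp (lP0 s)); [rewrite exp_plus; ring|f_equal; f_equal; ring]. }
 (* The second-order defect of [c * cos (a X)]: half the squares of the small angles [chi0 * t] and
    [a * exp lP0 * t]. *)
 set (B := fun s => / 2 * (chi0 s * chi0 s + a * exp (lP0 s) * (a * exp (lP0 s)))).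
 assert (Oq : bo 2 (fun s t => y s t - chi0 s * t)) by (bo_by (fun s t => (y s t / t - chi0 s) * t) HN; field; lra).
 assert (Osq : bo 2 (fun s t => sin (a * X s t) - a * exp (lP0 s) * t)).
 { bo_by (fun s t => a * (exp (lP s t) * (v s t - t) + (exp (lP s t) - exp (lP0 s)) * t)) HN.
  rewrite (Hv s t) by lra. field; pos. }
 assert (OF : bo 3 (fun s t => c s t * Co s t - 1 + B s * (t * t))).
 { bo_by (fun s t => - (/ 2 * ((y s t - chi0 s * t) * ((y s t - chi0 s * t) + 2 * chi0 s * t) + (1 - c s t) * (1 - c s t)))
   - / 2 * ((sin (a * X s t) - a * exp (lP0 s) * t) * ((sin (a * X s t) - a * exp (lP0 s) * t) + 2 * (a * exp (lP0 s)) * t) + (1 - Co s t) * (1 - Co s t)) + (1 - c s t) * (1 - Co s t)) HN.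
  specialize (Hcy s t ltac:(lra)). pose proof (sin2_cos2 (a * X s t)) as E. unfold Rsqr in E. unfold B, Co. lra. }
 pose proof (bigO_div _ _ OF : bo 2 (fun s t => (c s t * Co s t - 1 + B s * (t * t)) / t)) as OFt.
 set (rv := fun s t => v s t - (t - / 2 * kap s * (t * t) + c3 s * (t * t * t))).
 assert (Orv : bow al 3 rv).
 { exists (Rabs K3). split; [lra|]. apply (near0_imp _ _ HN). intros s t Ht Hn. eapply Rle_trans; [apply H3; lra|]. rewrite Rpower_3_plus by lra.
  replace (t ^ 3) with (t * t * t) by ring. apply Rmult_le_compat_r; [|lra]. apply Rmult_le_pos; [nra|left; apply exp_pos]. }
 pose proof (bow_div _ _ _ Orv) as Orv2. pose proof (bow_div _ _ _ Orv2) as Orv1. pose proof (bow_bo _ _ _ Hal Orv2) as Orv2b. pose proof (bow_bo _ _ _ Hal Orv1) as Orv1b.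
 (* By the formula for [v], [N] is also [exp (lP - lP0) * (v / t)]. Its derivative involves [lP]
    only to first order, because [(t * c * cos (a X) - v) / t^2] is bounded; integrating it and
    taking logarithms gives [lP] to second order. *)
 set (N := fun s t => sin (a * X s t) / (a * exp (lP0 s) * t)).
 set (D' := fun s => / 2 * (kap s * kap s) - B s - c3 s).
 assert (EN : near0 (fun s t => N s t = exp (lP s t - lP0 s) * (v s t / t))).
 { apply (near0_imp _ _ HN). intros s t Ht Hn. unfold N, Rminus. rewrite exp_plus, exp_Ropp, (Hv s t) by lra. field; pos. }
 destruct (bigO_primitive (fun t => t ^ 1 * Rpower t al) (fun s t => N s t - (/ 2 * kap s * t + / 2 * D' s * (t * t)))
  (fun s t => exp (lP s t - lP0 s) * (t * (c s t * Co s t) - v s t) / (t * t) - (/ 2 * kap s + D' s * t))) as [h0 Oh].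
 { intros r t Hr Hrt Ht. apply Rmult_le_compat; [lra|left; apply exp_pos|lra|apply Rle_Rpower_l; lra]. }
 { apply (near0_imp _ _ HN). intros s t Ht Hn. pose proof (DX s t ltac:(lra)). unfold N. der; [pos|]. rewrite (Hv s t) by lra.
  replace (exp (lP s t - lP0 s)) with (exp (lP s t) * / exp (lP0 s)) by (rewrite <- exp_Ropp, <- exp_plus; reflexivity). unfold Co. field; pos. }
 {
  bo_by (fun s t => (c s t * Co s t - 1 + B s * (t * t)) / t - rv s t / t / t
   + kap s * t * (- (B s + c3 s) * t + (c s t * Co s t - 1 + B s * (t * t)) / t - rv s t / t / t)
   + ((lP s t - kap s * t - lP0 s) + (exp (lP s t - lP0 s) - 1 - (lP s t - lP0 s))) * (/ 2 * kap s - (B s + c3 s) * t + (c s t * Co s t - 1 + B s * (t * t)) / t - rv s t / t / t)) HN.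
  unfold D', rv. field. lra. }
 assert (Oh2 : bow al 2 (fun s t => N s t - (/ 2 * kap s * t + / 2 * D' s * (t * t)) - h0 s)).
 { refine (bigO_le _ _ _ _ Oh _ (near0_refl _)). apply near0_gauge. intros t Ht. lra. }
 pose proof (bow_bo _ _ _ Hal Oh2) as Oh2b.
 (* The first-order estimates of [lP] and [v] already force [N] to tend to 1, which fixes the
    constant of integration. *)
 assert (Eh0 : forall s, h0 s - 1 = 0).
 { apply bo_const_zero. bo_by (fun s t => ((exp (lP s t - lP0 s) - 1 - (lP s t - lP0 s)) + (lP s t - lP0 s)) * (1 + (v s t - t) / t) + (v s t - t) / t
   - (/ 2 * kap s * t + / 2 * D' s * (t * t)) - (N s t - (/ 2 * kap s * t + / 2 * D' s * (t * t)) - h0 s)) (near0_and _ _ HN EN).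
  destruct Hn as [Hn E]. rewrite E. field. lra. }
 set (g := fun s t => N s t - (/ 2 * kap s * t + / 2 * D' s * (t * t)) - 1).
 assert (Og : bow al 2 g) by (refine (bigO_ext _ _ _ Oh2 _); apply (near0_imp _ _ HN); intros s t _ _; unfold g; specialize (Eh0 s); lra).
 pose proof (bow_bo _ _ _ Hal Og) as Ogb.
 set (e1 := fun s t => / 2 * kap s * t + / 2 * D' s * (t * t) + g s t). set (e2 := fun s t => - / 2 * kap s * t + c3 s * (t * t) + rv s t / t).
 assert (Oe1 : bo 1 e1) by (unfold e1; bo_tac). assert (Oe2 : bo 1 e2) by (unfold e2; bo_tac).
 pose proof (bo_ln_third _ Oe1) as Ol1. pose proof (bo_ln_third _ Oe2) as Ol2.
 assert (Ostar : bow al 2 (fun s t => lP s t - lP0 s - kap s * t - (/ 2 * D' s - c3 s) * (t * t))).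
 { bo_by (fun s t => g s t - rv s t / t - / 2 * ((kap s * t + (/ 2 * D' s - c3 s) * (t * t) + g s t - rv s t / t) * ((/ 2 * D' s + c3 s) * (t * t) + g s t + rv s t / t))
   + (ln (1 + e1 s t) - e1 s t + / 2 * (e1 s t * e1 s t)) - (ln (1 + e2 s t) - e2 s t + / 2 * (e2 s t * e2 s t))) (near0_and _ _ HN EN).
  destruct Hn as [Hn E]. assert (E1' : 1 + e1 s t = N s t) by (unfold e1, g; ring). assert (E2' : 1 + e2 s t = v s t / t) by (unfold e2, rv; field; lra).
  rewrite E1', E2', E, ln_mult, ln_exp by pos. unfold e1, e2. lra. }
 assert (OS2 : bo 1 (fun s t => S2 s t - chi0 s)) by (bo_by (fun s t => (S2 s t - y s t / t) + (y s t / t - chi0 s)) HN; ring).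
 assert (OPc : bo 1 (fun s t => exp (lP s t) * c s t - exp (lP0 s))) by (bo_by (fun s t => (exp (lP s t) - exp (lP0 s)) * c s t - exp (lP0 s) * (1 - c s t)) HN; ring).
 destruct E2 as [K1 [HK1 N1]]. destruct OS2 as [K2 [HK2 N2]]. destruct Oz as [K4 [HK4 N4]]. destruct OPc as [K5 [HK5 N5]]. destruct Ostar as [K6 [HK6 N6]].
 destruct (near0_and _ _ HN (near0_and _ _ N1 (near0_and _ _ N2 (near0_and _ _ N4 (near0_and _ _ N5 N6))))) as [t0 [Ht0 Hall]].
 assert (Ht0T : t0 < T) by (destruct (Hall 0 t0 ltac:(lra)) as [Hn _]; lra).
 exists t0, (1 + K1 + K2 + K4 + K5 + K6), chi0, lP0. split; [lra|]. split; [lra|]. intros s t Ht. destruct (Hall s t Ht) as [_ [A1 [A2 [A4 [A5 A6]]]]].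
 assert (W : forall q p K', Rabs q <= K' * p -> 0 <= p -> K' <= 1 + K1 + K2 + K4 + K5 + K6 -> Rabs q <= (1 + K1 + K2 + K4 + K5 + K6) * p).
 { intros q p K' H Hp HK'. nra. }
 rewrite pow_1 in *. split; [nra|]. split; [nra|]. split; [nra|]. split; [nra|].
 replace (/ 4 * (kap s * kap s) - / 4 * (chi0 s * chi0 s + a * a * (exp (lP0 s) * exp (lP0 s))) - 3 / 2 * c3 s) with (/ 2 * D' s - c3 s) by (unfold D', B; field).
 replace (t * t) with (t ^ 2) at 2 by ring. apply (W _ _ _ A6); [|lra]. apply Rmult_le_pos; [nra|left; apply exp_pos].
Qed.

End BoundaryODE.

(** * The conformal map in the collar *)

Definition collar_point (g : R -> C) (s t : R) : C := (g s + t * left_normal g s)%C.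

Section CollarPoints.
Context (gam : R -> C) (L alpha : R) (Ha : 0 < alpha < 1) (HJ : C3alpha_jordan_arclength gam L alpha).

Lemma cder_collar_t (s t : R) : cder (fun t => collar_point gam s t) t (left_normal gam s).
Proof. apply cder_segment. Qed.

Lemma cder_collar_s (s t : R) : cder (fun s => collar_point gam s t) s (RtoC (1 - curvature gam s * t) * tangent gam s)%C.
Proof.
 eapply cder_eq; [|apply cder_plus; [apply (cder_gamma gam L alpha HJ)|apply cder_mult; [apply (cder_const (RtoC t))|apply (cder_normal gam L alpha HJ)]]].
 apply injective_projections; simpl; ring.
Qed.

Lemma collar_period (s t : R) : collar_point gam (s + L) t = collar_point gam s t.
Proof. unfold collar_point. rewrite (gamma_period gam L alpha HJ), (normal_period gam L alpha HJ). reflexivity. Qed.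

Lemma cder_collar_path (s1 t1 s2 t2 r : R) : exists l, cder (fun r => collar_point gam (s1 + r * (s2 - s1)) (t1 + r * (t2 - t1))) r l.
Proof.
 assert (Hlin : forall p q : R, is_derive (fun r : R => p + r * (q - p)) r (q - p)) by (intros p q; auto_derive; trivial; ring).
 eexists. apply cder_plus; [apply (cder_comp gam), Hlin; apply (cder_gamma gam L alpha HJ)|].
 apply (cder_mult (fun r => RtoC (t1 + r * (t2 - t1))) (fun r => left_normal gam (s1 + r * (s2 - s1)))); [|apply (cder_comp (left_normal gam)), Hlin; apply (cder_normal gam L alpha HJ)].
 instantiate (1 := RtoC (t2 - t1)). split; simpl; [pos|apply (is_derive_const 0)].
Qed.

Lemma collar_point_continuous (G s1 t1 s2 t2 : R) : 1 <= G ->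
  (forall s t, Cmod (gam t - gam s) <= 2 * Rabs (t - s)) ->
  (forall s t, Cmod (left_normal gam t - left_normal gam s) <= G * Rabs (t - s)) -> Rabs t1 <= 1 ->
  Cmod (collar_point gam s2 t2 - collar_point gam s1 t1) <= (2 + G) * Rabs (s2 - s1) + Rabs (t2 - t1).
Proof.
 intros HG H1 H2 Ht.
 replace (collar_point gam s2 t2 - collar_point gam s1 t1)%C with
  (gam s2 - gam s1 + (RtoC (t2 - t1) * left_normal gam s2 + t1 * (left_normal gam s2 - left_normal gam s1)))%C
  by (unfold collar_point; rewrite RtoC_minus; ring).
 le_via Cmod_triangle. eapply Rle_trans; [apply Rplus_le_compat_l, Cmod_triangle|].
 rewrite !Cmod_mult, !Cmod_R, (Cmod_normal gam L alpha HJ). specialize (H1 s1 s2).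
 assert (Rabs t1 * Cmod (left_normal gam s2 - left_normal gam s1) <= 1 * (G * Rabs (s2 - s1))).
 { pos. }
 lra.
Qed.

End CollarPoints.

(** * The boundary circle that corresponds to the outer curve *)

Section Orientation.
Context (beta : R) (Omega : C -> Prop) (f g : C -> C).
Context (Hbeta : 0 < beta < 1) (HO : planar_open Omega)
  (Hf : holomorphic_on Omega f) (Hg : holomorphic_on (annulus beta) g)
  (HfA : forall z, Omega z -> annulus beta (f z)) (HgO : forall w, annulus beta w -> Omega (g w))
  (Hgf : forall z, Omega z -> g (f z) = z) (Hfg : forall w, annulus beta w -> f (g w) = w).
Context (gam : R -> C) (L alpha : R) (Ha : 0 < alpha < 1) (HJ : C3alpha_jordan_arclength gam L alpha)
  (Hout : outer_boundary_component Omega gam).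

Lemma collar_in_domain : exists d, 0 < d /\ forall s t, 0 < t < d -> forall w, Cmod (w - collar_point gam s t) < t -> Omega w.
Proof.
 destruct (collar gam L alpha Ha HJ Omega HO Hout) as [d [Hd H]]. exists d. split; trivial. intros s t Ht. apply (proj1 (H s t Ht)).
Qed.

Lemma collar_side (e : R) : 0 < e -> exists d, 0 < d /\ forall s t, 0 < t < d ->
  Omega (collar_point gam s t) /\ (Cmod (f (collar_point gam s t)) < beta + e \/ 1 - e < Cmod (f (collar_point gam s t))).
Proof.
 intros He. destruct collar_in_domain as [d1 [Hd1 Hin]].
 destruct (annular_core beta Omega f g HO Hg HgO Hgf e He) as [d2 [Hd2 Hcore]].
 exists (Rmin d1 d2). split; [pos|]. intros s t Ht.
 assert (Hz : Omega (collar_point gam s t)).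
 { apply (Hin s t); [lra|]. replace (_ - _)%C with (RtoC 0) by ring. rewrite Cmod_0. lra. }
 split; trivial. apply NNPP. intros Hn. apply (proj1 (proj1 Hout s)).
 apply (Hcore (collar_point gam s t) Hz).
 - lra.
 - rewrite Cmod_minus_sym. replace (collar_point gam s t - gam s)%C with (t * left_normal gam s)%C by (unfold collar_point; ring).
  rewrite Cmod_mult, Cmod_R, (Cmod_normal gam L alpha HJ), Rabs_right by lra. lra.
Qed.

(** The collar is connected through paths linear in [(s, t)]. If [|f|] were near [beta] at one of
    its points and near [1] at another, it would take the value [(1 + beta) / 2] in between, which
    [collar_side] excludes. *)
Lemma collar_orientation :
  (forall e, 0 < e -> exists d, 0 < d /\ forall s t, 0 < t < d -> Omega (collar_point gam s t) /\ 1 - e < Cmod (f (collar_point gam s t))) \/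
  (forall e, 0 < e -> exists d, 0 < d /\ forall s t, 0 < t < d -> Omega (collar_point gam s t) /\ Cmod (f (collar_point gam s t)) < beta + e).
Proof.
 set (e0 := (1 - beta) / 4). assert (He0 : 0 < e0) by (unfold e0; lra).
 destruct (collar_side e0 He0) as [d0 [Hd0 H0]].
 set (F := fun s t => Cmod (f (collar_point gam s t))).
 assert (Hsame : forall s1 t1 s2 t2, 0 < t1 < d0 -> 0 < t2 < d0 -> F s1 t1 < beta + e0 -> 1 - e0 < F s2 t2 -> False).
 { intros s1 t1 s2 t2 Ht1 Ht2 H1 H2.
  assert (Hconv : forall r, 0 <= r <= 1 -> 0 < t1 + r * (t2 - t1) < d0).
  { split; [nra|destruct (Rle_dec t1 t2); nra]. }
  destruct (Ranalysis5.IVT_interv (fun r => F (s1 + r * (s2 - s1)) (t1 + r * (t2 - t1)) - (1 + beta) / 2) 0 1) as [r [Hr E]].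
  - intros r Hr. apply continuity_pt_minus; [|apply continuity_pt_const; intros ? ?; reflexivity].
   destruct (cder_collar_path gam L alpha HJ s1 t1 s2 t2 r) as [l Hl].
   apply ccontR_continuity_Cmod. eapply (ccont_cder f _ r l); [|pos].
   apply (holomorphic_ccont Omega); trivial. apply H0, Hconv, Hr.
  - lra.
  - replace (s1 + 0 * (s2 - s1)) with s1 by ring. replace (t1 + 0 * (t2 - t1)) with t1 by ring. unfold e0 in H1. lra.
  - replace (s1 + 1 * (s2 - s1)) with s2 by ring. replace (t1 + 1 * (t2 - t1)) with t2 by ring. unfold e0 in H2. lra.
  - destruct (H0 (s1 + r * (s2 - s1)) (t1 + r * (t2 - t1)) (Hconv r Hr)) as [_ [H|H]]; unfold F in E; unfold e0 in H; lra. }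
 destruct (proj2 (H0 0 (d0 / 2) ltac:(lra))) as [Hlow|Hhigh]; [right|left]; intros e He.
 - destruct (collar_side (Rmin e e0) ltac:(pos)) as [d1 [Hd1 H1]].
  exists (Rmin d0 d1). split; [pos|]. intros s t Ht.
  destruct (H1 s t ltac:(lra)) as [Hz [G2|G2]]; pose proof (Rmin_l e e0); pose proof (Rmin_r e e0); split; trivial; [lra|].
  exfalso. apply (Hsame 0 (d0 / 2) s t); unfold F; trivial; lra.
 - destruct (collar_side (Rmin e e0) ltac:(pos)) as [d1 [Hd1 H1]].
  exists (Rmin d0 d1). split; [pos|]. intros s t Ht.
  destruct (H1 s t ltac:(lra)) as [Hz [G2|G2]]; pose proof (Rmin_l e e0); pose proof (Rmin_r e e0); split; trivial; [|lra].
  exfalso. apply (Hsame s t 0 (d0 / 2)); unfold F; trivial; lra.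
Qed.

End Orientation.

Lemma annulus_inversion (beta : R) (w : C) : 0 < beta < 1 -> annulus beta w -> annulus beta (beta / w)%C /\ (beta / (beta / w))%C = w /\
  Cmod (beta / w) = beta / Cmod w.
Proof.
 intros Hb [H1 H2]. assert (Hw : w <> 0) by (apply Cmod_gt_0; lra).
 assert (E : Cmod (beta / w) = beta / Cmod w) by (rewrite Cmod_div, Cmod_R, Rabs_right by pos; reflexivity).
 assert (Hbn : RtoC beta <> 0) by (intros E2; apply RtoC_inj in E2; lra).
 split; [|split; [field; split; trivial|lra]]. unfold annulus. rewrite E. split.
 - apply Rmult_lt_reg_r with (Cmod w); [lra|]. unfold Rdiv. rewrite Rmult_assoc, Rinv_l by lra. nra.
 - apply Rmult_lt_reg_r with (Cmod w); [lra|]. unfold Rdiv. rewrite Rmult_assoc, Rinv_l by lra. lra.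
Qed.

(** When the outer curve corresponds to the inner circle, composition with the inversion [beta / w]
    of the annulus exchanges the two circles. *)
Lemma oriented_biholomorphism (beta : R) (Omega : C -> Prop) (gam : R -> C) (L alpha : R) : 0 < beta < 1 -> planar_open Omega ->
  biholomorphic Omega (annulus beta) -> 0 < alpha < 1 -> C3alpha_jordan_arclength gam L alpha -> outer_boundary_component Omega gam ->
  exists f g : C -> C, holomorphic_on Omega f /\ holomorphic_on (annulus beta) g /\
  (forall z, Omega z -> annulus beta (f z)) /\ (forall w, annulus beta w -> Omega (g w)) /\
  (forall z, Omega z -> g (f z) = z) /\ (forall w, annulus beta w -> f (g w) = w) /\
  forall e, 0 < e -> exists d, 0 < d /\ forall s t, 0 < t < d -> Omega (collar_point gam s t) /\ 1 - e < Cmod (f (collar_point gam s t)).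
Proof.
 intros Hb HO [f [g [Hf [Hg [HfA [HgO [Hgf Hfg]]]]]]] Ha HJ Hout.
 destruct (collar_orientation beta Omega f g Hb HO Hf Hg HgO Hgf gam L alpha Ha HJ Hout) as [H|H].
 - exists f, g. pos.
 - exists (fun z => (beta / f z)%C), (fun w => g (beta / w)%C).
  split.
  { intros z Hz. apply C_differentiable_hder. eexists. apply hder_div; [|apply hder_const|apply (holomorphic_hder Omega); trivial].
   apply (annular_neq_0 beta Omega f Hb HfA z Hz). }
  split.
  { intros w Hw. apply C_differentiable_hder. eexists. apply (hder_comp g (fun w => (beta / w)%C)).
   - apply (holomorphic_hder (annulus beta)); trivial. apply annulus_inversion; trivial.
   - apply (hder_div (fun _ => RtoC beta) (fun w => w)); [|apply hder_const|apply hder_id]. apply Cmod_gt_0. unfold annulus in Hw. lra. }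
  split; [intros z Hz; apply annulus_inversion; auto|]. split; [intros w Hw; apply HgO, annulus_inversion; auto|].
  split.
  { intros z Hz. destruct (annulus_inversion beta (f z) Hb (HfA z Hz)) as [_ [E _]]. rewrite E. auto. }
  split.
  { intros w Hw. destruct (annulus_inversion beta w Hb Hw) as [A [E _]]. rewrite Hfg; trivial. }
  intros e He. destruct (H (beta * e)) as [d [Hd Hd2]]; [nra|]. exists d. split; trivial. intros s t Ht. destruct (Hd2 s t Ht) as [Hz Hlt]. split; trivial.
  destruct (annulus_inversion beta _ Hb (HfA _ Hz)) as [_ [_ E]]. rewrite E. destruct (HfA _ Hz) as [F1 F2].
  apply Rmult_lt_reg_r with (Cmod (f (collar_point gam s t))); [lra|]. unfold Rdiv. rewrite Rmult_assoc, Rinv_l by lra.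
  nra.
Qed.

Lemma liouville_solution_at (Omega : C -> Prop) (u : C -> R) : planar_open Omega -> liouville_blowup_solution Omega u ->
  forall z, Omega z -> liouville_at u z.
Proof.
 intros HO [HC [HL _]] z Hz. split; [apply (C2_on_rcont Omega); trivial|].
 do 4 eexists. split; [apply (C2_on_zjet Omega); trivial|]. eauto.
Qed.

(** * Verification of the differential system for the conformal map *)

Section CollarData.
Context (beta : R) (Omega : C -> Prop) (f g : C -> C).
Context (Hbeta : 0 < beta < 1) (HO : planar_open Omega) (HBd : bounded_set Omega)
  (Hf : holomorphic_on Omega f) (Hg : holomorphic_on (annulus beta) g)
  (HfA : forall z, Omega z -> annulus beta (f z)) (HgO : forall w, annulus beta w -> Omega (g w))
  (Hgf : forall z, Omega z -> g (f z) = z) (Hfg : forall w, annulus beta w -> f (g w) = w).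
Context (gam : R -> C) (L alpha : R) (Ha : 0 < alpha < 1) (HJ : C3alpha_jordan_arclength gam L alpha)
  (Hout : outer_boundary_component Omega gam).
Context (Hor : forall e, 0 < e -> exists d, 0 < d /\ forall s t, 0 < t < d -> Omega (collar_point gam s t) /\ 1 - e < Cmod (f (collar_point gam s t))).
Context (u c3 : C -> R) (Hsol : liouville_blowup_solution Omega u) (H3 : third_coefficient Omega u gam alpha c3).

Let cp := collar_point gam.
Let nu := left_normal gam.
Let kap := curvature gam.
Let a := PI / - ln beta.
Let p s t := logder f (cp s t).
Let X s t := height f (cp s t).
Let lP s t := ln (Cmod (p s t)).
(** [S] is the derivative of [log p] along the normal and [E] the one of [- log f]; [c] and [y] are
    the cosine and the sine of the argument of [E], that is, the normal and tangential parts of the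
    unit gradient of the height. *)
Let S s t := (logder (logder f) (cp s t) * nu s)%C.
Let E s t := (- (p s t * nu s))%C.
Let c s t := fst (E s t) * exp (- lP s t).
Let y s t := snd (E s t) * exp (- lP s t).
Let v s t := exp (- u (cp s t)).

Lemma collar_angle_pos : 0 < a.
Proof. apply Rdiv_lt_0_compat; [lra|apply ln_beta_neg, Hbeta]. Qed.

Lemma metric_identity (z : C) : Omega z -> u z = strip_metric f a 0 z.
Proof.
 apply (annulus_metric_unique beta Omega f g); trivial; [apply liouville_solution_at; trivial|].
 exact (proj2 (proj2 Hsol)).
Qed.

Lemma logder_logder_hder (z : C) : Omega z -> hder (logder f) z (logder (logder f) z * logder f z)%C.
Proof.
 intros Hz. eapply hder_eq; [|apply (holomorphic_hder Omega); trivial; apply (logder_holomorphic beta); trivial].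
 unfold logder at 2. field. apply (logder_neq_0 beta Omega f g); trivial.
Qed.

Lemma logder_hder (z : C) : Omega z -> hder f z (logder f z * f z)%C.
Proof.
 intros Hz. eapply hder_eq; [|apply (holomorphic_hder Omega); trivial]. unfold logder. field. apply (annular_neq_0 beta Omega f); trivial.
Qed.

Lemma logder_logder_ccont (z : C) : Omega z -> ccont (logder (logder f)) z.
Proof.
 intros Hz. assert (H1 : holomorphic_on Omega (logder f)) by (apply (logder_holomorphic beta); trivial).
 eapply hder_ccont. apply (hder_div (Cderive (logder f)) (logder f)); [apply (logder_neq_0 beta Omega f g); trivial| |];
  apply (holomorphic_hder Omega); trivial. apply holomorphic_Cderive; trivial.
Qed.

Lemma E_polar (s t : R) : Omega (cp s t) -> 0 < Cmod (p s t) /\ exp (lP s t) = Cmod (p s t) /\ Cmod (E s t) = exp (lP s t) /\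
  fst (E s t) = exp (lP s t) * c s t /\ snd (E s t) = exp (lP s t) * y s t /\ c s t * c s t + y s t * y s t = 1.
Proof.
 intros Hz. assert (Hp : 0 < Cmod (p s t)) by (apply Cmod_gt_0, (logder_neq_0 beta Omega f g); trivial).
 assert (He : exp (lP s t) = Cmod (p s t)) by (apply exp_ln; trivial).
 assert (HE : Cmod (E s t) = exp (lP s t)) by (unfold E; rewrite Cmod_opp, Cmod_mult, He; unfold nu; rewrite (Cmod_normal gam L alpha HJ); ring).
 assert (Hx : exp (lP s t) * exp (- lP s t) = 1) by (rewrite <- exp_plus; replace (lP s t + - lP s t) with 0 by ring; apply exp_0).
 assert (E1 : fst (E s t) = exp (lP s t) * c s t).
 { unfold c. transitivity (fst (E s t) * (exp (lP s t) * exp (- lP s t))); [rewrite Hx; ring|ring]. }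
 assert (E2 : snd (E s t) = exp (lP s t) * y s t).
 { unfold y. transitivity (snd (E s t) * (exp (lP s t) * exp (- lP s t))); [rewrite Hx; ring|ring]. }
 split; trivial. split; trivial. split; trivial. split; trivial. split; trivial.
 pose proof (Cmod_sqr (E s t)) as Q. rewrite HE in Q. unfold c, y. nra.
Qed.

(** Along the normal [E' = S * E]: the real part of [S] changes [ln |p|] and the imaginary part
    rotates the unit vector [(c, y)]. *)
Lemma derive_collar_t (s t : R) : Omega (cp s t) ->
  is_derive (X s) t (exp (lP s t) * c s t) /\ is_derive (lP s) t (fst (S s t)) /\
  is_derive (c s) t (- (y s t * snd (S s t))) /\ is_derive (y s) t (c s t * snd (S s t)).
Proof.
 intros Hz. pose proof (cder_collar_t gam s t) as D0. destruct (E_polar s t Hz) as [Hp [He [HE [E1 [E2 _]]]]].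
 assert (Hpn : p s t <> 0) by (apply Cmod_gt_0; trivial). assert (Hfn : f (cp s t) <> 0) by (apply (annular_neq_0 beta Omega f); trivial).
 assert (DP : cder (fun t => p s t) t (logder (logder f) (cp s t) * logder f (cp s t) * nu s)%C).
 { apply (hder_comp_curve (logder f) (fun t => cp s t) t); [apply logder_logder_hder, Hz|pos]. }
 assert (DlP : is_derive (lP s) t (fst (S s t))).
 { pose proof (is_derive_ln_Cmod _ t _ DP Hpn) as D1. evar_last; [exact D1|]. f_equal. unfold S, p. field; pos. }
 assert (DE : cder (fun t => E s t) t (S s t * E s t)%C).
 {
  assert (DE1 : cder (fun t => (p s t * (- nu s))%C) t (S s t * (- (p s t * nu s)))%C).
  { eapply cder_eq; [|apply (cder_mult (fun t => p s t) (fun _ => (- nu s)%C)); [exact DP|apply cder_const]]. ceq. }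
  destruct DE1 as [Q1 Q2]. split.
  - eapply is_derive_ext; [|exact Q1]. intros r. simpl. ring.
  - eapply is_derive_ext; [|exact Q2]. intros r. simpl. ring. }
 destruct DE as [DE1 DE2].
 split; [|split; [pos|split]].
 - assert (Df : cder (fun t => f (cp s t)) t (logder f (cp s t) * f (cp s t) * nu s)%C).
  { apply (hder_comp_curve f (fun t => cp s t) t); [apply logder_hder, Hz|pos]. }
  pose proof (is_derive_ln_Cmod _ t _ Df Hfn) as D1. evar_last; [apply (is_derive_opp (fun t : R => ln (Cmod (f (cp s t))))); exact D1|].
  rewrite <- E1. replace (logder f (cp s t) * f (cp s t) * nu s / f (cp s t))%C with (p s t * nu s)%C by (unfold p; field; exact Hfn). easy.
 - unfold c. der. unfold y. simpl. ring.
 - unfold y. der. unfold c. simpl. ring.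
Qed.

Lemma density_formula (s t : R) : Omega (cp s t) -> 0 < a * X s t < PI /\ v s t = sin (a * X s t) / (a * exp (lP s t)).
Proof.
 intros Hz. pose proof collar_angle_pos as Hap. pose proof (strip_range beta Omega f Hbeta HfA _ Hz) as Hr. fold a in Hr.
 rewrite Rminus_0_r in Hr. fold (X s t) in Hr. split; trivial.
 destruct (E_polar s t Hz) as [Hp [He _]].
 unfold v. rewrite (metric_identity _ Hz). unfold strip_metric. rewrite Rminus_0_r. fold (X s t). fold (p s t).
 assert (Hs : 0 < sin (a * X s t)) by (apply sin_gt_0; lra).
 replace (- (- ln (sin (a * X s t) / a) + ln (Cmod (p s t)))) with (ln (sin (a * X s t) / a) + - ln (Cmod (p s t))) by ring.
 rewrite exp_plus, exp_Ropp, !exp_ln by pos. rewrite He. field. lra.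
Qed.

(** The coordinate estimates of the gradient are rotated into the frame of the curve; its normal
    part involves [Re S] and its tangential part [Im S], and the two coordinates account for the
    factor 2. *)
Lemma gradient_rotation (K q t s : R) (a1 a2 : R) : Omega (cp s t) -> 0 <= K ->
  a1 = a * cos (a * X s t) / sin (a * X s t) * fst (p s t) + fst (logder (logder f) (cp s t)) ->
  a2 = - (a * cos (a * X s t) / sin (a * X s t) * snd (p s t) + snd (logder (logder f) (cp s t))) ->
  Rabs (a1 + q * fst (nu s)) <= K -> Rabs (a2 + q * snd (nu s)) <= K ->
  Rabs (fst (S s t) - (cos (a * X s t) * c s t / v s t - q)) <= 2 * K /\ Rabs (snd (S s t) - cos (a * X s t) * y s t / v s t) <= 2 * K.
Proof.
 intros Hz HK E1 E2 B1 B2. destruct (density_formula s t Hz) as [Hr Hv]. destruct (E_polar s t Hz) as [Hp [He [_ [F1 [F2 _]]]]].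
 assert (Hs : 0 < sin (a * X s t)) by (apply sin_gt_0; lra). pose proof collar_angle_pos as Hap.
 assert (Hn : Rabs (fst (nu s)) <= 1 /\ Rabs (snd (nu s)) <= 1).
 { pose proof (Re_le_Cmod (nu s)) as Q1. pose proof (Im_le_Cmod (nu s)) as Q2. rewrite (Cmod_normal gam L alpha HJ) in Q1, Q2. tauto. }
 assert (Hnn : fst (nu s) * fst (nu s) + snd (nu s) * snd (nu s) = 1).
 { pose proof (Cmod_sqr (nu s)) as Q. rewrite (Cmod_normal gam L alpha HJ) in Q. lra. }
 assert (G1 : cos (a * X s t) * c s t / v s t = a * cos (a * X s t) / sin (a * X s t) * fst (E s t)) by (rewrite Hv, F1; field; lra).
 assert (G2 : cos (a * X s t) * y s t / v s t = a * cos (a * X s t) / sin (a * X s t) * snd (E s t)) by (rewrite Hv, F2; field; lra).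
 rewrite G1, G2. set (ct := a * cos (a * X s t) / sin (a * X s t)) in *.
 assert (I1 : fst (S s t) - (ct * fst (E s t) - q) = (a1 + q * fst (nu s)) * fst (nu s) + (a2 + q * snd (nu s)) * snd (nu s)).
 { rewrite E1, E2. transitivity (fst (S s t) - ct * fst (E s t) + q * (fst (nu s) * fst (nu s) + snd (nu s) * snd (nu s))); [rewrite Hnn; ring|].
  simpl. ring. }
 assert (I2 : snd (S s t) - ct * snd (E s t) = (a1 + q * fst (nu s)) * snd (nu s) - (a2 + q * snd (nu s)) * fst (nu s)).
 { rewrite E1, E2. simpl. ring. }
 assert (Bm : forall x n, Rabs x <= K -> Rabs n <= 1 -> Rabs (x * n) <= K).
 { intros x n Hx Hn'. rewrite Rabs_mult. nra. }
 rewrite I1, I2. split.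
 - pose proof (Bm _ _ B1 (proj1 Hn)). pose proof (Bm _ _ B2 (proj2 Hn)). lra.
 - nra.
Qed.

(** Continuity and periodicity reduce the infimum over the curve to a minimum over one period. *)
Lemma height_positive_collar (t : R) : (forall s, Omega (cp s t)) -> exists m, 0 < m /\ forall s, m <= X s t.
Proof.
 intros Hz. pose proof (length_pos gam L alpha HJ) as HL.
 destruct (continuity_ab_min (fun s => X s t) 0 L) as [s0 [Hs0 Hs1]]; [lra| |].
 - intros s _. apply (continuity_pt_opp (fun s => ln (Cmod (f (cp s t))))). apply continuity_pt_filterlim.
  assert (Df : cder (fun s => f (cp s t)) s (logder f (cp s t) * f (cp s t) * (RtoC (1 - curvature gam s * t) * tangent gam s))%C).
  { apply (hder_comp_curve f (fun s => cp s t) s); [apply logder_hder, Hz|apply (cder_collar_s gam L alpha HJ)]. }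
  apply (is_derive_cont (fun s => ln (Cmod (f (cp s t)))) s _ (is_derive_ln_Cmod _ s _ Df (annular_neq_0 beta Omega f Hbeta HfA _ (Hz s)))).
 - exists (X s0 t). split; [apply (height_range beta Omega f Hbeta HfA _ (Hz s0))|].
  intros s. destruct (period_reduce L s HL) as [k Hk].
  assert (Hper : forall s, X (s + L) t = X s t) by (intros r; unfold X, cp; rewrite (collar_period gam L alpha HJ); reflexivity).
  rewrite <- (period_Z (fun s => X s t) L Hper k s). apply Hs0. lra.
Qed.

Lemma collar_expansion : exists (t0 C : R) (chi0 lP0 : R -> R), 0 < t0 <= 1 /\ 1 <= C /\ forall s t, 0 < t <= t0 -> Omega (cp s t) /\
  Rabs (fst (S s t) - kap s) <= C * t /\ Rabs (snd (S s t) - chi0 s) <= C * t /\ Rabs (lP s t - lP0 s) <= C * t /\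
  Rabs (fst (E s t) - exp (lP0 s)) <= C * t /\
  Rabs (lP s t - lP0 s - kap s * t - (/ 4 * (kap s * kap s) - / 4 * (chi0 s * chi0 s + a * a * (exp (lP0 s) * exp (lP0 s))) - 3 / 2 * c3 (gam s)) * (t * t))
  <= C * (t * t * Rpower t alpha).
Proof.
 pose proof (liouville_solution_at Omega u HO Hsol) as Hu.
 destruct (blowup_bounded_below Omega u HBd (fun z Hz => proj1 (Hu z Hz)) (proj2 (proj2 Hsol))) as [m Hm].
 destruct (boundary_gradient gam L alpha Ha HJ Omega HO Hout u c3 Hu m Hm H3) as [d1 [K [Hd1 [HK Hgr]]]].
 destruct (third_coefficient_bounded gam L alpha Ha HJ Omega HO Hout u c3 m Hm H3) as [Q [HQ0 HQ]].
 destruct (taylor_bounds gam L alpha Ha HJ) as [G [HG [Hk _]]].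
 destruct (collar_in_domain Omega HO gam L alpha Ha HJ Hout) as [d2 [Hd2 Hcol]].
 destruct H3 as [dl [K3 [Hdl HK3]]].
 set (T := Rmin (Rmin d1 d2) dl). assert (HT : 0 < T <= 1).
 { split; [repeat apply Rmin_pos; lra|]. le_via Rmin_l. lra. }
 assert (HTd : T <= d1 /\ T <= d2 /\ T <= dl).
 { unfold T. lra. }
 assert (Hz : forall s t, 0 < t < T -> Omega (cp s t)) by (intros s t Ht; apply (Hgr s t); lra).
 assert (Hgrad : forall s t, 0 < t < T -> Rabs (v s t - (t - / 2 * kap s * (t * t))) <= 2 * K * (t * t * t) /\
  Rabs (fst (S s t) - (cos (a * X s t) * c s t / v s t - (1 - kap s * t) / (t - / 2 * kap s * (t * t)))) <= 2 * K * t /\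
  Rabs (snd (S s t) - cos (a * X s t) * y s t / v s t) <= 2 * K * t).
 { intros s t Ht. destruct (Hgr s t ltac:(lra)) as [_ [Hkt [Hve Hj]]]. split.
  - le_via Hve. pos.
  - destruct (strip_metric_zjet beta Omega f g Hbeta HO Hf Hg HfA Hgf a 0 (cp s t) (Hz s t Ht) collar_angle_pos (strip_range beta Omega f Hbeta HfA _ (Hz s t Ht))) as [b1 [b2 [J _]]].
   rewrite Rminus_0_r in J.
   assert (J' : zjet u (cp s t) (a * cos (a * X s t) / sin (a * X s t) * fst (p s t) + fst (logder (logder f) (cp s t)))
    (- (a * cos (a * X s t) / sin (a * X s t) * snd (p s t) + snd (logder (logder f) (cp s t)))) b1 b2).
   { apply (zjet_ext_loc (strip_metric f a 0)); [|pos]. destruct (HO _ (Hz s t Ht)) as [r [Hr Hb]]. exists r. split; trivial.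
    intros w Hw. symmetry. apply metric_identity, Hb, Hw. }
   specialize (Hj _ _ _ _ J'). destruct Hj as [Hj1 Hj2].
   set (q := (1 - kap s * t) / (t - / 2 * kap s * (t * t))).
   destruct (gradient_rotation (K * t) q t s _ _ (Hz s t Ht) ltac:(nra) eq_refl eq_refl) as [R1 R2].
   + eapply Rle_trans; [|exact Hj1]. right. f_equal. unfold q, Rdiv. fold (kap s). fold nu. ring.
   + eapply Rle_trans; [|exact Hj2]. right. f_equal. unfold q, Rdiv. fold (kap s). fold nu. ring.
   + lra. }
 destruct (boundary_expansion a (2 * K) G T X lP c y (fun s t => fst (S s t)) (fun s t => snd (S s t)) v kap collar_angle_pos ltac:(lra) HG HT Hk) with
  (c3 := fun s => c3 (gam s)) (K3 := K3) (Q := Q) (al := alpha) as [t0 [C [chi0 [lP0 [Ht0 [HC Hall]]]]]]; trivial.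
 - intros s t Ht. apply density_formula, Hz, Ht.
 - intros s t Ht. apply derive_collar_t, Hz, Ht.
 - intros s t Ht. apply derive_collar_t, Hz, Ht.
 - intros s t Ht. apply derive_collar_t, Hz, Ht.
 - intros s t Ht. apply derive_collar_t, Hz, Ht.
 - intros s t Ht. apply E_polar, Hz, Ht.
 - intros s t Ht. apply density_formula, Hz, Ht.
 - intros s t Ht. apply Hgrad, Ht.
 - intros s t Ht. apply Hgrad, Ht.
 - intros s t Ht. apply Hgrad, Ht.
 - intros e He. destruct (Hor (1 - exp (- e))) as [d [Hd Hdb]].
  { assert (exp (- e) < exp 0) by (apply exp_increasing; lra). rewrite exp_0 in H. lra. }
  exists d. split; trivial. intros s t Ht _. destruct (Hdb s t Ht) as [_ Hlt]. unfold X, height.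
  assert (- e < ln (Cmod (f (cp s t)))); [|lra]. rewrite <- (ln_exp (- e)). apply ln_increasing; [lra|]. unfold cp. lra.
 - intros t Ht. apply height_positive_collar. auto.
 - intros s t Ht.
  assert (Hdz : Cmod (cp s t - gam s) = t).
  { replace (cp s t - gam s)%C with (t * left_normal gam s)%C by ceq.
   rewrite Cmod_mult, Cmod_R, (Cmod_normal gam L alpha HJ), Rabs_right by lra. ring. }
  assert (Hnear : forall w, boundary Omega w -> Cmod (cp s t - gam s) <= Cmod (cp s t - w)).
  { intros w Hw. rewrite Hdz. apply Rnot_lt_le. intros Hlt. apply (proj1 Hw). apply (Hcol s t ltac:(lra)). rewrite Cmod_minus_sym. pos. }
  specialize (HK3 (cp s t) s (Hz s t Ht) Hnear ltac:(lra)). rewrite Hdz in HK3.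
  replace (t - / 2 * kap s * (t * t) + c3 (gam s) * (t * t * t)) with (t - / 2 * curvature gam s * t ^ 2 + c3 (gam s) * t ^ 3) by (unfold kap; ring). easy.
 - exists t0, C, chi0, lP0. split; [lra|]. split; trivial. intros s t Ht. destruct (Hall s t Ht) as [A1 [A2 [A3 [A4 A5]]]].
  assert (HzT : Omega (cp s t)) by (apply Hz; lra). split; trivial. split; trivial. split; trivial. split; trivial.
  destruct (E_polar s t HzT) as [_ [_ [_ [F1 _]]]]. lra.
Qed.

Section FixedLevel.
Context (t : R) (Hz : forall s, Omega (cp s t)).

Lemma cder_p_s (s : R) : cder (fun s => p s t) s (logder (logder f) (cp s t) * p s t * (RtoC (1 - kap s * t) * tangent gam s))%C.
Proof. apply (hder_comp_curve (logder f) (fun s => cp s t) s); [apply logder_logder_hder, Hz|apply (cder_collar_s gam L alpha HJ)]. Qed.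

Lemma cder_f_s (s : R) : cder (fun s => f (cp s t)) s (p s t * f (cp s t) * (RtoC (1 - kap s * t) * tangent gam s))%C.
Proof. apply (hder_comp_curve f (fun s => cp s t) s); [apply logder_hder, Hz|apply (cder_collar_s gam L alpha HJ)]. Qed.

Lemma is_derive_lP_s (s : R) : is_derive (fun s => lP s t) s ((1 - kap s * t) * snd (S s t)).
Proof.
 assert (Hp : p s t <> 0) by (apply (logder_neq_0 beta Omega f g); trivial).
 evar_last; [apply (is_derive_ln_Cmod _ s _ (cder_p_s s) Hp)|].
 replace (logder (logder f) (cp s t) * p s t * (RtoC (1 - kap s * t) * tangent gam s) / p s t)%C
  with (logder (logder f) (cp s t) * (RtoC (1 - kap s * t) * tangent gam s))%C by (field; pos).
 unfold S, nu. simpl. ring.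
Qed.

Lemma ccontR_speed (s : R) : ccontR (fun s => (RtoC (1 - kap s * t) * tangent gam s)%C) s.
Proof.
 apply ccontR_mult; [|eapply cder_ccontR, (cder_tangent gam L alpha HJ)]. apply ccontR_RtoC.
 pose proof (is_derive_cont _ s _ (is_derive_curvature gam L alpha HJ s)). unfold kap. cont.
Qed.

Lemma ccontR_psi (s : R) : ccontR (fun s => logder (logder f) (cp s t)) s.
Proof. eapply (ccont_cder (logder (logder f)) (fun s => cp s t)); [apply logder_logder_ccont, Hz|apply (cder_collar_s gam L alpha HJ)]. Qed.

Lemma ccontR_S (s : R) : ccontR (fun s => S s t) s.
Proof. apply ccontR_mult; [apply ccontR_psi|eapply cder_ccontR, (cder_normal gam L alpha HJ)]. Qed.

Lemma ccontR_E (s : R) : ccontR (fun s => E s t) s.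
Proof.
 apply (ccontR_opp (fun s => (p s t * nu s)%C)). apply ccontR_mult; [eapply cder_ccontR, cder_p_s|eapply cder_ccontR, (cder_normal gam L alpha HJ)].
Qed.

(** By the Cauchy-Riemann equations the normal flux of [ln |p|] through a parallel curve is minus
    the increment of the argument of [p] along it; [(1 - kap s * t) * tangent] is the velocity of
    the parallel curve. *)
Lemma flux_S : exists k : Z, RInt (fun s => (1 - kap s * t) * fst (S s t)) 0 L = 2 * IZR k * PI.
Proof.
 assert (Hp : forall s, p s t <> 0) by (intros s; apply (logder_neq_0 beta Omega f g); trivial).
 pose proof (log_integral_period (fun s => p s t) (fun s => (logder (logder f) (cp s t) * p s t * (RtoC (1 - kap s * t) * tangent gam s))%C) 0 L) as H.
 destruct (cexp_eq_1 _ (H cder_p_s (fun s => ccontR_mult _ _ s (ccontR_mult _ _ s (ccontR_psi s) (cder_ccontR _ _ _ (cder_p_s s))) (ccontR_speed s)) Hp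
  ltac:(cbv beta; unfold p, cp; rewrite <- (collar_period gam L alpha HJ 0 t), Rplus_0_l; reflexivity))) as [k Hk].
 apply (f_equal snd) in Hk.
 change (RInt (fun s => snd (logder (logder f) (cp s t) * p s t * (RtoC (1 - kap s * t) * tangent gam s) / p s t)%C) 0 L = 2 * IZR k * PI) in Hk.
 exists (- k)%Z. rewrite opp_IZR. replace (2 * - IZR k * PI) with (- (2 * IZR k * PI)) by ring. rewrite <- Hk.
 rewrite <- (RInt_opp (V := R_CompleteNormedModule)).
 - apply RInt_ext. intros s _.
  replace (logder (logder f) (cp s t) * p s t * (RtoC (1 - kap s * t) * tangent gam s) / p s t)%C with
   (logder (logder f) (cp s t) * (RtoC (1 - kap s * t) * tangent gam s))%C by (field; pos).
  unfold S, nu. unfold opp; simpl. ring.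
 - apply (ccontR_ex_RInt (fun s => (logder (logder f) (cp s t) * p s t * (RtoC (1 - kap s * t) * tangent gam s) / p s t)%C)).
  intros s _. apply ccontR_mult; [apply (ccontR_mult _ _ s (ccontR_mult _ _ s (ccontR_psi s) (cder_ccontR _ _ _ (cder_p_s s))) (ccontR_speed s))|].
  apply (ccontR_inv _ s _ (cder_p_s s) (Hp s)).
Qed.

(** The same relation for [f] itself: the normal flux of the height is the increment of the argument
    of [f]. *)
Lemma flux_E : exists k : Z, RInt (fun s => (1 - kap s * t) * fst (E s t)) 0 L = 2 * IZR k * PI.
Proof.
 assert (Hp : forall s, f (cp s t) <> 0) by (intros s; apply (annular_neq_0 beta Omega f); trivial).
 pose proof (log_integral_period (fun s => f (cp s t)) (fun s => (p s t * f (cp s t) * (RtoC (1 - kap s * t) * tangent gam s))%C) 0 L) as H.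
 destruct (cexp_eq_1 _ (H cder_f_s (fun s => ccontR_mult _ _ s (ccontR_mult _ _ s (cder_ccontR _ _ _ (cder_p_s s)) (cder_ccontR _ _ _ (cder_f_s s))) (ccontR_speed s)) Hp
  ltac:(cbv beta; unfold cp; rewrite <- (collar_period gam L alpha HJ 0 t), Rplus_0_l; reflexivity))) as [k Hk].
 apply (f_equal snd) in Hk.
 change (RInt (fun s => snd (p s t * f (cp s t) * (RtoC (1 - kap s * t) * tangent gam s) / f (cp s t))%C) 0 L = 2 * IZR k * PI) in Hk.
 exists k. rewrite <- Hk. apply RInt_ext. intros s _.
 replace (p s t * f (cp s t) * (RtoC (1 - kap s * t) * tangent gam s) / f (cp s t))%C with
  (p s t * (RtoC (1 - kap s * t) * tangent gam s))%C by (field; pos).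
 unfold E, nu. simpl. ring.
Qed.

End FixedLevel.

Lemma continuity_2d_S (s t : R) : 0 < t <= 1 -> Omega (cp s t) -> continuity_2d_pt (fun r q => fst (S q r)) t s.
Proof.
 intros Ht Hz eps. destruct (taylor_bounds gam L alpha Ha HJ) as [G [HG [_ [_ [H1 [H2 _]]]]]].
 set (ps := logder (logder f)). set (q0 := Cmod (ps (cp s t)) + 1). assert (Hq0 : 0 < q0) by (unfold q0; pose proof (Cmod_ge_0 (ps (cp s t))); lra).
 pose proof (cond_pos eps) as He.
 destruct (logder_logder_ccont _ Hz (eps / 2)) as [d [Hd Hdb]]; [lra|].
 set (d1 := Rmin (d / (2 * (3 + G))) (eps / (2 * (q0 * G)))).
 assert (Hd1 : 0 < d1) by (apply Rmin_pos; apply Rdiv_lt_0_compat; try lra; nra).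
 exists (mkposreal d1 Hd1). intros r q Hr Hq. change (Rabs (r - t) < d1) in Hr. change (Rabs (q - s) < d1) in Hq.
 assert (L1 : d1 <= d / (2 * (3 + G))) by apply Rmin_l. assert (L2 : d1 <= eps / (2 * (q0 * G))) by apply Rmin_r.
 assert (B1 : Cmod (cp q r - cp s t) < d).
 { eapply Rle_lt_trans; [apply (collar_point_continuous gam L alpha HJ G s t q r HG H1 H2); rewrite Rabs_right; lra|].
  apply Rlt_le_trans with ((3 + G) * d1); [nra|]. apply Rle_trans with ((3 + G) * (d / (2 * (3 + G)))); [pos|].
  replace ((3 + G) * (d / (2 * (3 + G)))) with (d / 2) by (field; lra). lra. }
 specialize (Hdb _ B1).
 assert (B2 : q0 * Cmod (nu q - nu s) <= eps / 2).
 { apply Rle_trans with (q0 * (G * d1)).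
  - apply Rmult_le_compat_l; [lra|]. le_via H2. pos.
  - apply Rle_trans with (q0 * (G * (eps / (2 * (q0 * G))))); [pos|]. right. field; pos. }
 change (Rabs (fst (S q r - S s t)%C) < eps).
 lt_via Re_le_Cmod. unfold S. fold ps.
 replace (ps (cp q r) * nu q - ps (cp s t) * nu s)%C with
  ((ps (cp q r) - ps (cp s t)) * nu q + ps (cp s t) * (nu q - nu s))%C by ring.
 lt_via Cmod_triangle. rewrite !Cmod_mult. rewrite (Cmod_normal gam L alpha HJ).
 assert (Cmod (ps (cp s t)) * Cmod (nu q - nu s) <= q0 * Cmod (nu q - nu s)) by (apply Rmult_le_compat_r; [lra|unfold q0; lra]).
 fold ps in Hdb. lra.
Qed.

(** Differentiation under the integral sign; [continuity_2d_S] supplies the joint continuity in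
    depth and parameter. *)
Lemma is_derive_mean_lP (t t0 : R) : 0 < t < t0 -> t0 <= 1 -> (forall s t, 0 < t < t0 -> Omega (cp s t)) ->
  is_derive (fun t => RInt (fun s => lP s t) 0 L) t (RInt (fun s => fst (S s t)) 0 L).
Proof.
 intros Ht Ht0 Hz. set (d := Rmin t (t0 - t)). assert (Hd : 0 < d) by (apply Rmin_pos; lra).
 assert (Hnb : forall r, Rabs (r - t) < d -> 0 < r < t0).
 { intros r Hr. apply Rabs_def2 in Hr. pose proof (Rmin_l t (t0 - t)). pose proof (Rmin_r t (t0 - t)). unfold d in *. lra. }
 assert (HD : forall r q, 0 < r < t0 -> Derive (fun z => lP q z) r = fst (S q r)).
 { intros r q Hr. apply is_derive_unique. apply (derive_collar_t q r (Hz q r Hr)). }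
 evar_last.
 - apply (is_derive_RInt_param (fun r q => lP q r) 0 L t).
  + exists (mkposreal d Hd). intros r Hr q _. eexists. apply (derive_collar_t q r). auto.
  + intros q _. apply (continuity_2d_pt_ext_loc (fun r q => fst (S q r))).
   * exists (mkposreal d Hd). symmetry. auto.
   * apply continuity_2d_S; [lra|apply Hz; lra].
  + exists (mkposreal d Hd). intros r Hr. apply (ex_RInt_continuous (V := R_CompleteNormedModule)). intros q _.
   apply (is_derive_cont (fun s => lP s r) q _ (is_derive_lP_s r (fun s => Hz s r (Hnb r Hr)) q)).
 - apply RInt_ext. auto.
Qed.

(** All that the integral identity needs, expressed by real functions of [s] and [t], with the
    conformal map no longer visible. *)
Lemma collar_data : exists (t0 C : R) (chi0 lP0 : R -> R) (lP S1 S2 W : R -> R -> R), 0 < t0 <= 1 /\ 1 <= C /\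
  (forall s t, 0 < t <= t0 ->
  Rabs (S1 s t - kap s) <= C * t /\ Rabs (S2 s t - chi0 s) <= C * t /\ Rabs (lP s t - lP0 s) <= C * t /\
  Rabs (W s t - exp (lP0 s)) <= C * t /\
  Rabs (lP s t - lP0 s - kap s * t - (/ 4 * (kap s * kap s) - / 4 * (chi0 s * chi0 s + a * a * (exp (lP0 s) * exp (lP0 s))) - 3 / 2 * c3 (gam s)) * (t * t))
  <= C * (t * t * Rpower t alpha)) /\
  (forall s t, 0 < t <= t0 -> continuous (fun s => S1 s t) s /\ continuous (fun s => S2 s t) s /\ continuous (fun s => W s t) s /\
  is_derive (fun s => lP s t) s ((1 - kap s * t) * S2 s t) /\ lP (s + L) t = lP s t) /\
  (forall t, 0 < t <= t0 -> exists k : Z, RInt (fun s => (1 - kap s * t) * S1 s t) 0 L = 2 * IZR k * PI) /\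
  (forall t, 0 < t <= t0 -> exists k : Z, RInt (fun s => (1 - kap s * t) * W s t) 0 L = 2 * IZR k * PI) /\
  (forall t, 0 < t < t0 -> is_derive (fun t => RInt (fun s => lP s t) 0 L) t (RInt (fun s => S1 s t) 0 L)).
Proof.
 destruct collar_expansion as [t0 [C [chi0 [lP0 [Ht0 [HC Hall]]]]]].
 assert (Hz : forall t, 0 < t <= t0 -> forall s, Omega (cp s t)) by (intros t Ht s; apply (Hall s t Ht)).
 exists t0, C, chi0, lP0, lP, (fun s t => fst (S s t)), (fun s t => snd (S s t)), (fun s t => fst (E s t)).
 split; trivial. split; trivial. split; [intros s t Ht; apply (Hall s t Ht)|]. split.
 { intros s t Ht. split; [apply (ccontR_S t (Hz t Ht) s)|]. split; [apply (ccontR_S t (Hz t Ht) s)|]. split; [apply (ccontR_E t (Hz t Ht) s)|].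
  split; [apply is_derive_lP_s; apply Hz, Ht|]. unfold lP, p, cp. rewrite (collar_period gam L alpha HJ). easy. }
 split; [intros t Ht; apply flux_S, Hz, Ht|]. split; [intros t Ht; apply flux_E, Hz, Ht|].
 intros t Ht. apply (is_derive_mean_lP t t0); trivial; [lra|]. intros s r Hr. apply Hz. lra.
Qed.

End CollarData.

(** * The integral identity *)

Lemma RInt_close (h k : R -> R) (L M : R) : 0 < L -> ex_RInt h 0 L -> ex_RInt k 0 L -> (forall s, 0 <= s <= L -> Rabs (h s - k s) <= M) ->
  Rabs (RInt h 0 L - RInt k 0 L) <= M * L.
Proof.
 intros HL Hh Hk HM. pose proof (RInt_minus (V := R_CompleteNormedModule) h k 0 L Hh Hk) as E.
 replace (RInt h 0 L - RInt k 0 L) with (RInt (fun s => h s + - k s) 0 L) by exact E.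
 le_via (abs_RInt_bound _ 0 L M).
 - apply (ex_RInt_minus (V := R_NormedModule) h k 0 L Hh Hk).
 - intros s Hs. apply HM. rewrite Rmin_left, Rmax_right in Hs by lra. easy.
 - rewrite Rabs_right; lra.
Qed.

Lemma RInt_plus_R (h k : R -> R) (a b : R) : ex_RInt h a b -> ex_RInt k a b -> RInt (fun s => h s + k s) a b = RInt h a b + RInt k a b.
Proof. intros Hh Hk. exact (RInt_plus (V := R_CompleteNormedModule) h k a b Hh Hk). Qed.

Lemma RInt_scal_R (h : R -> R) (a b l : R) : ex_RInt h a b -> RInt (fun s => l * h s) a b = l * RInt h a b.
Proof. intros Hh. exact (RInt_scal (V := R_CompleteNormedModule) h a b l Hh). Qed.

Lemma ex_RInt_cont (h : R -> R) (a b : R) : (forall s, continuous h s) -> ex_RInt h a b.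
Proof. intros H. apply (ex_RInt_continuous (V := R_CompleteNormedModule)). easy. Qed.

Lemma continuous_R_eps (h : R -> R) (s : R) : continuous h s <->
  (forall eps, 0 < eps -> exists d, 0 < d /\ forall r, Rabs (r - s) < d -> Rabs (h r - h s) < eps).
Proof.
 split.
 - intros H eps He. destruct (proj1 (filterlim_locally h (h s)) H (mkposreal eps He)) as [d Hd]. exists d. split; [apply cond_pos|]. easy.
 - intros H. apply filterlim_locally. intros eps. destruct (H eps (cond_pos eps)) as [d [Hd Hb]]. exists (mkposreal d Hd). easy.
Qed.

Lemma Rpower_small (al eps : R) : 0 < al -> 0 < eps -> exists d, 0 < d /\ forall t, 0 < t < d -> Rpower t al < eps.
Proof.
 exists (exp (ln eps / al)). split; [lra|]. intros t Ht.
 rewrite <- (exp_ln eps) at 1 by trivial. apply exp_increasing.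
 assert (Hl : ln t < ln eps / al) by (rewrite <- (ln_exp (ln eps / al)); apply ln_increasing; lra).
 apply (Rmult_lt_compat_l al) in Hl; trivial. replace (al * (ln eps / al)) with (ln eps) in Hl by (field; lra). lra.
Qed.

Section BoundaryIdentity.
Context (L alpha a t0 C G : R) (kap chi0 lP0 c3 : R -> R) (lP S1 S2 W : R -> R -> R).
Context (HL : 0 < L) (Hal : 0 < alpha < 1) (Ht0 : 0 < t0 <= 1) (HC : 1 <= C) (HG : 1 <= G).
Context (Hkc : forall s, continuous kap s) (HkG : forall s, Rabs (kap s) <= G) (Hc3 : ex_RInt c3 0 L).
Context (Hest : forall s t, 0 < t <= t0 ->
  Rabs (S1 s t - kap s) <= C * t /\ Rabs (S2 s t - chi0 s) <= C * t /\ Rabs (lP s t - lP0 s) <= C * t /\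
  Rabs (W s t - exp (lP0 s)) <= C * t /\
  Rabs (lP s t - lP0 s - kap s * t - (/ 4 * (kap s * kap s) - / 4 * (chi0 s * chi0 s + a * a * (exp (lP0 s) * exp (lP0 s))) - 3 / 2 * c3 s) * (t * t))
  <= C * (t * t * Rpower t alpha)).
Context (Hreg : forall s t, 0 < t <= t0 -> continuous (fun s => S1 s t) s /\ continuous (fun s => S2 s t) s /\ continuous (fun s => W s t) s /\
  is_derive (fun s => lP s t) s ((1 - kap s * t) * S2 s t) /\ lP (s + L) t = lP s t).
Context (HfS : forall t, 0 < t <= t0 -> exists k : Z, RInt (fun s => (1 - kap s * t) * S1 s t) 0 L = 2 * IZR k * PI).
Context (HfW : forall t, 0 < t <= t0 -> exists k : Z, RInt (fun s => (1 - kap s * t) * W s t) 0 L = 2 * IZR k * PI).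
Context (HdL : forall t, 0 < t < t0 -> is_derive (fun t => RInt (fun s => lP s t) 0 L) t (RInt (fun s => S1 s t) 0 L)).

Lemma small_level (d Q eps : R) : 0 < d -> 0 < Q -> 0 < eps -> exists t, 0 < t < t0 /\ t < d /\ Q * t < eps.
Proof.
 intros Hd HQ He. exists (Rmin (Rmin t0 d) (eps / Q) / 2). assert (H : 0 < Rmin (Rmin t0 d) (eps / Q)) by pos.
 split; [lra|]. split; [lra|]. rewrite Rmult_comm. apply Rlt_div_r; lra.
Qed.

Lemma chi0_continuous (s : R) : continuous chi0 s.
Proof.
 apply continuous_R_eps. intros eps He. destruct (small_level 1 C (eps / 3)) as [t [Ht1 [_ HCt]]]; [lra|lra|lra|].
 destruct (proj1 (continuous_R_eps (fun s => S2 s t) s) (proj1 (proj2 (Hreg s t ltac:(lra)))) (eps / 3)) as [d [Hd Hb]]; [lra|].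
 exists d. split; trivial. intros r Hr. specialize (Hb r Hr).
 destruct (Hest s t ltac:(lra)) as [_ [A _]]. destruct (Hest r t ltac:(lra)) as [_ [B _]]. lra.
Qed.

(** The functions [lP] at depth [t] and their tangential derivatives converge uniformly, to [lP0]
    and [chi0]. The depth is chosen after the increment [h], so that its error disappears through
    [le_epsilon]. *)
Lemma lP0_derive (s : R) : is_derive lP0 s (chi0 s).
Proof.
 apply is_derive_eps. intros eps He.
 destruct (proj1 (continuous_R_eps chi0 s) (chi0_continuous s) (Rmin 1 (eps / 2))) as [d [Hd Hb]]; [pos|].
 set (B := Rabs (chi0 s) + 1 + C). set (Q := C + G * B).
 assert (HB : 0 < B) by (unfold B; pose proof (Rabs_pos (chi0 s)); lra). assert (HQ : 0 < Q) by (unfold Q; nra).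
 exists d. split; trivial. intros h Hh.
 apply le_epsilon. intros e2 He2.
 set (Z := 2 * C + 1 + Q * (Rabs h + 1)). assert (HZ : 0 < Z) by (unfold Z; pose proof (Rabs_pos h); nra).
 destruct (small_level 1 Z e2) as [t [Ht1 [Ht2 HtZ]]]; trivial; [lra|].
 pose proof (real_mean_value (fun r => lP r t - chi0 s * r) (fun r => (1 - kap r * t) * S2 r t - chi0 s) s (s + h) (eps / 2 + Q * t)) as Hm.
 assert (Hm2 : Rabs (lP (s + h) t - chi0 s * (s + h) - (lP s t - chi0 s * s)) <= (eps / 2 + Q * t) * Rabs (s + h - s)).
 { apply Hm.
  - intros r _. destruct (Hreg r t ltac:(lra)) as [_ [_ [_ [Dl _]]]]. der. ring.
  - intros r Hr. assert (Hrs : Rabs (r - s) < d).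
   { lt_via (Rabs_le_of_between s (s + h) r Hr). lra. }
   specialize (Hb r Hrs).
   destruct (Hest r t ltac:(lra)) as [_ [A _]].
   assert (HS2 : Rabs (S2 r t) <= B).
   { unfold B. replace (S2 r t) with ((S2 r t - chi0 r) + (chi0 r - chi0 s) + chi0 s) by ring.
    le_via Rabs_triang. eapply Rle_trans; [apply Rplus_le_compat_r, Rabs_triang|]. nra. }
   assert (Hk2 : Rabs (kap r * t * S2 r t) <= G * B * t).
   { rewrite !Rabs_mult, (Rabs_right t) by lra. replace (G * B * t) with (G * t * B) by ring. pos. }
   unfold Q. lra. }
 replace (s + h - s) with h in Hm2 by ring.
 destruct (Hest s t ltac:(lra)) as [_ [_ [A1 _]]]. destruct (Hest (s + h) t ltac:(lra)) as [_ [_ [A2 _]]].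
 assert (Hfin : Q * t * Rabs h + 2 * (C * t) <= e2).
 { unfold Z in HtZ. nra. }
 assert (0 <= eps * Rabs h) by nra. lra.
Qed.

Lemma lP0_period (s : R) : lP0 (s + L) = lP0 s.
Proof.
 apply Rminus_diag_uniq.
 destruct (Req_dec (lP0 (s + L) - lP0 s) 0) as [E|E]; trivial.
 apply Rabs_pos_lt in E. destruct (small_level 1 C (Rabs (lP0 (s + L) - lP0 s) / 2)) as [t [Ht1 [_ Hlt]]]; [lra|lra|lra|].
 destruct (Hest s t ltac:(lra)) as [_ [_ [A1 _]]]. destruct (Hest (s + L) t ltac:(lra)) as [_ [_ [A2 _]]].
 destruct (Hreg s t ltac:(lra)) as [_ [_ [_ [_ Hper]]]].
 assert (Rabs (lP0 (s + L) - lP0 s) <= 2 * (C * t)); lra.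
Qed.

Lemma lP0_continuous (s : R) : continuous lP0 s.
Proof. apply (is_derive_cont lP0 s _ (lP0_derive s)). Qed.

Lemma P0_continuous (s : R) : continuous (fun s => exp (lP0 s)) s.
Proof. pose proof lP0_continuous. cont. Qed.

Lemma P0_bounded : exists B, 1 <= B /\ forall s, 0 <= s <= L -> exp (lP0 s) <= B.
Proof.
 destruct (continuity_ab_maj (fun s => exp (lP0 s)) 0 L) as [m [Hm _]]; [lra| |].
 - intros s _. apply continuity_pt_filterlim, P0_continuous.
 - exists (exp (lP0 m) + 1). split; [lra|]. intros s Hs. specialize (Hm s Hs). lra.
Qed.

Lemma flux_close (S : R -> R -> R) (S0 : R -> R) (B t : R) : 0 < t <= t0 -> 0 <= B -> (forall s, continuous (fun s => S s t) s) -> (forall s, continuous S0 s) ->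
  (forall s, 0 <= s <= L -> Rabs (S0 s) <= B /\ Rabs (S s t - S0 s) <= C * t) ->
  Rabs (RInt (fun s => (1 - kap s * t) * S s t) 0 L - RInt S0 0 L) <= (C + G * (B + C)) * L * t.
Proof.
 intros Ht HB Hc Hc0 H. replace ((C + G * (B + C)) * L * t) with ((C + G * (B + C)) * t * L) by ring. apply RInt_close; trivial.
 - apply ex_RInt_cont. intros s. cont.
 - apply ex_RInt_cont, Hc0.
 - intros s Hs. destruct (H s Hs) as [H1 H2]. specialize (HkG s). assert (HW : Rabs (S s t) <= B + C) by nra.
  assert (Hk2 : Rabs (kap s * t * S s t) <= G * (B + C) * t).
  { rewrite !Rabs_mult, (Rabs_right t) by lra. replace (G * (B + C) * t) with (G * t * (B + C)) by ring. pos. }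
  lra.
Qed.

(* The flux is an integral multiple of 2 pi, within [O(t)] of the limit. *)
Lemma total_P0_lower : 2 * PI <= RInt (fun s => exp (lP0 s)) 0 L.
Proof.
 destruct P0_bounded as [B [HB HP]]. set (Y := RInt (fun s => exp (lP0 s)) 0 L).
 assert (HY : 0 < Y). { apply RInt_gt_0; trivial; [intros s _; apply exp_pos|intros s _; apply P0_continuous]. }
 apply Rnot_lt_le. intros Hlt. set (Q := (C + G * (B + C)) * L).
 assert (HQ : 0 < Q) by (unfold Q; assert (0 < G * (B + C)) by nra; apply Rmult_lt_0_compat; lra).
 destruct (small_level 1 Q (Rmin Y (2 * PI - Y))) as [t [Ht [_ Hq]]]; [lra|lra|pos|].
 assert (Hcl : Rabs (RInt (fun s => (1 - kap s * t) * W s t) 0 L - Y) <= Q * t).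
 { apply flux_close; [lra|lra|intros s; apply (Hreg s t); lra|exact P0_continuous|]. intros s Hs. specialize (HP s Hs).
  split; [rewrite Rabs_right; lra|apply (Hest s t); lra]. }
 destruct (HfW t ltac:(lra)) as [k Hk].
 assert (0 < IZR k) by nra. assert (IZR k < 1) by nra. apply lt_IZR in H. assert (k < 1)%Z by (apply lt_IZR; lra). lia.
Qed.

(** Integral multiples of [2 PI] that lie within [O(t)] of the total curvature are all equal for
    small [t], and then equal to their limit. *)
Lemma flux_constant : exists t1, 0 < t1 <= t0 /\ forall t, 0 < t <= t1 -> RInt (fun s => (1 - kap s * t) * S1 s t) 0 L = RInt kap 0 L.
Proof.
 set (I := RInt kap 0 L). set (Q := (C + G * (G + C)) * L).
 assert (HQ : 0 < Q) by (unfold Q; assert (0 < G * (G + C)) by nra; apply Rmult_lt_0_compat; lra).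
 assert (Hcl : forall t, 0 < t <= t0 -> Rabs (RInt (fun s => (1 - kap s * t) * S1 s t) 0 L - I) <= Q * t).
 { intros t Ht. apply flux_close; trivial; [lra|intros s; apply (Hreg s t Ht)|]. intros s _. split; [apply HkG|apply (Hest s t Ht)]. }
 destruct (small_level 1 Q 1) as [t1 [Ht1 [_ Q1]]]; [lra|lra|lra|].
 exists t1. split; [lra|]. intros t Ht.
 assert (Hsame : forall r, 0 < r <= t1 -> RInt (fun s => (1 - kap s * r) * S1 s r) 0 L = RInt (fun s => (1 - kap s * t) * S1 s t) 0 L).
 { intros r Hr. pose proof (Hcl t ltac:(lra)) as A. pose proof (Hcl r ltac:(lra)) as B. destruct (HfS t ltac:(lra)) as [k Hk]. destruct (HfS r ltac:(lra)) as [j Hj].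
  rewrite Hk, Hj. assert (j = k); [|subst; reflexivity].
  pose proof PI2_3_2. assert (H3 : -1 < IZR j - IZR k < 1) by nra. rewrite <- minus_IZR in H3.
  assert (-1 < j - k)%Z by (apply lt_IZR; lra). assert (j - k < 1)%Z by (apply lt_IZR; lra). lia. }
 set (J := RInt (fun s => (1 - kap s * t) * S1 s t) 0 L) in *.
 destruct (Req_dec J I) as [E|E]; trivial. assert (0 < Rabs (J - I)) by lra.
 destruct (small_level t1 Q (Rabs (J - I))) as [r [Hr1 [Hr2 Hr3]]]; trivial; [lra|].
 specialize (Hcl r ltac:(lra)). rewrite (Hsame r ltac:(lra)) in Hcl. lra.
Qed.

(** Constancy of the flux gives [int S1 = int kap + t * int (kap * S1)], and [S1] is [kap] up to
    [O(t)]; integrating in the depth yields the second-order term without any second-order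
    information on [lP]. *)
Lemma mean_expansion : exists t1 Q, 0 < t1 < t0 /\ 0 < Q /\ forall t, 0 < t <= t1 ->
  Rabs (RInt (fun s => lP s t) 0 L - RInt lP0 0 L - t * RInt kap 0 L - / 2 * (t * t) * RInt (fun s => kap s * kap s) 0 L) <= Q * (t * t * t).
Proof.
 destruct flux_constant as [t2 [Ht2 Hfl]]. set (I1 := RInt kap 0 L) in *. set (I2 := RInt (fun s => kap s * kap s) 0 L).
 set (Q := G * C * L). assert (HQ : 0 < Q) by (unfold Q; apply Rmult_lt_0_compat; [nra|lra]).
 set (t1 := t2 / 2). exists t1, Q. split; [unfold t1; lra|]. split; trivial.
 assert (Ht1 : 0 < t1 < t2) by (unfold t1; lra).
 set (h := fun t => RInt (fun s => lP s t) 0 L - t * I1 - / 2 * (t * t) * I2).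
 assert (HlPi : forall t, 0 < t <= t0 -> ex_RInt (fun s => lP s t) 0 L).
 { intros t Ht. apply ex_RInt_cont. intros s. apply (is_derive_cont (fun s => lP s t) s _ (proj1 (proj2 (proj2 (proj2 (Hreg s t Ht)))))). }
 assert (Dh : forall t, 0 < t <= t1 -> is_derive h t (RInt (fun s => S1 s t) 0 L - I1 - t * I2)).
 { intros t Ht. pose proof (HdL t ltac:(lra)). unfold h. der. field. }
 assert (Bh : forall t, 0 < t <= t1 -> Rabs (RInt (fun s => S1 s t) 0 L - I1 - t * I2) <= Q * (t * t)).
 { intros t Ht. specialize (Hfl t ltac:(lra)).
  assert (HS1i : ex_RInt (fun s => S1 s t) 0 L) by (apply ex_RInt_cont; intros s; apply (Hreg s t); lra).
  assert (HkSi : ex_RInt (fun s => kap s * S1 s t) 0 L) by (apply ex_RInt_cont; intros s; destruct (Hreg s t ltac:(lra)); cont).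
  assert (E : RInt (fun s => (1 - kap s * t) * S1 s t) 0 L = RInt (fun s => S1 s t) 0 L + - t * RInt (fun s => kap s * S1 s t) 0 L).
  { rewrite <- RInt_scal_R, <- RInt_plus_R; trivial; [|exact (ex_RInt_scal (V := R_NormedModule) _ 0 L (- t) HkSi)].
   apply RInt_ext. intros s _. lra. }
  assert (E2 : RInt (fun s => S1 s t) 0 L - I1 - t * I2 = t * (RInt (fun s => kap s * S1 s t) 0 L - I2)) by lra.
  rewrite E2, Rabs_mult, (Rabs_right t) by lra. replace (Q * (t * t)) with (t * (G * C * t * L)) by (unfold Q; ring). apply Rmult_le_compat_l; [lra|].
  apply RInt_close; trivial.
  - apply ex_RInt_cont. intros s. cont.
  - intros s _. replace (kap s * S1 s t - kap s * kap s) with (kap s * (S1 s t - kap s)) by ring. rewrite Rabs_mult.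
   replace (G * C * t) with (G * (C * t)) by ring. apply Rmult_le_compat; try apply Rabs_pos; [pos|apply (Hest s t); lra]. }
 intros t Ht. replace (RInt (fun s => lP s t) 0 L - RInt lP0 0 L - t * I1 - / 2 * (t * t) * I2) with (h t - RInt lP0 0 L) by (unfold h; ring).
 apply le_epsilon. intros eps He. set (B := C * L + Rabs I1 + Rabs I2 + 1).
 assert (HB : 0 < B) by (unfold B; pose proof (Rabs_pos I1); pose proof (Rabs_pos I2); nra).
 destruct (small_level t B eps) as [r [Hr1 [Hr2 HBr]]]; trivial; [lra|].
 pose proof (real_mean_value h (fun t => RInt (fun s => S1 s t) 0 L - I1 - t * I2) r t (Q * (t * t))) as Hm. rewrite Rmin_left, Rmax_right in Hm by lra.
 assert (Hm1 : Rabs (h t - h r) <= Q * (t * t) * Rabs (t - r)).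
 { apply Hm; intros q Hq; [apply Dh; lra|]. eapply Rle_trans; [apply Bh; lra|]. pos. }
 rewrite (Rabs_right (t - r)) in Hm1 by lra.
 assert (Hm2 : Q * (t * t) * (t - r) <= Q * (t * t * t)). { nra. }
 assert (Hc : Rabs (RInt (fun s => lP s r) 0 L - RInt lP0 0 L) <= C * r * L).
 { apply RInt_close; [trivial|apply HlPi; lra|apply ex_RInt_cont, lP0_continuous|]. intros s _. apply (Hest s r). lra. }
 assert (Hh0 : Rabs (h r - RInt lP0 0 L) <= B * r).
 { replace (h r - RInt lP0 0 L) with ((RInt (fun s => lP s r) 0 L - RInt lP0 0 L) + - (r * I1) + - (/ 2 * (r * r) * I2)) by (unfold h; ring).
  le_via Rabs_triang. eapply Rle_trans; [apply Rplus_le_compat_r, Rabs_triang|].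
  rewrite !Rabs_Ropp, !Rabs_mult, (Rabs_right r), (Rabs_right (/ 2)) by lra. unfold B.
  assert (/ 2 * (r * r) * Rabs I2 <= r * Rabs I2) by (apply Rmult_le_compat_r; nra). nra. }
 lra.
Qed.

(** The coefficient of [t^2] in the mean of [lP] is [int kap^2 / 2] by the flux and [int kap^2 / 4 -
    (int chi0^2 + a^2 int P^2) / 4 - 3 / 2 * int c3] by the pointwise expansion. *)
Lemma third_coefficient_identity : - 6 * RInt c3 0 L =
  RInt (fun s => kap s * kap s) 0 L + RInt (fun s => chi0 s * chi0 s) 0 L + a * a * RInt (fun s => exp (lP0 s) * exp (lP0 s)) 0 L.
Proof.
 destruct mean_expansion as [t1 [Q [Ht1 [HQ Hme]]]].
 set (I1 := RInt kap 0 L) in *. set (I2 := RInt (fun s => kap s * kap s) 0 L) in *. set (J := RInt (fun s => chi0 s * chi0 s) 0 L).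
 set (P2 := RInt (fun s => exp (lP0 s) * exp (lP0 s)) 0 L). set (I3 := RInt c3 0 L).
 assert (Xk : ex_RInt kap 0 L) by (apply ex_RInt_cont, Hkc).
 pose proof chi0_continuous. pose proof lP0_continuous.
 assert (Xkk : ex_RInt (fun s => kap s * kap s) 0 L) by (apply ex_RInt_cont; intros s; cont).
 assert (Xch : ex_RInt (fun s => chi0 s * chi0 s) 0 L) by (apply ex_RInt_cont; intros s; cont).
 assert (XP : ex_RInt (fun s => exp (lP0 s) * exp (lP0 s)) 0 L) by (apply ex_RInt_cont; intros s; cont).
 assert (XlP0 : ex_RInt lP0 0 L) by (apply ex_RInt_cont, lP0_continuous).
 set (Dl := / 4 * I2 - / 4 * (J + a * a * P2) - 3 / 2 * I3).
 assert (Hst : forall t, 0 < t <= t0 -> Rabs (RInt (fun s => lP s t) 0 L - (RInt lP0 0 L + t * I1 + t * t * Dl)) <= C * (t * t * Rpower t alpha) * L).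
 { intros t Ht.
  assert (sc : forall (h : R -> R) (l : R), ex_RInt h 0 L -> ex_RInt (fun s => l * h s) 0 L) by (intros h l Hh; exact (ex_RInt_scal (V := R_NormedModule) h 0 L l Hh)).
  assert (pl : forall (h k : R -> R), ex_RInt h 0 L -> ex_RInt k 0 L -> ex_RInt (fun s => h s + k s) 0 L) by (intros h k Hh Hk; exact (ex_RInt_plus (V := R_NormedModule) h k 0 L Hh Hk)).
  set (m := fun s => lP0 s + (t * kap s + ((t * t * / 4) * (kap s * kap s) + ((t * t * - / 4) * (chi0 s * chi0 s) + ((t * t * - / 4 * (a * a)) * (exp (lP0 s) * exp (lP0 s)) + (t * t * - (3 / 2)) * c3 s))))).
  pose proof (sc _ (t * t * - (3 / 2)) Hc3) as Y5. pose proof (sc _ (t * t * - / 4 * (a * a)) XP) as Y4. pose proof (sc _ (t * t * - / 4) Xch) as Y3.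
  pose proof (sc _ (t * t * / 4) Xkk) as Y2. pose proof (sc _ t Xk) as Y1.
  pose proof (pl _ _ Y4 Y5) as Z4. pose proof (pl _ _ Y3 Z4) as Z3. pose proof (pl _ _ Y2 Z3) as Z2. pose proof (pl _ _ Y1 Z2) as Z1.
  assert (Xm : ex_RInt m 0 L) by exact (pl _ _ XlP0 Z1).
  assert (Em : RInt m 0 L = RInt lP0 0 L + t * I1 + t * t * Dl).
  { unfold m. rewrite (RInt_plus_R _ _ 0 L XlP0 Z1), (RInt_plus_R _ _ 0 L Y1 Z2), (RInt_plus_R _ _ 0 L Y2 Z3), (RInt_plus_R _ _ 0 L Y3 Z4), (RInt_plus_R _ _ 0 L Y4 Y5).
   rewrite (RInt_scal_R _ 0 L _ Xk), (RInt_scal_R _ 0 L _ Xkk), (RInt_scal_R _ 0 L _ Xch), (RInt_scal_R _ 0 L _ XP), (RInt_scal_R _ 0 L _ Hc3).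
   fold I1 I2 J P2 I3. unfold Dl. lra. }
  rewrite <- Em. apply RInt_close; trivial.
  - apply ex_RInt_cont. intros s. apply (is_derive_cont (fun s => lP s t) s _ (proj1 (proj2 (proj2 (proj2 (Hreg s t Ht)))))).
  - intros s _. destruct (Hest s t Ht) as [_ [_ [_ [_ A]]]]. eapply Rle_trans; [|exact A]. right. f_equal. unfold m. field. }
 assert (Hdiff : Rabs (/ 2 * I2 - Dl) = 0).
 (* After division by [t^2] the errors are [Q * t] and a multiple of [t^alpha]; since
    [t <= t^alpha], both vanish with [t^alpha]. *)
 { apply Rle_antisym; [|lra]. apply le_epsilon. intros eps He.
  destruct (Rpower_small alpha (eps / (Q + C * L))) as [d [Hd Hdb]]; [lra|pos|].
  destruct (small_level (Rmin t1 d) 1 1) as [t [Ht2 [Ht3 _]]]; [pos|lra|lra|].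
  specialize (Hme t ltac:(lra)). specialize (Hst t ltac:(lra)). specialize (Hdb t ltac:(lra)).
  pose proof (Rpower_between t alpha ltac:(lra) Hal) as Hw. set (w := Rpower t alpha) in *.
  assert (Htt : 0 < t * t) by nra.
  assert (Hk : Rabs ((/ 2 * I2 - Dl) * (t * t)) <= (Q + C * L) * w * (t * t)).
  { assert (Q1 : Q * (t * t * t) <= Q * w * (t * t)) by nra. lra. }
  rewrite Rabs_mult, (Rabs_right (t * t)) in Hk by lra. apply Rmult_le_reg_r in Hk; trivial.
  assert ((Q + C * L) * w <= eps).
  { apply Rle_trans with ((Q + C * L) * (eps / (Q + C * L))); [pos|right; field; nra]. }
  lra. }
 assert (E : / 2 * I2 - Dl = 0). { lra. }
 unfold Dl in E. lra.
Qed.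

End BoundaryIdentity.

(** * Total curvature *)

Lemma RInt_translate (h : R -> R) (a b c : R) : (forall s, continuous h s) -> RInt (fun s => h (s + c)) a b = RInt h (a + c) (b + c).
Proof.
 intros Hc. pose proof (RInt_comp_lin (V := R_CompleteNormedModule) h 1 c a b) as H. rewrite !Rmult_1_l in H. rewrite <- H.
 - apply RInt_ext. intros s _. rewrite !Rmult_1_l. easy.
 - apply ex_RInt_cont, Hc.
Qed.

Lemma RInt_period (h : R -> R) (L a : R) : (forall s, continuous h s) -> (forall s, h (s + L) = h s) -> RInt h a (a + L) = RInt h 0 L.
Proof.
 intros Hc Hp.
 assert (Hx : forall p q, ex_RInt h p q) by (intros p q; apply ex_RInt_cont, Hc).
 assert (E : RInt h L (a + L) = RInt h 0 a).
 { rewrite <- (Rplus_0_l L) at 1. rewrite <- (RInt_translate h 0 a L Hc). apply RInt_ext. easy. }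
 pose proof (RInt_Chasles (V := R_CompleteNormedModule) h a L (a + L) (Hx _ _) (Hx _ _)) as C1.
 pose proof (RInt_Chasles (V := R_CompleteNormedModule) h 0 a L (Hx _ _) (Hx _ _)) as C2.
 unfold plus in C1, C2; simpl in C1, C2. lra.
Qed.

(** An increase would pass through [h a + PI], which is not an integral multiple of [2 PI] when
    [h a] is one. *)
Lemma lipschitz_integer_increasing (h : R -> R) (a b K : R) : a <= b ->
  (forall x y, a <= x <= b -> a <= y <= b -> Rabs (h x - h y) <= K * Rabs (x - y)) ->
  (forall x, a <= x <= b -> exists k : Z, h x = 2 * IZR k * PI) -> h b <= h a.
Proof.
 intros Hab HL Hk. apply Rnot_lt_le. intros Hlt.
 assert (Hab' : a < b). { destruct (Req_dec a b) as [E|E]; [rewrite E in Hlt; lra|lra]. }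
 destruct (Hk a ltac:(lra)) as [k Ek]. destruct (Hk b ltac:(lra)) as [j Ej].
 assert (Hkj : (k < j)%Z) by (apply lt_IZR; nra). assert (Hkj' : IZR k + 1 <= IZR j) by (rewrite <- plus_IZR; apply IZR_le; lia).
 (* Clamping to the interval makes the function continuous at the two end points from both sides, as
    the intermediate value theorem asks. *)
 set (cl := fun x => Rmax a (Rmin b x)).
 assert (Hcl : forall x, a <= cl x <= b).
 { split; [apply Rmax_l|]. apply Rmax_lub; [lra|lra]. }
 assert (Hcl1 : forall x y, Rabs (cl x - cl y) <= Rabs (x - y)).
 { intros x y. unfold cl, Rmax, Rmin. repeat destruct Rle_dec; unfold Rabs; repeat destruct Rcase_abs; lra. }
 assert (HK : 0 <= K). { specialize (HL a b ltac:(lra) ltac:(lra)). nra. }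
 destruct (Ranalysis5.IVT_interv (fun x => h (cl x) - (h a + PI)) a b) as [x [Hx E]].
 - intros x _. apply continuity_pt_filterlim. apply (proj2 (continuous_R_eps (fun x => h (cl x) - (h a + PI)) x)). intros eps He. exists (eps / (K + 1)). split; [pos|].
  intros r Hr. replace (h (cl r) - (h a + PI) - (h (cl x) - (h a + PI))) with (h (cl r) - h (cl x)) by ring.
  eapply Rle_lt_trans; [apply HL; apply Hcl|]. apply Rle_lt_trans with (K * Rabs (r - x)); [pos|].
  apply Rle_lt_trans with (K * (eps / (K + 1))); [pos|].
  apply Rmult_lt_reg_r with (K + 1); [lra|]. replace (K * (eps / (K + 1)) * (K + 1)) with (K * eps) by (field; lra). nra.
 - easy.
 - replace (cl a) with a by (unfold cl; rewrite Rmin_right, Rmax_left; lra). lra.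
 - replace (cl b) with b by (unfold cl; rewrite Rmin_left, Rmax_right; lra). nra.
 - destruct (Hk (cl x) (Hcl x)) as [m Em].
  assert (E2 : 2 * (IZR m - IZR k) = 1) by nra.
  rewrite <- minus_IZR in E2. assert (E3 : IZR (2 * (m - k)) = 1) by (rewrite mult_IZR; exact E2). apply eq_IZR in E3. lia.
Qed.

Lemma lipschitz_integer_constant (h : R -> R) (a b K : R) : a <= b ->
  (forall x y, a <= x <= b -> a <= y <= b -> Rabs (h x - h y) <= K * Rabs (x - y)) ->
  (forall x, a <= x <= b -> exists k : Z, h x = 2 * IZR k * PI) -> h b = h a.
Proof.
 intros Hab HL Hk. apply Rle_antisym; [apply (lipschitz_integer_increasing h a b K); trivial|].
 assert (- h b <= - h a); [|lra]. apply (lipschitz_integer_increasing (fun x => - h x) a b K); trivial.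
 - intros x y Hx Hy. replace (- h x - - h y) with (- (h x - h y)) by ring. rewrite Rabs_Ropp. auto.
 - intros x Hx. destruct (Hk x Hx) as [k E]. exists (- k)%Z. rewrite opp_IZR, E. ring.
Qed.

Section Hopf.
Context (gam : R -> C) (L alpha : R) (Ha : 0 < alpha < 1) (HJ : C3alpha_jordan_arclength gam L alpha).

(** Hopf's secants: [turning x] is the change of the argument of the chord of parameter length [x]
    as it moves once around the curve. It interpolates between the tangent at [x = 0] and the
    half-period chord. *)
Let chord (x s : R) := (gam (s + x)%R - gam s)%C.
Let dchord (x s : R) := (tangent gam (s + x)%R - tangent gam s)%C.
Let quot (x s : R) := (dchord x s / chord x s)%C.
Let turning (x : R) := RInt (fun s => snd (quot x s)) 0 L.

Lemma cder_translate (h : R -> C) (x s : R) (l : C) : cder h (s + x) l -> cder (fun s => h (s + x)) s l.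
Proof.
 intros H. eapply cder_eq; [|apply (cder_comp h (fun s => s + x)); [exact H|der_core]]. ceq.
Qed.

Lemma cder_minus (c1 c2 : R -> C) (s : R) (l1 l2 : C) : cder c1 s l1 -> cder c2 s l2 -> cder (fun s => (c1 s - c2 s)%C) s (l1 - l2)%C.
Proof. intros [A1 A2] [B1 B2]. split; [apply (is_derive_minus (fun s : R => fst (c1 s)) (fun s : R => fst (c2 s)))|apply (is_derive_minus (fun s : R => snd (c1 s)) (fun s : R => snd (c2 s)))]; trivial. Qed.

Lemma cder_chord (x s : R) : cder (chord x) s (dchord x s).
Proof. apply cder_minus; [apply cder_translate|]; apply (cder_gamma gam L alpha HJ). Qed.

Lemma ccontR_dchord (x s : R) : ccontR (dchord x) s.
Proof. eapply cder_ccontR. apply cder_minus; [apply cder_translate|]; apply (cder_tangent gam L alpha HJ). Qed.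

Lemma chord_neq_0 (x s : R) : 0 < x < L -> chord x s <> 0.
Proof.
 intros Hx E. apply (gamma_injective gam L alpha HJ s (s + x)); [lra|]. unfold chord in E. rewrite <- (Cplus_0_r (gam s)), <- E. ring.
Qed.

Lemma ccontR_quot (x s : R) : 0 < x < L -> ccontR (quot x) s.
Proof. intros Hx. apply ccontR_mult; [apply ccontR_dchord|apply (ccontR_inv _ s _ (cder_chord x s) (chord_neq_0 x s Hx))]. Qed.

Lemma turning_integer (x : R) : 0 < x < L -> exists k : Z, turning x = 2 * IZR k * PI.
Proof.
 intros Hx. destruct (cexp_eq_1 _ (log_integral_period (chord x) (dchord x) 0 L (cder_chord x) (ccontR_dchord x) (fun s => chord_neq_0 x s Hx)
  ltac:(unfold chord; rewrite Rplus_0_l; replace (L + x) with (x + L) by ring; rewrite <- (Rplus_0_l L) at 2; rewrite !(gamma_period gam L alpha HJ); reflexivity))) as [k Hk].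
 exists k. apply (f_equal snd) in Hk. pos.
Qed.

Lemma dchord_normal (x s : R) : dchord x s = (- Ci * (left_normal gam (s + x)%R - left_normal gam s))%C.
Proof. ceq. Qed.

Lemma Cmod_Ci : Cmod Ci = 1.
Proof. unfold Ci, Cmod; simpl. replace (0 * (0 * 1) + 1 * (1 * 1)) with 1 by ring. apply sqrt_1. Qed.

(** To leading order the chord is [x * tangent] and its derivative [kap * x * normal], so the
    logarithmic derivative tends to [Ci * kap]; the chord-arc bound controls the denominator. *)
Lemma turning_near_0 : exists K, 0 < K /\ forall x, 0 < x <= L / 2 -> Rabs (turning x - RInt (curvature gam) 0 L) <= K * x.
Proof.
 pose proof (length_pos gam L alpha HJ) as HL.
 destruct (taylor_bounds gam L alpha Ha HJ) as [G [HG [Hk [_ [_ [_ [HT [HN _]]]]]]]]. destruct (bilipschitz gam L alpha Ha HJ) as [c [Hc Hbl]].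
 exists ((G + G * G) / c * L). split; [pos|]. intros x Hx.
 replace ((G + G * G) / c * L * x) with ((G + G * G) / c * x * L) by ring. apply RInt_close; trivial.
 - apply ex_RInt_cont. intros s. apply ccontR_quot. lra.
 - apply ex_RInt_cont. intros s. apply (is_derive_cont _ s _ (is_derive_curvature gam L alpha HJ s)).
 - intros s _. assert (Hn := chord_neq_0 x s ltac:(lra)). specialize (HT s (s + x)). specialize (HN s (s + x)). specialize (Hbl s (s + x)). specialize (Hk s).
  replace (s + x - s) with x in HT, HN, Hbl by ring. rewrite (Rabs_right x) in HT, HN, Hbl by lra. fold (chord x s) in HT, Hbl.
  set (k := curvature gam s) in *. set (e2 := (chord x s - x * tangent gam s)%C) in *.
  set (e1 := (left_normal gam (s + x)%R - left_normal gam s + RtoC (k * x) * tangent gam s)%C) in *.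
  assert (EQ : (quot x s - Ci * k)%C = ((- Ci * e1 - Ci * k * e2) / chord x s)%C).
  { unfold quot. rewrite dchord_normal. unfold e1, e2. rewrite RtoC_mult. field; pos. }
  replace (snd (quot x s) - k) with (snd (quot x s - Ci * k)%C) by (simpl; ring).
  le_via Im_le_Cmod. rewrite EQ, Cmod_div by exact Hn.
  assert (B1 : Cmod (- Ci * e1 - Ci * k * e2) <= (G + G * G) * (x * x)).
  { le_via Cmod_triangle_minus. rewrite !Cmod_mult, Cmod_opp, Cmod_Ci, Cmod_R.
   nra. }
  apply Rmult_le_reg_r with (Cmod (chord x s)); [nra|]. unfold Rdiv at 1. rewrite Rmult_assoc, Rinv_l, Rmult_1_r by nra.
  le_via B1. apply Rle_trans with ((G + G * G) / c * x * (c * x)); [right; field; lra|]. pos.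
Qed.

Lemma turning_lipschitz (d : R) : 0 < d <= L / 2 -> exists K, forall x y, d <= x <= L / 2 -> d <= y <= L / 2 -> Rabs (turning x - turning y) <= K * Rabs (x - y).
Proof.
 intros Hd. pose proof (length_pos gam L alpha HJ) as HL.
 destruct (taylor_bounds gam L alpha Ha HJ) as [G [HG [_ [_ [HLip [HN1 _]]]]]]. destruct (bilipschitz gam L alpha Ha HJ) as [c [Hc Hbl]].
 set (m := c * d). assert (Hm : 0 < m) by (apply Rmult_lt_0_compat; lra).
 exists ((G / m + 4 / (m * m)) * L). intros x y Hx Hy. replace ((G / m + 4 / (m * m)) * L * Rabs (x - y)) with ((G / m + 4 / (m * m)) * Rabs (x - y) * L) by ring.
 apply RInt_close; trivial; [apply ex_RInt_cont; intros s; apply ccontR_quot; lra|apply ex_RInt_cont; intros s; apply ccontR_quot; lra|].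
 intros s _. assert (Hnx := chord_neq_0 x s ltac:(lra)). assert (Hny := chord_neq_0 y s ltac:(lra)).
 assert (Hlow : forall z, d <= z <= L / 2 -> m <= Cmod (chord z s)).
 { intros z Hz. specialize (Hbl s (s + z)). specialize (Hbl ltac:(lra)). unfold chord, m. nra. }
 pose proof (Hlow x Hx) as Lx. pose proof (Hlow y Hy) as Ly.
 change (snd (quot x s) - snd (quot y s)) with (snd (quot x s - quot y s)%C). le_via Im_le_Cmod.
 assert (EQ : (quot x s - quot y s)%C = ((dchord x s - dchord y s) / chord x s + dchord y s * (chord y s - chord x s) / (chord x s * chord y s))%C).
 { unfold quot. field; pos. }
 rewrite EQ. le_via Cmod_triangle. rewrite !Cmod_div by (try apply Cmult_neq_0; trivial). rewrite !Cmod_mult.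
 assert (B1 : Cmod (dchord x s - dchord y s) <= G * Rabs (x - y)).
 { rewrite !dchord_normal. replace (- Ci * (left_normal gam (s + x)%R - left_normal gam s) - - Ci * (left_normal gam (s + y)%R - left_normal gam s))%C
   with (- Ci * (left_normal gam (s + x)%R - left_normal gam (s + y)%R))%C by ring.
  rewrite Cmod_mult, Cmod_opp, Cmod_Ci, Rmult_1_l. le_via HN1. pos. }
 assert (B2 : Cmod (chord y s - chord x s) <= 2 * Rabs (x - y)).
 { unfold chord. replace (gam (s + y)%R - gam s - (gam (s + x)%R - gam s))%C with (gam (s + y)%R - gam (s + x)%R)%C by ring.
  le_via HLip. pos. }
 assert (B3 : Cmod (dchord y s) <= 2).
 { le_via Cmod_triangle_minus. rewrite !(Cmod_tangent gam L alpha HJ). lra. }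
 assert (I1 : / Cmod (chord x s) <= / m) by (apply Rinv_le_contravar; trivial).
 assert (I2 : / (Cmod (chord x s) * Cmod (chord y s)) <= / (m * m)) by (apply Rinv_le_contravar; [nra|pos]).
 rewrite Rmult_plus_distr_r. unfold Rdiv. apply Rplus_le_compat.
 - replace (G * / m * Rabs (x - y)) with (G * Rabs (x - y) * / m) by ring. pos.
 - replace (4 * / (m * m) * Rabs (x - y)) with (2 * (2 * Rabs (x - y)) * / (m * m)) by ring. pos.
Qed.

(* The half-period chord is antiperiodic, so its argument changes by an odd multiple of pi over each half. *)
Lemma turning_half : exists k : Z, turning (L / 2) = 2 * PI * (2 * IZR k + 1).
Proof.
 pose proof (length_pos gam L alpha HJ) as HL. assert (Hx : 0 < L / 2 < L) by lra.
 assert (Hanti : forall s, chord (L / 2) (s + L / 2) = (- chord (L / 2)%R s)%C).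
 { intros s. unfold chord. replace (s + L / 2 + L / 2) with (s + L) by field. rewrite (gamma_period gam L alpha HJ). ring. }
 assert (Hdanti : forall s, dchord (L / 2) (s + L / 2) = (- dchord (L / 2)%R s)%C).
 { intros s. unfold dchord. replace (s + L / 2 + L / 2) with (s + L) by field. rewrite (tangent_period gam L alpha HJ). ring. }
 assert (Hq : forall s, quot (L / 2) (s + L / 2) = quot (L / 2) s).
 { intros s. unfold quot. rewrite Hanti, Hdanti. assert (Hn := chord_neq_0 (L / 2) s Hx). field; pos. }
 pose proof (exp_log_integral (chord (L / 2)) (dchord (L / 2)) 0 (L / 2) (cder_chord _) (ccontR_dchord _) (fun s => chord_neq_0 _ s Hx)) as H.
 change (fun t => (dchord (L / 2)%R t / chord (L / 2)%R t)%C) with (quot (L / 2)) in H.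
 set (I := CInt (quot (L / 2)) 0 (L / 2)) in *.
 rewrite <- (Rplus_0_l (L / 2)) in H at 2. rewrite Hanti in H. assert (Hn := chord_neq_0 (L / 2) 0 Hx).
 assert (HI : cexp I = (- 1)%C).
 { replace (cexp I) with (chord (L / 2)%R 0 * cexp I / chord (L / 2)%R 0)%C by (field; pos). rewrite <- H. field; pos. }
 assert (Hpi : cexp (I + ((0, PI) : C))%C = 1).
 { rewrite cexp_add, HI. apply injective_projections; simpl; rewrite ?exp_0, ?cos_PI, ?sin_PI; ring. }
 destruct (cexp_eq_1 _ Hpi) as [k Hk]. apply (f_equal snd) in Hk.
 change (RInt (fun s => snd (quot (L / 2) s)) 0 (L / 2) + PI = 2 * IZR k * PI) in Hk.
 exists (k - 1)%Z. rewrite minus_IZR.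
 assert (Hc : forall s, continuous (fun s => snd (quot (L / 2) s)) s) by (intros s; apply ccontR_quot; exact Hx).
 unfold turning. pose proof (RInt_Chasles (V := R_CompleteNormedModule) (fun s => snd (quot (L / 2) s)) 0 (L / 2) L (ex_RInt_cont _ _ _ Hc) (ex_RInt_cont _ _ _ Hc)) as E.
 change (RInt (fun s => snd (quot (L / 2) s)) 0 (L / 2) + RInt (fun s => snd (quot (L / 2) s)) (L / 2) L = RInt (fun s => snd (quot (L / 2) s)) 0 L) in E.
 rewrite <- E.
 assert (E2 : RInt (fun s => snd (quot (L / 2) s)) (L / 2) L = RInt (fun s => snd (quot (L / 2) s)) 0 (L / 2)).
 { pose proof (RInt_translate (fun s => snd (quot (L / 2) s)) 0 (L / 2) (L / 2) Hc) as T.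
  replace (L / 2 + L / 2) with L in T by field. rewrite Rplus_0_l in T. rewrite <- T. apply RInt_ext. intros s _. rewrite Hq. reflexivity. }
 lra.
Qed.

(** [turning] is locally Lipschitz on [(0, L / 2]] with values in multiples of [2 PI], hence
    constant there, and its limit at 0 is the total curvature. *)
Lemma total_curvature_odd : exists k : Z, RInt (curvature gam) 0 L = 2 * PI * (2 * IZR k + 1).
Proof.
 pose proof (length_pos gam L alpha HJ) as HL. destruct turning_half as [k Hk]. exists k. rewrite <- Hk.
 destruct turning_near_0 as [K [HK Hn]].
 assert (Hc : forall x, 0 < x <= L / 2 -> turning (L / 2) = turning x).
 { intros x Hx. destruct (turning_lipschitz x Hx) as [Q HQ]. apply (lipschitz_integer_constant turning x (L / 2) Q); [lra|pos|].
  intros r Hr. apply turning_integer. lra. }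
 destruct (Req_dec (turning (L / 2)) (RInt (curvature gam) 0 L)) as [E|E]; [lra|exfalso].
 set (e := Rabs (turning (L / 2) - RInt (curvature gam) 0 L)). assert (He : 0 < e) by (apply Rabs_pos_lt; lra).
 set (x := Rmin (L / 2) (e / (2 * K))). assert (H1 : 0 < x) by (apply Rmin_pos; [lra|pos]).
 assert (H2 : x <= L / 2) by apply Rmin_l. assert (H3 : x <= e / (2 * K)) by apply Rmin_r.
 specialize (Hn x ltac:(lra)). rewrite <- (Hc x ltac:(lra)) in Hn. fold e in Hn.
 assert (K * x <= e / 2) by (apply Rle_trans with (K * (e / (2 * K))); [pos|right; field; lra]). lra.
Qed.

End Hopf.

(** * The Wirtinger inequality *)

Lemma is_derive_primitive (P : R -> R) (a s : R) : (forall s, continuous P s) -> is_derive (fun s => RInt P a s) s (P s).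
Proof.
 intros Hc. apply (is_derive_RInt (V := R_NormedModule) P (fun s => RInt P a s) a s); [|pos].
 exists (mkposreal 1 Rlt_0_1). intros r _. apply (RInt_correct (V := R_CompleteNormedModule)), ex_RInt_cont, Hc.
Qed.

Lemma antiperiodic_zero (h : R -> R) (L : R) : 0 < L -> (forall s, continuous h s) -> (forall s, h (s + L) = - h s) -> exists s, h s = 0.
Proof.
 intros HL Hc Ha. pose proof (Ha 0) as E. rewrite Rplus_0_l in E.
 destruct (Rtotal_order (h 0) 0) as [H|[H|H]]; [|exists 0; exact H|].
 - destruct (Ranalysis5.IVT_interv h 0 L) as [s [_ Hs]]; [intros s _; apply continuity_pt_filterlim, Hc|lra|lra|lra|exists s; exact Hs].
 - destruct (Ranalysis5.IVT_interv (fun s => - h s) 0 L) as [s [_ Hs]]; [intros s _; apply (continuity_pt_opp h), continuity_pt_filterlim, Hc|lra|lra|lra|exists s; lra].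
Qed.

Section Wirtinger.
Context (L : R) (h h' P : R -> R) (HL : 0 < L) (HP : forall s, 0 < P s) (HPc : forall s, continuous P s) (HPp : forall s, P (s + L) = P s)
  (Hd : forall s, is_derive h s (h' s)) (Hc' : forall s, continuous h' s)
  (Hanti : forall s, h (s + L) = - h s) (Hanti' : forall s, h' (s + L) = - h' s).

Let Y := RInt P 0 L.

(* Completing the square against [h^2 cot x] with [x' = mu P]; a frequency [mu < PI / Y] keeps [x] inside (0, PI). *)
Lemma wirtinger_subcritical (mu : R) : 0 < mu -> mu * Y < PI ->
  mu * mu * RInt (fun s => h s * h s * P s) 0 L <= RInt (fun s => h' s * h' s / P s) 0 L.
Proof.
 intros Hmu HmuY.
 assert (Hc : forall s, continuous h s) by (intros s; apply (is_derive_cont h s _ (Hd s))).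
 (* Starting the period at a zero of [h] makes the boundary terms of [F] vanish at both ends. *)
 destruct (antiperiodic_zero h L HL Hc Hanti) as [s0 Hs0].
 (* The slack is split evenly: [x] runs from [dl] to [PI - dl], away from the poles of the
    cotangent. *)
 set (dl := (PI - mu * Y) / 2).
 set (x := fun s => dl + mu * RInt P s0 s).
 assert (Dx : forall s, is_derive x s (mu * P s)).
 { intros s. pose proof (is_derive_primitive P s0 s HPc). unfold x. der. ring. }
 assert (Hx : forall s, s0 <= s <= s0 + L -> 0 < x s < PI).
 { intros s Hs. assert (A1 : 0 <= RInt P s0 s) by (apply RInt_ge_0; [lra|apply ex_RInt_cont, HPc|intros r _; left; apply HP]).
  assert (A2 : 0 <= RInt P s (s0 + L)) by (apply RInt_ge_0; [lra|apply ex_RInt_cont, HPc|intros r _; left; apply HP]).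
  pose proof (RInt_Chasles (V := R_CompleteNormedModule) P s0 s (s0 + L) (ex_RInt_cont _ _ _ HPc) (ex_RInt_cont _ _ _ HPc)) as E.
  change (RInt P s0 s + RInt P s (s0 + L) = RInt P s0 (s0 + L)) in E. rewrite (RInt_period P L s0 HPc HPp) in E. fold Y in E.
  unfold x, dl. nra. }
 set (F := fun s => h s * h s * (cos (x s) / sin (x s))).
 set (G := fun s => 2 * h s * h' s * (cos (x s) / sin (x s)) - h s * h s * (mu * P s / (sin (x s) * sin (x s)))).
 assert (Hsin : forall s, s0 <= s <= s0 + L -> 0 < sin (x s)) by (intros s Hs; specialize (Hx s Hs); apply sin_gt_0; lra).
 assert (DF : forall s, s0 <= s <= s0 + L -> is_derive F s (G s)).
 { intros s Hs. specialize (Hsin s Hs). unfold F. der; [lra|]. pose proof (sin2_cos2 (x s)) as E. unfold Rsqr in E. unfold G.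
  transitivity (2 * h s * h' s * (cos (x s) / sin (x s)) - h s * h s * (mu * P s * (sin (x s) * sin (x s) + cos (x s) * cos (x s)) / (sin (x s) * sin (x s)))); [field; lra|].
  rewrite E. field. lra. }
 assert (Hxc : forall s, continuous x s) by (intros s; apply (is_derive_cont x s _ (Dx s))).
 assert (HGc : forall s, s0 <= s <= s0 + L -> continuous G s).
 { intros s Hs. specialize (Hsin s Hs). unfold G. cont; [lra|nra]. }
 assert (IG : is_RInt G s0 (s0 + L) 0).
 { evar_last; [apply (is_RInt_derive (V := R_CompleteNormedModule) F G s0 (s0 + L)); rewrite Rmin_left, Rmax_right by lra; [pos|pos]|].
  unfold minus, plus, opp; simpl. unfold F. rewrite Hanti, Hs0. ring. }
 set (A := fun s => h s * h s * P s). set (B := fun s => h' s * h' s / P s).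
 assert (HA : forall s, continuous A s) by (intros s; unfold A; cont).
 assert (HB : forall s, continuous B s) by (intros s; specialize (HP s); unfold B; cont; lra).
 rewrite <- (RInt_period A L s0 HA) by (intros s; unfold A; rewrite Hanti, HPp; ring).
 rewrite <- (RInt_period B L s0 HB) by (intros s; unfold B; rewrite Hanti', HPp; field; apply Rgt_not_eq, HP).
 assert (IA := RInt_correct (V := R_CompleteNormedModule) A s0 (s0 + L) (ex_RInt_cont _ _ _ HA)).
 assert (IB := RInt_correct (V := R_CompleteNormedModule) B s0 (s0 + L) (ex_RInt_cont _ _ _ HB)).
 assert (IS : is_RInt (fun s => B s + ((- (mu * mu)) * A s + (- mu) * G s)) s0 (s0 + L) (RInt B s0 (s0 + L) + ((- (mu * mu)) * RInt A s0 (s0 + L) + (- mu) * 0))).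
 { apply (is_RInt_plus (V := R_NormedModule) B (fun s => (- (mu * mu)) * A s + (- mu) * G s)); [pos|].
  apply (is_RInt_plus (V := R_NormedModule) (fun s => (- (mu * mu)) * A s) (fun s => (- mu) * G s)).
  - apply (is_RInt_scal (V := R_NormedModule) A); exact IA.
  - apply (is_RInt_scal (V := R_NormedModule) G); exact IG. }
 assert (Hge : 0 <= RInt B s0 (s0 + L) + ((- (mu * mu)) * RInt A s0 (s0 + L) + (- mu) * 0)).
 { rewrite <- (is_RInt_unique (V := R_CompleteNormedModule) _ _ _ _ IS). apply RInt_ge_0; [lra|eexists; exact IS|].
  intros s Hs. specialize (Hsin s ltac:(lra)). specialize (HP s). pose proof (sin2_cos2 (x s)) as E. unfold Rsqr in E.
  set (ct := cos (x s) / sin (x s)).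
  assert (Ect : / (sin (x s) * sin (x s)) = 1 + ct * ct).
  { unfold ct. apply (Rmult_eq_reg_r (sin (x s) * sin (x s))); [|nra]. rewrite Rinv_l by nra. rewrite <- E at 1. field. lra. }
  replace (B s + (- (mu * mu) * A s + - mu * G s)) with ((h' s - mu * P s * h s * ct) * (h' s - mu * P s * h s * ct) / P s).
  - pos.
  - unfold A, B, G. fold ct. replace (mu * P s / (sin (x s) * sin (x s))) with (mu * P s * (1 + ct * ct)) by nra. field. lra. }
 lra.
Qed.

(** The critical frequency is reached by approximation: a strict failure with margin [gap] would
    persist at frequency [q - e], since lowering [q] by [e] costs at most [2 q e A <= gap / 2]. *)
Lemma weighted_wirtinger : (PI / Y) * (PI / Y) * RInt (fun s => h s * h s * P s) 0 L <= RInt (fun s => h' s * h' s / P s) 0 L.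
Proof.
 assert (HY : 0 < Y) by (apply RInt_gt_0; [lra|pos|pos]).
 pose proof PI_RGT_0 as Hpi. set (q := PI / Y). assert (Hq : 0 < q) by (apply Rdiv_lt_0_compat; trivial).
 set (A := RInt (fun s => h s * h s * P s) 0 L). set (B := RInt (fun s => h' s * h' s / P s) 0 L).
 apply Rnot_lt_le. intros Hlt. set (gap := q * q * A - B). assert (Hgap : 0 < gap) by (unfold gap; lra).
 assert (HAp : 0 < A). { pose proof (wirtinger_subcritical (q / 2) ltac:(lra)) as H. assert (q / 2 * Y < PI) by (unfold q; replace (PI / Y / 2 * Y) with (PI / 2) by (field; lra); lra).
  fold A B in H. nra. }
 set (e := Rmin (q / 2) (gap / (4 * q * A))). assert (He : 0 < e) by (apply Rmin_pos; [lra|pos]).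
 assert (E1 : e <= q / 2) by apply Rmin_l. assert (E2 : e <= gap / (4 * q * A)) by apply Rmin_r.
 pose proof (wirtinger_subcritical (q - e) ltac:(lra)) as H.
 assert (H0 : (q - e) * Y < PI). { apply Rlt_le_trans with (q * Y); [pos|unfold q; right; field; lra]. }
 fold A B in H.
 assert (H1 : 4 * q * A * e <= gap). { apply Rle_trans with (4 * q * A * (gap / (4 * q * A))); [pos|right; field; split; lra]. }
 unfold gap in *. nra.
Qed.

End Wirtinger.

(** * The energy inequality and the conclusion *)

Lemma cos_sin_odd_PI (k : Z) (x : R) : cos (x + PI * (2 * IZR k + 1)) = - cos x /\ sin (x + PI * (2 * IZR k + 1)) = - sin x.
Proof.
 assert (S : sin (IZR k * PI) = 0) by (apply sin_eq_0_1; exists k; reflexivity).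
 assert (C2 : cos (2 * (IZR k * PI)) = 1) by (rewrite cos_2a_sin, S; ring).
 assert (S2 : sin (2 * (IZR k * PI)) = 0) by (rewrite sin_2a, S; ring).
 replace (x + PI * (2 * IZR k + 1)) with ((x + PI) + 2 * (IZR k * PI)) by ring.
 rewrite (cos_plus (x + PI)), (sin_plus (x + PI)), C2, S2, neg_cos, neg_sin. lra.
Qed.

(* [exp (lP0 / 2) * (cos (theta / 2), sin (theta / 2))], with [theta' = kap], is antiperiodic because the total curvature is an odd multiple of 2 pi. *)
Lemma curvature_energy_lower (L : R) (k : Z) (kap lP0 chi0 : R -> R) : 0 < L -> (forall s, continuous kap s) -> (forall s, kap (s + L) = kap s) ->
  (forall s, is_derive lP0 s (chi0 s)) -> (forall s, continuous chi0 s) -> (forall s, lP0 (s + L) = lP0 s) ->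
  RInt kap 0 L = 2 * PI * (2 * IZR k + 1) ->
  let Y := RInt (fun s => exp (lP0 s)) 0 L in
  4 * ((PI / Y) * (PI / Y)) * RInt (fun s => exp (lP0 s) * exp (lP0 s)) 0 L <= RInt (fun s => kap s * kap s) 0 L + RInt (fun s => chi0 s * chi0 s) 0 L.
Proof.
 intros HL Hkc Hkp HdP Hchc HPp Hodd Y.
 set (P := fun s => exp (lP0 s)).
 assert (HlPc : forall s, continuous lP0 s) by (intros s; apply (is_derive_cont lP0 s _ (HdP s))).
 assert (HPc : forall s, continuous P s) by (intros s; unfold P; cont).
 assert (HPpos : forall s, 0 < P s) by (intros s; apply exp_pos).
 assert (HPper : forall s, P (s + L) = P s) by (intros s; unfold P; rewrite HPp; reflexivity).
 assert (Hchp : forall s, chi0 (s + L) = chi0 s).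
 { intros s. assert (D1 : is_derive lP0 s (chi0 (s + L))).
  { apply (is_derive_ext (fun s : R => lP0 (s + L))); [pos|]. evar_last; [apply (der_comp lP0 (fun s => s + L)); der_core|ring]. }
  rewrite <- (is_derive_unique _ _ _ D1). apply is_derive_unique, HdP. }
 set (th := fun s => RInt kap 0 s).
 assert (Dth : forall s, is_derive th s (kap s)) by (intros s; apply is_derive_primitive, Hkc).
 assert (Hth : forall s, th (s + L) = th s + 2 * PI * (2 * IZR k + 1)).
 { intros s. unfold th. pose proof (RInt_Chasles (V := R_CompleteNormedModule) kap 0 s (s + L) (ex_RInt_cont _ _ _ Hkc) (ex_RInt_cont _ _ _ Hkc)) as E.
  change (RInt kap 0 s + RInt kap s (s + L) = RInt kap 0 (s + L)) in E. rewrite (RInt_period kap L s Hkc Hkp), Hodd in E. lra. }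
 set (r := fun s => exp (/ 2 * lP0 s)). assert (Hrr : forall s, r s * r s = P s) by (intros s; unfold r, P; rewrite <- exp_plus; f_equal; field).
 set (h1 := fun s => r s * cos (/ 2 * th s)). set (h2 := fun s => r s * sin (/ 2 * th s)).
 set (h1' := fun s => / 2 * (chi0 s * h1 s - kap s * h2 s)). set (h2' := fun s => / 2 * (chi0 s * h2 s + kap s * h1 s)).
 assert (Dr : forall s, is_derive r s (/ 2 * chi0 s * r s)).
 { intros s. unfold r. der. ring. }
 assert (D1 : forall s, is_derive h1 s (h1' s)) by (intros s; unfold h1; der; unfold h1', h1, h2; ring).
 assert (D2 : forall s, is_derive h2 s (h2' s)) by (intros s; unfold h2; der; unfold h2', h1, h2; ring).
 assert (H1c : forall s, continuous h1 s) by (intros s; apply (is_derive_cont h1 s _ (D1 s))).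
 assert (H2c : forall s, continuous h2 s) by (intros s; apply (is_derive_cont h2 s _ (D2 s))).
 assert (H1c' : forall s, continuous h1' s) by (intros s; unfold h1'; cont).
 assert (H2c' : forall s, continuous h2' s) by (intros s; unfold h2'; cont).
 assert (Hanti : forall s, h1 (s + L) = - h1 s /\ h2 (s + L) = - h2 s).
 { intros s. unfold h1, h2, r. rewrite HPp, Hth. replace (/ 2 * (th s + 2 * PI * (2 * IZR k + 1))) with (/ 2 * th s + PI * (2 * IZR k + 1)) by field.
  destruct (cos_sin_odd_PI k (/ 2 * th s)) as [E1 E2]. nra. }
 assert (Hanti' : forall s, h1' (s + L) = - h1' s /\ h2' (s + L) = - h2' s).
 { intros s. unfold h1', h2'. destruct (Hanti s) as [E1 E2]. rewrite E1, E2, Hchp, Hkp. lra. }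
 pose proof (weighted_wirtinger L h1 h1' P HL HPpos HPc HPper D1 H1c' (fun s => proj1 (Hanti s)) (fun s => proj1 (Hanti' s))) as W1.
 pose proof (weighted_wirtinger L h2 h2' P HL HPpos HPc HPper D2 H2c' (fun s => proj2 (Hanti s)) (fun s => proj2 (Hanti' s))) as W2.
 change (RInt P 0 L) with Y in W1, W2.
 assert (ES : RInt (fun s => h1 s * h1 s * P s) 0 L + RInt (fun s => h2 s * h2 s * P s) 0 L = RInt (fun s => exp (lP0 s) * exp (lP0 s)) 0 L).
 { rewrite <- RInt_plus_R by (apply ex_RInt_cont; intros s; cont). apply RInt_ext. intros s _.
  match goal with |- ?l = ?q => change (@eq R l q) end. fold (P s).
  transitivity (r s * r s * (Rsqr (sin (/ 2 * th s)) + Rsqr (cos (/ 2 * th s))) * P s); [unfold h1, h2, Rsqr; ring|]. rewrite sin2_cos2, Hrr. ring. }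
 assert (EB : RInt (fun s => h1' s * h1' s / P s) 0 L + RInt (fun s => h2' s * h2' s / P s) 0 L = / 4 * (RInt (fun s => kap s * kap s) 0 L + RInt (fun s => chi0 s * chi0 s) 0 L)).
 { rewrite <- (RInt_plus_R (fun s => h1' s * h1' s / P s)) by (apply ex_RInt_cont; intros s; specialize (HPpos s); cont; lra).
  rewrite <- (RInt_plus_R (fun s => kap s * kap s)) by (apply ex_RInt_cont; intros s; cont).
  rewrite <- RInt_scal_R by (apply ex_RInt_cont; intros s; cont). apply RInt_ext. intros s _.
  match goal with |- ?l = ?q => change (@eq R l q) end. pose proof (HPpos s) as Hp.
  assert (Eh : h1 s * h1 s + h2 s * h2 s = P s).
  { transitivity (r s * r s * (Rsqr (sin (/ 2 * th s)) + Rsqr (cos (/ 2 * th s)))); [unfold h1, h2, Rsqr; ring|]. rewrite sin2_cos2, Hrr. ring. }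
  transitivity (/ 4 * (kap s * kap s + chi0 s * chi0 s) * (h1 s * h1 s + h2 s * h2 s) / P s); [unfold h1', h2'; field; lra|]. rewrite Eh. field. lra. }
 nra.
Qed.

(** Integrates the square of [P - Y / L], the deviation of [P] from its mean. *)
Lemma square_mean (L : R) (P : R -> R) : 0 < L -> (forall s, continuous P s) -> RInt P 0 L * RInt P 0 L <= L * RInt (fun s => P s * P s) 0 L.
Proof.
 intros HL Hc. set (Y := RInt P 0 L). set (S := RInt (fun s => P s * P s) 0 L).
 assert (X1 : ex_RInt P 0 L) by (apply ex_RInt_cont, Hc). assert (X2 : ex_RInt (fun s => P s * P s) 0 L) by (apply ex_RInt_cont; intros s; cont).
 assert (I1 := RInt_correct (V := R_CompleteNormedModule) P 0 L X1). assert (I2 := RInt_correct (V := R_CompleteNormedModule) _ 0 L X2).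
 assert (IS : is_RInt (fun s => P s * P s + ((- (2 * (Y / L))) * P s + (Y / L) * (Y / L))) 0 L (S + ((- (2 * (Y / L))) * Y + (L - 0) * ((Y / L) * (Y / L))))).
 { apply (is_RInt_plus (V := R_NormedModule) (fun s => P s * P s)); [pos|]. apply (is_RInt_plus (V := R_NormedModule) (fun s => (- (2 * (Y / L))) * P s) (fun _ => (Y / L) * (Y / L))).
  - apply (is_RInt_scal (V := R_NormedModule) P); exact I1.
  - apply (is_RInt_const (V := R_NormedModule)). }
 assert (H : 0 <= S + ((- (2 * (Y / L))) * Y + (L - 0) * ((Y / L) * (Y / L)))).
 { rewrite <- (is_RInt_unique (V := R_CompleteNormedModule) _ _ _ _ IS). apply RInt_ge_0; [lra|eexists; exact IS|]. intros s _.
  replace (P s * P s + (- (2 * (Y / L)) * P s + Y / L * (Y / L))) with (Rsqr (P s - Y / L)) by (unfold Rsqr; ring). apply Rle_0_sqr. }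
 replace (S + ((- (2 * (Y / L))) * Y + (L - 0) * ((Y / L) * (Y / L)))) with ((L * S - Y * Y) / L) in H by (field; lra).
 apply (Rmult_le_compat_r L) in H; [|lra]. replace ((L * S - Y * Y) / L * L) with (L * S - Y * Y) in H by (field; lra). lra.
Qed.

Theorem theorem3p3 (beta : R) (Omega : C -> Prop) (gamma : R -> C)
    (L alpha : R) (u : C -> R) (c3 : C -> R) :
  0 < beta < 1 ->
  planar_open Omega -> bounded_set Omega ->
  biholomorphic Omega (annulus beta) ->
  0 < alpha < 1 ->
  C3alpha_jordan_arclength gamma L alpha ->
  outer_boundary_component Omega gamma ->
  liouville_blowup_solution Omega u ->
  third_coefficient Omega u gamma alpha c3 ->
  ex_RInt (fun s => c3 (gamma s)) 0 L ->
  lambda_inv gamma L c3 >= 2 * PI ^ 2 / 3 * ((PI / ln beta) ^ 2 + 1).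
Proof.
 intros Hb HO HB Hbi Ha HJ Hout Hsol H3 Hint.
 destruct (oriented_biholomorphism beta Omega gamma L alpha Hb HO Hbi Ha HJ Hout) as [f [g [Hf [Hg [HfA [HgO [Hgf [Hfg Hor]]]]]]]].
 destruct (collar_data beta Omega f g Hb HO HB Hf Hg HfA HgO Hgf Hfg gamma L alpha Ha HJ Hout Hor u c3 Hsol H3)
  as [t0 [C [chi0 [lP0 [lP [S1 [S2 [W [Ht0 [HC [Hest [Hreg [HfS [HfW HdL]]]]]]]]]]]]]].
 pose proof (length_pos gamma L alpha HJ) as HL.
 destruct (taylor_bounds gamma L alpha Ha HJ) as [G [HG [HkG _]]].
 assert (Hkc : forall s, continuous (curvature gamma) s) by (intros s; apply (is_derive_cont _ s _ (is_derive_curvature gamma L alpha HJ s))).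
 set (a := PI / - ln beta) in *.
 pose proof (third_coefficient_identity L alpha a t0 C G (curvature gamma) chi0 lP0 (fun s => c3 (gamma s)) lP S1 S2 W HL Ha Ht0 HC HG Hkc HkG Hint Hest Hreg HfS HdL) as Hid.
 pose proof (total_P0_lower L alpha a t0 C G (curvature gamma) chi0 lP0 (fun s => c3 (gamma s)) lP S1 S2 W HL Ha Ht0 HC HG Hkc HkG Hest Hreg HfW) as HY.
 assert (HdP : forall s, is_derive lP0 s (chi0 s)) by (intros s; apply (lP0_derive L alpha a t0 C G (curvature gamma) chi0 lP0 (fun s => c3 (gamma s)) lP S1 S2 W); trivial).
 assert (Hcc : forall s, continuous chi0 s) by (intros s; apply (chi0_continuous L alpha a t0 C (curvature gamma) chi0 lP0 (fun s => c3 (gamma s)) lP S1 S2 W); trivial).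
 assert (HPp : forall s, lP0 (s + L) = lP0 s) by (intros s; apply (lP0_period L alpha a t0 C (curvature gamma) chi0 lP0 (fun s => c3 (gamma s)) lP S1 S2 W); trivial).
 destruct (total_curvature_odd gamma L alpha Ha HJ) as [k Hodd].
 pose proof (curvature_energy_lower L k (curvature gamma) lP0 chi0 HL Hkc (curvature_period gamma L alpha HJ) HdP Hcc HPp Hodd) as Hen.
 assert (HPc : forall s, continuous (fun s => exp (lP0 s)) s) by (intros s; apply (P0_continuous L alpha a t0 C G (curvature gamma) chi0 lP0 (fun s => c3 (gamma s)) lP S1 S2 W); trivial).
 pose proof (square_mean L (fun s => exp (lP0 s)) HL HPc) as Hsm.
 set (Y := RInt (fun s => exp (lP0 s)) 0 L) in *. set (P2 := RInt (fun s => exp (lP0 s) * exp (lP0 s)) 0 L) in *.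
 set (I3 := RInt (fun s => c3 (gamma s)) 0 L) in *. unfold lambda_inv. fold I3.
 set (I2 := RInt (fun s => curvature gamma s * curvature gamma s) 0 L) in *. set (J := RInt (fun s => chi0 s * chi0 s) 0 L) in *.
 assert (Hln : ln beta < 0) by (rewrite <- ln_1; apply ln_increasing; lra).
 replace ((PI / ln beta) ^ 2) with (a * a) by (unfold a; field; lra).
 (* Replacing [L * P2] by the smaller [Y * Y] cancels [Y] from the curvature term, leaving [4 PI^2],
    and turns the other term into [a^2 Y^2 >= 4 PI^2 a^2]. *)
 assert (E1 : 4 * (PI / Y * (PI / Y)) * (Y * Y) = 4 * (PI * PI)) by (field; lra).
 assert (E2 : (4 * (PI / Y * (PI / Y)) + a * a) * (Y * Y) <= (4 * (PI / Y * (PI / Y)) + a * a) * (L * P2)) by pos.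
 assert (E3 : L * ((4 * (PI / Y * (PI / Y)) + a * a) * P2) <= L * (- 6 * I3)) by pos.
 assert (E4 : a * a * (4 * (PI * PI)) <= a * a * (Y * Y)) by (apply Rmult_le_compat_l; nra). lra.
Qed.
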